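(* For any $p\in[1,\infty)$ and $s\in[0,\tfrac1p)$ there is $C_{s,p}<\infty$ such that for any measurable $A\subseteq Q=(0,1)^2$ there is an incompressible flow $u:Q\times(0,1)\to\mathbb{R}^2$ with $u\cdot n=0$ on $\partial Q\times(0,1)$, satisfying $\sup_{t\in(0,1-\delta)}\|u(\cdot,t)\|_{BV}<\infty$ for any $\delta>0$ and $$\sup_{t\in(0,1)}\|u(\cdot,t)\|_{\dot W^{s,p}}\le C_{s,p},$$ such that if $\rho$ solves $\rho_t+u\cdot\nabla\rho=0$ and $\rho(\cdot,0)=\chi_{\{0<x<|A|\}}$, then $\lim_{t\to1}\|\rho(\cdot,t)-\chi_A\|_1=0$.
   Context: $Q=(0,1)^2\subseteq\mathbb{R}^2$ with unit outer normal $n$; $|A|$ is the Lebesgue measure of $A$; $\chi$ denotes characteristic functions, and $\{0<x<|A|\}$ denotes $\{(x,y)\in Q: 0<x<|A|\}$; $\|\cdot\|_1$ is the $L^1(Q)$ norm, $\|\cdot\|_{BV}$ the norm of functions of bounded variation on $Q$, and $\|\cdot\|_{\dot W^{s,p}}$ the homogeneous (fractional) Sobolev seminorm on $Q$. Incompressible means $\nabla\cdot u=0$. *)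

(* Defs.v *)
From HB Require Import structures.
From mathcomp Require Import all_boot all_order all_algebra.
From mathcomp Require Import all_classical all_reals all_analysis.

Set Implicit Arguments.
Unset Strict Implicit.
Unset Printing Implicit Defensive.

Import Order.TTheory GRing.Theory Num.Theory.
Import numFieldNormedType.Exports.

Local Open Scope classical_set_scope.
Local Open Scope ring_scope.

Section lebesgue_measures.
Variable R : realType.
Local Open Scope ereal_scope.

(* The Lebesgue (not Borel) sigma-algebras, as completions of the products. *)
Definition lebesgue_plane : measurableType _ :=
  caratheodory_type ((@lebesgue_measure R \x @lebesgue_measure R)^*)%mu.

Definition leb2 : set lebesgue_plane -> \bar R :=
  @completed_measure_extension _ _ _
    (@lebesgue_measure R \x @lebesgue_measure R).
HB.instance Definition _ := Measure.on leb2.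

(* Space-time points are pairs ((x, y), t). *)
Definition lebesgue_spacetime : measurableType _ :=
  caratheodory_type
    ((@lebesgue_measure R \x @lebesgue_measure R) \x @lebesgue_measure R)^*%mu.

Definition leb3 : set lebesgue_spacetime -> \bar R :=
  @completed_measure_extension _ _ _
    ((@lebesgue_measure R \x @lebesgue_measure R) \x @lebesgue_measure R).
HB.instance Definition _ := Measure.on leb3.

End lebesgue_measures.
Arguments leb2 {R}.
Arguments leb3 {R}.

Definition unit_square (R : realType) : set (R * R) := `]0, 1[ `*` `]0, 1[.
Arguments unit_square {R}.

(* The norm that the library puts on [R * R] is the sup norm. *)
Definition dot2 (R : realType) (v w : R * R) : R := v.1 * w.1 + v.2 * w.2.
Definition norm2 (R : realType) (v : R * R) : R := Num.sqrt (dot2 v v).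

Section smooth_functions.
Variables (R : realType) (V : normedModType R).

(* In finite dimension this is the class C^k: it is enough, and necessary, that
   the iterated directional derivatives of order at most k be continuous. *)
Fixpoint Ck (k : nat) (f : V -> R) : Prop :=
  continuous f /\
  if k is k'.+1 then
    forall v : V, (forall x, derivable f x v) /\ Ck k' (fun x => 'D_v f x)
  else True.

Definition smooth (f : V -> R) : Prop := forall k, Ck k f.

Definition support_of (f : V -> R) : set V := closure [set x | f x != 0].

Definition test_function (U : set V) (f : V -> R) : Prop :=
  [/\ smooth f, compact (support_of f) & support_of f `<=` U].

End smooth_functions.

Section planar_fields.
Variable R : realType.
Implicit Types (f : R * R -> R) (v : R * R -> R * R) (s p : R).

Definition grad f (x : R * R) : R * R := ('D_(1, 0) f x, 'D_(0, 1) f x).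

Definition divergence v (x : R * R) : R :=
  'D_(1, 0) (fun y => (v y).1) x + 'D_(0, 1) (fun y => (v y).2) x.

Definition divergence_free v : Prop :=
  forall phi, test_function unit_square phi ->
  (\int[leb2]_(x in unit_square) (dot2 (v x) (grad phi x))%:E = 0)%E.

(* For v with zero distributional divergence, the Gauss-Green formula identifies
   the integral below with the boundary integral of phi times the normal trace
   of v; here the test functions do not vanish on the boundary. *)
Definition no_normal_flux v : Prop :=
  forall phi : R * R -> R, smooth phi ->
  (\int[leb2]_(x in unit_square) (dot2 (v x) (grad phi x))%:E = 0)%E.

Definition L1_norm v : \bar R :=
  (\int[leb2]_(x in unit_square) (norm2 (v x))%:E)%E.

(* [Phi1] and [Phi2] are the rows of a matrix field whose Frobenius norm is
   at most 1. *)
Definition total_variation v : \bar R := ereal_sup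
  [set z | exists Phi1 Phi2 : R * R -> R * R,
    [/\ test_function unit_square (fun x => (Phi1 x).1),
        test_function unit_square (fun x => (Phi1 x).2),
        test_function unit_square (fun x => (Phi2 x).1) &
        test_function unit_square (fun x => (Phi2 x).2)] /\
    (forall x, dot2 (Phi1 x) (Phi1 x) + dot2 (Phi2 x) (Phi2 x) <= 1) /\
    z = (\int[leb2]_(x in unit_square)
           ((v x).1 * divergence Phi1 x + (v x).2 * divergence Phi2 x)%:E)%E].

Definition BV_norm v : \bar R := (L1_norm v + total_variation v)%E.

(* The Gagliardo seminorm in dimension 2 for 0 < s < 1, and the L^p norm for
   s = 0; only used for 0 <= s < 1. *)
Definition sobolev_seminorm s p v : \bar R :=
  if s == 0 then
    ((\int[leb2]_(x in unit_square) (norm2 (v x) `^ p)%:E) `^ p^-1)%E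
  else
    ((\int[leb2]_(x in unit_square) \int[leb2]_(y in unit_square)
        (norm2 (v x - v y) `^ p / norm2 (x - y) `^ (2 + s * p))%:E) `^ p^-1)%E.

End planar_fields.

Section flows.
Variable R : realType.
Implicit Types (u : (R * R) * R -> R * R) (rho : (R * R) * R -> R).

(* Measurability in space-time alone gives that of almost all time slices. *)
Definition measurable_evolution (J : set R) rho : Prop :=
  measurable_fun (unit_square `*` J : set (lebesgue_spacetime R)) rho /\
  forall t, J t ->
    measurable_fun (unit_square : set (lebesgue_plane R)) (fun x => rho (x, t)).

Definition incompressible_flow u : Prop :=
  [/\ measurable_evolution `]0, 1[ (fun z => (u z).1),
      measurable_evolution `]0, 1[ (fun z => (u z).2) &
      forall t, 0 < t < 1 -> divergence_free (fun x => u (x, t))].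

(* Bounded weak solutions on the time interval [0, 1): the equation holds in the
   sense of distributions, in the conservative form rho_t + div (rho u) = 0 (u
   being divergence free), and rho is the representative that is weakly-*
   continuous in time, so that rho(., t) is meaningful for every t. *)
Definition transport_solution u (rho0 : R * R -> R) rho : Prop :=
  [/\ measurable_evolution `[0, 1[ rho,
      exists M : R, forall t, 0 <= t < 1 ->
        {ae leb2, forall x : R * R, unit_square x -> `|rho (x, t)| <= M},
      forall psi, test_function unit_square psi ->
        {within `[0, 1[, continuous
          (fun t => \int[leb2]_(x in unit_square) (rho (x, t) * psi x))},
      forall phi : (R * R * R)%type -> R,
        test_function
          (unit_square `*` `]0, 1[ : set (R * R * R)%type) phi ->
        (\int[leb3]_(z in unit_square `*` `]0%R, 1%R[)
          (rho z * ('D_1 (fun t : R => phi (z.1, t)) z.2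
            + dot2 (u z) (grad (fun x => phi (x, z.2)) z.1)))%:E = 0)%E &
      {ae leb2, forall x : R * R, unit_square x -> rho (x, 0) = rho0 x}].

End flows.

(* Main.v *)
(* The rectangle field box_field turns a rectangle around its center, in such a
   way that a half turn is the point reflection and a quarter turn exchanges the
   two axes (normalized by the sides).  Cells of size n are obtained by halving Q
   n times, alternately in the two directions.  Inductively, at the beginning of
   the stage 2n the density is, in every cell c of size n, the indicator of a
   strip of area |A n c| that starts at one end of c in the direction in which c
   is halved next.  Cut from this strip a part whose area is the mass of A in the
   first child; a half turn of the rest of c sends the remaining part of the strip
   to the other end, in the second child.  In stage 2n + 1, a quarter turn of one
   child and three quarter turns of the other prepare the next halving.

   The stages have durations q^k (1 - q), with q = 2^(-(1 - s)/4).  The field of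
   stage k has size 2^(-k/4) q^(-k), and is a bounded combination of jumps across
   segments on the scale 2^(-k/4): since s p < 1, its W^(s,p) norm stays bounded,
   and on each stage the field is piecewise linear, hence BV.

   On a rectangle the weak equation is solved on the union of two adjacent sectors
   cut by the diagonals, in coordinates in which the flow is a shear; testing with
   functions transported by the flow determines the solution, without using the
   uniqueness theory of the transport equation.  At time 1 - q^(2n) the density
   has the same mass as 1_A in all cells of size n, which forces L^1 convergence
   to 1_A as A is approximated by unions of cells. *)
Require Import Defs.
From HB Require Import structures.
From mathcomp Require Import all_boot all_order all_algebra.
From mathcomp Require Import all_classical all_reals all_analysis.
From mathcomp Require Import measurable_realfun zify ring lra.

Set Implicit Arguments.
Unset Strict Implicit.
Unset Printing Implicit Defensive.

Import Order.TTheory GRing.Theory Num.Theory.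
Import numFieldNormedType.Exports.

Local Open Scope classical_set_scope.
Local Open Scope ring_scope.

(** * Completed measures *)

(** The obstacle is that [rho] is an arbitrary bounded weak solution while the field jumps: a test
    function transported by the flow is only Lipschitz. Smoothing it across a diagonal at width
    [eps] leaves a transport defect that is bounded uniformly in [eps] and lives in a band of area
    O([eps]), so in the limit the duality between two times is exact. The constant density 1, which
    evolves into itself by zero flux alone, goes through the same charts: it shows that the turns
    preserve area and that the moved sectors still cover, and adding a constant reduces signed
    densities to nonnegative ones. The cuts depend on [A] and may produce arbitrarily thin
    rectangles, so every norm estimate uses only upper bounds for the sides. The rate of the
    schedule balances the seminorm: about 2^n rectangles of side l = 2^(-n/2) contribute v^p l^(2 -
    s p) each, which stays bounded for speeds v of order l^s, that is for durations of order l^(1 -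
    s), summable because s < 1. *)

Section completion.
Context d (T : measurableType d) (R : realType).
Variable mu : {measure set T -> \bar R}.
Local Open Scope ereal_scope.

Let cT : measurableType _ := caratheodory_type (mu^*)%mu.
Let cmu : {measure set cT -> \bar R} := @completed_measure_extension _ T R mu.

Lemma completed_measurable (B : set T) : measurable B -> measurable (B : set cT).
Proof. exact: caratheodory_measurable_mu_ext. Qed.

Lemma completedE (B : set T) : measurable B -> cmu B = mu B.
Proof. exact: measurable_mu_extE. Qed.

Lemma completed_measurable_fun d' (T' : measurableType d') (D : set T) (f : T -> T') :
  measurable D -> measurable_fun D f -> measurable_fun (D : set cT) (f : cT -> T').
Proof. by move=> mD mf _ Y mY; apply: completed_measurable; exact: mf. Qed.

(** The identity from the completed space to the original one is measurable and pushes the completed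
    measure forward to [mu], so the change of variables formula applies to positive and negative
    parts. *)
Lemma integral_completed (D : set T) (f : T -> \bar R) :
  measurable D -> measurable_fun D f ->
  \int[cmu]_(x in D) f x = \int[mu]_(x in D) f x.
Proof.
move=> mD mf.
have mid : measurable_fun [set: cT] (idfun : cT -> T).
  by move=> _ Y mY; rewrite setTI; exact: completed_measurable.
have pf (g : T -> \bar R) : (forall x, 0 <= g x) -> measurable_fun D g ->
    \int[cmu]_(x in D) g x = \int[mu]_(x in D) g x.
  move=> g0 mg.
  have := @ge0_integral_pushforward _ _ cT T R idfun mid cmu D g mD mg.
  rewrite /= => <- //.
  by apply: eq_measure_integral => A mA _; rewrite -completedE.
rewrite integralE [RHS]integralE pf ?pf //.
- exact: measurable_funeneg.
- exact: measurable_funepos.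
Qed.

(** By definition of the outer measure there are countable covers that are optimal up to 1/(n+1);
    the hull is the intersection of their unions. *)
Lemma outer_hull (E : set T) : (mu^*)%mu E < +oo ->
  exists F : set T, [/\ measurable F, E `<=` F & mu F = (mu^*)%mu E].
Proof.
move=> Efin.
have fE : (mu^*)%mu E \is a fin_num.
  by rewrite ge0_fin_numE //; exact: mu_ext_ge0.
have inv0 n : (0 < n.+1%:R^-1 :> R)%R by rewrite invr_gt0.
have ex n : exists F : set T, [/\ measurable F, E `<=` F &
    mu F <= (mu^*)%mu E + n.+1%:R^-1%:E].
  have [_ [A [mA EA] <-] lt] := lb_ereal_inf_adherent (inv0 n) fE.
  exists (\bigcup_k A k); split => //; first exact: bigcupT_measurable.
  by apply: (le_trans _ (ltW lt)); apply: measure_sigma_subadditive => //; exact: bigcupT_measurable.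
pose F n := sval (cid (ex n)).
have FP n : [/\ measurable (F n), E `<=` F n &
    mu (F n) <= (mu^*)%mu E + n.+1%:R^-1%:E] by rewrite /F; case: cid.
have mF : measurable (\bigcap_n F n) by apply: bigcapT_measurable => n; have [] := FP n.
have EF : E `<=` \bigcap_n F n by move=> x Ex n _; have [_ + _] := FP n; exact.
exists (\bigcap_n F n); split => //.
apply/eqP; rewrite eq_le; apply/andP; split; last first.
  by rewrite -(measurable_mu_extE mu mF); apply: le_mu_ext.
apply/lee_addgt0Pr => _/posnumP[e]; near \oo => n.
have [mFn _ leF] := FP n.
apply: (@le_trans _ _ (mu (F n))).
  by apply: le_measure; rewrite ?inE //; exact: bigcap_inf.
apply: (le_trans leF); apply: leeD => //; rewrite lee_fin ltW //.
by near: n; apply: near_infty_natSinv_lt.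
Unshelve. all: by end_near. Qed.

(** Finiteness makes the excess of the hull [F] over [E] null for the completed measure, and this
    null excess has a hull [N] of its own, now measurable in the original sense. *)
Lemma completed_hull (E : set T) : measurable (E : set cT) -> cmu E < +oo ->
  exists F N : set T, [/\ measurable F, measurable N, mu N = 0,
    E `<=` F & F `\` E `<=` N].
Proof.
move=> mE Efin; have [F [mF EF FE]] := outer_hull Efin.
have mF' := completed_measurable mF.
have FE0 : cmu (F `\` E) = 0.
  have cF : cmu F = cmu E by exact: etrans (completedE mF) FE.
  have -> : cmu (F `\` E) = cmu F - cmu (F `&` E).
    by apply: measureD => //; change (cmu F < +oo); rewrite cF.
  rewrite (_ : F `&` E = E); last by apply/setIidPr.
  by rewrite cF subee // ge0_fin_numE.
have [|N [mN FN N0]] := @outer_hull (F `\` E).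
  by move: FE0; rewrite /cmu /= /completed_measure_extension => ->.
exists F, N; split=> //.
by move: N0 FE0; rewrite /cmu /= /completed_measure_extension => -> ->.
Qed.

Lemma completed_null (E : set T) : cmu.-negligible E ->
  exists N : set T, [/\ measurable N, mu N = 0 & E `<=` N].
Proof.
move=> [B [mB B0 EB]].
have [|F [mF BF F0]] := @outer_hull B.
  by move: B0; rewrite /cmu /= /completed_measure_extension => ->.
exists F; split => //; last exact: subset_trans BF.
by rewrite F0; move: B0; rewrite /cmu /= /completed_measure_extension => ->.
Qed.

(** Only the countably many superlevel sets at rational heights matter. Each has a hull in the
    original sigma-algebra with null excess, and [N] collects the excesses; off [N] every superlevel
    set coincides with its hull. Restricting to subsets off [N] keeps [f] itself instead of
    replacing it by another function. *)
Lemma completed_measurable_rep (D : set T) (f : T -> R) :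
  measurable D -> mu D < +oo ->
  measurable_fun (D : set cT) f ->
  exists N : set T, [/\ measurable N, mu N = 0 &
    forall D', measurable D' -> D' `<=` D `\` N -> measurable_fun D' f].
Proof.
move=> mD Dfin mf.
have ex (q : rat) : exists FN : set T * set T, [/\ measurable FN.1, measurable FN.2,
    mu FN.2 = 0, D `&` f @^-1` `]ratr q, +oo[ `<=` FN.1 &
    FN.1 `\` (D `&` f @^-1` `]ratr q, +oo[) `<=` FN.2].
  have mE : measurable (D `&` f @^-1` `]ratr q, +oo[ : set cT).
    by apply: mf => //; exact: completed_measurable.
  have [|F [N [? ? ? ? ?]]] := completed_hull mE; last by exists (F, N).
  apply: (@le_lt_trans _ _ (mu D)) => //.
  rewrite -completedE //; apply: le_measure; rewrite ?inE //.
  exact: completed_measurable.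
pose FN q := sval (cid (ex q)).
have FNP q : [/\ measurable (FN q).1, measurable (FN q).2,
    mu (FN q).2 = 0, D `&` f @^-1` `]ratr q, +oo[ `<=` (FN q).1 &
    (FN q).1 `\` (D `&` f @^-1` `]ratr q, +oo[) `<=` (FN q).2] by rewrite /FN; case: cid.
(* The rationals are enumerated through [unpickle]; the default 0 only repeats a set that is already
   in the list. *)
pose g n := (FN (odflt 0%R (unpickle n))).2.
exists (\bigcup_n g n); split.
- by apply: bigcupT_measurable => n; rewrite /g; case: (FNP (odflt 0%R (unpickle n))).
- apply/eqP; rewrite -measure_le0.
  apply: (@le_trans _ _ (\sum_(n <oo) mu (g n))).
    apply: measure_sigma_subadditive => //.
    + by move=> n; rewrite /g; case: (FNP (odflt 0%R (unpickle n))).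
    + by apply: bigcupT_measurable => n; rewrite /g; case: (FNP (odflt 0%R (unpickle n))).
  rewrite eseries0 // => n _ _; rewrite /g.
  by case: (FNP (odflt 0%R (unpickle n))).
move=> D' mD' D'D.
have mq (q : rat) : measurable (D' `&` f @^-1` `]ratr q, +oo[).
  rewrite (_ : _ `&` _ = D' `&` (FN q).1).
    by apply: measurableI => //; case: (FNP q).
  have [_ _ _ sub1 sub2] := FNP q.
  apply/seteqP; split=> x [D'x /= h]; split => //.
    by apply: sub1; split=> //; case: (D'D _ D'x).
  apply: contrapT => nh; have [Dx] := D'D _ D'x; apply.
  exists (pickle q) => //; rewrite /g pickleK /=.
  by apply: sub2; split => //; case.
apply: (measurability _ (RGenOInfty.measurableE R)) => //.
move=> _ [_ [r ->] <-].
(* An open superlevel set at a real height is the union of those at the rational heights above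
   it. *)
rewrite (_ : D' `&` _ = \bigcup_(q : rat)
   (if r <= ratr q then D' `&` f @^-1` `]ratr q, +oo[ else set0))%R.
  by apply: bigcupT_measurable_rat => q; case: ifP.
apply/seteqP; split=> x.
  move=> [D'x /=]; rewrite in_itv /= andbT => /rat_in_itvoo[q].
  rewrite in_itv /= => /andP[h1 h2].
  by exists q => //; rewrite (ltW h1); split => //=; rewrite in_itv /= h2.
move=> [q _]; case: ifP => // rq [D'x /=]; rewrite in_itv /= andbT => qf; split => //=.
by rewrite in_itv /= andbT (le_lt_trans rq).
Qed.

End completion.

Section sigma_finite_product.
Local Open Scope ereal_scope.
Context d1 d2 (T1 : measurableType d1) (T2 : measurableType d2) (R : realType).
Variables (m1 : {sigma_finite_measure set T1 -> \bar R}).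
Variables (m2 : {sigma_finite_measure set T2 -> \bar R}).

Lemma product_measure_sigma_finite : sigma_finite setT (m1 \x m2).
Proof.
have /sigma_finiteP[F [TF ndF Foo]] := sigma_finiteT m1.
have /sigma_finiteP[G [TG ndG Goo]] := sigma_finiteT m2.
exists (fun n => F n `*` G n).
  apply/seteqP; split=> // -[x y] _.
  have [n _ Fx] : (\bigcup_n F n) x by rewrite -TF.
  have [k _ Gy] : (\bigcup_n G n) y by rewrite -TG.
  exists (maxn n k) => //; split => /=.
    by move: Fx; exact/subsetPset/ndF/leq_maxl.
  by move: Gy; exact/subsetPset/ndG/leq_maxr.
move=> n; have [mF Fn] := Foo n; have [mG Gn] := Goo n; split; first exact: measurableX.
by rewrite product_measure1E // lte_mul_pinfty // ge0_fin_numE.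
Qed.

End sigma_finite_product.

(** * Borel representatives on the square and in space-time *)

Section plane_measures.
Context {R : realType}.
Local Open Scope ereal_scope.

Definition lam : {sigma_finite_measure set (measurableTypeR R) -> \bar R} := lebesgue_measure.

(** Named copies of the Borel product measures, carrying the sigma-finite structure that Fubini asks
    for. All computations take place with them; [integral_leb2] and its companions translate from
    the completed measures. *)
Definition lam2 : set (measurableTypeR R * measurableTypeR R)%type -> \bar R :=
  @lebesgue_measure R \x @lebesgue_measure R.
HB.instance Definition _ := Measure.on lam2.
HB.instance Definition _ := @Measure_isSigmaFinite.Build _ _ _ lam2
  (product_measure_sigma_finite (@lebesgue_measure R) (@lebesgue_measure R)).

Definition lam3 : set (measurableTypeR R * measurableTypeR R * measurableTypeR R)%type -> \bar R :=
  (@lebesgue_measure R \x @lebesgue_measure R) \x @lebesgue_measure R.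
HB.instance Definition _ := Measure.on lam3.
HB.instance Definition _ := @Measure_isSigmaFinite.Build _ _ _ lam3
  (product_measure_sigma_finite lam2 lam).

Lemma integral_leb2 (D : set (R * R)) (f : R * R -> \bar R) :
  measurable D -> measurable_fun D f ->
  \int[leb2]_(x in D) f x = \int[lam2]_(x in D) f x.
Proof. exact: (@integral_completed _ _ R (@lebesgue_measure R \x @lebesgue_measure R) D f). Qed.

Lemma integral_leb3 (D : set (R * R * R)) (f : R * R * R -> \bar R) :
  measurable D -> measurable_fun D f ->
  \int[leb3]_(x in D) f x = \int[lam3]_(x in D) f x.
Proof.
exact: (@integral_completed _ _ R ((@lebesgue_measure R \x @lebesgue_measure R) \x @lebesgue_measure R) D f).
Qed.

Lemma leb2E (D : set (R * R)) : measurable D -> leb2 D = lam2 D.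
Proof. exact: (@completedE _ _ R (@lebesgue_measure R \x @lebesgue_measure R) D). Qed.

Lemma measurable_rep_leb2 (D : set (R * R)) (f : R * R -> R) :
  measurable D -> lam2 D < +oo -> measurable_fun (D : set (lebesgue_plane R)) f ->
  exists N : set (R * R), [/\ measurable N, lam2 N = 0 &
    forall D', measurable D' -> D' `<=` D `\` N -> measurable_fun D' f].
Proof.
exact: (@completed_measurable_rep _ _ R (@lebesgue_measure R \x @lebesgue_measure R) D f).
Qed.

Lemma measurable_rep_leb3 (D : set (R * R * R)) (f : R * R * R -> R) :
  measurable D -> lam3 D < +oo -> measurable_fun (D : set (lebesgue_spacetime R)) f ->
  exists N : set (R * R * R), [/\ measurable N, lam3 N = 0 &
    forall D', measurable D' -> D' `<=` D `\` N -> measurable_fun D' f].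
Proof.
exact: (@completed_measurable_rep _ _ R
  ((@lebesgue_measure R \x @lebesgue_measure R) \x @lebesgue_measure R) D f).
Qed.

Lemma ae_leb2 (P : R * R -> Prop) : {ae leb2, forall x, P x} -> {ae lam2, forall x, P x}.
Proof. by move=> /completed_null[N [mN N0 PN]]; exists N. Qed.

Lemma ae_lam2 (P : R * R -> Prop) : {ae lam2, forall x, P x} -> {ae leb2, forall x, P x}.
Proof.
move=> [N [mN N0 PN]]; exists N; split => //; first exact: completed_measurable.
by rewrite leb2E.
Qed.

Lemma measurable_unit_square : measurable (@unit_square R).
Proof. by apply: measurableX; exact: measurable_itv. Qed.

Lemma lam2_unit_square : lam2 unit_square = 1.
Proof.
rewrite /lam2 /unit_square /= product_measure1E //=; try exact: measurable_itv.
by rewrite !lebesgue_measure_itv /= lte01 oppr0 addr0 mule1.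
Qed.

Lemma ae_impl d (T : measurableType d) (mu : {measure set T -> \bar R})
    (P Q : T -> Prop) :
  {ae mu, forall x, P x} -> (forall x, P x -> Q x) -> {ae mu, forall x, Q x}.
Proof. by move=> aP PQ; apply: filterS aP. Qed.

Lemma measure_setU0 d (T : measurableType d) (mu : {measure set T -> \bar R})
    (A B : set T) :
  measurable A -> measurable B -> mu A = 0 -> mu B = 0 -> mu (A `|` B) = 0.
Proof.
move=> mA mB A0 B0; apply/eqP; rewrite -measure_le0.
by apply: (@le_trans _ _ (mu A + mu B)); [exact: measureU2|rewrite A0 B0 adde0].
Qed.

Lemma bounded_integrable d (T : measurableType d) (mu : {measure set T -> \bar R})
    (D : set T) (f : T -> R) (M : R) :
  measurable D -> mu D < +oo -> measurable_fun D f ->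
  (forall x, D x -> (`|f x| <= M)%R) -> mu.-integrable D (EFin \o f).
Proof.
move=> mD Dfin mf fM; apply: measurable_bounded_integrable => //.
exists M; split; [exact: num_real|move=> y My x Dx].
by rewrite /= (le_trans (fM _ Dx)) // ltW.
Qed.

Lemma lam3_slab (J : set R) : measurable J ->
  lam3 (unit_square `*` J) = lam J.
Proof.
move=> mJ; rewrite /lam3 /= product_measure1E //=; last exact: measurable_unit_square.
by have := lam2_unit_square; rewrite /lam2 /= => ->; rewrite mul1e.
Qed.

Lemma ysectionE (N : set (R * R * R)) t : [set x | N (x, t)] = ysection N t.
Proof. by apply/seteqP; split => x; rewrite /ysection /= inE. Qed.

Lemma measurable_slice (N : set (R * R * R)) t :
  measurable N -> measurable [set x | N (x, t)].
Proof. by move=> mN; rewrite ysectionE; exact: measurable_ysection. Qed.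

Lemma lam3E (N : set (R * R * R)) : measurable N ->
  lam3 N = \int[lam]_t lam2 [set x | N (x, t)].
Proof.
move=> mN.
have := @fubini_tonelli2 _ _ _ _ R lam2 lam (fun z => (\1_N z)%:E).
rewrite integral_indic // setIT => ->.
- apply: eq_integral => t _; rewrite /fubini_G.
  rewrite [RHS](_ : _ = \int[lam2]_x (\1_[set x | N (x, t)] x)%:E); last first.
    by rewrite integral_indic ?setIT //; exact: measurable_slice.
  by [].
- by apply/measurable_EFinP; exact: measurable_indic.
- by move=> z; rewrite lee_fin.
Qed.

(** By Tonelli the measure of the slices is a nonnegative function of [t] with integral 0. *)
Lemma ae_slice (N : set (R * R * R)) : measurable N -> lam3 N = 0 ->
  {ae lam, forall t, lam2 [set x | N (x, t)] = 0}.
Proof.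
move=> mN; rewrite lam3E // => N0.
have mf : measurable_fun setT (fun t => lam2 [set x | N (x, t)]).
  under eq_fun do rewrite ysectionE.
  exact: (@measurable_fun_ysection _ _ _ _ R lam2 N mN).
have : \int[lam]_t `|lam2 [set x | N (x, t)]| = 0.
  by rewrite -N0; apply: eq_integral => t _; rewrite gee0_abs.
move=> /(ae_eq_integral_abs lam measurableT mf).
by apply: filterS => t /= h; exact: h.
Qed.

(** Truncation makes a function bounded everywhere without changing it where the bound already
    holds, which for a solution is known only almost everywhere. *)
Definition clip (M : R) (x : R) : R := Num.max (- M)%R (Num.min M x).

Lemma clip_bound M x : (0 <= M)%R -> (`|clip M x| <= M)%R.
Proof.
move=> M0; rewrite ler_norml /clip le_max lexx /= ge_max ge_min lexx /=.
by rewrite andbT; lra.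
Qed.

Lemma clip_id M x : (`|x| <= M)%R -> clip M x = x.
Proof.
by rewrite ler_norml /clip => /andP[h1 h2]; rewrite (min_idPr h2) (max_idPr h1).
Qed.

Lemma measurable_clip M : measurable_fun setT (clip M).
Proof.
by apply: measurable_maxr => //; apply: measurable_minr.
Qed.

(** The solution is measurable in space-time only for the completed measure, and the Borel slices
    [w t] are chosen separately for each [t], so Fubini applies directly to neither. It is applied
    to a truncation of [rho] off a null set, whose slices agree with [w t] for almost every [t]; [G]
    is a measurable function of time that stands for the inner integral. *)
Lemma fubini_rep (rho : R * R * R -> R) (w : R -> R * R -> R) (M B : R) (J : set R)
    (zeta : R * R * R -> R) :
  (0 <= M)%R -> measurable J -> lam J < +oo ->
  measurable_fun (unit_square `*` J : set (lebesgue_spacetime R)) rho ->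
  (forall t, J t -> {ae lam2, forall x, unit_square x -> rho (x, t) = w t x}) ->
  (forall t x, J t -> (`|w t x| <= M)%R) ->
  (forall t, J t -> measurable_fun setT (w t)) ->
  measurable_fun (unit_square `*` J) zeta ->
  (forall z, (unit_square `*` J) z -> (`|zeta z| <= B)%R) ->
  exists G : R -> R, [/\ measurable_fun setT G,
    (\int[leb3]_(z in unit_square `*` J) (rho z * zeta z)%:E =
     \int[lam]_(t in J) (G t)%:E)%E &
    {ae lam, forall t, J t ->
       G t = (\int[lam2]_(x in unit_square) (w t x * zeta (x, t)))%R}].
Proof.
move=> M0 mJ Jfin mrho rhow wM mw mz zB.
have mQ := measurable_unit_square.
set D := unit_square `*` J.
have mD : measurable D by exact: measurableX.
have Dfin : lam3 D < +oo by rewrite lam3_slab.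
have [N [mN N0 mrep]] := measurable_rep_leb3 mD Dfin mrho.
have mDN : measurable (D `\` N) by exact: measurableD.
have mr : measurable_fun (D `\` N) rho by exact: mrep.
pose g := ((clip M \o rho) \_ (D `\` N))%R.
have mg : measurable_fun setT g.
  apply/(measurable_restrictT _ mDN).
  by apply: measurableT_comp => //; exact: measurable_clip.
have gM z : (`|g z| <= M)%R.
  by rewrite /g patchE; case: ifP => _; [exact: clip_bound|rewrite normr0].
pose gz := ((fun z => g z * zeta z) \_ D)%R.
have mgz : measurable_fun setT gz.
  apply/(measurable_restrictT _ mD); apply: measurable_funM => //.
  exact: measurable_funS mg.
have gzB z : (`|gz z| <= M * `|B|)%R.
  rewrite /gz patchE; case: ifPn => [/set_mem Dz|_]; last by rewrite normr0 mulr_ge0.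
  by rewrite normrM ler_pM // (le_trans (zB _ Dz)) // ler_norm.
have igz : lam3.-integrable setT (EFin \o gz).
  have -> : EFin \o gz = (EFin \o gz) \_ D.
    apply/funext => z; rewrite patchE /= /gz patchE; case: ifPn => // _.
  refine (proj1 (@integrable_mkcond _ _ R lam3 D (EFin \o gz) mD) _).
  apply: (@bounded_integrable _ _ _ _ _ (M * `|B|)%R) => //.
  exact: measurable_funS mgz.
(* The points off [N] where truncation at [M] changes [rho]. Each time slice is null because [w t]
   is bounded by [M], hence so is the whole set. *)
pose H := (D `\` N) `&` [set z | (M < `|rho z|)%R].
have mH : measurable H.
  have : measurable_fun (D `\` N) (Num.norm \o rho) by exact: measurableT_comp.
  move=> /(_ mDN `]M, +oo[%classic); rewrite (_ : H = (D `\` N) `&` ((Num.norm \o rho) @^-1` `]M, +oo[)); first exact.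
  by apply/seteqP; split=> z; rewrite /H /= in_itv /= andbT.
have H0 : lam3 H = 0.
  rewrite lam3E // (eq_integral (cst 0)) ?integral0 // => t _ /=.
  have mHt : measurable [set x | H (x, t)] by exact: measurable_slice.
  have [Jt|nJt] := pselect (J t); last first.
    rewrite (_ : [set x | H (x, t)] = set0) ?measure0 //.
    by apply/seteqP; split=> x // [[[]]].
  apply/eqP; rewrite -measure_le0.
  have [E [mE E0 sE]] := rhow _ Jt.
  rewrite -E0; apply: le_measure; rewrite ?inE // => x [[[Qx _] _] /= hx].
  apply: sE => /= /(_ Qx) eqw; have := wM _ x Jt; rewrite -eqw.
  by rewrite leNgt hx.
have mG : measurable_fun setT (fun t => fine (fubini_G lam2 (EFin \o gz) t)).
  apply: (measurableT_comp (fine_measurable measurableT)).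
  exact: (@measurable_fubini_G _ _ _ _ R lam2 lam _ igz).
exists (fun t => fine (fubini_G lam2 (EFin \o gz) t)); split.
- exact: mG.
- rewrite (_ : \int[leb3]_(z in D) _ = \int[leb3]_(z in D) (g z * zeta z)%:E).
    rewrite integral_leb3 //; last first.
      by apply/measurable_EFinP; apply: measurable_funM => //; exact: measurable_funS mg.
    transitivity (\int[lam3]_z (gz z)%:E).
      rewrite integral_mkcond; apply: eq_integral => z _.
      by rewrite /gz /patch; case: ifP.
    rewrite -(@integral21_prod_meas1 _ _ _ _ R lam2 lam _ igz).
    rewrite [RHS]integral_mkcond; apply: ae_eq_integral => //.
    + exact: (@measurable_fubini_G _ _ _ _ R lam2 lam _ igz).
    + apply/(measurable_restrictT _ mJ).
      by apply/measurable_EFinP; apply: (@measurable_funS _ _ _ _ setT).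
    have := (@ae_integrable2 _ _ _ _ R lam2 lam _ igz); apply: filterS => t it _.
    rewrite patchE; case: ifPn => [_|/negP nJt].
      by rewrite /= fineK // /fubini_G; exact: integrable_fin_num.
    rewrite /fubini_G (eq_integral (cst 0)) ?integral0 // => x _ /=.
    rewrite /gz patchE; case: ifPn => // /set_mem[_ /= Jt].
    by exfalso; apply: nJt; rewrite inE.
  apply: ae_eq_integral.
  + exact: completed_measurable.
  + apply/measurable_EFinP; apply: measurable_funM => //.
    exact: completed_measurable_fun.
  + apply/measurable_EFinP; apply: completed_measurable_fun => //.
    by apply: measurable_funM => //; exact: measurable_funS mg.
  exists (N `|` H); split.
  + by apply: completed_measurable; exact: measurableU.
  + rewrite -[LHS]/(leb3 (N `|` H)) /leb3 completedE; last exact: measurableU.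
    exact: measure_setU0.
  + move=> z /= /not_implyP[Dz ne]; apply: contrapT => /not_orP[nN nH].
    apply: ne; congr EFin; rewrite /g patchE mem_set //= clip_id // leNgt.
    by apply/negP => h; apply: nH.
- apply: (ae_impl (ae_slice mN N0)) => t Nt0 Jt.
  have mNt : measurable [set x | N (x, t)] by exact: measurable_slice.
  rewrite /Rintegral /fubini_G; congr fine.
  rewrite [RHS]integral_mkcond.
  have mzt : measurable_fun unit_square (fun x => zeta (x, t)).
    move=> _ Y mY.
    have := @measurable_ysection _ _ _ _ _ t (mz mD Y mY).
    rewrite (_ : ysection _ _ = unit_square `&` (fun x => zeta (x, t)) @^-1` Y) //.
    apply/seteqP; split=> x.
      by rewrite /ysection /= inE => -[[]].
    by move=> [Qx hx]; rewrite /ysection /= inE.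
  apply: ae_eq_integral => //.
  + apply/measurable_EFinP => /=.
    exact: (@measurable_fun_pair1 _ _ _ _ _ _ gz t mgz).
  + apply/(measurable_restrictT _ mQ); apply/measurable_EFinP.
    by apply: measurable_funM => //; apply: measurable_funS (mw _ Jt).
  have [E [mE E0 sE]] := rhow _ Jt.
  exists (E `|` [set x | N (x, t)]); split.
  + exact: measurableU.
  + exact: measure_setU0.
  + move=> x /= /not_implyP[_ ne]; apply: contrapT => /not_orP[nE nN].
    apply: ne; rewrite /gz !patchE.
    have [Qx|nQx] := boolP (x \in unit_square); last first.
      case: ifPn => // /set_mem[/= Qx].
      by rewrite mem_set in nQx.
    have Dx : D (x, t) by split => //; exact: set_mem.
    rewrite mem_set //; congr (_ * _)%:E.
    rewrite /g patchE mem_set //=.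
    have -> : rho (x, t) = w t x.
      by apply: contrapT => h; apply: nE; apply: sE => /= /(_ (set_mem Qx)).
    by rewrite clip_id // wM.
Qed.

(** For each time separately, the slice is restricted to a set where it is Borel, truncated, and
    extended by 0. Nothing is claimed about measurability of [w] in time; [fubini_rep] supplies what
    is needed. *)
Lemma borel_solution (u : R * R * R -> R * R) (rho0 : R * R -> R) (rho : R * R * R -> R) :
  transport_solution u rho0 rho ->
  exists M (w : R -> R * R -> R), (0 <= M)%R /\
   forall t, (0 <= t < 1)%R ->
   [/\ measurable_fun setT (w t), (forall x, (`|w t x| <= M)%R),
      (forall x, ~ unit_square x -> w t x = 0%R) &
      {ae lam2, forall x, unit_square x -> rho (x, t) = w t x}].
Proof.
case=> [[mrho mrhot] [M rhoM] _ _ _].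
have mQ := measurable_unit_square.
have ex (t : R) : exists wt : R * R -> R, (0 <= t < 1)%R ->
   [/\ measurable_fun setT wt, (forall x, (`|wt x| <= `|M|)%R),
      (forall x, ~ unit_square x -> wt x = 0%R) &
      {ae lam2, forall x, unit_square x -> rho (x, t) = wt x}].
  have [t01|nt] := boolP (0 <= t < 1)%R; last first.
    by exists (cst 0%R).
  have mt : measurable_fun (unit_square : set (lebesgue_plane R)) (fun x => rho (x, t)).
    by apply: mrhot; rewrite /= in_itv.
  have [|N [mN N0 mrep]] := measurable_rep_leb2 mQ _ mt.
    by rewrite lam2_unit_square ltry.
  have mQN : measurable (unit_square `\` N) by exact: measurableD.
  exists ((clip `|M| \o (fun x => rho (x, t))) \_ (unit_square `\` N)) => _; split.
  - apply/(measurable_restrictT _ mQN).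
    apply: measurableT_comp; first exact: measurable_clip.
    exact: mrep.
  - by move=> x; rewrite patchE; case: ifP => _; [exact: clip_bound|rewrite normr0].
  - by move=> x nQ; rewrite patchE; case: ifPn => // /set_mem[].
  - have [E [mE E0 sE]] := ae_leb2 (rhoM t t01).
    exists (E `|` N); split.
    + exact: measurableU.
    + exact: measure_setU0.
    + move=> x /= /not_implyP[Qx ne]; apply: contrapT => /not_orP[nE nN]; apply: ne.
      rewrite patchE mem_set //= clip_id //.
      apply: contrapT => h; apply: nE; apply: sE => /= /(_ Qx) h'; apply: h.
      by rewrite (le_trans h') // ler_norm.
exists `|M|%R, (fun t => sval (cid (ex t))); split=> // t t01.
by case: cid => wt /= /(_ t01).
Qed.

End plane_measures.

(** * Smooth functions *)

Section smooth_calculus.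
Context {R : realType} {V : normedModType R}.
Implicit Types (f g : V -> R) (k : nat).

Lemma CkS k f : Ck k.+1 f -> Ck k f.
Proof.
elim: k f => [|k IH] f [cf df]; first by split.
split=> // v; have [d1 d2] := df v; split=> //; exact: IH.
Qed.

Lemma smooth_continuous f : smooth f -> continuous f.
Proof. by move=> /(_ 0) []. Qed.

Lemma smooth_derivable f x v : smooth f -> derivable f x v.
Proof. by move=> /(_ 1) [_ /(_ v)[]]. Qed.

Lemma smooth_derive f v : smooth f -> smooth ('D_v f).
Proof. by move=> sf k; have [_ /(_ v)[]] := sf k.+1. Qed.

Lemma Ck_cst k (c : R) : Ck k (fun _ : V => c).
Proof.
elim: k c => [|k IH] c; split => //; try exact: cst_continuous.
move=> v; split; first by move=> x; exact: derivable_cst.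
rewrite (_ : 'D_v (fun=> c) = fun=> 0); first exact: IH.
by apply/funext => x; exact: derive_cst.
Qed.

Lemma smooth_cst (c : R) : smooth (fun _ : V => c).
Proof. by move=> k; exact: Ck_cst. Qed.

Lemma CkD k f g : Ck k f -> Ck k g -> Ck k (fun x => f x + g x).
Proof.
elim: k f g => [|k IH] f g [cf df] [cg dg]; split => //;
  try by move=> x; apply: cvgD; [exact: cf|exact: cg].
move=> v; have [f1 f2] := df v; have [g1 g2] := dg v; split.
  by move=> x; exact: derivableD.
rewrite (_ : 'D_v (fun x => f x + g x) = fun x => 'D_v f x + 'D_v g x); first exact: IH.
by apply/funext => x; exact: deriveD.
Qed.

Lemma smoothD f g : smooth f -> smooth g -> smooth (fun x => f x + g x).
Proof. by move=> sf sg k; exact: CkD. Qed.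

Lemma CkM k f g : Ck k f -> Ck k g -> Ck k (fun x => f x * g x).
Proof.
elim: k f g => [|k IH] f g Cf Cg; have [cf df] := Cf; have [cg dg] := Cg; split => //;
  try by move=> x; apply: cvgM; [exact: cf|exact: cg].
move=> v; have [f1 f2] := df v; have [g1 g2] := dg v; split.
  by move=> x; exact: derivableM.
rewrite (_ : 'D_v (fun x => f x * g x) = fun x => f x * 'D_v g x + g x * 'D_v f x).
  by apply: CkD; apply: IH => //; exact: CkS.
by apply/funext => x; rewrite deriveM.
Qed.

Lemma smoothM f g : smooth f -> smooth g -> smooth (fun x => f x * g x).
Proof. by move=> sf sg k; exact: CkM. Qed.

Lemma smoothN f : smooth f -> smooth (fun x => - f x).
Proof.
move=> sf; rewrite (_ : (fun x => _) = fun x => (-1) * f x).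
  by apply: smoothM => //; exact: smooth_cst.
by apply/funext => x; rewrite mulN1r.
Qed.

Lemma smoothB f g : smooth f -> smooth g -> smooth (fun x => f x - g x).
Proof. by move=> sf sg; apply: smoothD => //; exact: smoothN. Qed.

Lemma smooth_linear (f : V -> R) : continuous f ->
  (forall x y, f (x + y) = f x + f y) -> (forall c x, f (c *: x) = c * f x) -> smooth f.
Proof.
move=> cf fD fZ.
have df (x v : V) : is_derive x v f (f v).
  have e : (fun h : R => h^-1 *: ((f \o shift x) (h *: v) - f x)) @ 0^' --> f v.
    apply: cvg_near_cst; near=> h.
    have h0 : h != 0 by near: h; exact: nbhs_dnbhs_neq.
    by rewrite /= fD fZ addrK /GRing.scale /= mulrA mulVf // mul1r.
  apply: DeriveDef; first by apply/cvg_ex; exists (f v).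
  exact: cvg_lim.
case=> [|k]; split => // v; split; first by move=> x; exact: (@ex_derive _ _ _ _ _ _ _ (df x v)).
rewrite (_ : 'D_v f = fun=> f v); first exact: Ck_cst.
by apply/funext => x; rewrite (@derive_val _ _ _ _ _ _ _ (df x v)).
Unshelve. all: by end_near. Qed.

(** A directional derivative is a one-variable derivative along a line, which brings the scalar
    chain rule to functions on [V]. *)
Lemma is_derive_line f x v df :
  is_derive x v f df <-> is_derive (0 : R) (1 : R) (fun t : R => f (t *: v + x)) df.
Proof.
have E : (fun h : R => h^-1 *: ((f \o shift x) (h *: v) - f x)) =
  (fun h : R => h^-1 *: (((fun t : R => f (t *: v + x)) \o shift 0) (h *: (1:R)) -
     f (0 *: v + x))).
  by apply/funext => h /=; rewrite addr0 scale0r add0r [_%:A]mulr1.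
split=> -[e <-]; apply: DeriveDef.
- by rewrite /derivable -E.
- by rewrite /derive -E.
- by rewrite /derivable E.
- by rewrite /derive E.
Qed.

Lemma is_derive_outer (h : R -> R) f x v dh df :
  is_derive (f x) (1 : R) h dh -> is_derive x v f df -> is_derive x v (fun y => h (f y)) (dh * df).
Proof.
move=> hh /is_derive_line hf; apply/is_derive_line.
apply: (@is_derive1_comp _ h (fun t : R => f (t *: v + x))) => //.
by rewrite scale0r add0r.
Qed.

End smooth_calculus.

Section smooth_outer.
Context {R : realType} {V : normedModType R}.

Lemma derive_outer (h : R -> R) (f : V -> R) x v :
  derivable h (f x) 1 -> derivable f x v ->
  derivable (fun y => h (f y)) x v /\
  'D_v (fun y => h (f y)) x = 'D_1 h (f x) * 'D_v f x.
Proof.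
move=> dh df.
have H := is_derive_outer (derivableP dh) (derivableP df).
by split; [exact: (@ex_derive _ _ _ _ _ _ _ H)|rewrite (@derive_val _ _ _ _ _ _ _ H)].
Qed.

(** Induction on the order for all [h] and [f] at once, because the derivative contains the
    derivative of [h] composed with [f]. *)
Lemma smooth_outer (h : R -> R) (f : V -> R) :
  smooth h -> smooth f -> smooth (fun x => h (f x)).
Proof.
move=> sh sf k; elim: k h f sh sf => [|k IH] h f sh sf; split => //;
  try by move=> x; apply: continuous_comp; exact: smooth_continuous.
move=> v.
have D x := derive_outer (@smooth_derivable _ _ h (f x) 1 sh) (@smooth_derivable _ _ f x v sf).
split; first by move=> x; case: (D x).
rewrite (_ : 'D_v (fun x => h (f x)) = fun x => 'D_1 h (f x) * 'D_v f x).
  apply: CkM; last exact: smooth_derive.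
  have sh' : smooth ('D_(1 : R) h) by exact: smooth_derive.
  exact: (IH _ f sh' sf).
by apply/funext => x; case: (D x).
Qed.

Lemma smooth_inv (f : V -> R) : (forall x, f x != 0) -> smooth f ->
  smooth (fun x => (f x)^-1).
Proof.
move=> f0 sf k; elim: k => [|k IH]; split => //;
  try by move=> x; apply: cvgV => //; exact: smooth_continuous.
move=> v; split; first by move=> x; apply: derivableV => //; exact: smooth_derivable.
rewrite (_ : 'D_v (fun x => (f x)^-1) = fun x => (-1) * ((f x)^-1 * (f x)^-1) * 'D_v f x).
  apply: CkM; last exact: smooth_derive.
  apply: CkM; first exact: Ck_cst.
  exact: CkM.
apply/funext => x; rewrite deriveV //; last exact: smooth_derivable.
by rewrite /GRing.scale /= mulN1r -invfM expr2.
Qed.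

End smooth_outer.

Section smooth_real.
Context {R : realType}.

Lemma derive_scale (f : R -> R) (x v : R) : derivable f x 1 ->
  derivable f x v /\ 'D_v f x = v * 'D_1 f x.
Proof.
move=> /derivable1_diffP df; split; first exact: diff_derivable.
rewrite !deriveE // -[v in LHS]mulr1.
exact: linearZ.
Qed.

Lemma Ck_real k (f f' : R -> R) : (forall x : R, is_derive x (1 : R) f (f' x)) -> Ck k f' -> Ck k.+1 f.
Proof.
move=> df Cf'; split.
  move=> x; apply: differentiable_continuous; apply/derivable1_diffP.
  exact: (@ex_derive _ _ _ _ _ _ _ (df x)).
move=> v; split.
  by move=> x; apply: (derive_scale _ _).1; exact: (@ex_derive _ _ _ _ _ _ _ (df x)).
rewrite (_ : 'D_v f = fun x => v * f' x); first by apply: CkM => //; exact: Ck_cst.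
apply/funext => x; have dx := @ex_derive _ _ _ _ _ _ _ (df x).
by rewrite (derive_scale v dx).2 (@derive_val _ _ _ _ _ _ _ (df x)).
Qed.

Lemma smooth_id : smooth (@idfun R).
Proof.
apply: smooth_linear => //.
by move=> x; exact: cvg_id.
Qed.

(* The exponential factor beats every polynomial in 1/t, so that all these
   functions vanish to infinite order at 0. *)
Definition flat (p : {poly R}) (t : R) : R :=
  if 0 < t then p.[t^-1] * expR (- t^-1) else 0.

(** Induction on the polynomial: half of the exponent pays for the polynomial of lower degree and
    the other half for the new factor [x], through [1 + y <= expR y]. *)
Lemma poly_le_exp (p : {poly R}) (e : R) : 0 < e ->
  exists2 C, 0 <= C & forall x, 0 <= x -> `|p.[x]| <= C * expR (e * x).
Proof.
elim/poly_ind: p e => [|p c IH] e e0.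
  by exists 0 => // x _; rewrite horner0 normr0 mul0r.
have e2 : 0 < e / 2 by rewrite divr_gt0.
have [C C0 HC] := IH _ e2.
exists (C * (2 / e) + `|c|) => [|x x0].
  by rewrite addr_ge0 // mulr_ge0 // divr_ge0 // ltW.
rewrite hornerMXaddC (le_trans (ler_normD _ _)) // mulrDl lerD //; last first.
  by rewrite ler_peMr // (le_trans _ (expR_ge1Dx _)) // lerDl mulr_ge0 // ltW.
rewrite normrM (ger0_norm x0).
have xle : x <= 2 / e * expR (e / 2 * x).
  rewrite -ler_pdivrMl ?divr_gt0 // invf_div.
  by apply: (le_trans _ (expR_ge1Dx _)); rewrite lerDr.
have -> : expR (e * x) = expR (e / 2 * x) * expR (e / 2 * x).
  by rewrite -expRD; congr expR; field.
apply: (le_trans (ler_pM _ _ (HC x x0) xle)) => //.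
by rewrite mulrACA.
Qed.

(** The exponential bound for ['X^2 * p] at 1/t. A quadratic bound makes the difference quotient at
    0 tend to 0. *)
Lemma flat_le (p : {poly R}) : exists2 C, 0 <= C & forall t, `|flat p t| <= C * t ^+ 2.
Proof.
have [C C0 HC] := @poly_le_exp ('X^2 * p) 1 ltr01.
exists C => // t; rewrite /flat; case: ifPn => t0; last first.
  by rewrite normr0 mulr_ge0 // sqr_ge0.
have ti : 0 <= t^-1 by rewrite invr_ge0 ltW.
have := HC _ ti; rewrite hornerM hornerXn mul1r normrM ger0_norm ?sqr_ge0 // => H.
rewrite normrM (ger0_norm (expR_ge0 _)) expRN ler_pdivrMr ?expR_gt0 //.
rewrite mulrAC -ler_pdivrMr ?exprn_gt0 // mulrC.
by rewrite -exprVn.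
Qed.

(** For t > 0 this is the product rule with the derivative - 1/t^2 of 1/t. The class of functions
    [flat p] is thus closed under differentiation, and smoothness follows by induction. *)
Lemma is_derive_flat (p : {poly R}) (x : R) :
  is_derive x (1 : R) (flat p) (flat ('X^2 * (p - p^`())) x).
Proof.
have [x0|x0|->] := ltgtP x 0.
- have <- : 0 = flat ('X^2 * (p - p^`())) x.
    by rewrite /flat ltNge (ltW x0).
  have H : is_derive x (1 : R) (cst (0 : R)) 0 by exact: is_derive_cst.
  apply: near_eq_is_derive H.
  near=> y; rewrite /flat ltNge /=.
  by have -> : y <= 0 by near: y; exact: lt_le_nbhsl.
- have xn0 : x != 0 by rewrite gt_eqF.
  have dinv : is_derive x 1 (fun y : R => y^-1) (- x ^- 2).
    have := @is_deriveV _ (@idfun R) x 1 1 xn0 (is_derive_id _ _).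
    by rewrite /GRing.scale /= mulr1.
  have dp := @is_derive1_comp _ (horner p) (fun y : R => y^-1) x _ _
    (is_derive_poly p x^-1) dinv.
  have de := @is_derive1_comp _ expR (fun y : R => - y^-1) x _ _
    (is_derive_expR _) (is_deriveN dinv).
  have dM := is_deriveM dp de.
  apply: (@near_eq_is_derive _ _ _ ((horner p \o (fun y => y^-1)) *
     (expR \o (fun y => - y^-1)))); last first.
    apply: (is_derive_eq dM).
    rewrite /flat x0 /GRing.scale /= !hornerE /=.
    by rewrite -exprVn; ring.
  near=> y; rewrite /flat.
  have -> // : 0 < y by near: y; exact: lt_nbhsr.
- have -> : flat ('X^2 * (p - p^`())) 0 = 0 by rewrite /flat ltxx.
  have [C C0 HC] := flat_le p.
  suff H : (fun h : R => h^-1 *: ((flat p \o shift 0) (h *: (1:R)) - flat p 0)) @ 0^' --> (0:R).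
    by apply: DeriveDef; [apply/cvg_ex; exists 0|exact: cvg_lim].
  have -> : (fun h : R => h^-1 *: ((flat p \o shift 0) (h *: (1:R)) - flat p 0)) =
      (fun h => h^-1 * flat p h).
    apply/funext => h /=.
    by rewrite addr0 [_%:A]mulr1 {2}/flat ltxx subr0.
  apply/norm_cvg0P.
  apply: (@squeeze_cvgr _ _ _ _ (cst 0) (fun h : R => C * `|h|)).
  + near=> h; rewrite normr_ge0 /=.
    have h0 : h != 0 by near: h; exact: nbhs_dnbhs_neq.
    rewrite normrM normfV ler_pdivrMl ?normr_gt0 //.
    apply: (le_trans (HC h)).
    by rewrite [leRHS]mulrCA ler_wpM2l // -(ger0_norm (sqr_ge0 h)) normrX expr2.
  + exact: cvg_cst.
  + have H : (fun h : R => C * `|h|) @ 0^' --> C * `|0 : R|.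
      by apply: cvgMr; apply: cvg_norm; exact: nbhs_dnbhs.
    by rewrite normr0 mulr0 in H.
Unshelve. all: by end_near. Qed.

Lemma smooth_flat p : smooth (flat p).
Proof.
move=> k; elim: k p => [|k IH] p.
  split => // x; apply: differentiable_continuous; apply/derivable1_diffP.
  exact: (@ex_derive _ _ _ _ _ _ _ (is_derive_flat p x)).
exact: Ck_real (is_derive_flat p) (IH _).
Qed.

(** The usual smooth transition over the unit interval; all time cutoffs, bumps and smoothed
    absolute values are made from it. *)
Definition step (t : R) : R := flat 1 t / (flat 1 t + flat 1 (1 - t)).

Lemma flat1_ge0 t : 0 <= flat 1 t.
Proof. by rewrite /flat; case: ifP => // _; rewrite hornerC mul1r expR_ge0. Qed.

Lemma flat1_gt0 t : 0 < t -> 0 < flat 1 t.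
Proof. by move=> t0; rewrite /flat t0 hornerC mul1r expR_gt0. Qed.

Lemma step_den t : 0 < flat 1 t + flat 1 (1 - t).
Proof.
have [t0|t0] := ltP 0 t; first by rewrite ltr_pwDl ?flat1_gt0 ?flat1_ge0.
by rewrite ltr_wpDl ?flat1_ge0 // flat1_gt0 //; lra.
Qed.

Lemma smooth_step : smooth step.
Proof.
apply: smoothM; first exact: smooth_flat.
apply: smooth_inv; first by move=> t; rewrite gt_eqF // step_den.
apply: smoothD; first exact: smooth_flat.
apply: (@smooth_outer _ _ (flat 1) (fun t : R => 1 - t)); first exact: smooth_flat.
by apply: smoothB; [exact: smooth_cst|exact: smooth_id].
Qed.

Lemma step0 t : t <= 0 -> step t = 0.
Proof. by move=> t0; rewrite /step {1}/flat ltNge t0 mul0r. Qed.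

Lemma step1 t : 1 <= t -> step t = 1.
Proof.
move=> t1; rewrite /step.
have -> : flat 1 (1 - t) = 0 by rewrite /flat subr_gt0 ltNge t1.
by rewrite addr0 divff // gt_eqF // flat1_gt0 //; lra.
Qed.

Lemma step_ge0 t : 0 <= step t.
Proof. by rewrite /step divr_ge0 ?flat1_ge0 // ltW ?step_den. Qed.

Lemma step_le1 t : step t <= 1.
Proof. by rewrite /step ler_pdivrMr ?step_den // mul1r lerDl flat1_ge0. Qed.

Lemma derive_step_out t : t < 0 \/ 1 < t -> 'D_1 step t = 0.
Proof.
case=> h.
  rewrite (@near_eq_derive _ _ _ _ (cst (0 : R))) ?derive_cst //.
  near=> y; apply: step0; near: y; exact: lt_le_nbhsl.
rewrite (@near_eq_derive _ _ _ _ (cst (1 : R))) ?derive_cst //.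
near=> y; apply: step1; apply: ltW; near: y; exact: lt_nbhsr.
Unshelve. all: by end_near. Qed.

Lemma derive_step_bound : exists2 C, 0 <= C & forall t, `|'D_1 step t| <= C.
Proof.
have c : {within `[0, 1], continuous (fun t => `|'D_1 step t|)}.
  apply: continuous_subspaceT => t; apply: cvg_norm.
  by have := smooth_continuous (smooth_derive (1 : R) smooth_step); exact.
have [x _ Hx] := @EVT_max _ _ 0 1 ler01 c.
exists `|'D_1 step x|; first exact: normr_ge0.
move=> t.
have [t01|] := boolP (t \in `[0, 1]); first exact: Hx.
rewrite in_itv /= negb_and -!ltNge => /orP h.
by rewrite derive_step_out ?normr0.
Qed.

End smooth_real.

Section derivatives.
Context {R : realType} {V : normedModType R}.
Implicit Types (f g : V -> R).

Lemma is_derive_add f g x v df dg : is_derive x v f df -> is_derive x v g dg ->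
  is_derive x v (fun y => f y + g y) (df + dg).
Proof. by move=> hf hg; exact: (is_deriveD hf hg). Qed.

Lemma is_derive_opp f x v df : is_derive x v f df ->
  is_derive x v (fun y => - f y) (- df).
Proof. by move=> hf; exact: (is_deriveN hf). Qed.

Lemma is_derive_sub f g x v df dg : is_derive x v f df -> is_derive x v g dg ->
  is_derive x v (fun y => f y - g y) (df - dg).
Proof. by move=> hf hg; exact: (is_deriveB hf hg). Qed.

Lemma is_derive_mul f g x v df dg : is_derive x v f df -> is_derive x v g dg ->
  is_derive x v (fun y => f y * g y) (f x * dg + g x * df).
Proof. by move=> hf hg; exact: (is_deriveM hf hg). Qed.

Lemma is_derive_const (c : R) (x v : V) : is_derive x v (fun _ => c) 0.
Proof. exact: is_derive_cst. Qed.

Lemma is_derive_mulr f (c : R) x v df : is_derive x v f df ->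
  is_derive x v (fun y => f y * c) (df * c).
Proof.
move=> hf; have := is_derive_mul hf (is_derive_const c x v).
by rewrite mulr0 add0r mulrC.
Qed.

Lemma is_derive_linear (f : V -> R) x v :
  (forall x y, f (x + y) = f x + f y) -> (forall c x, f (c *: x) = c * f x) ->
  is_derive x v f (f v).
Proof.
move=> fD fZ.
have e : (fun h : R => h^-1 *: ((f \o shift x) (h *: v) - f x)) @ 0^' --> f v.
  apply: cvg_near_cst; near=> h.
  have h0 : h != 0 by near: h; exact: nbhs_dnbhs_neq.
  by rewrite /= fD fZ addrK /GRing.scale /= mulrA mulVf // mul1r.
apply: DeriveDef; first by apply/cvg_ex; exists (f v).
exact: cvg_lim.
Unshelve. all: by end_near. Qed.

End derivatives.

(** * The weak equation tested on transported functions *)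

Section borel_continuous.
Context {R : realType}.

(** A countable base of the topology that consists of measurable sets. It passes to products, and
    this is how open subsets of pairs and triples enter the product sigma-algebra and continuous
    functions become Borel. *)
Definition measurable_base (T : topologicalType) (M : set (set T)) :=
  exists B : nat -> set T, (forall n, M (B n)) /\
    forall x U, nbhs x U -> exists n, B n x /\ B n `<=` U.

Lemma measurable_base_prod (T1 T2 : topologicalType) (M1 : set (set T1))
    (M2 : set (set T2)) (M : set (set (T1 * T2)%type)) :
  (forall A B, M1 A -> M2 B -> M (A `*` B)) ->
  measurable_base M1 -> measurable_base M2 -> measurable_base M.
Proof.
move=> M12 [B1 [mB1 hB1]] [B2 [mB2 hB2]].
pose f n := odflt (0%N, 0%N) (unpickle n).
exists (fun n => B1 (f n).1 `*` B2 (f n).2); split.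
  by move=> n; exact: M12.
move=> [x y] U [[U1 U2] /= [nx ny] sub].
have [n1 [n1x s1]] := hB1 _ _ nx; have [n2 [n2x s2]] := hB2 _ _ ny.
exists (pickle (n1, n2)); rewrite /f pickleK /=; split=> //.
by move=> [a b] [/= /s1 a1 /s2 b2]; exact: sub.
Qed.

Lemma open_measurable_base (T : topologicalType) (M : set (set T)) (U : set T) :
  measurable_base M -> M set0 -> (forall F : nat -> set T, (forall n, M (F n)) ->
    M (\bigcup_n F n)) -> open U -> M U.
Proof.
move=> [B [mB hB]] M0 MU oU.
pose F n : set T := if pselect (B n `<=` U) then B n else set0.
rewrite (_ : U = \bigcup_n F n); first by apply: MU => n; rewrite /F; case: pselect => /= _; [exact: mB|exact: M0].
apply/seteqP; split=> [x Ux|x [n _]]; last first.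
  by rewrite /F; case: pselect => // h /h.
have [n [Bx BU]] := hB x U (open_nbhs_nbhs (conj oU Ux)).
by exists n => //; rewrite /F; case: pselect.
Qed.

Lemma measurable_base_R : @measurable_base R (@measurable _ (measurableTypeR R)).
Proof.
pose f n : R * R := let q := odflt (0%Q, 0%Q) (unpickle n) in (ratr q.1, ratr q.2).
exists (fun n => `](f n).1, (f n).2[%classic); split.
  by move=> n; exact: measurable_itv.
move=> x U /nbhs_ballP[e /= e0 sub].
have [q1] : exists q : rat, ratr q \in `]x - e, x[.
  by apply: rat_in_itvoo; lra.
have [q2] : exists q : rat, ratr q \in `]x, x + e[.
  by apply: rat_in_itvoo; lra.
rewrite !in_itv /= => /andP[h1 h2] /andP[h3 h4].
exists (pickle (q1, q2)); rewrite /f pickleK /= !in_itv /= h4 h1; split=> //.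
move=> y; rewrite /= in_itv /= => /andP[h5 h6]; apply: sub.
by rewrite /ball /= ltr_distl; apply/andP; split; lra.
Qed.

Lemma measurable_base_RR : @measurable_base (R * R)%type
  (@measurable _ (measurableTypeR R * measurableTypeR R)%type).
Proof.
apply: (measurable_base_prod _ measurable_base_R measurable_base_R).
by move=> A B mA mB; exact: measurableX.
Qed.

Lemma measurable_base_RRR : @measurable_base (R * R * R)%type
  (@measurable _ (measurableTypeR R * measurableTypeR R * measurableTypeR R)%type).
Proof.
apply: (measurable_base_prod _ measurable_base_RR measurable_base_R).
by move=> A B mA mB; exact: measurableX.
Qed.

Lemma open_measurable2 (U : set (R * R)) : open U -> measurable U.
Proof.
move=> oU; apply: (open_measurable_base measurable_base_RR) => //.
by move=> F mF; exact: bigcupT_measurable.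
Qed.

Lemma open_measurable3 (U : set (R * R * R)) : open U -> measurable U.
Proof.
move=> oU; apply: (open_measurable_base measurable_base_RRR) => //.
by move=> F mF; exact: bigcupT_measurable.
Qed.

Lemma continuous_measurable2 (f : R * R -> R) : continuous f -> measurable_fun setT f.
Proof.
move=> cf; apply: (measurability _ (RGenOpens.measurableE R)) => //.
move=> _ [_ [a [b ->]] <-]; rewrite setTI; apply: open_measurable2.
by apply: open_comp => //; exact: interval_open.
Qed.

Lemma continuous_measurable3 (f : R * R * R -> R) : continuous f -> measurable_fun setT f.
Proof.
move=> cf; apply: (measurability _ (RGenOpens.measurableE R)) => //.
move=> _ [_ [a [b ->]] <-]; rewrite setTI; apply: open_measurable3.
by apply: open_comp => //; exact: interval_open.
Qed.

Lemma compact_bounded (T : topologicalType) (f : T -> R) (K : set T) :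
  compact K -> continuous f -> exists2 C, 0 <= C & forall z, K z -> `|f z| <= C.
Proof.
move=> cK cf.
have [K0|/set0P K0] := eqVneq K set0.
  by exists 0 => // z; rewrite K0.
have cn : {within K, continuous (fun z => `|f z|)}.
  by apply: continuous_subspaceT => z; apply: cvg_norm; exact: cf.
have [[M [Mr HM]] _] : bounded_set (f @` K) /\ True.
  split=> //; apply: compact_bounded; apply: continuous_compact => //.
  by apply: continuous_subspaceT.
exists (`|M| + 1); first by rewrite addr_ge0.
move=> z Kz; apply: HM; last by exists z.
by rewrite (le_lt_trans (ler_norm M)) // ltrDl.
Qed.

End borel_continuous.

Section slices.
Context {R : realType} {V W : normedModType R}.
Implicit Types (F : V * W -> R).

(** A partial derivative is the derivative of the full function in a direction with a zero
    component: the two difference quotients are equal. *)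
Lemma slice_snd F x t w :
  (derivable (fun t => F (x, t)) t w <-> derivable F (x, t) (0, w)) /\
  'D_w (fun t => F (x, t)) t = 'D_(0, w) F (x, t).
Proof.
rewrite /derivable /derive.
suff -> : (fun h : R => h^-1 *: (((fun t => F (x, t)) \o shift t) (h *: w) - F (x, t))) =
  (fun h : R => h^-1 *: ((F \o shift (x, t)) (h *: ((0, w) : V * W)) - F (x, t))) by [].
apply/funext => h /=; congr (_ *: (F _ - _)).
by rewrite /shift /=; congr pair; rewrite /= scaler0 add0r.
Qed.

Lemma slice_fst F v x t :
  (derivable (fun y => F (y, t)) x v <-> derivable F (x, t) (v, 0)) /\
  'D_v (fun y => F (y, t)) x = 'D_(v, 0) F (x, t).
Proof.
rewrite /derivable /derive.
suff -> : (fun h : R => h^-1 *: (((fun y => F (y, t)) \o shift x) (h *: v) - F (x, t))) =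
  (fun h : R => h^-1 *: ((F \o shift (x, t)) (h *: ((v, 0) : V * W)) - F (x, t))) by [].
apply/funext => h /=; congr (_ *: (F _ - _)).
by rewrite /shift /=; congr pair; rewrite /= scaler0 add0r.
Qed.

Lemma Ck_slice k F t : Ck k F -> Ck k (fun x => F (x, t)).
Proof.
have cs (G : V * W -> R) : continuous G -> continuous (fun x => G (x, t)).
  move=> cG x; apply: (continuous_comp _ (cG (x, t))).
  move=> A [[U U'] /= [nU nW] sub]; apply: filterS nU => y Uy.
  by apply: sub; split => //; exact: nbhs_singleton.
elim: k F => [|k IH] F [cF dF]; split => //; try exact: cs.
move=> v; have [d1 d2] := dF (v, 0); split.
  by move=> x; apply/(slice_fst F v x t).1.
rewrite (_ : 'D_v (fun x => F (x, t)) = fun x => 'D_(v, 0) F (x, t)).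
  exact: (IH ('D_(v, 0) F)).
by apply/funext => x; rewrite (slice_fst F v x t).2.
Qed.

Lemma smooth_slice F t : smooth F -> smooth (fun x => F (x, t)).
Proof. by move=> sF k; exact: Ck_slice. Qed.

Lemma Ck_slice_snd k F x : Ck k F -> Ck k (fun t => F (x, t)).
Proof.
have cs (G : V * W -> R) : continuous G -> continuous (fun t => G (x, t)).
  move=> cG t; apply: (continuous_comp _ (cG (x, t))).
  move=> A [[U U'] /= [nU nW] sub]; apply: filterS nW => y Uy.
  by apply: sub; split => //; exact: nbhs_singleton.
elim: k F => [|k IH] F [cF dF]; split => //; try exact: cs.
move=> w; have [d1 d2] := dF (0, w); split.
  by move=> t; apply/(slice_snd F x t w).1.
rewrite (_ : 'D_w (fun t => F (x, t)) = fun t => 'D_(0, w) F (x, t)).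
  exact: (IH ('D_(0, w) F)).
by apply/funext => t; rewrite (slice_snd F x t w).2.
Qed.

Lemma smooth_slice_snd F x : smooth F -> smooth (fun t => F (x, t)).
Proof. by move=> sF k; exact: Ck_slice_snd. Qed.

End slices.

Section transport.
Context {R : realType}.
Implicit Types (F : R * R * R -> R).

Lemma slice_t F x t :
  (derivable (fun t => F (x, t)) t 1 <-> derivable F (x, t) (0, 1)) /\
  'D_1 (fun t => F (x, t)) t = 'D_(0, 1) F (x, t).
Proof. exact: slice_snd. Qed.

Lemma slice_x F (v : R * R) x t :
  (derivable (fun y => F (y, t)) x v <-> derivable F (x, t) (v, 0)) /\
  'D_v (fun y => F (y, t)) x = 'D_(v, 0) F (x, t).
Proof. exact: slice_fst. Qed.

Lemma smooth_snd : smooth (fun z : R * R * R => z.2).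
Proof. by apply: smooth_linear => //; move=> z; exact: cvg_snd. Qed.

Lemma smooth_fst1 : smooth (fun z : R * R * R => z.1.1).
Proof.
apply: smooth_linear => //; move=> z.
by apply: (continuous_comp (f := fst) (g := fst)); [exact: cvg_fst|exact: cvg_fst].
Qed.

Lemma smooth_fst2 : smooth (fun z : R * R * R => z.1.2).
Proof.
apply: smooth_linear => //; move=> z.
by apply: (continuous_comp (f := fst) (g := snd)); [exact: cvg_fst|exact: cvg_snd].
Qed.

(** What the weak equation applies to a test function, for a velocity that is constant in time.
    [transportE] rewrites it with directional derivatives in space-time, where smoothness is at
    hand. *)
Definition transport (v : R * R -> R * R) F (z : R * R * R) : R :=
  'D_1 (fun t : R => F (z.1, t)) z.2 + dot2 (v z.1) (grad (fun x => F (x, z.2)) z.1).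

Lemma transportE v F z : transport v F z =
  'D_((0, 0), 1) F z + ((v z.1).1 * 'D_((1, 0), 0) F z + (v z.1).2 * 'D_((0, 1), 0) F z).
Proof.
case: z => x t; rewrite /transport /= (slice_t F x t).2 /dot2 /grad /=.
by rewrite (slice_x F (1, 0) x t).2 (slice_x F (0, 1) x t).2.
Qed.

Lemma transport_cutoff v F (eta : R -> R) z : smooth F -> smooth eta ->
  transport v (fun z => eta z.2 * F z) z = 'D_1 eta z.2 * F z + eta z.2 * transport v F z.
Proof.
move=> sF se; have seta : smooth (fun z : R * R * R => eta z.2) by apply: smooth_outer => //; exact: smooth_snd.
have D w : 'D_w (fun z : R * R * R => eta z.2 * F z) z =
    eta z.2 * 'D_w F z + F z * ('D_1 eta z.2 * w.2).
  rewrite deriveM; [|exact: smooth_derivable|exact: smooth_derivable].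
  have [_ ->] := @derive_outer _ _ eta (fun z : R * R * R => z.2) z w
    (smooth_derivable se) (smooth_derivable smooth_snd).
  have -> // : 'D_w (fun z : R * R * R => z.2) z = w.2.
  rewrite /derive; apply: cvg_lim => //; apply: cvg_near_cst; near=> h.
  have h0 : h != 0 by near: h; exact: nbhs_dnbhs_neq.
  by rewrite /= addrK /GRing.scale /= mulrA mulVf // mul1r.
have D1 := D (0, 1); have D2 := D ((1, 0), 0); have D3 := D ((0, 1), 0).
rewrite (transportE v (fun z => eta z.2 * F z)) (transportE v F).
move: D1 D2 D3 => /= -> -> ->.
have alg (e f e' d1 d2 d3 v1 v2 : R) :
  (e * d1 + f * (e' * 1)) + (v1 * (e * d2 + f * (e' * 0)) + v2 * (e * d3 + f * (e' * 0))) =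
  e' * f + e * (d1 + (v1 * d2 + v2 * d3)) by ring.
exact: alg.
Unshelve. all: by end_near. Qed.

End transport.

Section integral_bounds.
Context d (T : measurableType d) (R : realType).
Variable mu : {measure set T -> \bar R}.

Lemma norm_Rintegral_le (D S : set T) (f : T -> R) (c : R) :
  measurable D -> (mu D < +oo)%E -> measurable S -> measurable_fun D f -> 0 <= c ->
  (forall x, D x -> `|f x| <= c * \1_S x) ->
  `|\int[mu]_(x in D) f x| <= c * fine (mu (S `&` D)).
Proof.
move=> mD Dfin mS mf c0 fc.
have ic : mu.-integrable D (EFin \o (fun x => c * \1_S x)).
  apply: (@bounded_integrable _ _ _ _ _ _ c) => //.
    by apply: measurable_funM => //; apply: measurable_indic.
  move=> x _; rewrite normrM ger0_norm // ger0_norm ?indicE ?ler0n //.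
  by case: (_ \in _); rewrite ?mulr1 ?mulr0.
have if_ : mu.-integrable D (EFin \o f).
  apply: (@bounded_integrable _ _ _ _ _ _ c) => //.
  move=> x Dx; apply: (le_trans (fc x Dx)).
  by rewrite indicE; case: (_ \in _); rewrite ?mulr1 ?mulr0.
apply: (le_trans (le_normr_Rintegral mD if_)).
apply: (@le_trans _ _ (\int[mu]_(x in D) (c * \1_S x))).
  apply: le_Rintegral => //; first exact: integrable_norm.
rewrite RintegralZl //; last first.
  apply: (@bounded_integrable _ _ _ mu D (fun x => \1_S x) 1) => //; first by apply: measurable_indic.
  by move=> x _; rewrite indicE; case: (_ \in _); rewrite ?normr1 ?normr0.
rewrite ler_wpM2l // /Rintegral integral_indic //.
Qed.

Lemma integrable_scale (D : set T) (f : T -> R) (k : R) : measurable D ->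
  mu.-integrable D (EFin \o f) -> mu.-integrable D (EFin \o (fun x => k * f x)).
Proof. by move=> mD i; exact: (@integrableZl _ _ _ mu D mD k (EFin \o f)). Qed.

End integral_bounds.

Section ftc_smooth.
Context {R : realType}.

Lemma lamE (A : set R) : lam A = lebesgue_measure A.
Proof. by []. Qed.

Lemma lam_unit_itv : lam (`]0%R, 1%R[%classic : set R) = 1%E.
Proof. by rewrite lamE lebesgue_measure_itv /= lte01 oppr0 addr0. Qed.

Lemma FTC_C1 (F f : R -> R) (a b : R) : a <= b ->
  (forall x : R, is_derive x (1 : R) F (f x)) -> continuous f ->
  (\int[lam]_(x in `[a, b]) (f x)%:E = (F b - F a)%:E)%E.
Proof.
rewrite le_eqVlt => /predU1P[->|ab] dF cf.
  by rewrite set_itv1 integral_set1 subrr.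
have cF : continuous F.
  move=> x; apply: differentiable_continuous; apply/derivable1_diffP.
  exact: (@ex_derive _ _ _ _ _ _ _ (dF x)).
rewrite EFinB; apply: (@continuous_FTC2 _ f F a b ab).
- exact: continuous_subspaceT.
- split.
  + by move=> x _; exact: (@ex_derive _ _ _ _ _ _ _ (dF x)).
  + by apply: cvg_at_right_filter; exact: cF.
  + by apply: cvg_at_left_filter; exact: cF.
- by move=> x _; rewrite derive1E (@derive_val _ _ _ _ _ _ _ (dF x)).
Qed.

Lemma FTC_smooth (F : R -> R) (a b : R) : a <= b -> smooth F ->
  (\int[lam]_(x in `[a, b]) ('D_1 F x)%:E = (F b - F a)%:E)%E.
Proof.
move=> ab sF; apply: FTC_C1 => //.
  by move=> x; apply/derivableP; exact: smooth_derivable.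
by have := smooth_continuous (smooth_derive (1 : R) sF).
Qed.

(** Mean value theorem in time, with the bound of the time derivative on the closed unit cube, which
    is compact. *)
Lemma lipschitz_slice (F : R * R * R -> R) : smooth F ->
  exists2 C, 0 <= C & forall x t t', unit_square x -> 0 <= t <= 1 -> 0 <= t' <= 1 ->
    `|F (x, t) - F (x, t')| <= C * `|t - t'|.
Proof.
move=> sF.
pose K : set (R * R * R) := (`[0, 1] `*` `[0, 1]) `*` `[0, 1].
have cK : compact K by apply: compact_setX; [apply: compact_setX|]; exact: segment_compact.
have [C C0 HC] := compact_bounded cK (smooth_continuous (smooth_derive ((0, 1) : R * R * R) sF)).
exists C => // x; have W (t t' : R) : unit_square x -> 0 <= t <= 1 -> 0 <= t' <= 1 -> t <= t' ->
    `|F (x, t) - F (x, t')| <= C * `|t - t'|.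
  move=> [/=]; rewrite !in_itv /= => /andP[x1 x2] /andP[x3 x4] /andP[t0 t1] /andP[t'0 t'1].
  rewrite le_eqVlt => /predU1P[->|tt']; first by rewrite !subrr normr0 mulr0.
  have dx (y : R) : is_derive y (1 : R) (fun s => F (x, s)) ('D_(0, 1) F (x, y)).
    apply: DeriveDef; last by rewrite (slice_t F x y).2.
    by apply/(slice_t F x y).1; exact: smooth_derivable.
  have cx : {within `[t, t'], continuous (fun s => F (x, s))}.
    apply: continuous_subspaceT => y; apply: differentiable_continuous.
    apply/derivable1_diffP; exact: (@ex_derive _ _ _ _ _ _ _ (dx y)).
  have [c cin e] := @MVT _ (fun s => F (x, s)) (fun s => 'D_(0, 1) F (x, s)) t t' tt'
    (fun y _ => dx y) cx.
  rewrite distrC e normrM (distrC t) ler_wpM2r //; apply: HC.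
  move: cin; rewrite in_itv /= => /andP[c1 c2].
  rewrite /K /= !in_itv /= !(ltW x1) !(ltW x2) !(ltW x3) !(ltW x4) /=.
  by split=> //; apply/andP; split; lra.
move=> t t' Qx ht ht'; have [tt'|/ltW tt'] := leP t t'; first exact: W.
by rewrite distrC (distrC t); exact: W.
Qed.

End ftc_smooth.

(** * The weak equation between two times *)

Section weak_solution.
Context {R : realType}.
Variables (u : R * R * R -> R * R) (rho0 : R * R -> R) (rho : R * R * R -> R).
Variables (M : R) (w : R -> R * R -> R).
Hypothesis sol : transport_solution u rho0 rho.
Hypothesis M0 : 0 <= M.
Hypothesis hw : forall t, 0 <= t < 1 ->
   [/\ measurable_fun setT (w t), (forall x, (`|w t x| <= M)%R),
      (forall x, ~ unit_square x -> w t x = 0%R) &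
      {ae lam2, forall x, unit_square x -> rho (x, t) = w t x}].

Let mQ := @measurable_unit_square R.
Let Qfin : (lam2 (@unit_square R) < +oo)%E.
Proof. by rewrite lam2_unit_square ltry. Qed.

Lemma Rintegral_leb2_rep t (psi : R * R -> R) : 0 <= t < 1 -> measurable_fun setT psi ->
  \int[leb2]_(x in unit_square) (rho (x, t) * psi x) =
  \int[lam2]_(x in unit_square) (w t x * psi x).
Proof.
move=> t01 mpsi; have [mw wM w0 aew] := hw t01.
rewrite /Rintegral; congr fine.
rewrite -integral_leb2 //; last first.
  by apply/measurable_EFinP; apply: measurable_funM; apply: (@measurable_funS _ _ _ _ setT).
have [[_ mrho] _ _ _ _] := sol.
apply: ae_eq_integral.
- exact: completed_measurable.
- apply/measurable_EFinP; apply: measurable_funM; first by apply: mrho; rewrite /= in_itv.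
  by apply: completed_measurable_fun => //; apply: (@measurable_funS _ _ _ _ setT).
- apply/measurable_EFinP; apply: completed_measurable_fun => //.
  by apply: measurable_funM; apply: (@measurable_funS _ _ _ _ setT).
- by apply: (ae_impl (ae_lam2 aew)) => x h Qx; rewrite h.
Qed.

Variables (F : R * R * R -> R) (K : set (R * R)) (a b : R).
Hypothesis sF : smooth F.
Hypothesis cK : compact K.
Hypothesis KQ : K `<=` unit_square.
Hypothesis FK : forall x t, a <= t <= b -> F (x, t) != 0 -> K x.

Definition pairing t := \int[lam2]_(x in unit_square) (w t x * F (x, t)).

Lemma measurable_smooth_slice (G : R * R * R -> R) t : continuous G ->
  measurable_fun setT (fun x => G (x, t)).
Proof.
move=> cG; have := continuous_measurable3 cG.
exact: (@measurable_fun_pair1 _ _ _ _ _ _ G t).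
Qed.

Lemma slice_test t : a <= t <= b -> test_function unit_square (fun x => F (x, t)).
Proof.
move=> tab; have cl : closed K by apply: compact_closed => //; exact: norm_hausdorff.
have sub : support_of (fun x => F (x, t)) `<=` K.
  have := @closureS _ [set x | F (x, t) != 0] K (fun x h => FK tab h).
  by rewrite -((closure_id K).1 cl).
split; first exact: smooth_slice.
- by apply: subclosed_compact cK _ => //; exact: closed_closure.
- exact: subset_trans KQ.
Qed.

Lemma pairing_integrable t (G : R * R * R -> R) : 0 <= t < 1 -> continuous G ->
  lam2.-integrable unit_square (EFin \o (fun x => w t x * G (x, t))).
Proof.
move=> t01 cG; have [mw wM _ _] := hw t01.
pose KK : set (R * R * R) := (`[0, 1] `*` `[0, 1]) `*` `[0, 1].
have cKK : compact KK by apply: compact_setX; [apply: compact_setX|]; exact: segment_compact.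
have [C C0 HC] := compact_bounded cKK cG.
apply: (@bounded_integrable _ _ _ _ _ _ (M * C)) => //.
  apply: measurable_funM; apply: (@measurable_funS _ _ _ _ setT) => //.
  exact: measurable_smooth_slice.
move=> x [/=]; rewrite !in_itv /= => /andP[x1 x2] /andP[x3 x4].
rewrite normrM ler_pM // HC // /KK /= !in_itv /= !(ltW x1) !(ltW x2) !(ltW x3) !(ltW x4).
by move: t01 => /andP[-> /ltW ->].
Qed.

(** Weak-* continuity of [rho] handles a fixed test function, here the slice of [F] at time [t]; the
    change of the slice itself is controlled by the Lipschitz bound in time. *)
Lemma pairing_continuous t (e : R) : a <= t <= b -> 0 <= t < 1 -> 0 < e ->
  exists2 d, 0 < d & forall t', 0 <= t' < 1 -> `|t' - t| < d ->
    `|pairing t' - pairing t| <= e.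
Proof.
move=> tab t01 e0.
have [_ _ wc _ _] := sol.
have [C C0 HC] := lipschitz_slice sF.
have e2 : 0 < e / 2 by rewrite divr_gt0.
have MC : 0 < M * C + 1 by rewrite ltr_wpDl // mulr_ge0.
have := wc _ (slice_test tab).
move=> /subspace_continuousP /(_ t).
have t01' : `[0, 1[%classic t by rewrite /= in_itv.
move=> /(_ t01') /cvgrPdist_le /(_ _ e2).
rewrite near_withinE => /nbhs_ballP[d /= d0 Hd].
exists (Num.min d (e / 2 / (M * C + 1))) => [|t' t'01].
  by rewrite lt_min d0 divr_gt0.
rewrite lt_min => /andP[h1 h2].
have := Hd t'; rewrite /ball /= distrC => /(_ h1).
have t'01' : `[0, 1[%classic t' by rewrite /= in_itv.
have mFt := measurable_smooth_slice t (smooth_continuous sF).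
have t'01i : t' \in `[0, 1[ by rewrite in_itv.
move=> /(_ t'01i); rewrite /from_subspace !Rintegral_leb2_rep // => h3.
have cF := smooth_continuous sF.
have [mw' wM' _ _] := hw t'01.
have -> : pairing t' - pairing t =
    (pairing t' - \int[lam2]_(x in unit_square) (w t' x * F (x, t))) -
    (pairing t - \int[lam2]_(x in unit_square) (w t' x * F (x, t))) by ring.
apply: (le_trans (ler_normB _ _)); rewrite (splitr e) lerD //.
have if1 := pairing_integrable t'01 cF.
have if2 : lam2.-integrable unit_square (EFin \o (fun x => w t' x * F (x, t))).
  have := @pairing_integrable t' (fun z => F (z.1, t)) t'01; apply.
  have cs : continuous (fun x => F (x, t)) by have := smooth_continuous (smooth_slice t sF).
  by move=> z; apply: (continuous_comp (f := fst) (g := fun x => F (x, t))); [exact: cvg_fst|exact: cs].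
rewrite /pairing -RintegralB //.
apply: (@le_trans _ _ ((M * C) * `|t' - t| * fine (lam2 (setT `&` unit_square)))).
  apply: norm_Rintegral_le => //.
  - apply: measurable_funB; apply: measurable_funM;
      apply: (@measurable_funS _ _ _ _ setT) => //; exact: measurable_smooth_slice.
  - by rewrite !mulr_ge0.
  move=> x Qx; rewrite indicT mulr1 -mulrBr normrM -mulrA ler_pM // HC //.
    by move: t'01 => /andP[-> /ltW ->].
  by move: t01 => /andP[-> /ltW ->].
rewrite setTI lam2_unit_square mulr1.
apply: (@le_trans _ _ ((M * C + 1) * `|t' - t|)); first by rewrite ler_wpM2r // lerDl.
by rewrite mulrC -ler_pdivlMr // ltW.
Qed.

Variables (v : R * R -> R * R) (V : R) (S : set (R * R)) (B : R).
Hypothesis a0 : 0 <= a.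
Hypothesis ab : a < b.
Hypothesis b1 : b < 1.
Hypothesis uv : forall x t, a < t < b -> u (x, t) = v x.
Hypothesis mv1 : measurable_fun setT (fun x => (v x).1).
Hypothesis mv2 : measurable_fun setT (fun x => (v x).2).
Hypothesis vV : forall x, `|(v x).1| <= V /\ `|(v x).2| <= V.
Hypothesis mS : measurable S.
Hypothesis B0 : 0 <= B.
Hypothesis FB : forall x t, unit_square x -> a < t < b -> `|transport v F (x, t)| <= B * \1_S x.

Lemma measurable_transport (G : R * R * R -> R) : smooth G -> measurable_fun setT (transport v G).
Proof.
move=> sG; rewrite (_ : transport v G = fun z =>
  'D_((0, 0), 1) G z + ((v z.1).1 * 'D_((1, 0), 0) G z + (v z.1).2 * 'D_((0, 1), 0) G z)).
  have mD w' : measurable_fun setT ('D_w' G).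
    by apply: continuous_measurable3; apply: smooth_continuous; exact: smooth_derive.
  apply: measurable_funD => //; apply: measurable_funD; apply: measurable_funM => //.
    exact: (measurableT_comp mv1 measurable_fst).
  exact: (measurableT_comp mv2 measurable_fst).
by apply/funext => z; rewrite transportE.
Qed.

Lemma bounded_transport (G : R * R * R -> R) : smooth G ->
  exists2 C, 0 <= C & forall z, (unit_square `*` `]0, 1[) z -> `|transport v G z| <= C.
Proof.
move=> sG.
pose KK : set (R * R * R) := (`[0, 1] `*` `[0, 1]) `*` `[0, 1].
have cKK : compact KK by apply: compact_setX; [apply: compact_setX|]; exact: segment_compact.
have V0 : 0 <= V by apply: le_trans (vV 0).1; exact: normr_ge0.
have H w' := compact_bounded cKK (smooth_continuous (smooth_derive w' sG)).
have [C1 C10 H1] := H ((0, 0), 1).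
have [C2 C20 H2] := H ((1, 0), 0).
have [C3 C30 H3] := H ((0, 1), 0).
exists (C1 + (V * C2 + V * C3)) => [|z Qz].
  by rewrite addr_ge0 // addr_ge0 // mulr_ge0.
have Kz : KK z.
  move: Qz => [[/=]]; rewrite !in_itv /= => /andP[x1 x2] /andP[x3 x4] /andP[x5 x6].
  by rewrite /KK /= !in_itv /= !(ltW x1) !(ltW x2) !(ltW x3) !(ltW x4) !(ltW x5) !(ltW x6).
rewrite transportE.
apply: (le_trans (ler_normD _ _)); apply: lerD; first exact: H1.
apply: (le_trans (ler_normD _ _)); apply: lerD; rewrite normrM; apply: ler_pM => //.
- exact: (vV z.1).1.
- exact: H2.
- exact: (vV z.1).2.
- exact: H3.
Qed.

Let c := M * (B * fine (lam2 (S `&` unit_square))).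

Lemma pairing_transport t : a < t < b ->
  `|\int[lam2]_(x in unit_square) (w t x * transport v F (x, t))| <= c.
Proof.
move=> tab; have t01 : 0 <= t < 1 by move: tab => /andP[h1 h2]; rewrite (le_trans a0 (ltW h1)) (lt_trans h2 b1).
have [mw wM _ _] := hw t01.
rewrite /c mulrA; apply: norm_Rintegral_le => //.
- apply: measurable_funM; apply: (@measurable_funS _ _ _ _ setT) => //.
  exact: (@measurable_fun_pair1 _ _ _ _ _ _ _ t (measurable_transport sF)).
- by rewrite mulr_ge0.
- by move=> x Qx; rewrite normrM -mulrA ler_pM // FB.
Qed.

Lemma c_ge0 : 0 <= c.
Proof. by rewrite /c !mulr_ge0 // fine_ge0. Qed.

(** A smoothed indicator of [a, b] with ramps on [a + h, a + 2 h] and [b - h, b]. The first ramp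
    starts after [a], so that the support stays in the open time interval even when [a] is 0. *)
Definition cutoff (h t : R) := step ((t - a - h) / h) - step ((t - b + h) / h).

Lemma smooth_ramp (h k : R) : smooth (fun t => step ((t - k) / h)).
Proof.
apply: (@smooth_outer _ _ step (fun t : R => (t - k) / h)); first exact: smooth_step.
apply: smoothM; last exact: smooth_cst.
by apply: smoothB; [exact: smooth_id|exact: smooth_cst].
Qed.

Lemma derive_ramp (h k t : R) :
  'D_1 (fun t => step ((t - k) / h)) t = 'D_1 step ((t - k) / h) / h.
Proof.
have H : is_derive t (1 : R) (fun t : R => (t - k) * h^-1) h^-1.
  have H1 := @is_deriveB _ _ _ (@idfun R) (cst k) t 1 1 0 (is_derive_id _ _) (is_derive_cst _ _ _).
  have := is_deriveM H1 (is_derive_cst h^-1 t (1 : R)).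
  by rewrite /GRing.scale /= mulr0 add0r subr0 mulr1.
have [_ ->] := @derive_outer _ _ step (fun t : R => (t - k) * h^-1) t 1
  (smooth_derivable smooth_step) (@ex_derive _ _ _ _ _ _ _ H).
by rewrite (@derive_val _ _ _ _ _ _ _ H).
Qed.

Lemma cutoffE h : cutoff h = fun t => step ((t - (a + h)) / h) - step ((t - (b - h)) / h).
Proof. by apply/funext => t; rewrite /cutoff; congr (step (_ / _) - step (_ / _)); ring. Qed.

Lemma smooth_cutoff h : smooth (cutoff h).
Proof. by rewrite cutoffE; apply: smoothB; exact: smooth_ramp. Qed.

Lemma derive_cutoff h t : 'D_1 (cutoff h) t =
  'D_1 step ((t - (a + h)) / h) / h - 'D_1 step ((t - (b - h)) / h) / h.
Proof.
have d k : derivable (fun t : R => step ((t - k) / h)) t (1 : R).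
  by apply: smooth_derivable; exact: smooth_ramp.
rewrite cutoffE (deriveB (d (a + h)) (d (b - h))).
by congr (_ - _); exact: derive_ramp.
Qed.

Lemma cutoff_out h t : 0 < h -> 2 * h < b - a -> t <= a + h \/ b <= t -> cutoff h t = 0.
Proof.
move=> h0 h2 [ht|ht]; rewrite cutoffE.
  by rewrite !step0 ?subrr // ler_pdivrMr // mul0r; lra.
by rewrite !step1 ?subrr // ler_pdivlMr // mul1r; lra.
Qed.

Lemma cutoff_le1 h t : `|cutoff h t| <= 1.
Proof.
rewrite /cutoff; have := step_ge0 ((t - a - h) / h); have := step_le1 ((t - a - h) / h).
have := step_ge0 ((t - b + h) / h); have := step_le1 ((t - b + h) / h).
by rewrite ler_norml => *; apply/andP; split; lra.
Qed.

Lemma cutoff_test h : 0 < h -> 2 * h < b - a ->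
  test_function (unit_square `*` `]0, 1[ : set (R * R * R)) (fun z => cutoff h z.2 * F z).
Proof.
move=> h0 h2.
have cK2 : compact (K `*` `[a + h, b] : set (R * R * R)).
  by apply: compact_setX => //; exact: segment_compact.
have cl : closed (K `*` `[a + h, b] : set (R * R * R)).
  by apply: compact_closed => //; exact: norm_hausdorff.
have sub : support_of (fun z => cutoff h z.2 * F z) `<=` (K `*` `[a + h, b]).
  have := @closureS _ [set z | cutoff h z.2 * F z != 0] (K `*` `[a + h, b] : set (R * R * R)).
  rewrite -((closure_id _).1 cl); apply => -[x t] /=.
  rewrite mulf_eq0 negb_or => /andP[c0 F0]; split; last first.
    rewrite /= in_itv /=; apply/andP; split; rewrite leNgt; apply/negP => ht;
      move/eqP: c0; apply; apply: cutoff_out => //; [left|right]; exact: ltW.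
  apply: FK F0; apply/andP; split; rewrite leNgt; apply/negP => ht;
    move/eqP: c0; apply; apply: cutoff_out => //; [left|right]; last exact: ltW.
  by rewrite (le_trans (ltW ht)) // lerDl ltW.
split.
- apply: smoothM => //; apply: smooth_outer; [exact: smooth_cutoff|exact: smooth_snd].
- by apply: subclosed_compact cK2 _ => //; exact: closed_closure.
- move=> z /sub [Kz]; rewrite /= in_itv /= => /andP[z1 z2]; split; first exact: KQ.
  by rewrite /= in_itv /= (le_lt_trans z2 b1) (lt_le_trans _ z1) // ltr_wpDl.
Qed.

(** The weak equation for [F] times the cutoff, after Fubini. The time integrand has the displayed
    form only for almost every [t]; truncation makes [G] bounded at every [t]. *)
Lemma weak_cutoff h : 0 < h -> 2 * h < b - a ->
  exists G : R -> R, exists B' : R, [/\ measurable_fun setT G, (forall t, `|G t| <= B'),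
    (\int[lam]_(t in `]0%R, 1%R[) (G t)%:E = 0)%E &
    {ae lam, forall t, `]0%R, 1%R[%classic t -> G t =
      'D_1 (cutoff h) t * pairing t +
      cutoff h t * \int[lam2]_(x in unit_square) (w t x * transport v F (x, t))}].
Proof.
move=> h0 h2.
have [[mrho _] _ _ wf _] := sol.
have tf := cutoff_test h0 h2; have [sphi _ _] := tf.
set phi := fun z => cutoff h z.2 * F z in tf sphi *.
have := wf _ tf.
rewrite (_ : \int[leb3]_(z in _) _ =
  \int[leb3]_(z in unit_square `*` `]0%R, 1%R[) (rho z * transport v phi z)%:E)%E; last first.
  apply: eq_integral => -[x t] /set_mem [Qx /=]; rewrite in_itv /= => t01.
  congr (_ * _)%:E; rewrite /transport /=; congr (_ + _).
  (* The velocity is known to be [v] only between [a] and [b]; elsewhere the test function vanishes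
     together with its spatial gradient. *)
  have [tab|ntab] := boolP (a < t < b); first by rewrite uv.
  have c0 : cutoff h t = 0.
    apply: cutoff_out => //; move: ntab; rewrite negb_and -!leNgt => /orP[ht|ht]; [left|right] => //.
    by rewrite (le_trans ht) // lerDl ltW.
  have -> : (fun x : R * R => phi (x, t)) = cst 0.
    by apply/funext => y; rewrite /phi /= c0 mul0r.
  by rewrite /grad !derive_cst /dot2 /= !mulr0 addr0.
have [B1 B10 HB1] := bounded_transport sphi.
have mJ : measurable (`]0%R, 1%R[%classic : set R) by exact: measurable_itv.
have Jfin : (lam (`]0%R, 1%R[%classic : set R) < +oo)%E.
  by rewrite lam_unit_itv ltry.
have := @fubini_rep R rho w M B1 `]0%R, 1%R[%classic (transport v phi) M0 mJ Jfin.
case.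
- apply: (@measurable_funS _ _ (lebesgue_spacetime R) _ (unit_square `*` `[0%R, 1%R[)) => //.
  + apply: completed_measurable; apply: measurableX => //; exact: measurable_itv.
  + by move=> z [Qz]; rewrite /= !in_itv /= => /andP[/ltW z0 z1]; split => //; rewrite /= ?in_itv /= z0 z1.
- by move=> t; rewrite /= in_itv /= => /andP[/ltW t0 t1]; have [] := hw (t := t); rewrite ?t0.
- by move=> t x; rewrite /= in_itv /= => /andP[/ltW t0 t1]; have [] := hw (t := t); rewrite ?t0.
- by move=> t; rewrite /= in_itv /= => /andP[/ltW t0 t1]; have [] := hw (t := t); rewrite ?t0.
- by apply: (@measurable_funS _ _ _ _ setT) => //; exact: measurable_transport.
- exact: HB1.
move=> G [mG -> aeG] G0.
have G0' : {ae lam, forall t, `]0%R, 1%R[%classic t -> `|G t| <= M * B1}.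
  apply: (ae_impl aeG) => t h' t01; rewrite h' //.
  have t01' : 0 <= t < 1 by move: t01; rewrite /= in_itv /= => /andP[/ltW -> ->].
  have [mw wM _ _] := hw t01'.
  rewrite -[leRHS]mulr1 -[X in _ * X](_ : fine (lam2 (setT `&` unit_square)) = 1); last first.
    by rewrite setTI lam2_unit_square.
  apply: norm_Rintegral_le => //.
  + apply: measurable_funM; apply: (@measurable_funS _ _ _ _ setT) => //.
    exact: (@measurable_fun_pair1 _ _ _ _ _ _ _ t (measurable_transport sphi)).
  + by rewrite mulr_ge0.
  + by move=> x Qx; rewrite indicT mulr1 normrM ler_pM // HB1.
exists (clip (M * B1) \o G), (M * B1); split.
- by apply: measurableT_comp => //; exact: measurable_clip.
- by move=> t; apply: clip_bound; rewrite mulr_ge0.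
- rewrite -G0; apply: ae_eq_integral => //.
  + apply/measurable_EFinP; apply: (@measurable_funS _ _ _ _ setT) => //.
    by apply: measurableT_comp => //; exact: measurable_clip.
  + by apply/measurable_EFinP; apply: (@measurable_funS _ _ _ _ setT).
  + by apply: (ae_impl G0') => t h' t01; rewrite /= clip_id // h'.
- have [N [mN N0 sN]] := aeG; have [N' [mN' N0' sN']] := G0'.
  exists (N `|` N'); split; [exact: measurableU|exact: measure_setU0|].
  move=> t /= nt; apply: contrapT => /not_orP[n1 n2]; apply: nt => t01.
  have e1 : G t = \int[lam2]_(x in unit_square) (w t x * transport v phi (x, t)).
    by apply: contrapT => h'; apply: n1; apply: sN => /(_ t01).
  have e2 : `|G t| <= M * B1 by apply: contrapT => h'; apply: n2; apply: sN' => /(_ t01).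
  rewrite clip_id // e1.
  have t01' : 0 <= t < 1 by move: t01; rewrite /= in_itv /= => /andP[/ltW -> ->].
  have [mw wM _ _] := hw t01'.
  have i1 := pairing_integrable t01' (smooth_continuous sF).
  have i2 : lam2.-integrable unit_square (EFin \o (fun x => w t x * transport v F (x, t))).
    have [B2 B20 HB2] := bounded_transport sF.
    apply: (@bounded_integrable _ _ _ _ _ _ (M * B2)) => //.
      apply: measurable_funM; apply: (@measurable_funS _ _ _ _ setT) => //.
      exact: (@measurable_fun_pair1 _ _ _ _ _ _ _ t (measurable_transport sF)).
    by move=> x Qx; rewrite normrM ler_pM // HB2.
  rewrite /pairing -RintegralZl // -[in RHS]RintegralZl // -RintegralD //.
  + apply: eq_Rintegral => x _; rewrite transport_cutoff //; last exact: smooth_cutoff.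
    by rewrite /=; ring.
  + exact: integrable_scale.
  + exact: integrable_scale.
Qed.

Lemma integral_indic_itv_le (k p q : R) : 0 <= k -> p <= q ->
  (\int[lam]_(t in `]0%R, 1%R[) (k * \1_(`[p, q]%classic) t)%:E <= (k * (q - p))%:E)%E.
Proof.
move=> k0 pq; under eq_integral do rewrite EFinM.
have mI : measurable (`[p, q]%classic : set R) by exact: measurable_itv.
have mJ : measurable (`]0%R, 1%R[%classic : set R) by exact: measurable_itv.
rewrite ge0_integralZl //; last by apply/measurable_EFinP; apply: measurable_indic.
rewrite EFinM; apply: lee_pmul => //.
  by apply: integral_ge0 => t _; rewrite lee_fin.
rewrite integral_indic //.
apply: (@le_trans _ _ (lam (`[p, q]%classic : set R))).
  by apply: le_measure; rewrite ?inE //; exact: measurableI.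
rewrite lamE lebesgue_measure_itv /= lte_fin.
by case: ltP => h; rewrite ?lee_fin ?subr_ge0.
Qed.

(** The weak integrand is compared with its first term, in which [pairing t] is frozen at the end
    values on the two ramps. Freezing costs [e] times the slope of a ramp, and the transport term
    costs at most [c] on [a, b]. *)
Lemma cutoff_near_ends (C e h t : R) : 0 < h -> 4 * h < b - a ->
  (forall t, `|'D_1 step t| <= C) -> 0 <= C -> 0 <= e ->
  (forall t, 0 <= t < 1 -> `|t - a| <= 2 * h -> `|pairing t - pairing a| <= e) ->
  (forall t, 0 <= t < 1 -> `|t - b| <= h -> `|pairing t - pairing b| <= e) ->
  0 < t < 1 ->
  `|('D_1 step ((t - (a + h)) / h) / h * pairing a - 'D_1 step ((t - (b - h)) / h) / h * pairing b) -
    ('D_1 (cutoff h) t * pairing t +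
      cutoff h t * \int[lam2]_(x in unit_square) (w t x * transport v F (x, t)))| <=
  c * \1_(`[a, b]%classic) t + (C / h * e) * \1_(`[a + h, a + 2 * h]%classic) t
   + (C / h * e) * \1_(`[b - h, b]%classic) t.
Proof.
move=> h0 h4 HC C0 e0 Ha Hb t01.
have t01' : 0 <= t < 1 by move: t01 => /andP[/ltW -> ->].
have [ha hb] := (HC ((t - (a + h)) / h), HC ((t - (b - h)) / h)).
rewrite derive_cutoff; move: (derive_step_out (t := (t - (a + h)) / h)) (derive_step_out (t := (t - (b - h)) / h)) ha hb.
move: ('D_1 step ((t - (a + h)) / h)) ('D_1 step ((t - (b - h)) / h)) => p' q' outp outq hp hq.
set p := p' / h; set q := q' / h; set E := Rintegral _ _ _.
have -> : p * pairing a - q * pairing b - ((p - q) * pairing t + cutoff h t * E) =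
  - (cutoff h t * E) - p * (pairing t - pairing a) + q * (pairing t - pairing b) by ring.
apply: (le_trans (ler_normD _ _)); apply: lerD.
  apply: (le_trans (ler_normB _ _)); apply: lerD.
    rewrite normrN normrM.
    have [tab|ntab] := boolP (t \in `[a, b]); last first.
      rewrite cutoff_out //; first by rewrite normr0 mul0r; apply: mulr_ge0 => //; exact: c_ge0.
        by move: h0 h4; lra.
      move: ntab; rewrite in_itv /= negb_and -!ltNge => /orP[ht|ht]; [left|right]; last exact: ltW.
      by rewrite (le_trans (ltW ht)) // lerDl ltW.
    rewrite indicE mem_set // mulr1.
    have [tab'|ntab] := boolP (a < t < b); last first.
      rewrite cutoff_out //; first by rewrite normr0 mul0r; exact: c_ge0.
        by move: h0 h4; lra.
      move: ntab; rewrite negb_and -!leNgt => /orP[ht|ht]; [left|right] => //.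
      by rewrite (le_trans ht) // lerDl ltW.
    rewrite -[leRHS]mul1r; apply: ler_pM => //; first exact: cutoff_le1.
    exact: pairing_transport.
  rewrite normrM.
  have [ti|nti] := boolP (t \in `[a + h, a + 2 * h]).
    rewrite indicE mem_set // mulr1; apply: ler_pM => //.
      by rewrite /p normrM normfV (gtr0_norm h0) ler_wpM2r // invr_ge0 ltW.
    apply: Ha => //; move: ti; rewrite in_itv /= ler_norml => /andP[t1 t2].
    by apply/andP; split; move: h0 t1 t2; lra.
  rewrite /p outp ?mul0r ?normr0 ?mul0r //.
    by rewrite !mulr_ge0 // invr_ge0 ltW.
  move: nti; rewrite in_itv /= negb_and -!ltNge => /orP[ht|ht]; [left|right].
    by rewrite ltr_pdivrMr // mul0r subr_lt0.
  by rewrite ltr_pdivlMr // mul1r; move: ht; lra.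
rewrite normrM.
have [ti|nti] := boolP (t \in `[b - h, b]).
  rewrite indicE mem_set // mulr1; apply: ler_pM => //.
    by rewrite /q normrM normfV (gtr0_norm h0) ler_wpM2r // invr_ge0 ltW.
  apply: Hb => //; move: ti; rewrite in_itv /= ler_norml => /andP[t1 t2].
  by apply/andP; split; move: h0 t1 t2; lra.
rewrite /q outq ?mul0r ?normr0 ?mul0r //.
  by rewrite !mulr_ge0 // invr_ge0 ltW.
move: nti; rewrite in_itv /= negb_and -!ltNge => /orP[ht|ht]; [left|right].
  by rewrite ltr_pdivrMr // mul0r subr_lt0.
by rewrite ltr_pdivlMr // mul1r; move: ht; lra.
Qed.

Lemma weak_inequality : `|pairing b - pairing a| <= c * (b - a).
Proof.
have [C C0 HC] := @derive_step_bound R.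
apply/ler_addgt0Pr => e0 e0_gt0.
(* Each ramp costs at most [C / h * e * h = C * e], so both together stay below [e0]; the added 1
   keeps the denominator positive. *)
pose e := e0 / (2 * C + 1).
have C1 : 0 < 2 * C + 1 by rewrite ltr_wpDl // mulr_ge0.
have CC : C + C <= 2 * C + 1 by rewrite mulr_natl mulr2n lerDl.
have e_gt0 : 0 < e by rewrite divr_gt0.
have a01 : 0 <= a < 1 by rewrite a0 (lt_trans ab b1).
have b01 : 0 <= b < 1 by rewrite b1 (le_trans a0 (ltW ab)).
have aab : a <= a <= b by rewrite lexx ltW.
have bab : a <= b <= b by rewrite lexx ltW.
have [d1 d10 H1] := pairing_continuous aab a01 e_gt0.
have [d2 d20 H2] := pairing_continuous bab b01 e_gt0.
pose h := Num.min ((b - a) / 8) (Num.min (d1 / 4) (d2 / 4)).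
have ba0 : 0 < b - a by rewrite subr_gt0.
have h0 : 0 < h by rewrite !lt_min !divr_gt0.
have hba : h <= (b - a) / 8 by rewrite ge_min lexx.
have hd1 : h <= d1 / 4 by rewrite !ge_min lexx orbT.
have hd2 : h <= d2 / 4 by rewrite !ge_min lexx !orbT.
clearbody h.
have hd1' : 2 * h < d1 by move: hd1 d10; lra.
have hd2' : h < d2 by move: hd2 d20; lra.
have za : 0 - (a + h) <= 0 by move: a0 h0; lra.
have zb : 0 - (b - h) <= 0 by move: hba ba0 a0 ab; lra.
have oa : h <= 1 - (a + h) by move: hba ba0 b1 a0; lra.
have ob : h <= 1 - (b - h) by move: b1; lra.
have h4 : 4 * h < b - a by move: hba ba0; lra.
have h2 : 2 * h < b - a by move: h4 h0; lra.
have [G [B' [mG GB G0 aeG]]] := weak_cutoff h0 h2.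
pose P t := 'D_1 step ((t - (a + h)) / h) / h * pairing a - 'D_1 step ((t - (b - h)) / h) / h * pairing b.
pose H t := step ((t - (a + h)) / h) * pairing a - step ((t - (b - h)) / h) * pairing b.
have sH : smooth H.
  by apply: smoothB; apply: smoothM; [exact: smooth_ramp|exact: smooth_cst|exact: smooth_ramp|exact: smooth_cst].
have HP t : 'D_1 H t = P t.
  have D k c' : is_derive t (1 : R) (fun t => step ((t - k) / h) * c') ('D_1 step ((t - k) / h) / h * c').
    apply: is_derive_mulr; rewrite -derive_ramp; apply: derivableP.
    by apply: smooth_derivable; exact: smooth_ramp.
  exact: (@derive_val _ _ _ _ _ _ _ (is_derive_sub (D (a + h) (pairing a)) (D (b - h) (pairing b)))).
have mJ : measurable (`]0%R, 1%R[%classic : set R) by exact: measurable_itv.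
have Jfin : (lam (`]0%R, 1%R[%classic : set R) < +oo)%E.
  by rewrite lam_unit_itv ltry.
have cP : continuous P.
  have := smooth_continuous (smooth_derive (1 : R) sH).
  by rewrite (_ : 'D_1 H = P) //; apply/funext => t; exact: HP.
have mP : measurable_fun setT P by exact: continuous_measurable_fun.
have intP : (\int[lam]_(t in `]0%R, 1%R[) (P t)%:E = (pairing a - pairing b)%:E)%E.
  rewrite (_ : pairing a - pairing b = H 1 - H 0).
    rewrite -(FTC_smooth ler01 sH).
    under [RHS]eq_integral do rewrite HP.
    rewrite [RHS](@integral_itv_bndoo _ 0 1 (fun t => (P t)%:E) true false) //.
    by apply/measurable_EFinP; apply: (@measurable_funS _ _ _ _ setT).
  rewrite /H !(step0 (t := (0 - _) / h)) ?ler_pdivrMr ?mul0r //.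
  rewrite !step1 ?ler_pdivlMr // ?mul1r; last 2 first.
  - exact: ob.
  - exact: oa.
  by ring.
have [BP _ HBP] : exists2 C', 0 <= C' & forall t, `[0, 1]%classic t -> `|P t| <= C'.
  by apply: compact_bounded => //; exact: segment_compact.
have iP : lam.-integrable `]0%R, 1%R[ (EFin \o P).
  apply: (@bounded_integrable _ _ _ _ _ _ BP) => //.
    by apply: (@measurable_funS _ _ _ _ setT).
  by move=> t; rewrite /= in_itv /= => /andP[t1 t2]; apply: HBP; rewrite /= in_itv /= !ltW.
have iG : lam.-integrable `]0%R, 1%R[ (EFin \o G).
  apply: (@bounded_integrable _ _ _ _ _ _ B') => //.
  by apply: (@measurable_funS _ _ _ _ setT).
have mPG : measurable_fun (`]0%R, 1%R[%classic : set R) (EFin \o (fun t => P t - G t)).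
  by apply/measurable_EFinP; apply: measurable_funB; apply: (@measurable_funS _ _ _ _ setT).
rewrite -lee_fin distrC.
have -> : `|pairing a - pairing b|%:E = `|\int[lam]_(t in `]0%R, 1%R[) (P t - G t)%:E|%E.
  under eq_integral do rewrite EFinB.
  by rewrite integralB_EFin // intP G0 sube0.
apply: (@le_trans _ _ (\int[lam]_(t in `]0%R, 1%R[) `|(P t - G t)%:E|)%E).
  exact: (@le_abse_integral _ _ R lam _ _ mJ mPG).
pose k t := c * \1_(`[a, b]%classic) t + (C / h * e) * \1_(`[a + h, a + 2 * h]%classic) t
   + (C / h * e) * \1_(`[b - h, b]%classic) t.
have Che : 0 <= C / h * e by rewrite !mulr_ge0 // ?invr_ge0 ltW.
have mi (k' p q : R) : measurable_fun (`]0%R, 1%R[%classic : set R) (fun t => (k' * \1_(`[p, q]%classic) t)%:E).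
  have mI : measurable (`[p, q]%classic : set R) by exact: measurable_itv.
  by apply/measurable_EFinP; apply: measurable_funM => //; apply: measurable_indic.
apply: (@le_trans _ _ (\int[lam]_(t in `]0%R, 1%R[) (k t)%:E)%E).
  apply: ae_ge0_le_integral => //.
  - by apply: measurableT_comp.
  - by move=> t _; rewrite lee_fin /k !addr_ge0 //; apply: mulr_ge0 => //; exact: c_ge0.
  - apply/measurable_EFinP; apply: measurable_funD; [apply: measurable_funD|];
      by apply/measurable_EFinP; exact: mi.
  apply: (ae_impl aeG) => t Gt t01; rewrite /= lee_fin (Gt t01).
  have t01' : 0 < t < 1 by move: t01; rewrite /= in_itv.
  apply: cutoff_near_ends => //; first exact: ltW.
  - by move=> s s01 hs; apply: H1 => //; exact: le_lt_trans hs hd1'.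
  - by move=> s s01 hs; apply: H2 => //; exact: le_lt_trans hs hd2'.
pose k1 t := (c * \1_(`[a, b]%classic) t)%:E.
pose k2 t := ((C / h * e) * \1_(`[a + h, a + 2 * h]%classic) t)%:E.
pose k3 t := ((C / h * e) * \1_(`[b - h, b]%classic) t)%:E.
have -> : (\int[lam]_(t in `]0%R, 1%R[) (k t)%:E = \int[lam]_(t in `]0%R, 1%R[) (k1 t + k2 t + k3 t))%E.
  by apply: eq_integral => t _; rewrite -!EFinD.
have k10 t : (0 <= k1 t)%E by rewrite lee_fin; apply: mulr_ge0 => //; exact: c_ge0.
have k20 t : (0 <= k2 t)%E by rewrite lee_fin mulr_ge0.
have k30 t : (0 <= k3 t)%E by rewrite lee_fin mulr_ge0.
have mk1 : measurable_fun (`]0%R, 1%R[%classic : set R) k1 by exact: mi.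
have mk2 : measurable_fun (`]0%R, 1%R[%classic : set R) k2 by exact: mi.
have mk3 : measurable_fun (`]0%R, 1%R[%classic : set R) k3 by exact: mi.
rewrite (@ge0_integralD _ _ R lam _ mJ (fun t => k1 t + k2 t)%E k3) //; last 2 first.
- by move=> t _; rewrite adde_ge0.
- exact: emeasurable_funD.
rewrite (@ge0_integralD _ _ R lam _ mJ k1 k2) //.
apply: (@le_trans _ _ ((c * (b - a))%:E + (C / h * e * h)%:E + (C / h * e * h)%:E)%E).
  apply: leeD; [apply: leeD|].
  - by apply: integral_indic_itv_le; [exact: c_ge0|exact: ltW].
  - have hh : a + h <= a + 2 * h by rewrite lerD2l ler_peMl ?ler1n // ltW.
    by have := integral_indic_itv_le Che hh; rewrite (_ : a + 2 * h - (a + h) = h) //; ring.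
  - have hh : b - h <= b by rewrite gerBl ltW.
    by have := integral_indic_itv_le Che hh; rewrite (_ : b - (b - h) = h) //; ring.
rewrite -!EFinD lee_fin -addrA lerD2l.
have -> : C / h * e * h = C * e by field; rewrite gt_eqF.
rewrite /e -mulrDl mulrA ler_pdivrMr // mulrC; apply: ler_wpM2l; [exact: ltW|exact: CC].
Qed.

End weak_solution.

(** * The rectangle field *)

Section box_flow.
Context {R : realType}.

(* Center and half side lengths. *)
Record rect := Rect { rcx : R; rcy : R; rwx : R; rwy : R }.

Definition inside (P : rect) : set (R * R) :=
  [set x | `|x.1 - rcx P| < rwx P /\ `|x.2 - rcy P| < rwy P].

(* The coordinates normalized by the half sides, and their images under the
   quarter turns: co P i is a, b, -a, -b for i = 0, 1, 2, 3 modulo 4. *)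
Fixpoint co (P : rect) (i : nat) (x : R * R) : R :=
  match i with
  | 0 => (x.1 - rcx P) / rwx P
  | 1 => (x.2 - rcy P) / rwy P
  | j.+2 => - co P j x
  end%N.

(** The linear part of [co P i], that is, its directional derivative. *)
Fixpoint lin (P : rect) (i : nat) (w : R * R) : R :=
  match i with
  | 0 => w.1 / rwx P
  | 1 => w.2 / rwy P
  | j.+2 => - lin P j w
  end%N.

(* The Hamiltonian field of a multiple of max(a^2, b^2): its flow preserves the
   concentric rectangles, and makes a quarter turn in a time 2 / om. *)
Definition box_field (P : rect) (om : R) (x : R * R) : R * R :=
  if `[< inside P x >] then
    (om * rwx P * (- co P 1 x * (`|co P 0 x| < `|co P 1 x|)%R%:R),
     om * rwy P * (co P 0 x * (`|co P 1 x| < `|co P 0 x|)%R%:R))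
  else (0, 0).

(** On the half of the box where [co P i + co P i.+1] is positive, [rmax] labels the concentric
    rectangle through [x] and [rdif] is a position along it, with 0 at the corner. *)
Definition rmax (P : rect) i x := Num.max (co P i x) (co P i.+1 x).
Definition rdif (P : rect) i x := co P i.+1 x - co P i x.

(** The quarter-turn symmetry of the field: [co P i.+2 = - co P i] carries the formula from [i] to
    [i + 2], so one chart computation serves all four corners. *)
Lemma lin_box_field P om i x : 0 < rwx P -> 0 < rwy P -> inside P x ->
  lin P i (box_field P om x) = - om * co P i.+1 x * (`|co P i x| < `|co P i.+1 x|)%R%:R.
Proof.
move=> wx0 wy0 Px; rewrite /box_field asboolT //.
set A := co P 0 x; set B := co P 1 x.
set k1 : R := (`|A| < `|B|)%R%:R; set k2 : R := (`|B| < `|A|)%R%:R.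
elim/ltn_ind: i => -[|[|i]] IH.
- change (om * rwx P * (- B * k1) / rwx P = - om * B * k1).
  by field; rewrite gt_eqF.
- change (om * rwy P * (A * k2) / rwy P = - om * (- A) * (`|B| < `|- A|)%R%:R).
  by rewrite normrN -/k2; field; rewrite gt_eqF.
- change (- lin P i (om * rwx P * (- B * k1), om * rwy P * (A * k2)) =
    - om * (- co P i.+1 x) * (`|- co P i x| < `|- co P i.+1 x|)%R%:R).
  by rewrite IH ?normrN; [ring|lia].
Qed.

Lemma co_inside P i x : 0 < rwx P -> 0 < rwy P ->
  inside P x <-> (`|co P i x| < 1 /\ `|co P i.+1 x| < 1).
Proof.
move=> wx0 wy0.
have E j : inside P x <-> (`|co P j x| < 1 /\ `|co P j.+1 x| < 1) ->
    inside P x <-> (`|co P j.+1 x| < 1 /\ `|co P j.+2 x| < 1).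
  by rewrite [co P j.+2 x]/(- co P j x) normrN => ->; split => -[].
elim: i => [|i IH]; last exact: E.
rewrite /inside /= !normrM !normfV (gtr0_norm wx0) (gtr0_norm wy0).
by rewrite !ltr_pdivrMr // !mul1r.
Qed.

(* A smooth function that agrees with the absolute value outside [-e, e]. *)
Definition sabs (e d : R) : R := d * (2 * step ((d + e) / (2 * e)) - 1).

Lemma smooth_sabs e : smooth (sabs e).
Proof.
apply: smoothM; first exact: smooth_id.
apply: smoothB; last exact: smooth_cst.
apply: smoothM; first exact: smooth_cst.
apply: (@smooth_outer _ _ step (fun d => (d + e) / (2 * e))); first exact: smooth_step.
apply: smoothM; last exact: smooth_cst.
by apply: smoothD; [exact: smooth_id|exact: smooth_cst].
Qed.

Lemma sabs_out e d : 0 < e -> e <= `|d| -> sabs e d = `|d|.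
Proof.
move=> e0; rewrite ler_normr /sabs => /orP[ed|ed].
  rewrite step1 ?ler_pdivlMr ?mulr_gt0 // ?mul1r; last by lra.
  by rewrite ger0_norm; [ring|lra].
rewrite step0 ?ler_pdivrMr ?mulr_gt0 // ?mul0r; last by lra.
by rewrite ler0_norm; [ring|lra].
Qed.

Lemma sabs_near e d : 0 < e -> `|sabs e d - `|d| | <= 2 * e.
Proof.
move=> e0; have [ed|ed] := leP e `|d|.
  by rewrite sabs_out // subrr normr0 mulr_ge0 // ltW.
apply: (le_trans (ler_normB _ _)); rewrite normr_id /sabs normrM.
have : `|2 * step ((d + e) / (2 * e)) - 1| <= 1.
  have := step_ge0 ((d + e) / (2 * e)); have := step_le1 ((d + e) / (2 * e)).
  by rewrite ler_norml => *; apply/andP; split; lra.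
move=> h; apply: (@le_trans _ _ (`|d| * 1 + `|d|)); first by rewrite lerD2r ler_wpM2l.
by rewrite mulr1; lra.
Qed.

Lemma derive_sabs_out e d : 0 < e -> e < `|d| -> 'D_1 (sabs e) d = Num.sg d.
Proof.
move=> e0; rewrite ltr_normr => /orP[ed|ed].
  rewrite (@near_eq_derive _ _ _ _ (@idfun R)).
    by rewrite derive_id gtr0_sg //; lra.
  near=> y; have ey : e < y by near: y; exact: lt_nbhsr.
  by rewrite sabs_out // ?ger0_norm //; lra.
rewrite (@near_eq_derive _ _ _ _ (- (@idfun R))).
  have H := is_deriveN (is_derive_id d (1 : R)).
  by rewrite (@derive_val _ _ _ _ _ _ _ H) ltr0_sg //; lra.
near=> y; have ey : y < - e by near: y; apply: lt_nbhsl; lra.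
by rewrite sabs_out // ?ler0_norm //; lra.
Unshelve. all: by end_near. Qed.

(** Uniform in [e]: the derivative of the transition is of order 1/[e], but it is multiplied by [d],
    and it vanishes where [d] exceeds [e] in absolute value. *)
Lemma derive_sabs_bound : exists2 C, 0 <= C & forall e d, 0 < e -> `|'D_1 (sabs e) d| <= C.
Proof.
have [C C0 HC] := @derive_step_bound R.
exists (1 + C) => [|e d e0]; first by rewrite addr_ge0.
have [de|de] := ltP e `|d|.
  rewrite derive_sabs_out //; apply: (@le_trans _ _ 1); last by rewrite lerDl.
  by rewrite normr_sg; case: (d != 0); rewrite ?lexx ?ler01.
pose l (y : R) := (y - (- e)) * (2 * e)^-1.
have Hl : is_derive d (1 : R) l (2 * e)^-1.
  have H1 := @is_deriveB _ _ _ (@idfun R) (cst (- e)) d 1 1 0 (is_derive_id _ _) (is_derive_cst _ _ _).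
  have := is_deriveM H1 (is_derive_cst (2 * e)^-1 d (1 : R)).
  by rewrite /GRing.scale /= mulr0 add0r subr0 mulr1.
have Hs := is_derive_outer (derivableP (smooth_derivable (x := l d) (v := (1 : R)) smooth_step)) Hl.
have H2 := is_deriveB (is_deriveM (is_derive_cst (2 : R) d (1 : R)) Hs) (is_derive_cst (1 : R) d (1 : R)).
have H3 := is_deriveM (is_derive_id d (1 : R)) H2.
have -> : sabs e = (id * ((cst 2 * (fun y => step (l y))) - cst 1)).
  by apply/funext => y; rewrite /sabs /l opprK.
rewrite (@derive_val _ _ _ _ _ _ _ H3) /GRing.scale /= !mulr0 !addr0 !subr0 mulr1.
rewrite addrC; apply: (le_trans (ler_normD _ _)); apply: lerD.
  have := step_ge0 (l d); have := step_le1 (l d).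
  by rewrite /GRing.add /GRing.mul /= /GRing.opp /= ler_norml => *; apply/andP; split; lra.
rewrite !normrM normfV (gtr0_norm (mulr_gt0 _ e0)) //.
rewrite (ger0_norm (_ : 0 <= 2 :> R)) //.
have -> : `|d| * (2 * (`|'D_1 step (l d)| / (2 * e))) = (`|d| / e) * `|'D_1 step (l d)|.
  by field; rewrite gt_eqF.
rewrite -[leRHS]mul1r; apply: ler_pM => //; first by rewrite divr_ge0 // ltW.
by rewrite ler_pdivrMr // mul1r.
Qed.

End box_flow.

Section chart.
Context {R : realType}.
Variables (P : @rect R) (i : nat) (om s0 eps : R) (f g : R -> R).

(* On the union of two adjacent sectors the flow preserves max(co P i, co P i.+1)
   and acts as a shear on the difference co P i.+1 - co P i; sabs smooths the
   maximum across the diagonal that separates the sectors. *)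
Definition cmax (z : R * R * R) : R :=
  (co P i z.1 + co P i.+1 z.1 + sabs eps (rdif P i z.1)) * 2^-1.

(** Along the flow [rdif] grows at the rate [om * rmax] in both sectors, so this quantity is
    conserved away from the smoothed diagonal. *)
Definition cshear (z : R * R * R) : R := rdif P i z.1 - cmax z * ((z.2 - s0) * om).

Definition chart_fun (z : R * R * R) : R := f (cmax z) * g (cshear z).

Definition cmax' (z : R * R * R) (w : R * R) : R :=
  (lin P i w + lin P i.+1 w + 'D_1 (sabs eps) (rdif P i z.1) * (lin P i.+1 w - lin P i w)) * 2^-1.

Lemma is_derive_co j z w : is_derive z w (fun z : R * R * R => co P j z.1) (lin P j w.1).
Proof.
elim/ltn_ind: j => -[|[|j]] IH.
- have H := is_derive_mulr (rwx P)^-1 (is_derive_sub (@is_derive_linear _ _ (fun z : R * R * R => z.1.1) z w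
    (fun _ _ => erefl) (fun _ _ => erefl)) (is_derive_const (rcx P) z w)).
  by rewrite subr0 in H.
- have H := is_derive_mulr (rwy P)^-1 (is_derive_sub (@is_derive_linear _ _ (fun z : R * R * R => z.1.2) z w
    (fun _ _ => erefl) (fun _ _ => erefl)) (is_derive_const (rcy P) z w)).
  by rewrite subr0 in H.
- by apply: (@is_derive_opp _ _ (fun z : R * R * R => co P j z.1)); apply: IH; lia.
Qed.

Lemma smooth_co j : smooth (fun z : R * R * R => co P j z.1).
Proof.
elim/ltn_ind: j => -[|[|j]] IH.
- apply: smoothM; last exact: smooth_cst.
  by apply: smoothB; [exact: smooth_fst1|exact: smooth_cst].
- apply: smoothM; last exact: smooth_cst.
  by apply: smoothB; [exact: smooth_fst2|exact: smooth_cst].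
- by apply: (@smoothN _ _ (fun z : R * R * R => co P j z.1)); apply: IH; lia.
Qed.

Lemma smooth_rdif : smooth (fun z : R * R * R => rdif P i z.1).
Proof. by apply: smoothB; exact: smooth_co. Qed.

Lemma smooth_cmax : smooth cmax.
Proof.
apply: smoothM; last exact: smooth_cst.
apply: smoothD; first by apply: smoothD; exact: smooth_co.
by apply: (smooth_outer (smooth_sabs eps)); exact: smooth_rdif.
Qed.

Lemma smooth_cshear : smooth cshear.
Proof.
apply: smoothB; first exact: smooth_rdif.
apply: smoothM; first exact: smooth_cmax.
apply: smoothM; last exact: smooth_cst.
by apply: smoothB; [exact: smooth_snd|exact: smooth_cst].
Qed.

Lemma is_derive_rdif z w :
  is_derive z w (fun z : R * R * R => rdif P i z.1) (lin P i.+1 w.1 - lin P i w.1).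
Proof. by apply: is_derive_sub; exact: is_derive_co. Qed.

Lemma is_derive_cmax z w : is_derive z w cmax (cmax' z w.1).
Proof.
apply: is_derive_mulr; apply: is_derive_add.
  by apply: is_derive_add; exact: is_derive_co.
have hs := derivableP (@smooth_derivable _ _ (sabs eps) (rdif P i z.1) (1 : R) (smooth_sabs eps)).
exact: (@is_derive_outer R _ (sabs eps) (fun y => rdif P i y.1) z w _ _ hs (is_derive_rdif z w)).
Qed.

Lemma is_derive_cshear z w : is_derive z w cshear
  (lin P i.+1 w.1 - lin P i w.1 -
    (cmax z * (w.2 * om) + (z.2 - s0) * om * cmax' z w.1)).
Proof.
apply: is_derive_sub; first exact: is_derive_rdif.
apply: is_derive_mul; first exact: is_derive_cmax.
apply: is_derive_mulr.
have := is_derive_sub (@is_derive_linear _ _ (fun z : R * R * R => z.2) z w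
    (fun _ _ => erefl) (fun _ _ => erefl)) (is_derive_const s0 z w).
by rewrite subr0.
Qed.

Hypothesis sf : smooth f.
Hypothesis sg : smooth g.

Lemma smooth_chart : smooth chart_fun.
Proof.
by apply: smoothM; apply: smooth_outer => //; [exact: smooth_cmax|exact: smooth_cshear].
Qed.

Lemma derive_chart z w : 'D_w chart_fun z =
  'D_1 f (cmax z) * g (cshear z) * cmax' z w.1 +
  f (cmax z) * 'D_1 g (cshear z) * (lin P i.+1 w.1 - lin P i w.1 -
    (cmax z * (w.2 * om) + (z.2 - s0) * om * cmax' z w.1)).
Proof.
have df := is_derive_outer (derivableP (smooth_derivable (x := cmax z) (v := (1:R)) sf)) (is_derive_cmax z w).
have dg := is_derive_outer (derivableP (smooth_derivable (x := cshear z) (v := (1:R)) sg)) (is_derive_cshear z w).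
have H := is_derive_mul df dg.
rewrite /chart_fun (@derive_val _ _ _ _ _ _ _ H).
set a := 'D_1 f _; set b := 'D_1 g _; set c := cmax' _ _; set d := (_ - _ - _).
by ring.
Qed.

Lemma lin_comb j (w : R * R) : lin P j w = w.1 * lin P j (1, 0) + w.2 * lin P j (0, 1).
Proof.
elim/ltn_ind: j => -[|[|j]] IH; rewrite /=; [by ring|by ring|].
by rewrite IH; [ring|lia].
Qed.

Lemma lin0 j : lin P j (0, 0) = 0.
Proof. by rewrite lin_comb !mul0r addr0. Qed.

Arguments lin : simpl never.
Arguments co : simpl never.

Lemma transport_chart (v : R * R -> R * R) z : transport v chart_fun z =
  'D_1 f (cmax z) * g (cshear z) * cmax' z (v z.1) +
  f (cmax z) * 'D_1 g (cshear z) * (lin P i.+1 (v z.1) - lin P i (v z.1) -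
    (cmax z * om + (z.2 - s0) * om * cmax' z (v z.1))).
Proof.
rewrite transportE.
have D1 := derive_chart z ((0, 0), 1); have D2 := derive_chart z ((1, 0), 0).
have D3 := derive_chart z ((0, 1), 0).
rewrite D1 D2 D3 {D1 D2 D3} /cmax' /=.
rewrite (lin_comb i (v z.1)) (lin_comb i.+1 (v z.1)) !lin0.
set a := 'D_1 f _; set b := 'D_1 g _; set c := 'D_1 (sabs _) _.
set l1 := lin P i _; set l2 := lin P i _; set l3 := lin P i.+1 _; set l4 := lin P i.+1 _.
by ring.
Qed.

End chart.

Arguments lin : simpl never.
Arguments co : simpl never.

Lemma bounded_out (R : realType) (h : R -> R) a b : continuous h ->
  (forall m, m < a \/ b < m -> h m = 0) -> exists2 C, 0 <= C & forall m, `|h m| <= C.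
Proof.
move=> ch ho; have [C C0 HC] := compact_bounded (@segment_compact R a b) ch.
exists C => // m; have [mab|] := boolP (m \in `[a, b]); first exact: HC.
by rewrite in_itv /= negb_and -!ltNge => /orP /ho ->; rewrite normr0.
Qed.

Section chart_bound.
Context {R : realType}.
Variables (P : @rect R) (i : nat) (om s0 : R) (f g : R -> R).
Variables (r1 r2 q1 q2 kap : R).
Hypothesis wx0 : 0 < rwx P.
Hypothesis wy0 : 0 < rwy P.
Hypothesis om0 : 0 <= om.
Hypothesis sf : smooth f.
Hypothesis sg : smooth g.
Hypothesis f_out : forall m, m < r1 \/ r2 < m -> f m = 0.
Hypothesis g_out : forall m, m < q1 \/ q2 < m -> g m = 0.
Hypothesis kap0 : 0 < kap.
Hypothesis hq1 : kap <= 2 * r1 + q1.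
Hypothesis hq2 : kap <= - q2.
Hypothesis hr2 : kap <= 1 - r2.
Hypothesis hr1 : 0 < r1.

Lemma rmax_abs x : rmax P i x = (co P i x + co P i.+1 x + `|rdif P i x|) / 2.
Proof. by rewrite /rmax /rdif maxr_absE distrC. Qed.

Lemma cmax_rmax eps z : 0 < eps -> `|cmax P i eps z - rmax P i z.1| <= eps.
Proof.
move=> e0; have := sabs_near (rdif P i z.1) e0.
rewrite rmax_abs /cmax => h.
have -> : (co P i z.1 + co P i.+1 z.1 + sabs eps (rdif P i z.1)) * 2^-1 -
  (co P i z.1 + co P i.+1 z.1 + `|rdif P i z.1|) / 2 =
  (sabs eps (rdif P i z.1) - `|rdif P i z.1|) / 2 by field.
rewrite normrM normfV (ger0_norm (_ : 0 <= 2 :> R)) // ler_pdivrMr //.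
by apply: (le_trans h); lra.
Qed.

(** With kap - 2 m <= q <= - kap and 0 <= m s <= 2 m, the position q + m s stays strictly between -2
    m and 2 m, that is, in the two adjacent sectors: this is why one chart lasts for one quarter
    turn. Smoothing eats at most half of the margin [kap]. *)
Lemma chart_region eps x t : 0 < eps -> 2 * eps <= kap / 2 -> 0 <= (t - s0) * om <= 2 ->
  r1 <= cmax P i eps (x, t) <= r2 -> q1 <= cshear P i om s0 eps (x, t) <= q2 ->
  `|rdif P i x| <= 2 * rmax P i x - kap / 2 /\ rmax P i x <= 1 - kap / 2.
Proof.
move=> e0 e1 /andP[s1 s2] /andP[m1 m2].
have := cmax_rmax (x, t) e0; rewrite ler_norml /= => /andP[n1 n2].
rewrite /cshear /=; set s := (t - s0) * om in s1 s2 *; set m := cmax _ _ _ _ in m1 m2 n1 n2 *.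
move=> /andP[h1 h2].
have ms0 : 0 <= m * s by rewrite mulr_ge0 //; move: hr1 m1; lra.
have ms1 : m * s <= m * 2 by rewrite ler_wpM2l //; move: hr1 m1; lra.
split; last by move: hr2 m2 n1 e1 kap0; lra.
rewrite ler_norml; apply/andP; split.
  by move: hq1 m1 h1 ms0 n2 e1 kap0; lra.
by move: hq2 h2 ms1 n2 e1 n1 kap0; lra.
Qed.

(** The difference between [2 * rmax] and the absolute value of [rdif] is the sum of the two
    coordinates. If it is positive, the smaller coordinate lies above minus the larger one, which is
    below 1. *)
Lemma region_inside x : `|rdif P i x| < 2 * rmax P i x -> rmax P i x < 1 -> inside P x.
Proof.
rewrite rmax_abs /rdif => h1 h2; apply/(co_inside i x wx0 wy0).
move: h1 h2; set A := co P i x; set B := co P i.+1 x.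
have -> : 2 * ((A + B + `|B - A|) / 2) = A + B + `|B - A| by field.
rewrite ltr_pdivrMr // mul1r => h1 h2.
have [BA|AB] := leP 0 (B - A).
  by rewrite ger0_norm // in h1 h2; rewrite !ltr_norml; split; apply/andP; split; lra.
by rewrite ltr0_norm // in h1 h2; rewrite !ltr_norml; split; apply/andP; split; lra.
Qed.

Variable (v : R * R -> R * R).
Hypothesis vP : forall x, inside P x -> v x = box_field P om x.

Lemma derive_out (h : R -> R) a b m : (forall m, m < a \/ b < m -> h m = 0) ->
  m < a \/ b < m -> 'D_1 h m = 0.
Proof.
move=> ho [hm|hm]; rewrite (@near_eq_derive _ _ _ _ (cst (0 : R))) ?derive_cst //.
  by near=> y; apply: ho; left; near: y; exact: lt_nbhsl.
by near=> y; apply: ho; right; near: y; exact: lt_nbhsr.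
Unshelve. all: by end_near. Qed.

(** Off the band the smoothed maximum is the true one: the field preserves it and moves [rdif] at
    [om] times its value, so both arguments of the chart function are conserved. Where [f] or [g]
    vanishes there is nothing to check. *)
Lemma transport_chart_zero eps x t : 0 < eps -> 2 * eps <= kap / 2 -> 0 <= (t - s0) * om <= 2 ->
  eps < `|rdif P i x| -> transport v (chart_fun P i om s0 eps f g) (x, t) = 0.
Proof.
move=> e0 e1 hs hd; rewrite transport_chart //=.
set m := cmax P i eps (x, t); set q := cshear P i om s0 eps (x, t).
have [mi|/negP mo] := boolP (r1 <= m <= r2); last first.
  have mo' : m < r1 \/ r2 < m by move: mo => /negP; rewrite negb_and -!ltNge => /orP.
  by rewrite (derive_out f_out mo') (f_out mo') !mul0r addr0.
have [qi|/negP qo] := boolP (q1 <= q <= q2); last first.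
  have qo' : q < q1 \/ q2 < q by move: qo => /negP; rewrite negb_and -!ltNge => /orP.
  by rewrite (derive_out g_out qo') (g_out qo') !mulr0 !mul0r addr0.
have [R1 R2] := chart_region e0 e1 hs mi qi.
have k2 : 0 < kap / 2 by rewrite divr_gt0.
have R1' : `|rdif P i x| < 2 * rmax P i x by move: R1 k2; lra.
have R2' : rmax P i x < 1 by move: R2 k2; lra.
have Px := region_inside R1' R2'.
have mE : m = rmax P i x.
  by rewrite /m /cmax rmax_abs /= sabs_out // ltW.
have L j := lin_box_field om j wx0 wy0 Px.
suff [E1 E2] : cmax' P i eps (x, t) (v x) = 0 /\ lin P i.+1 (v x) - lin P i (v x) = om * m.
  by rewrite E1 E2 !mulr0 add0r; ring.
have co2 : co P i.+2 x = - co P i x by [].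
rewrite /cmax' /= vP // !L mE co2 normrN.
rewrite derive_sabs_out //.
move: R1' hd; rewrite rmax_abs /rdif; set A := co P i x; set B := co P i.+1 x.
have -> : 2 * ((A + B + `|B - A|) / 2) = A + B + `|B - A| by field.
have [AB|BA|->] := ltgtP (B - A) 0; last by rewrite normr0 => _; rewrite ltNge (ltW e0).
- rewrite ltr0_norm // ltr0_sg // => h1 h2.
  have -> : (`|B| < `|A|) = true.
    by rewrite (@gtr0_norm _ A) ?ltr_norml; [apply/andP; split; lra|lra].
  have -> : (`|A| < `|B|) = false.
    by apply/negbTE; rewrite -leNgt (@ger0_norm _ A) ?ler_norml; [apply/andP; split; lra|lra].
  by rewrite /=; split; field.
- rewrite gtr0_norm // gtr0_sg // => h1 h2.
  have -> : (`|A| < `|B|) = true.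
    by rewrite (@gtr0_norm _ B) ?ltr_norml; [apply/andP; split; lra|lra].
  have -> : (`|B| < `|A|) = false.
    by apply/negbTE; rewrite -leNgt (@ger0_norm _ B) ?ler_norml; [apply/andP; split; lra|lra].
  by rewrite /=; split; field.
Qed.

(** [B0] is chosen before [eps]: the only derivative that depends on [eps] is that of [sabs eps],
    which is bounded uniformly. The defect then tends to 0 with the area of the band. *)
Lemma transport_chart_bound : exists2 B0, 0 <= B0 &
  forall eps x t, 0 < eps -> 2 * eps <= kap / 2 -> 0 <= (t - s0) * om <= 2 ->
  `|transport v (chart_fun P i om s0 eps f g) (x, t)| <=
    B0 * \1_[set x | inside P x /\ `|rdif P i x| <= eps] x.
Proof.
have [Cf Cf0 Hf] := bounded_out (smooth_continuous sf) f_out.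
have [Cg Cg0 Hg] := bounded_out (smooth_continuous sg) g_out.
have [Cf' Cf'0 Hf'] := bounded_out (smooth_continuous (smooth_derive (1:R) sf)) (fun m => derive_out f_out (m:=m)).
have [Cg' Cg'0 Hg'] := bounded_out (smooth_continuous (smooth_derive (1:R) sg)) (fun m => derive_out g_out (m:=m)).
have [Cs Cs0 Hs] := @derive_sabs_bound R.
pose Cm := (2 * om + Cs * (2 * om)) / 2.
have Cm0 : 0 <= Cm by rewrite divr_ge0 // addr_ge0 // !mulr_ge0.
have BB0 : 0 <= Cf' * Cg * Cm + Cf * Cg' * (3 * om + 2 * Cm).
  apply: addr_ge0; first by apply: mulr_ge0 => //; exact: mulr_ge0.
  apply: mulr_ge0; first exact: mulr_ge0.
  by apply: addr_ge0; apply: mulr_ge0.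
exists (Cf' * Cg * Cm + Cf * Cg' * (3 * om + 2 * Cm)).
  exact: BB0.
move=> eps x t e0 e1 hs.
have [hd|hd] := ltP eps `|rdif P i x|.
  rewrite transport_chart_zero // normr0; apply: mulr_ge0; [exact: BB0|by rewrite indicE ler0n].
rewrite transport_chart //=.
set m := cmax P i eps (x, t); set q := cshear P i om s0 eps (x, t).
have z0 : 0 <= (Cf' * Cg * Cm + Cf * Cg' * (3 * om + 2 * Cm)) *
    \1_[set x | inside P x /\ `|rdif P i x| <= eps] x.
  apply: mulr_ge0; [exact: BB0|by rewrite indicE ler0n].
have [mi|/negP mo] := boolP (r1 <= m <= r2); last first.
  have mo' : m < r1 \/ r2 < m by move: mo => /negP; rewrite negb_and -!ltNge => /orP.
  by rewrite (derive_out f_out mo') (f_out mo') !mul0r addr0 normr0.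
have [qi|/negP qo] := boolP (q1 <= q <= q2); last first.
  have qo' : q < q1 \/ q2 < q by move: qo => /negP; rewrite negb_and -!ltNge => /orP.
  by rewrite (derive_out g_out qo') (g_out qo') !mulr0 !mul0r addr0 normr0.
have [R1 R2] := chart_region e0 e1 hs mi qi.
have k2 : 0 < kap / 2 by rewrite divr_gt0.
have R1' : `|rdif P i x| < 2 * rmax P i x by move: R1 k2; lra.
have R2' : rmax P i x < 1 by move: R2 k2; lra.
have Px := region_inside R1' R2'.
rewrite indicE mem_set // mulr1.
have L j : `|lin P j (v x)| <= om.
  rewrite vP // lin_box_field // !normrM normrN (ger0_norm om0).
  have [_ c1] := (co_inside j x wx0 wy0).1 Px.
  rewrite -[leRHS]mulr1 -[X in _ <= X * _]mulr1.
  apply: ler_pM => //; first by rewrite mulr_ge0.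
    by rewrite ler_wpM2l // ltW.
  by case: (_ < _); rewrite ?normr1 ?normr0.
have M1 : `|cmax' P i eps (x, t) (v x)| <= Cm.
  rewrite /cmax' /Cm normrM (ger0_norm (_ : 0 <= 2^-1 :> R)) ?invr_ge0 // ler_wpM2r ?invr_ge0 //.
  apply: (le_trans (ler_normD _ _)); apply: lerD.
    apply: (le_trans (ler_normD _ _)); rewrite mulrDl mul1r; apply: lerD; exact: L.
  rewrite normrM; apply: ler_pM => //; first exact: Hs.
  by apply: (le_trans (ler_normB _ _)); rewrite mulrDl mul1r; apply: lerD; exact: L.
have M2 : `|m| <= 1 by move: mi => /andP[m1 m2]; rewrite ler_norml; apply/andP; split; move: m1 m2 hr1 hr2 kap0; lra.
apply: (le_trans (ler_normD _ _)); apply: lerD.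
  rewrite normrM; apply: ler_pM => //; rewrite normrM; exact: ler_pM.
rewrite normrM; apply: ler_pM => //; first by rewrite normrM ler_pM.
apply: (le_trans (ler_normB _ _)).
have -> : 3 * om + 2 * Cm = (om + om) + (om + 2 * Cm) by ring.
apply: lerD; first by apply: (le_trans (ler_normB _ _)); apply: lerD; exact: L.
apply: (le_trans (ler_normD _ _)); apply: lerD.
  by rewrite normrM (ger0_norm om0) -[leRHS]mul1r ler_wpM2r.
by rewrite normrM; apply: ler_pM => //; move: hs => /andP[h1 h2]; rewrite ger0_norm.
Qed.

End chart_bound.

(** * Evolution of a density between two times *)

Section weak_evolution.
Context {R : realType}.
Implicit Types (v : R * R -> R * R) (w : R * R -> R).

(* From time a to time b, the density wa evolves into wb.  Since v is not smooth, a
   smooth F is transported only up to a small error, supported in a small set S. *)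
Definition weak_evolution v (a b M : R) (wa wb : R * R -> R) : Prop :=
  forall (F : R * R * R -> R) (K S : set (R * R)) (B : R),
  smooth F -> compact K -> K `<=` unit_square ->
  (forall x t, a <= t <= b -> F (x, t) != 0 -> K x) ->
  measurable S -> 0 <= B ->
  (forall x t, unit_square x -> a < t < b -> `|transport v F (x, t)| <= B * \1_S x) ->
  `|\int[lam2]_(x in unit_square) (wb x * F (x, b)) -
    \int[lam2]_(x in unit_square) (wa x * F (x, a))| <=
  M * (B * fine (lam2 (S `&` unit_square))) * (b - a).

Let mQ := @measurable_unit_square R.
Let Qfin : (lam2 (@unit_square R) < +oo)%E.
Proof. by rewrite lam2_unit_square ltry. Qed.

Lemma integrable_slice (w : R * R -> R) M (F : R * R * R -> R) t : 0 <= t <= 1 ->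
  measurable_fun setT w -> (forall x, `|w x| <= M) -> continuous F ->
  lam2.-integrable unit_square (EFin \o (fun x => w x * F (x, t))).
Proof.
move=> t01 mw wM cF.
pose KK : set (R * R * R) := (`[0, 1] `*` `[0, 1]) `*` `[0, 1].
have cKK : compact KK by apply: compact_setX; [apply: compact_setX|]; exact: segment_compact.
have [C C0 HC] := compact_bounded cKK cF.
have M0 : 0 <= M by apply: le_trans (wM 0); exact: normr_ge0.
apply: (@bounded_integrable _ _ _ _ _ _ (M * C)) => //.
  apply: measurable_funM; apply: (@measurable_funS _ _ _ _ setT) => //.
  exact: measurable_smooth_slice.
move=> x [/=]; rewrite !in_itv /= => /andP[x1 x2] /andP[x3 x4].
rewrite normrM ler_pM // HC // /KK /= !in_itv /= !(ltW x1) !(ltW x2) !(ltW x3) !(ltW x4).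
by move: t01 => /andP[-> ->].
Qed.

Lemma weak_evolutionD v a b M1 M2 (wa wb wa' wb' : R * R -> R) C : 0 <= a -> b <= 1 -> a <= b ->
  measurable_fun setT wa -> measurable_fun setT wb ->
  measurable_fun setT wa' -> measurable_fun setT wb' ->
  (forall x, [/\ `|wa x| <= C, `|wb x| <= C, `|wa' x| <= C & `|wb' x| <= C]) ->
  weak_evolution v a b M1 wa wb -> weak_evolution v a b M2 wa' wb' ->
  weak_evolution v a b (M1 + M2) (fun x => wa x + wa' x) (fun x => wb x + wb' x).
Proof.
move=> a0 b1 ab ma mb ma' mb' wC h1 h2 F K S B sF cK KQ FK mS B0 FB.
have cF := smooth_continuous sF.
have a01 : 0 <= a <= 1 by rewrite a0 (le_trans ab b1).
have b01 : 0 <= b <= 1 by rewrite b1 (le_trans a0 ab).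
have i1 := integrable_slice a01 ma (fun x => let: And4 h _ _ _ := wC x in h) cF.
have i2 := integrable_slice b01 mb (fun x => let: And4 _ h _ _ := wC x in h) cF.
have i3 := integrable_slice a01 ma' (fun x => let: And4 _ _ h _ := wC x in h) cF.
have i4 := integrable_slice b01 mb' (fun x => let: And4 _ _ _ h := wC x in h) cF.
have E (p q : R * R -> R) t : lam2.-integrable unit_square (EFin \o (fun x => p x * F (x, t))) ->
    lam2.-integrable unit_square (EFin \o (fun x => q x * F (x, t))) ->
    \int[lam2]_(x in unit_square) ((p x + q x) * F (x, t)) =
    \int[lam2]_(x in unit_square) (p x * F (x, t)) +
    \int[lam2]_(x in unit_square) (q x * F (x, t)).
  by move=> ip iq; rewrite -RintegralD //; apply: eq_Rintegral => x _; rewrite mulrDl.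
rewrite !E // !mulrDl opprD addrACA.
apply: (le_trans (ler_normD _ _)); by apply: lerD; [exact: (h1 F K S B)|exact: (h2 F K S B)].
Qed.

(** Zero flux removes the gradient term from the integral of [transport v F] over the square and
    leaves the time derivative of [F]; Fubini and the fundamental theorem turn it into the
    difference of the two integrals. *)
Lemma weak_evolution_cst v a b V : 0 <= a -> a < b -> b <= 1 ->
  measurable_fun setT (fun x => (v x).1) -> measurable_fun setT (fun x => (v x).2) ->
  (forall x, `|(v x).1| <= V /\ `|(v x).2| <= V) -> no_normal_flux v ->
  weak_evolution v a b 1 (cst 1) (cst 1).
Proof.
move=> a0 ab b1 mv1 mv2 vV flux F K S B sF cK KQ FK mS B0 FB.
rewrite mul1r.
pose D : R * R * R -> R := 'D_((0, 0), 1) F.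
have cD : continuous D by apply: smooth_continuous; exact: smooth_derive.
pose J : set R := `]a, b[%classic.
have mJ : measurable J by exact: measurable_itv.
pose KK : set (R * R * R) := (`[0, 1] `*` `[0, 1]) `*` `[0, 1].
have cKK : compact KK by apply: compact_setX; [apply: compact_setX|]; exact: segment_compact.
have [C C0 HC] := compact_bounded cKK cD.
have JK z : (unit_square `*` J) z -> KK z.
  move: z => [[x y] t] [[/=]]; rewrite /J /= !in_itv /= => /andP[x1 x2] /andP[x3 x4] /andP[t1 t2].
  rewrite /KK /= !in_itv /= !(ltW x1) !(ltW x2) !(ltW x3) !(ltW x4).
  by rewrite (le_trans a0 (ltW t1)) (le_trans (ltW t2) b1).
have mD : measurable_fun setT D by exact: continuous_measurable3.
have mQJ : measurable (unit_square `*` J : set (measurableTypeR R * measurableTypeR R * measurableTypeR R)).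
  exact: measurableX.
pose f := (EFin \o D) \_ (unit_square `*` J).
have lamJ : lam J = (b - a)%:E by rewrite lamE lebesgue_measure_itv /= lte_fin ab EFinN.
have lJ : (lam3 (unit_square `*` J) < +oo)%E by rewrite lam3_slab // lamJ ltry.
have iff : lam3.-integrable setT f.
  refine (proj1 (@integrable_mkcond _ _ R lam3 _ (EFin \o D) mQJ) _).
  apply: (@bounded_integrable _ _ _ _ _ _ C) => //.
  - exact: measurable_funS mD.
  - by move=> z /JK; exact: HC.
have FE x : unit_square x -> fubini_F lam f x = (F (x, b) - F (x, a))%:E.
  move=> Qx; rewrite /fubini_F.
  transitivity (\int[lam]_(t in J) (D (x, t))%:E)%E.
    rewrite [RHS]integral_mkcond; apply: eq_integral => t _.
    rewrite /f !patchE; case: ifPn => [/set_mem[_ /= Jt]|].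
      by rewrite mem_set.
    by case: ifPn => // /set_mem Jt /negP; rewrite inE => -[].
  have dx (y : R) : is_derive y (1 : R) (fun s => F (x, s)) (D (x, y)).
    apply: DeriveDef; last by rewrite (slice_t F x y).2.
    by apply/(slice_t F x y).1; exact: smooth_derivable.
  have cDx : continuous (fun s => D (x, s)).
    move=> s; apply: (continuous_comp (f := fun s : R => (x, s)) (g := D)); last exact: cD.
    move=> A [[U W] /= [nU nW] sub]; apply: filterS nW => y Wy.
    by apply: sub; split => //; exact: nbhs_singleton.
  rewrite -(FTC_C1 (ltW ab) dx cDx).
  rewrite -(@integral_itv_bndoo R a b (fun t => (D (x, t))%:E) true false) //.
  apply/measurable_EFinP; apply: (@measurable_funS _ _ _ _ setT) => //.
  exact: continuous_measurable_fun.
have F0 x : ~ unit_square x -> fubini_F lam f x = 0%E.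
  move=> nQ; rewrite /fubini_F (eq_integral (cst 0%E)) ?integral0 // => t _.
  by rewrite /f patchE; case: ifPn => // /set_mem[].
have GE t : J t -> fubini_G lam2 f t = (\int[lam2]_(x in unit_square) (D (x, t))%:E)%E.
  move=> Jt; rewrite /fubini_G [RHS]integral_mkcond; apply: eq_integral => x _.
  rewrite /f !patchE; case: ifPn => [/set_mem[/= Qx _]|]; first by rewrite mem_set.
  by case: ifPn => // /set_mem Qx /negP; rewrite inE => -[].
have G0 t : ~ J t -> fubini_G lam2 f t = 0%E.
  move=> nJ; rewrite /fubini_G (eq_integral (cst 0%E)) ?integral0 // => x _.
  by rewrite /f patchE; case: ifPn => // /set_mem[].
have iD t : J t -> lam2.-integrable unit_square (EFin \o (fun x => D (x, t))).
  rewrite /J /= in_itv /= => /andP[t1 t2].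
  have t01 : 0 <= t <= 1 by rewrite (le_trans a0 (ltW t1)) (le_trans (ltW t2) b1).
  have := @integrable_slice (cst 1) 1 D t t01 (measurable_cst _) (fun=> ltac:(by rewrite /= normr1)) cD.
  by under eq_fun do rewrite mul1r.
have Gbound t : J t -> (`|fubini_G lam2 f t| <= (B * fine (lam2 (S `&` unit_square)))%:E)%E.
  move=> Jt; rewrite GE //; have iDt := iD t Jt.
  have tab : a < t < b by move: Jt; rewrite /J /= in_itv.
  have mT : measurable_fun unit_square (fun x => transport v F (x, t)).
    apply: (@measurable_funS _ _ _ _ setT) => //.
    exact: (@measurable_fun_pair1 _ _ _ _ _ _ _ t (measurable_transport mv1 mv2 sF)).
  have bT x : unit_square x -> `|transport v F (x, t)| <= B * \1_S x by move=> Qx; exact: FB.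
  have mg : measurable_fun unit_square (fun x => transport v F (x, t) - D (x, t)).
    apply: measurable_funB => //; apply: (@measurable_funS _ _ _ _ setT) => //.
    exact: measurable_smooth_slice.
  have iT : lam2.-integrable unit_square (EFin \o (fun x => transport v F (x, t))).
    apply: (@bounded_integrable _ _ _ _ _ _ B) => // x Qx.
    apply: (le_trans (bT x Qx)); rewrite indicE.
    by case: (_ \in _); rewrite ?mulr1 ?mulr0.
  have e : \int[lam2]_(x in unit_square) D (x, t) =
      \int[lam2]_(x in unit_square) transport v F (x, t).
    apply/esym/eqP; rewrite -subr_eq0 -RintegralB //; apply/eqP.
    rewrite -[RHS]/(fine 0%E) -(flux _ (smooth_slice t sF)) integral_leb2 //; last first.
      apply/measurable_EFinP; apply: (eq_measurable_fun (fun x => transport v F (x, t) - D (x, t))) => //.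
      move=> x _; rewrite /D -(slice_t F x t).2 /transport /=.
      by rewrite addrAC subrr add0r.
    congr fine; apply: eq_integral => x _; congr EFin.
    by rewrite /D -(slice_t F x t).2 /transport /= addrAC subrr add0r.
  have fD : (\int[lam2]_(x in unit_square) (D (x, t))%:E)%E \is a fin_num.
    exact: integrable_fin_num.
  rewrite -(fineK fD) -[fine _]/(\int[lam2]_(x in unit_square) D (x, t)) e.
  by rewrite lee_fin; exact: norm_Rintegral_le.
have iF t : 0 <= t <= 1 -> lam2.-integrable unit_square (EFin \o (fun x => cst 1 x * F (x, t))).
  move=> t01; apply: (@integrable_slice _ 1) => //; first by move=> x; rewrite /= normr1.
  exact: smooth_continuous.
rewrite -RintegralB //; last 2 first.
- by apply: iF; rewrite b1 (le_trans a0 (ltW ab)).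
- by apply: iF; rewrite a0 (le_trans (ltW ab) b1).
have -> : \int[lam2]_(x in unit_square) (cst 1 x * F (x, b) - cst 1 x * F (x, a)) =
    fine (\int[lam2]_x fubini_F lam f x)%E.
  congr fine; rewrite [LHS]integral_mkcond; apply: eq_integral => x _.
  rewrite patchE; case: ifPn => [/set_mem Qx|/negP nQ].
    by rewrite FE // /= !mul1r.
  by rewrite F0 // => Qx; apply: nQ; rewrite inE.
rewrite (@Fubini _ _ _ _ R lam2 lam f iff).
have mG := @measurable_fubini_G _ _ _ _ R lam2 lam f iff.
have -> : (\int[lam]_y \int[lam2]_x f (x, y) = \int[lam]_(t in J) fubini_G lam2 f t)%E.
  rewrite [RHS]integral_mkcond; apply: eq_integral => t _.
  rewrite patchE; case: ifPn => // /negP nJ.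
  by have := G0 t; apply => Jt; apply: nJ; rewrite inE.
have mGJ : measurable_fun J (fubini_G lam2 f) by apply: (@measurable_funS _ _ _ _ setT).
have c0 : 0 <= B * fine (lam2 (S `&` unit_square)) by rewrite mulr_ge0 // fine_ge0.
have : (`|\int[lam]_(t in J) fubini_G lam2 f t| <=
    (B * fine (lam2 (S `&` unit_square)) * (b - a))%:E)%E.
  apply: (le_trans (@le_abse_integral _ _ R lam _ _ mJ mGJ)).
  apply: (@le_trans _ _ (\int[lam]_(t in J) (B * fine (lam2 (S `&` unit_square)))%:E)%E).
    by apply: ge0_le_integral => //; apply: measurableT_comp.
  apply: (@le_trans _ _ ((B * fine (lam2 (S `&` unit_square)))%:E * lam J)%E); last by rewrite lamJ EFinM.
  by rewrite le_eqVlt; apply/orP; left; apply/eqP; exact: (@integral_cst _ _ R lam J mJ).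
by case: (integral _ _ _) => [r| |] //=; rewrite ?lee_fin // leye_eq.
Qed.

End weak_evolution.

(** * Evolution in a sector *)

Section strips.
Context {R : realType}.

Let mQ := @measurable_unit_square R.
Let Qfin : (lam2 (@unit_square R) < +oo)%E.
Proof. by rewrite lam2_unit_square ltry. Qed.

Lemma lam2_strip (c : R -> R) (h : R) : measurable_fun setT c -> 0 <= h ->
  (lam2 ([set x : R * R | (`|x.2 - c x.1| <= h)%R] `&` unit_square) <= (2 * h)%:E)%E.
Proof.
move=> mc h0; set S := [set x : R * R | _].
have mS : measurable S.
  have mf : measurable_fun setT (fun x : R * R => `|x.2 - c x.1|).
    apply: measurableT_comp => //; apply: measurable_funB; first exact: measurable_snd.
    exact: (measurableT_comp mc measurable_fst).
  rewrite (_ : S = setT `&` (fun x : R * R => `|x.2 - c x.1|) @^-1` `]-oo, h]%classic).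
    by apply: mf => //; exact: measurable_itv.
  by apply/seteqP; split => x; rewrite /= in_itv /=; [|case].
have mI : measurable (`]0%R, 1%R[%classic : set R) by exact: measurable_itv.
rewrite /lam2 /product_measure1.
apply: (@le_trans _ _ (\int[lebesgue_measure]_x ((2 * h)%:E * (\1_(`]0%R, 1%R[%classic : set R) x)%:E))%E).
  apply: ge0_le_integral => //.
  - by apply: measurable_fun_xsection; exact: measurableI.
  - apply: measurable_funeM; apply/measurable_EFinP; exact: measurable_indic.
  move=> x _ /=; have [x01|nx] := boolP (x \in `]0%R, 1%R[).
    rewrite indicE mem_set //= mule1.
    apply: (@le_trans _ _ (lebesgue_measure (`[c x - h, c x + h]%classic : set R))).
      apply: le_measure; rewrite ?inE //; first by apply: measurable_xsection; exact: measurableI.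
      move=> y; rewrite /xsection /= inE /S /= => -[+ _].
      by rewrite in_itv /= ler_distl.
    rewrite lebesgue_measure_itv /=; case: ifP => _; last by rewrite lee_fin mulr_ge0.
    by rewrite -EFinB lee_fin; lra.
  rewrite [X in lebesgue_measure X](_ : _ = set0) ?measure0.
    by rewrite mule_ge0 // lee_fin // mulr_ge0.
  apply/seteqP; split => y //; rewrite /xsection /= inE => -[_ [/= x01 _]].
  by move/negP: nx.
rewrite ge0_integralZl //; last 2 first.
- by apply/measurable_EFinP; exact: measurable_indic.
- by rewrite lee_fin mulr_ge0.
have e : (\int[lam]_x (\1_(`]0%R, 1%R[%classic : set R) x)%:E = 1)%E.
  by rewrite integral_indic // setIT; exact: lam_unit_itv.
apply: (@le_trans _ _ ((2 * h)%:E * 1)%E); last by rewrite mule1.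
by rewrite le_eqVlt; apply/orP; left; apply/eqP; congr (_ * _)%E; exact: e.
Qed.

Lemma bounded_cvg_Rintegral (f_ : nat -> R * R -> R) (f : R * R -> R) (C : R) :
  (forall n, measurable_fun setT (f_ n)) ->
  (forall n x, unit_square x -> `|f_ n x| <= C) ->
  (forall x, unit_square x -> f_ ^~ x @ \oo --> f x) ->
  \int[lam2]_(x in unit_square) f_ n x @[n --> \oo] --> \int[lam2]_(x in unit_square) f x.
Proof.
move=> mf fC ff.
have mfQ n : measurable_fun unit_square (EFin \o f_ n).
  by apply/measurable_EFinP; apply: (@measurable_funS _ _ _ _ setT).
have mlim : measurable_fun unit_square (EFin \o f).
  apply/measurable_EFinP; apply: (measurable_fun_cvg (h := f_)) => //.
  by move=> n; apply: (@measurable_funS _ _ _ _ setT).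
have iC : lam2.-integrable unit_square (EFin \o cst C).
  apply: (@bounded_integrable _ _ _ _ _ _ `|C|) => //.
have ffE x : unit_square x -> (fun n => (EFin \o f_ n) x) @ \oo --> (EFin \o f) x.
  by move=> Qx; apply: cvg_EFin; [exact: nearW|exact: ff].
have [intf _ cv] := @dominated_convergence _ _ _ lam2 unit_square mQ (fun n => EFin \o f_ n)
  (EFin \o f) (EFin \o cst C) mfQ mlim
  (@aeW _ _ _ lam2 _ ffE)
  iC (@aeW _ _ _ lam2 _ (fun x n Qx => fC n x Qx)).
apply: fine_cvg; rewrite fineK; last exact: integrable_fin_num.
exact: cv.
Qed.

End strips.

Section coordinates.
Context {R : realType}.
Variables (P : @rect R).
Hypothesis wx0 : 0 < rwx P.
Hypothesis wy0 : 0 < rwy P.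

Lemma continuous_co i : continuous (co P i).
Proof. by have := smooth_continuous (smooth_slice 0 (smooth_co P i)). Qed.

Lemma measurable_co i : measurable_fun setT (co P i).
Proof. by apply: continuous_measurable2; exact: continuous_co. Qed.

Lemma measurable_rdif i : measurable_fun setT (rdif P i).
Proof. by apply: measurable_funB; exact: measurable_co. Qed.

Lemma measurable_rmax i : measurable_fun setT (rmax P i).
Proof. by apply: measurable_maxr; exact: measurable_co. Qed.

Lemma continuous_rdif i : continuous (rdif P i).
Proof. by move=> x; apply: cvgB; exact: continuous_co. Qed.

Lemma continuous_rmax i : continuous (rmax P i).
Proof.
rewrite (_ : rmax P i = fun x => (co P i x + co P i.+1 x + `|rdif P i x|) / 2).
  move=> x; apply: cvgM; last exact: cvg_cst.
  apply: cvgD; first by apply: cvgD; exact: continuous_co.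
  by apply: cvg_norm; exact: continuous_rdif.
by apply/funext => x; exact: rmax_abs.
Qed.

Lemma open_inside : open (inside P).
Proof.
rewrite (_ : inside P = fst @^-1` (ball (rcx P) (rwx P)) `&` snd @^-1` (ball (rcy P) (rwy P))).
  apply: openI; apply: open_comp; try exact: ball_open.
    by move=> x _; exact: cvg_fst.
  by move=> x _; exact: cvg_snd.
by apply/seteqP; split => x; rewrite /inside /ball /= (distrC x.1) (distrC x.2).
Qed.

Lemma measurable_inside : measurable (inside P).
Proof. by apply: open_measurable2; exact: open_inside. Qed.

(** Both diagonals are graphs over the first coordinate, so a band around one of them consists of
    points at a small vertical distance from a graph, and [lam2_strip] bounds its area. *)
Lemma rdif_graph i : exists2 c : R -> R, measurable_fun setT c &
  forall x, `|rdif P i x| = `|x.2 - c x.1| / rwy P.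
Proof.
have E j (h : exists2 c : R -> R, measurable_fun setT c &
    forall x, `|rdif P j x| = `|x.2 - c x.1| / rwy P) :
    exists2 c : R -> R, measurable_fun setT c &
    forall x, `|rdif P j.+2 x| = `|x.2 - c x.1| / rwy P.
  case: h => c mc hc; exists c => // x; rewrite -hc -normrN; congr `|_|.
  by rewrite /rdif -[co P j.+3 x]/(- co P j.+1 x) -[co P j.+2 x]/(- co P j x); ring.
have mlin (k : R) : measurable_fun setT (fun s : R => rcy P + k * (s - rcx P)).
  apply: measurable_funD => //; apply: measurable_funM => //.
  by apply: measurable_funB.
elim/ltn_ind: i => -[|[|i]] IH; last by apply: E; apply: IH; lia.
- exists (fun s => rcy P + rwy P / rwx P * (s - rcx P)) => // x.
  transitivity `|(x.2 - (rcy P + rwy P / rwx P * (x.1 - rcx P))) / rwy P|; last by rewrite normrM normfV (gtr0_norm wy0).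
  rewrite /rdif /co; congr `|_|.
  by field; rewrite !gt_eqF.
- exists (fun s => rcy P + (- (rwy P / rwx P)) * (s - rcx P)) => // x.
  transitivity `|(x.2 - (rcy P + - (rwy P / rwx P) * (x.1 - rcx P))) / rwy P|; last by rewrite normrM normfV (gtr0_norm wy0).
  rewrite -normrN /rdif.
  rewrite -[co P 2 x]/(- co P 0 x) /co; congr `|_|.
  by field; rewrite !gt_eqF.
Qed.

Lemma measurable_rdif_le i e : measurable [set x | inside P x /\ `|rdif P i x| <= e].
Proof.
have mf : measurable_fun setT (fun x => `|rdif P i x|).
  by apply: measurableT_comp => //; exact: measurable_rdif.
rewrite (_ : [set x | _] = inside P `&` (setT `&` (fun x => `|rdif P i x|) @^-1` `]-oo, e]%classic)).
  by apply: measurableI; [exact: measurable_inside|apply: mf => //; exact: measurable_itv].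
by apply/seteqP; split => x; rewrite /= in_itv /=; [move=> [? ?]|move=> [? []]].
Qed.

Lemma lam2_rdif_le i e : 0 <= e ->
  (lam2 ([set x | inside P x /\ (`|rdif P i x| <= e)%R] `&` unit_square) <= (2 * (e * rwy P))%:E)%E.
Proof.
move=> e0; have [c mc hc] := rdif_graph i.
apply: le_trans (lam2_strip mc (mulr_ge0 e0 (ltW wy0))).
have mf : measurable_fun setT (fun x : R * R => `|x.2 - c x.1|).
  apply: measurableT_comp => //; apply: measurable_funB; first exact: measurable_snd.
  exact: (measurableT_comp mc measurable_fst).
apply: le_measure; rewrite ?inE.
- by apply: measurableI; [exact: measurable_rdif_le|exact: measurable_unit_square].
- apply: measurableI; last exact: measurable_unit_square.
  rewrite (_ : [set x | _] = setT `&` (fun x : R * R => `|x.2 - c x.1|) @^-1` `]-oo, (e * rwy P)]%classic).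
    by apply: mf => //; exact: measurable_itv.
  by apply/seteqP; split => x; rewrite /= in_itv /=; [|case].
- by move=> x [[_ +] Qx]; rewrite /= hc ler_pdivrMr //.
Qed.

Lemma lam2_rdif0 i : lam2 ([set x | rdif P i x = 0%R] `&` unit_square) = 0%E.
Proof.
have [c mc hc] := rdif_graph i.
apply/eqP; rewrite -measure_le0.
have := lam2_strip mc (lexx (0 : R)); rewrite mulr0.
suff -> : [set x | rdif P i x = 0%R] = [set x : R * R | (`|x.2 - c x.1| <= 0)%R] by [].
apply/seteqP; split => x /=.
  move=> h; have := hc x; rewrite h normr0 => /esym/eqP.
  by rewrite mulf_eq0 invr_eq0 (gt_eqF wy0) orbF => /eqP ->.
rewrite normr_le0 => /eqP h; have := hc x; rewrite h normr0 mul0r => /eqP.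
by rewrite normr_eq0 => /eqP.
Qed.

End coordinates.

Section chart_limit.
Context {R : realType}.
Variables (P : @rect R) (i : nat) (om a b M C : R) (v : R * R -> R * R).
Variables (wa wb : R * R -> R).
Hypothesis wx0 : 0 < rwx P.
Hypothesis wy0 : 0 < rwy P.
Hypothesis om0 : 0 <= om.
Hypothesis M0 : 0 <= M.
Hypothesis ab : a <= b.
Hypothesis abom : (b - a) * om <= 2.
Hypothesis PQ : inside P `<=` unit_square.
Hypothesis vP : forall x, inside P x -> v x = box_field P om x.
Hypothesis mwa : measurable_fun setT wa.
Hypothesis mwb : measurable_fun setT wb.
Hypothesis wC : forall x, `|wa x| <= C /\ `|wb x| <= C.
Hypothesis ev : weak_evolution v a b M wa wb.

Definition chart_region_compact kap : set (R * R) :=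
  [set x | `|rdif P i x| <= 2 * rmax P i x - kap / 2 /\ rmax P i x <= 1 - kap / 2].

Lemma region_sub kap : 0 < kap -> chart_region_compact kap `<=` inside P.
Proof.
move=> k0 x [h1 h2]; have k2 : 0 < kap / 2 by rewrite divr_gt0.
by apply: (region_inside (i := i) wx0 wy0); lra.
Qed.

Lemma compact_region kap : 0 < kap -> compact (chart_region_compact kap).
Proof.
move=> k0.
pose K : set (R * R) := `[rcx P - rwx P, rcx P + rwx P] `*` `[rcy P - rwy P, rcy P + rwy P].
have cK : compact K by apply: compact_setX; exact: segment_compact.
apply: subclosed_compact cK _; last first.
  move=> x /(region_sub k0)[h1 h2]; split; rewrite /= in_itv /=.
    by move: h1; rewrite ltr_distl => /andP[/ltW -> /ltW ->].
  by move: h2; rewrite ltr_distl => /andP[/ltW -> /ltW ->].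
have c1 : continuous (fun x => 2 * rmax P i x - kap / 2 - `|rdif P i x|).
  move=> x; apply: cvgB; last by apply: cvg_norm; exact: continuous_rdif.
  apply: cvgB; last exact: cvg_cst.
  by apply: cvgM; [exact: cvg_cst|exact: continuous_rmax].
have c2 : continuous (fun x => 1 - kap / 2 - rmax P i x).
  by move=> x; apply: cvgB; [exact: cvg_cst|exact: continuous_rmax].
rewrite (_ : chart_region_compact kap =
  (fun x => 2 * rmax P i x - kap / 2 - `|rdif P i x|) @^-1` [set t | 0 <= t] `&`
  (fun x => 1 - kap / 2 - rmax P i x) @^-1` [set t | 0 <= t]).
  by apply: closedI; apply: closed_comp => //; exact: closed_ge.
by apply/seteqP; split => x; rewrite /chart_region_compact /= !subr_ge0.
Qed.

(** The limit of [chart_fun] as the smoothing width tends to 0, after a turn by the angle [s]. *)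
Definition chart_lim (f g : R -> R) s x := f (rmax P i x) * g (rdif P i x - rmax P i x * s).

Lemma measurable_pi (s : R) : measurable_fun setT (fun x => rdif P i x - rmax P i x * s).
Proof.
apply: measurable_funB; first exact: measurable_rdif.
by apply: measurable_funM => //; exact: measurable_rmax.
Qed.

Section smooth_limit.
Variables (f g : R -> R) (r1 r2 q1 q2 kap : R).
Hypothesis sf : smooth f.
Hypothesis sg : smooth g.
Hypothesis f_out : forall m, m < r1 \/ r2 < m -> f m = 0.
Hypothesis g_out : forall m, m < q1 \/ q2 < m -> g m = 0.
Hypothesis kap0 : 0 < kap.
Hypothesis hq1 : kap <= 2 * r1 + q1.
Hypothesis hq2 : kap <= - q2.
Hypothesis hr2 : kap <= 1 - r2.
Hypothesis hr1 : 0 < r1.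

(** The factor 1/4 ensures [2 * eps n <= kap / 2], as the chart bounds require. *)
Let eps n := kap / 4 * n.+1%:R^-1.

Let eps0 n : 0 < eps n. Proof. by rewrite /eps !divr_gt0 // ltr0n. Qed.

Let epsk n : 2 * eps n <= kap / 2.
Proof.
have : n.+1%:R^-1 <= 1 :> R by rewrite invf_le1 ?ltr0n // ler1n.
rewrite /eps => h; have : kap / 4 * n.+1%:R^-1 <= kap / 4 * 1 by rewrite ler_wpM2l // divr_ge0 // ltW.
by move: (kap / 4 * n.+1%:R^-1) => z; lra.
Qed.

Let eps_cvg : eps @ \oo --> 0.
Proof.
rewrite -[0](mulr0 (kap / 4)); apply: cvgM; first exact: cvg_cst.
exact: cvg_harmonic.
Qed.

Let ts t : a <= t <= b -> 0 <= (t - a) * om <= 2.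
Proof.
move=> /andP[at_ tb]; rewrite mulr_ge0 ?subr_ge0 //=.
by apply: le_trans abom; rewrite ler_wpM2r // lerD2r.
Qed.

Lemma chart_fun_cvg x t : chart_fun P i om a (eps n) f g (x, t) @[n --> \oo] -->
  chart_lim f g ((t - a) * om) x.
Proof.
have cm : cmax P i (eps n) (x, t) @[n --> \oo] --> rmax P i x.
  apply/cvgrPdist_le => e e0.
  have [N _ HN] : \forall n \near \oo, `|0 - eps n| <= e by move/cvgrPdist_le: eps_cvg; apply.
  exists N => // n /HN /=; rewrite sub0r normrN (gtr0_norm (eps0 n)) => h.
  by rewrite distrC; apply: le_trans h; exact: (cmax_rmax P i (x, t) (eps0 n)).
have cs : cshear P i om a (eps n) (x, t) @[n --> \oo] --> rdif P i x - rmax P i x * ((t - a) * om).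
  rewrite /cshear /=; apply: cvgB; first exact: cvg_cst.
  by apply: cvgM => //; exact: cvg_cst.
rewrite /chart_fun /chart_lim; apply: cvgM.
  by apply: (cvg_comp _ _ cm); exact: (smooth_continuous sf).
by apply: (cvg_comp _ _ cs); exact: (smooth_continuous sg).
Qed.

(** The two sides for [chart_fun] differ by at most a constant times the area of the band, hence by
    a constant times [eps n], so the identity is exact in the limit. *)
Lemma chart_smooth_eq :
  \int[lam2]_(x in unit_square) (wb x * chart_lim f g ((b - a) * om) x) =
  \int[lam2]_(x in unit_square) (wa x * chart_lim f g 0 x).
Proof.
have [Cf Cf0 Hf] := bounded_out (smooth_continuous sf) f_out.
have [Cg Cg0 Hg] := bounded_out (smooth_continuous sg) g_out.
pose F n := chart_fun P i om a (eps n) f g.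
have sF n : smooth (F n) by exact: smooth_chart.
have [B0 B00 HB] := transport_chart_bound i a wx0 wy0 om0 sf sg f_out g_out kap0 hq1 hq2 hr2 hr1 vP.
pose A n := \int[lam2]_(x in unit_square) (wb x * F n (x, b)).
pose D n := \int[lam2]_(x in unit_square) (wa x * F n (x, a)).
have bnd n : `|A n - D n| <= (M * (B0 * (2 * rwy P)) * (b - a)) * eps n.
  have FK x t : a <= t <= b -> F n (x, t) != 0 -> chart_region_compact kap x.
    move=> tab Fn0.
    have [m1|nm] := boolP (r1 <= cmax P i (eps n) (x, t) <= r2); last first.
      move: Fn0; rewrite /F /chart_fun f_out ?mul0r ?eqxx //.
      by move: nm; rewrite negb_and -!ltNge => /orP.
    have [m2|nm] := boolP (q1 <= cshear P i om a (eps n) (x, t) <= q2); last first.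
      move: Fn0; rewrite /F /chart_fun (g_out (m := cshear _ _ _ _ _ _)) ?mulr0 ?eqxx //.
      by move: nm; rewrite negb_and -!ltNge => /orP.
    exact: (chart_region kap0 hq1 hq2 hr2 hr1 (eps0 n) (epsk n) (ts tab) m1 m2).
  have mS := measurable_rdif_le P i (eps n).
  apply: (le_trans (ev (sF n) (compact_region kap0) (subset_trans (region_sub kap0) PQ) FK mS B00 _)).
    move=> x t Qx /andP[at_ tb]; apply: HB => //; apply: ts.
    by rewrite (ltW at_) (ltW tb).
  have : fine (lam2 ([set x | inside P x /\ `|rdif P i x| <= eps n] `&` unit_square)) <= 2 * (eps n * rwy P).
    have h := lam2_rdif_le wx0 wy0 i (ltW (eps0 n)).
    rewrite -lee_fin fineK // ge0_fin_numE //; exact: le_lt_trans h (ltry _).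
  move=> h; rewrite (mulrAC _ _ (eps n)) ler_wpM2r ?subr_ge0 //.
  rewrite -!mulrA ler_wpM2l // ler_wpM2l //; apply: (le_trans h).
  by rewrite le_eqVlt; apply/orP; left; apply/eqP; ring.
have cvgAD : A n - D n @[n --> \oo] --> 0.
  apply/norm_cvg0P.
  apply: (@squeeze_cvgr _ _ _ _ (fun=> 0) (fun n => (M * (B0 * (2 * rwy P)) * (b - a)) * eps n)).
  - by apply: nearW => n; rewrite normr_ge0 bnd.
  - exact: cvg_cst.
  - rewrite -[0](mulr0 (M * (B0 * (2 * rwy P)) * (b - a))).
    by apply: cvgM => //; exact: cvg_cst.
have C0 : 0 <= C by apply: le_trans (wC 0).1; exact: normr_ge0.
have lim (w : R * R -> R) (t : R) : measurable_fun setT w -> (forall x, `|w x| <= C) ->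
    \int[lam2]_(x in unit_square) (w x * F n (x, t)) @[n --> \oo] -->
    \int[lam2]_(x in unit_square) (w x * chart_lim f g ((t - a) * om) x).
  move=> mw wC'; apply: (@bounded_cvg_Rintegral R _ _ (C * (Cf * Cg))).
  - move=> n; apply: measurable_funM => //.
    by apply: measurable_smooth_slice; exact: smooth_continuous (sF n).
  - by move=> n x _; rewrite normrM ler_pM // normrM ler_pM.
  - move=> x _; apply: cvgM; first exact: cvg_cst.
    exact: chart_fun_cvg.
have cvA := lim wb b mwb (fun x => (wC x).2).
have cvD := lim wa a mwa (fun x => (wC x).1).
rewrite subrr mul0r in cvD.
apply/eqP; rewrite -subr_eq0; apply/eqP.
by apply: (cvg_unique (@norm_hausdorff _ _) (cvgB cvA cvD)); exact: cvgAD.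
Qed.

End smooth_limit.

Definition bump (p q : R) (n : nat) (m : R) := step (n%:R * (m - p)) * step (n%:R * (q - m)).

Lemma bump_cvg (p q : R) (f := bump p q) :
  [/\ (forall n, smooth (f n)), (forall n m, m < p \/ q < m -> f n m = 0),
      (forall n m, `|f n m| <= 1) &
      forall m, f ^~ m @ \oo --> (\1_(`]p, q[%classic) m : R)].
Proof.
rewrite {}/f; split.
- move=> n; apply: smoothM.
    apply: (@smooth_outer _ _ step (fun m => n%:R * (m - p))); first exact: smooth_step.
    apply: smoothM; first exact: smooth_cst.
    by apply: smoothB; [exact: smooth_id|exact: smooth_cst].
  apply: (@smooth_outer _ _ step (fun m => n%:R * (q - m))); first exact: smooth_step.
  apply: smoothM; first exact: smooth_cst.
  by apply: smoothB; [exact: smooth_cst|exact: smooth_id].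
- move=> n m [h|h]; rewrite /bump.
    by rewrite step0 ?mul0r // mulr_ge0_le0 //; lra.
  by rewrite (step0 (t := n%:R * (q - m))) ?mulr0 // mulr_ge0_le0 //; lra.
- move=> n m; rewrite /bump normrM !ger0_norm ?step_ge0 //.
  rewrite -[leRHS]mulr1; apply: ler_pM; rewrite ?step_ge0 ?step_le1 //.
move=> m; have [mpq|] := boolP (m \in `]p, q[).
  rewrite indicE mem_set //; move: mpq; rewrite in_itv /= => /andP[pm mq].
  apply: cvg_near_cst; near=> n.
  have mp0 : 0 < m - p by rewrite subr_gt0.
  have qm0 : 0 < q - m by rewrite subr_gt0.
  have h1 : (m - p)^-1 <= n%:R by near: n; exact: nbhs_infty_ger.
  have h2 : (q - m)^-1 <= n%:R by near: n; exact: nbhs_infty_ger.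
  rewrite /bump !step1 ?mulr1 //.
    by rewrite -ler_pdivrMr // mul1r.
  by rewrite -ler_pdivrMr // mul1r.
rewrite in_itv /= negb_and -!leNgt => h.
rewrite indicE memNset; last by rewrite /= in_itv /= => /andP[h1 h2]; move: h => /orP[]; lra.
apply: cvg_near_cst; apply: nearW => n; rewrite /bump.
move: h => /orP[h|h]; first by rewrite step0 ?mul0r // mulr_ge0_le0 //; lra.
by rewrite (step0 (t := n%:R * (q - m))) ?mulr0 // mulr_ge0_le0 //; lra.
Unshelve. all: by end_near. Qed.

(** Indicators of open intervals are bounded pointwise limits of the functions [bump], all supported
    in the same interval, so that one margin [kap] serves every [n]. *)
Lemma chart_box_eq (r1 r2 q1 q2 : R) :
  0 < r1 -> r2 < 1 -> q2 < 0 -> 0 < 2 * r1 + q1 ->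
  \int[lam2]_(x in unit_square) (wb x * (chart_lim (\1_(`]r1, r2[%classic)) (\1_(`]q1, q2[%classic)) ((b - a) * om) x)) =
  \int[lam2]_(x in unit_square) (wa x * (chart_lim (\1_(`]r1, r2[%classic)) (\1_(`]q1, q2[%classic)) 0 x)).
Proof.
move=> h1 h2 h3 h4.
pose kap := Num.min (1 - r2) (Num.min (- q2) (2 * r1 + q1)).
have kap0 : 0 < kap by rewrite !lt_min subr_gt0 h2 oppr_gt0 h3 h4.
have k1 : kap <= 1 - r2 by rewrite ge_min lexx.
have k2 : kap <= - q2 by rewrite !ge_min lexx orbT.
have k3 : kap <= 2 * r1 + q1 by rewrite !ge_min lexx !orbT.
pose f := bump r1 r2; have [sf f_out f1 fcv] := bump_cvg r1 r2.
pose g := bump q1 q2; have [sg g_out g1 gcv] := bump_cvg q1 q2.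
have C0 : 0 <= C by apply: le_trans (wC 0).1; exact: normr_ge0.
have lim (w : R * R -> R) (s : R) : measurable_fun setT w -> (forall x, `|w x| <= C) ->
    \int[lam2]_(x in unit_square) (w x * chart_lim (f n) (g n) s x) @[n --> \oo] -->
    \int[lam2]_(x in unit_square) (w x * chart_lim (\1_(`]r1, r2[%classic)) (\1_(`]q1, q2[%classic)) s x).
  move=> mw wC'; apply: (@bounded_cvg_Rintegral R _ _ (C * 1)).
  - move=> n; apply: measurable_funM => //; apply: measurable_funM.
      apply: (measurableT_comp (f := f n)); last exact: measurable_rmax.
      by apply: continuous_measurable_fun; exact: smooth_continuous (sf n).
    apply: (measurableT_comp (f := g n)); last exact: measurable_pi.
    by apply: continuous_measurable_fun; exact: smooth_continuous (sg n).
  - move=> n x _; rewrite normrM ler_pM // /chart_lim normrM -[leRHS]mulr1.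
    by apply: ler_pM; [| |exact: f1|exact: g1].
  - move=> x _; apply: cvgM; first exact: cvg_cst.
    by apply: cvgM; [exact: fcv|exact: gcv].
have cvA := lim wb ((b - a) * om) mwb (fun x => (wC x).2).
have cvD := lim wa 0 mwa (fun x => (wC x).1).
have e n : \int[lam2]_(x in unit_square) (wb x * chart_lim (f n) (g n) ((b - a) * om) x) =
   \int[lam2]_(x in unit_square) (wa x * chart_lim (f n) (g n) 0 x).
  exact: (chart_smooth_eq (sf n) (sg n) (@f_out n) (@g_out n) kap0 k3 k2 k1 h1).
have ee : (fun n => \int[lam2]_(x in unit_square) (wb x * chart_lim (f n) (g n) ((b - a) * om) x)) =
   (fun n => \int[lam2]_(x in unit_square) (wa x * chart_lim (f n) (g n) 0 x)) by apply/funext.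
rewrite ee in cvA.
by apply: (cvg_unique (@norm_hausdorff _ _) cvA); exact: cvD.
Qed.

End chart_limit.

(** * Measures determined by their values on boxes *)

Section measures_on_boxes.
Context {R : realType}.
Local Notation RR := (measurableTypeR R * measurableTypeR R)%type.

Definition box (p : R * R * (R * R)) : set (R * R) := `]p.1.1, p.1.2[ `*` `]p.2.1, p.2.2[.

Definition boxes : set (set (R * R)) := range box.

Lemma measurable_box p : measurable (box p).
Proof. by apply: measurableX; exact: measurable_itv. Qed.

Lemma boxI p q : box p `&` box q = box ((Num.max p.1.1 q.1.1, Num.min p.1.2 q.1.2),
  (Num.max p.2.1 q.2.1, Num.min p.2.2 q.2.2)).
Proof.
apply/seteqP; split => -[x y]; rewrite /box /= !in_itv /= !gt_max !lt_min.
  by move=> [[/andP[-> ->] /andP[-> ->]] [/andP[-> ->] /andP[-> ->]]].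
move=> [/andP[/andP[-> ->] /andP[-> ->]] /andP[/andP[-> ->] /andP[-> ->]]].
by [].
Qed.

Lemma big_boxes_cover : \bigcup_n box ((- n%:R, n%:R), (- n%:R, n%:R)) = setT.
Proof.
apply/seteqP; split => // -[x y] _.
have [n _ Hn] : \forall n \near \oo, `|x| + `|y| + 1 <= n%:R.
  near=> n; near: n; exact: nbhs_infty_ger.
exists n => //; have := Hn n (leqnn n).
have x0 := normr_ge0 x; have y0 := normr_ge0 y => h.
rewrite /box /= !in_itv /= -!ltr_norml; split; lra.
Unshelve. all: by end_near. Qed.

Lemma measurable_boxes : @measurable _ RR = <<s boxes >>.
Proof.
apply/seteqP; split; last first.
  apply: smallest_sub; first exact: sigma_algebra_measurable.
  by move=> _ [p _ <-]; exact: measurable_box.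
have m1 : measurable_fun setT (fst : g_sigma_algebraType boxes -> measurableTypeR R).
  apply: (measurability _ (RGenOpens.measurableE R)) => //.
  move=> _ [_ [a [b ->]] <-]; rewrite setTI.
  rewrite (_ : _ @^-1` _ = \bigcup_n box ((a, b), (- n%:R, n%:R))).
    by apply: bigcupT_measurable => n; apply: sub_sigma_algebra; exists ((a, b), (- n%:R, n%:R)).
  apply/seteqP; split => -[x y] /=; last by move=> [n _ []].
  have [n _ [_ hn]] : (\bigcup_n box ((- n%:R, n%:R), (- n%:R, n%:R))) (x, y) by rewrite big_boxes_cover.
  by move=> hx; exists n.
have m2 : measurable_fun setT (snd : g_sigma_algebraType boxes -> measurableTypeR R).
  apply: (measurability _ (RGenOpens.measurableE R)) => //.
  move=> _ [_ [a [b ->]] <-]; rewrite setTI.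
  rewrite (_ : _ @^-1` _ = \bigcup_n box ((- n%:R, n%:R), (a, b))).
    by apply: bigcupT_measurable => n; apply: sub_sigma_algebra; exists ((- n%:R, n%:R), (a, b)).
  apply/seteqP; split => -[x y] /=; last by move=> [n _ []].
  have [n _ [hn _]] : (\bigcup_n box ((- n%:R, n%:R), (- n%:R, n%:R))) (x, y) by rewrite big_boxes_cover.
  by move=> hx; exists n.
rewrite measurable_prod_measurableType; apply: smallest_sub; first exact: smallest_sigma_algebra.
move=> _ [A mA [B mB <-]].
have -> : A `*` B = (setT `&` fst @^-1` A) `&` (setT `&` snd @^-1` B) by rewrite !setTI.
by apply: (@measurableI _ (g_sigma_algebraType boxes)); [exact: m1|exact: m2].
Qed.

(** Boxes are stable under intersection, but equality is known only for those inside [box p];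
    uniqueness is therefore applied to the two measures restricted to [box p]. *)
Lemma measure_eq_box (m1 m2 : {measure set RR -> \bar R}) p :
  (forall q, [/\ p.1.1 <= q.1.1, q.1.2 <= p.1.2, p.2.1 <= q.2.1 & q.2.2 <= p.2.2] ->
    m1 (box q) = m2 (box q)) -> (m1 (box p) < +oo)%E ->
  forall A, measurable A -> A `<=` box p -> m1 A = m2 A.
Proof.
move=> h fin A mA Ap.
have mp := measurable_box p.
have : mrestr m1 mp A = mrestr m2 mp A; last by rewrite /mrestr /= (setIidl Ap).
apply: (@measure_unique _ R RR boxes (fun n => box ((- n%:R, n%:R), (- n%:R, n%:R)))
  measurable_boxes _ _ big_boxes_cover (mrestr m1 mp) (mrestr m2 mp)) => //.
- move=> _ _ [q _ <-] [r _ <-]; rewrite boxI; eexists; first by [].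
  by [].
- by move=> n; eexists.
- move=> _ [q _ <-].
  have [r [e rp]] : exists r, box q `&` box p = box r /\
      [/\ p.1.1 <= r.1.1, r.1.2 <= p.1.2, p.2.1 <= r.2.1 & r.2.2 <= p.2.2].
    rewrite boxI; eexists; split; first by [].
    by split; rewrite /= ?le_max ?ge_min lexx orbT.
  by have := h r rp; rewrite -e.
- move=> n; apply: le_lt_trans fin; apply: le_measure; rewrite ?inE //.
  apply: measurableI => //; exact: measurable_box.
Qed.

Lemma measure_eq_cover (m1 m2 : {measure set RR -> \bar R}) (D : nat -> set (R * R)) :
  (forall n, measurable (D n)) ->
  (forall n A, measurable A -> A `<=` D n -> m1 A = m2 A) ->
  forall A, measurable A -> A `<=` \bigcup_n D n -> m1 A = m2 A.
Proof.
move=> mD h A mA AD.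
pose E n := A `&` seqDU D n.
have mE n : measurable (E n).
  apply: measurableI => //; apply: measurableD => //.
  by apply: bigsetU_measurable.
have AE : A = \bigcup_n E n by rewrite -setI_bigcupr -seqDU_bigcup_eq (setIidl AD).
have tE : trivIset setT E.
  apply/trivIsetP => i j _ _ ij; have /trivIsetP/(_ i j I I ij) := trivIset_seqDU D.
  move=> e; apply/seteqP; split => // x [[_ xi] [_ xj]].
  by rewrite -e.
rewrite AE !measure_bigcup //; try by move=> i _; exact: mE.
apply: eq_eseriesr => n _; apply: (h n) => //.
by move=> x [_ []].
Qed.

(* The image of the half sector of the chart in coordinates (m, q). *)
Definition triangle : set (R * R) := [set y | y.1 < 1 /\ y.2 < 0 /\ 0 < 2 * y.1 + y.2].

Definition triangle_box (p : R * R * (R * R)) : Prop :=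
  [/\ 0 < p.1.1, p.1.2 < 1, p.2.2 < 0 & 0 < 2 * p.1.1 + p.2.1].

Lemma triangle_cover : exists D : nat -> R * R * (R * R),
  (forall n, triangle_box (D n)) /\ triangle `<=` \bigcup_n box (D n).
Proof.
pose f n : R * R * (R * R) := let q := odflt ((0%Q, 0%Q), (0%Q, 0%Q)) (unpickle n) in
  ((ratr q.1.1, ratr q.1.2), (ratr q.2.1, ratr q.2.2)).
(* The default box is empty and satisfies [triangle_box]. *)
pose D n := if `[< triangle_box (f n) >] then f n else ((1/2, 1/2), (- (1/2), - (1/2))).
exists D; split.
  move=> n; rewrite /D; case: asboolP => // _; split => /=; lra.
move=> [m q] [/= h1 [h2 h3]].
have [r1] : exists r : rat, ratr r \in `] (- q / 2), m[ by apply: rat_in_itvoo; lra.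
have [r2] : exists r : rat, ratr r \in `]m, 1[ by exact: rat_in_itvoo.
have [q2] : exists r : rat, ratr r \in `]q, 0[ by exact: rat_in_itvoo.
rewrite !in_itv /= => /andP[b1 b2] /andP[c1 c2] /andP[d1 d2].
(* [r1] was chosen above [- q / 2], which leaves room for a rational [q1] below [q] with
   [2 * r1 + q1] positive. *)
have [q1] : exists r : rat, ratr r \in `] (- 2 * ratr r1), q[ by apply: rat_in_itvoo; lra.
rewrite !in_itv /= => /andP[e1 e2].
exists (pickle ((r1, r2), (q1, q2))) => //.
have tb : triangle_box (f (pickle ((r1, r2), (q1, q2)))) by rewrite /f pickleK /=; split => /=; lra.
rewrite /D asboolT // /f pickleK /box /= !in_itv /=.
by rewrite d2 c1 b1 e2.
Qed.

End measures_on_boxes.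

(** * Quarter turns *)

Section image_mass.
Context {R : realType}.
Local Notation RR := (measurableTypeR R * measurableTypeR R)%type.
Variables (w : R * R -> R) (pi : R * R -> R * R).
Hypothesis mw : measurable_fun (setT : set RR) w.
Hypothesis w0 : forall x, 0 <= w x.
Hypothesis mpi : measurable_fun (setT : set RR) (pi : RR -> RR).
Local Open Scope ereal_scope.

(** The pushforward under [pi] of the measure with density [w] on the square. The hypotheses are
    arguments so that the measure structure can be attached to this symbol. *)
Definition image_mass of measurable_fun (setT : set RR) w & (forall x, (0 <= w x)%R) &
    measurable_fun (setT : set RR) (pi : RR -> RR) := fun A : set RR =>
  \int[lam2]_(x in pi @^-1` A `&` unit_square) (w x)%:E.

Local Notation m := (image_mass mw w0 mpi).

Let m0 : m set0 = 0.
Proof. by rewrite /image_mass preimage_set0 set0I integral_set0. Qed.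

Let m_ge0 A : 0 <= m A.
Proof. by apply: integral_ge0 => x _; rewrite lee_fin. Qed.

Let m_sigma : semi_sigma_additive m.
Proof.
move=> F mF tF mUF; rewrite /image_mass preimage_bigcup setI_bigcupl.
have mpF n : measurable (pi @^-1` F n `&` unit_square).
  apply: measurableI; last exact: measurable_unit_square.
  by rewrite -[X in measurable X]setTI; exact: mpi.
have := @semi_sigma_additive_nng_induced _ _ _ lam2 (EFin \o w) _ _ _ mpF.
apply.
- exact/measurable_EFinP.
- by move=> x; rewrite lee_fin.
- apply/trivIsetP => i j _ _ ij; have /trivIsetP/(_ i j I I ij) e := tF.
  apply/seteqP; split => // x [[/= xi _] [xj _]].
  by have : (F i `&` F j) (pi x) by []; rewrite e.
- by apply: bigcup_measurable => k _; exact: mpF.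
Qed.

HB.instance Definition _ := isMeasure.Build _ _ _ m m0 m_ge0 m_sigma.

Lemma image_mass_fin C A : (forall x, w x <= C)%R -> measurable A -> m A < +oo.
Proof.
move=> wC mA; apply: (@le_lt_trans _ _ (\int[lam2]_(x in unit_square) C%:E)).
  have mQ := @measurable_unit_square R.
  apply: (@le_trans _ _ (\int[lam2]_(x in unit_square) (w x)%:E)).
    apply: ge0_subset_integral => //.
    - by apply: measurableI => //; rewrite -[X in measurable X]setTI; exact: mpi.
    - by apply/measurable_EFinP; apply: measurable_funS mw.
    - by move=> x _; rewrite lee_fin.
  apply: ge0_le_integral => //.
  - by move=> x _; rewrite lee_fin.
  - by apply/measurable_EFinP; apply: measurable_funS mw.
  - by move=> x _; rewrite lee_fin.
rewrite (@integral_cst _ _ R lam2 _ (@measurable_unit_square R)).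
apply: (@le_lt_trans _ _ (C%:E * 1)); last by rewrite mule1 ltry.
by rewrite le_eqVlt; apply/orP; left; apply/eqP; congr (_ * _); exact: lam2_unit_square.
Qed.

End image_mass.

Section charts.
Context {R : realType}.
Local Notation RR := (measurableTypeR R * measurableTypeR R)%type.
Variable P : @rect R.
Hypothesis wx0 : 0 < rwx P.
Hypothesis wy0 : 0 < rwy P.

(** The inverse of the normalized coordinates [co P i] and [co P i.+1]; raising [i] by one is a
    quarter turn of the arguments. *)
Fixpoint uncart (i : nat) (y : R * R) : R * R :=
  if i is j.+1 then uncart j (- y.2, y.1)
  else (rcx P + rwx P * y.1, rcy P + rwy P * y.2).

Lemma co_uncart i y : co P i (uncart i y) = y.1 /\ co P i.+1 (uncart i y) = y.2.
Proof.
elim: i y => [|i IH] y.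
  by split; rewrite /co /=; field; rewrite gt_eqF.
have [h1 h2] := IH (- y.2, y.1); split => //.
by rewrite -[LHS]/(- co P i (uncart i (- y.2, y.1))) h1 opprK.
Qed.

Lemma uncart_co i x : uncart i (co P i x, co P i.+1 x) = x.
Proof.
elim: i => [|i IH].
  by case: x => x y; rewrite /co /=; congr (_, _); field; rewrite gt_eqF.
by rewrite /= -[co P i.+2 x]/(- co P i x) opprK.
Qed.

Definition chart_pi i s (x : R * R) : R * R := (rmax P i x, rdif P i x - rmax P i x * s).

(** With m the maximum and d = q + m s the difference, the larger coordinate is m and the smaller
    one is m minus the absolute value of d; the maximum and minimum with 0 decide which is which. *)
Definition chart_inv i s (y : R * R) : R * R :=
  uncart i (y.1 - Num.max (y.2 + y.1 * s) 0, y.1 + Num.min (y.2 + y.1 * s) 0).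

Lemma chart_piK i s : cancel (chart_pi i s) (chart_inv i s).
Proof.
move=> x; rewrite /chart_inv /chart_pi /= subrK -[RHS](uncart_co i).
congr (uncart i (_, _)); rewrite /rmax /rdif; set A := co P i x; set B := co P i.+1 x.
  by case: (leP A B) => h; case: (leP (B - A) 0) => h'; lra.
by case: (leP A B) => h; case: (leP (B - A) 0) => h'; lra.
Qed.

Lemma measurable_uncart i : measurable_fun (setT : set RR) (uncart i : RR -> RR).
Proof.
elim: i => [|i IH] /=.
  by apply: measurable_fun_pair; apply: measurable_funD => //; apply: measurable_funM.
apply: (measurableT_comp IH); apply: measurable_fun_pair.
  by apply: measurableT_comp => //; exact: measurable_snd.
exact: measurable_fst.
Qed.

Lemma measurable_chart_pi i s : measurable_fun (setT : set RR) (chart_pi i s : RR -> RR).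
Proof. by apply: measurable_fun_pair; [exact: measurable_rmax|exact: measurable_pi]. Qed.

Lemma measurable_chart_inv i s : measurable_fun (setT : set RR) (chart_inv i s : RR -> RR).
Proof.
have m1 : measurable_fun (setT : set RR) (fun y : RR => (y.1 : R)) by exact: measurable_fst.
have m2 : measurable_fun (setT : set RR) (fun y : RR => (y.2 : R)) by exact: measurable_snd.
have md : measurable_fun (setT : set RR) (fun y : RR => (y.2 + y.1 * s : R)).
  by apply: measurable_funD => //; apply: measurable_funM.
apply: (measurableT_comp (measurable_uncart i)); apply: measurable_fun_pair.
  by apply: measurable_funB => //; apply: measurable_maxr.
by apply: measurable_funD => //; apply: measurable_minr.
Qed.

Lemma measurable_triangle : measurable (triangle : set RR).
Proof.
rewrite (_ : triangle = (setT `&` fst @^-1` `]-oo, 1[%classic) `&`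
  ((setT `&` snd @^-1` `]-oo, 0[%classic) `&`
   (setT `&` (fun y : R * R => 2 * y.1 + y.2) @^-1` `]0, +oo[%classic))).
  apply: measurableI; [|apply: measurableI].
  - by apply: measurable_fst => //; exact: measurable_itv.
  - by apply: measurable_snd => //; exact: measurable_itv.
  - have mf : measurable_fun (setT : set RR) (fun y : RR => (2 * y.1 + y.2 : R)).
      by apply: measurable_funD => //; apply: measurable_funM.
    by apply: mf => //; exact: measurable_itv.
by apply/seteqP; split => y; rewrite /triangle /= !in_itv /= andbT; [move=> [? []]|move=> [[? ?] [[? ?] []]]].
Qed.

(** The sector where [co P i] dominates, turned by the angle [s]. Indices from 4 on give the empty
    set, so that the four sectors form a sequence. *)
Definition region s i : set (R * R) :=
  if (i < 4)%N then chart_pi i s @^-1` triangle else set0.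

Lemma measurable_preim (pi : R * R -> R * R) A : measurable_fun (setT : set RR) (pi : RR -> RR) ->
  measurable (A : set RR) -> measurable (pi @^-1` A : set RR).
Proof. by move=> mpi mA; rewrite -[X in measurable X]setTI; exact: mpi. Qed.

Lemma measurable_region s i : measurable (region s i : set RR).
Proof.
rewrite /region; case: ifP => // _; apply: measurable_preim; last exact: measurable_triangle.
exact: measurable_chart_pi.
Qed.

Lemma rmax_rdif i x : 2 * rmax P i x - `|rdif P i x| = co P i x + co P i.+1 x.
Proof. by rewrite rmax_abs; field. Qed.

Lemma chart_pi_triangle s i x : 0 <= s <= 2 -> triangle (chart_pi i s x) ->
  [/\ rmax P i x < 1, 0 < rmax P i x & `|rdif P i x| < 2 * rmax P i x].
Proof.
move=> /andP[s0 s2] [/= h1 [h2 h3]].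
have m0 : 0 < rmax P i x by lra.
have ms : rmax P i x * s <= rmax P i x * 2 by rewrite ler_wpM2l // ltW.
have ms0 : 0 <= rmax P i x * s by rewrite mulr_ge0 // ltW.
by split => //; rewrite ltr_norml; apply/andP; split; lra.
Qed.

Lemma region_inside' s i : 0 <= s <= 2 -> region s i `<=` inside P.
Proof.
move=> hs x; rewrite /region; case: ifP => // _ /(chart_pi_triangle hs)[h1 h2 h3].
exact: (region_inside (i := i) wx0 wy0).
Qed.

(** A common point has [co P i.+1] as its maximum in both charts; there the bound q < 0 of the first
    chart and the bound q > -2 m of the second are opposite strict inequalities. *)
Lemma chart_next s i x : 0 <= s <= 2 ->
  triangle (chart_pi i s x) -> triangle (chart_pi i.+1 s x) -> False.
Proof.
move=> hs t1 t2; have [_ _ a1] := chart_pi_triangle hs t1; have [_ _ a2] := chart_pi_triangle hs t2.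
have := rmax_rdif i x; have := rmax_rdif i.+1 x => e2 e1.
move: t1 t2 => [/= _ [b1 _]] [/= _ [_ b2]].
have c2 : co P i.+2 x = - co P i x by [].
have s1 : 0 < co P i x + co P i.+1 x by rewrite -e1; lra.
have s2 : 0 < co P i.+1 x - co P i x by rewrite -c2 -e2; lra.
have r1 : rmax P i x = co P i.+1 x by apply/max_idPr; lra.
have r2 : rmax P i.+1 x = co P i.+1 x by apply/max_idPl; rewrite c2; lra.
by move: b1 b2; rewrite r1 r2 /rdif c2; lra.
Qed.

(** The sum of the two coordinates must be positive in each chart, and passing from [i] to [i + 2]
    changes its sign. *)
Lemma chart_opp s i x : 0 <= s <= 2 ->
  triangle (chart_pi i s x) -> triangle (chart_pi i.+2 s x) -> False.
Proof.
move=> hs t1 t2; have [_ _ a1] := chart_pi_triangle hs t1; have [_ _ a2] := chart_pi_triangle hs t2.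
have := rmax_rdif i x; have := rmax_rdif i.+2 x => e2 e1.
have c2 : co P i.+2 x = - co P i x by [].
have c3 : co P i.+3 x = - co P i.+1 x by [].
by rewrite c2 c3 in e2; lra.
Qed.

Lemma chart_pi4 i s x : chart_pi i.+4 s x = chart_pi i s x.
Proof.
by rewrite /chart_pi /rmax /rdif -[co P i.+4 x]/(- - co P i x) -[co P i.+4.+1 x]/(- - co P i.+1 x) !opprK.
Qed.

Lemma trivIset_region s : 0 <= s <= 2 -> trivIset setT (region s).
Proof.
move=> hs; have W i j x : (i < j)%N -> region s i x -> region s j x -> False.
  rewrite /region; case: ifP => // i4; case: ifP => // j4 ij t1 t2.
  have : [|| j == i.+1, j == i.+2 | (i == 0)%N && (j == 3)%N] by lia.
  case/or3P => [/eqP e|/eqP e|/andP[/eqP e1 /eqP e2]].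
  - by rewrite e in t2; exact: chart_next hs t1 t2.
  - by rewrite e in t2; exact: chart_opp hs t1 t2.
  - rewrite e1 in t1; rewrite e2 in t2; apply: (chart_next (i := 3) hs t2 (x := x)).
    by rewrite /= chart_pi4.
apply/trivIsetP => i j _ _ ij; apply/seteqP; split => // x [xi xj].
by have [h|h|h] := ltngtP i j; [exact: (W i j x)|exact: (W j i x)|rewrite h eqxx in ij].
Qed.

(** At angle 0 the regions are the four open sectors, so only the diagonals are missed. *)
Lemma region0_cover : inside P `\` \bigcup_i region 0 i `<=`
  [set x | rdif P 0 x = 0] `|` [set x | rdif P 1 x = 0].
Proof.
move=> x [Px nx]; apply: contrapT => /not_orP[/= d0 d1].
have T i : (i < 4)%N -> co P i.+1 x < co P i x -> 0 < co P i x + co P i.+1 x -> False.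
  move=> i4 h1 h2; apply: nx; exists i => //; rewrite /region i4 /chart_pi /triangle /=.
  have -> : rmax P i x = co P i x by apply/max_idPl; exact: ltW.
rewrite mulr0 subr0 /rdif.
  have [+ _] := (co_inside i x wx0 wy0).1 Px; rewrite ltr_norml => /andP[_ h].
  by split => //; split; lra.
have c2 : co P 2 x = - co P 0 x by []. have c3 : co P 3 x = - co P 1 x by [].
have c4 : co P 4 x = co P 0 x by rewrite -[LHS]/(- - co P 0 x) opprK.
have := T 0%N isT; have := T 1%N isT; have := T 2%N isT; have := T 3%N isT.
rewrite c4 c3 c2; move: d0 d1; rewrite /rdif c2.
set A := co P 0 x; set B := co P 1 x => d0 d1 t3 t2 t1 t0.
have [h|h|h] := ltgtP A B; last by apply: d0; rewrite h subrr.
  have [h'|h'|h'] := ltgtP 0 (A + B); last by apply: d1; lra.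
    by apply: t1; lra.
  by apply: t2; lra.
have [h'|h'|h'] := ltgtP 0 (A + B); last by apply: d1; lra.
  by apply: t0; lra.
by apply: t3; lra.
Qed.

(* Preimage under the flow map after the angle [s], up to the null set of the
   diagonals. *)
Definition pull s (N : set (R * R)) : set (R * R) :=
  \bigcup_i (region 0 i `&` (fun x => chart_inv i s (chart_pi i 0 x)) @^-1` N).

Lemma measurable_pull s N : measurable (N : set RR) -> measurable (pull s N : set RR).
Proof.
move=> mN; apply: bigcupT_measurable => i; apply: measurableI; first exact: measurable_region.
apply: (@measurable_preim (fun x => chart_inv i s (chart_pi i 0 x))) => //.
by apply: (measurableT_comp (measurable_chart_inv i s)); exact: measurable_chart_pi.
Qed.

End charts.

Section transfer.
Context {R : realType}.
Local Notation RR := (measurableTypeR R * measurableTypeR R)%type.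
Variables (P : @rect R) (om a b : R) (v : R * R -> R * R).
Hypothesis wx0 : 0 < rwx P.
Hypothesis wy0 : 0 < rwy P.
Hypothesis om0 : 0 <= om.
Hypothesis ab : a <= b.
Hypothesis abom : (b - a) * om <= 2.
Hypothesis PQ : inside P `<=` unit_square.
Hypothesis vP : forall x, inside P x -> v x = box_field P om x.

Let s := (b - a) * om.

Let hs : 0 <= s <= 2.
Proof. by rewrite abom mulr_ge0 // subr_ge0. Qed.

Section nonnegative.
Variables (M C : R) (wa wb : R * R -> R).
Hypothesis M0 : 0 <= M.
Hypothesis mwa : measurable_fun (setT : set RR) wa.
Hypothesis mwb : measurable_fun (setT : set RR) wb.
Hypothesis wa0 : forall x, 0 <= wa x.
Hypothesis wb0 : forall x, 0 <= wb x.
Hypothesis waC : forall x, wa x <= C.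
Hypothesis wbC : forall x, wb x <= C.
Hypothesis ev : weak_evolution v a b M wa wb.

Lemma image_mass_box (w : R * R -> R) (mw : measurable_fun (setT : set RR) w)
    (w0 : forall x, 0 <= w x) i s' p : (forall x, w x <= C) ->
  image_mass mw w0 (measurable_chart_pi P i s') (box p) =
  (\int[lam2]_(x in unit_square)
    (w x * chart_lim P i (\1_(`]p.1.1, p.1.2[%classic)) (\1_(`]p.2.1, p.2.2[%classic)) s' x))%:E.
Proof.
move=> wC.
have mb : measurable (chart_pi P i s' @^-1` box p : set RR).
  by apply: measurable_preim; [exact: measurable_chart_pi|exact: measurable_box].
have fin := image_mass_fin mw w0 (measurable_chart_pi P i s') wC (measurable_box p).
have ge0 : (0 <= image_mass mw w0 (measurable_chart_pi P i s') (box p))%E.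
  by apply: integral_ge0 => x _; rewrite lee_fin.
rewrite -[LHS]fineK ?ge0_fin_numE //; congr EFin.
rewrite /Rintegral /image_mass; congr fine.
rewrite integral_mkcondl; apply: eq_integral => x _.
rewrite /chart_lim !indicE patchE; case: ifPn => [/set_mem|/negP nx].
  by rewrite /box /chart_pi /= => -[h1 h2]; rewrite !mem_set //= !mulr1.
have [h1|h1] := boolP (rmax P i x \in `]p.1.1, p.1.2[%classic); last by rewrite mul0r mulr0.
have [h2|h2] := boolP (rdif P i x - rmax P i x * s' \in `]p.2.1, p.2.2[%classic); last by rewrite !mulr0.
exfalso; apply: nx; rewrite inE; split; exact: set_mem.
Qed.

(** The chart identity gives equality of the two pushforwards on every box inside one of the boxes
    that cover [triangle]; uniqueness of measures extends it. *)
Lemma image_mass_triangle i A : measurable (A : set RR) -> A `<=` triangle ->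
  image_mass mwb wb0 (measurable_chart_pi P i s) A =
  image_mass mwa wa0 (measurable_chart_pi P i 0) A.
Proof.
move=> mA AT; have [D [tD cD]] := @triangle_cover R.
apply: (@measure_eq_cover R (image_mass mwb wb0 (measurable_chart_pi P i s))
  (image_mass mwa wa0 (measurable_chart_pi P i 0)) (box \o D)) => //.
- by move=> n; exact: measurable_box.
- move=> n B mB; apply: measure_eq_box => //; last first.
    by exact: (image_mass_fin mwb wb0 _ wbC (measurable_box _)).
  move=> q [q1 q2 q3 q4]; have [d1 d2 d3 d4] := tD n.
  rewrite [LHS]image_mass_box // [RHS]image_mass_box //; congr EFin.
  have wC x : `|wa x| <= C /\ `|wb x| <= C by rewrite !ger0_norm.
  apply: (chart_box_eq i wx0 wy0 om0 M0 ab abom PQ vP mwa mwb wC ev).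
  - exact: lt_le_trans q1.
  - exact: le_lt_trans d2.
  - exact: le_lt_trans d3.
  - by lra.
- exact: subset_trans AT cD.
Qed.

(** The previous identity for the chart values in [triangle] that [chart_inv] sends into [N]: their
    preimages under the charts at the two times are the two domains of integration. *)
Lemma region_transfer i N : measurable (N : set RR) ->
  (\int[lam2]_(x in (N `&` region P s i) `&` unit_square) (wb x)%:E =
   \int[lam2]_(x in (region P 0 i `&` (fun x => chart_inv P i s (chart_pi P i 0 x)) @^-1` N) `&` unit_square) (wa x)%:E)%E.
Proof.
move=> mN; rewrite /region; case: ifP => _; last by rewrite setI0 !set0I !integral_set0.
pose B := triangle `&` (chart_inv P i s @^-1` N).
have mB : measurable (B : set RR).
  apply: measurableI; first exact: measurable_triangle.
  by apply: measurable_preim => //; exact: measurable_chart_inv.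
have := image_mass_triangle i mB (@subIsetl _ _ _); rewrite /image_mass.
rewrite (_ : chart_pi P i s @^-1` B = N `&` chart_pi P i s @^-1` triangle) //.
by apply/seteqP; split => x; rewrite /B /= chart_piK // => -[].
Qed.

End nonnegative.
End transfer.

Section null_sets.
Context d (T : measurableType d) (R : realType) (mu : {measure set T -> \bar R}).
Local Open Scope ereal_scope.

Lemma integral_null (A : set T) (f : T -> R) : measurable A -> measurable_fun setT f ->
  mu A = 0 -> \int[mu]_(x in A) (f x)%:E = 0.
Proof.
move=> mA mf A0; apply: null_set_integral => //.
by apply/measurable_EFinP; apply: measurable_funS mf.
Qed.

Lemma integral_cst_fin (A : set T) (c : R) : measurable A ->
  \int[mu]_(x in A) (cst c x)%:E = c%:E * mu A.
Proof. by move=> mA; exact: (@integral_cst _ _ R mu A mA c%:E). Qed.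

Lemma measure_diff_null (A U V : set T) : measurable A -> measurable U -> measurable V ->
  U `<=` A -> V `<=` A -> mu A < +oo -> mu U = mu V -> mu (A `\` V) = 0 -> mu (A `\` U) = 0.
Proof.
move=> mA mU mV UA VA fin e h.
have e1 : mu A = mu V.
  by rewrite (measureDI mu mA mV) (setIidr VA) -[RHS]add0e; congr (_ + _); exact: h.
have -> : mu (A `\` U) = mu A - mu U by rewrite measureD // (setIidr UA).
by rewrite e -e1 subee // ge0_fin_numE.
Qed.

End null_sets.

Section turn.
Context {R : realType}.
Local Notation RR := (measurableTypeR R * measurableTypeR R)%type.
Variables (P : @rect R) (om a b : R) (v : R * R -> R * R).
Hypothesis wx0 : 0 < rwx P.
Hypothesis wy0 : 0 < rwy P.
Hypothesis om0 : 0 <= om.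
Hypothesis ab : a <= b.
Hypothesis abom : (b - a) * om <= 2.
Hypothesis PQ : inside P `<=` unit_square.
Hypothesis vP : forall x, inside P x -> v x = box_field P om x.
Hypothesis ev1 : weak_evolution v a b 1 (cst 1) (cst 1).

Let s := (b - a) * om.

Let hs : 0 <= s <= 2.
Proof. by rewrite abom mulr_ge0 // subr_ge0. Qed.

Let U := \bigcup_i region P s i.

Let mU : measurable (U : set RR).
Proof. by apply: bigcupT_measurable => i; exact: measurable_region. Qed.

Let hs0 : 0 <= (0 : R) <= 2. Proof. by rewrite lexx /=. Qed.

Lemma lam2_inside_fin : (lam2 (inside P) < +oo)%E.
Proof.
apply: (@le_lt_trans _ _ (lam2 (@unit_square R))); last by rewrite lam2_unit_square ltry.
by apply: le_measure; rewrite ?inE //; [exact: measurable_inside|exact: measurable_unit_square].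
Qed.

(** Conservation of area: the transfer identity for the constant density 1. *)
Lemma lam2_region i : lam2 (region P s i) = lam2 (region P 0 i).
Proof.
have := region_transfer wx0 wy0 om0 ab abom PQ vP (ler01) (measurable_cst (1 : R)) (measurable_cst (1 : R))
  (fun=> ler01) (fun=> ler01) (fun=> lexx _) (fun=> lexx _) ev1 i (@measurableT _ RR).
rewrite preimage_setT setIT setTI !integral_cst_fin; first last.
- by apply: measurableI; [exact: measurable_region|exact: measurable_unit_square].
- by apply: measurableI; [exact: measurable_region|exact: measurable_unit_square].
have e s' (h : 0 <= s' <= 2) := setIidl (subset_trans (region_inside' (i := i) wx0 wy0 h) PQ).
rewrite (e _ hs) (e _ hs0) => h.
exact: (eq_trans (esym (mul1e _)) (eq_trans h (mul1e _))).
Qed.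

Lemma lam2_region0_cover : lam2 (inside P `\` \bigcup_i region P 0 i) = 0%E.
Proof.
have m0 : measurable (\bigcup_i region P 0 i : set RR).
  by apply: bigcupT_measurable => i; exact: measurable_region.
have mr i : measurable ([set x | rdif P i x = 0] `&` unit_square : set RR).
  apply: measurableI; last exact: measurable_unit_square.
  have := @measurable_rdif _ P i measurableT [set 0] (measurable_set1 _).
  by rewrite setTI.
apply/eqP; rewrite -measure_le0.
have e : lam2 (([set x | rdif P 0 x = 0%R] `&` unit_square) `|`
   ([set x | rdif P 1 x = 0%R] `&` unit_square)) = 0%E.
  by apply: measure_setU0 => //; exact: lam2_rdif0.
rewrite -e; apply: le_measure; rewrite ?inE.
- by apply: measurableD => //; exact: measurable_inside.
- exact: measurableU.
- move=> x Hx; have [h|h] := region0_cover wx0 wy0 Hx; [left|right];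
    by split => //; apply: PQ; case: Hx.
Qed.

(** Proved by counting area rather than by geometry at the angle [s]: the turned sectors are
    disjoint and have the areas of the four initial ones, which fill the box up to the diagonals. *)
Lemma lam2_region_cover : lam2 (inside P `\` U) = 0%E.
Proof.
have mI := @measurable_inside _ P.
have UI : U `<=` inside P by move=> x [i _]; exact: (region_inside' wx0 wy0 hs).
have m0 : measurable (\bigcup_i region P 0 i : set RR).
  by apply: bigcupT_measurable => i; exact: measurable_region.
have U0I : \bigcup_i region P 0 i `<=` inside P by move=> x [i _]; exact: (region_inside' wx0 wy0 hs0).
have tR s' : 0 <= s' <= 2 -> trivIset setT (region P s') by move=> h; apply: trivIset_region.
have e : lam2 U = lam2 (\bigcup_i region P 0 i).
  rewrite /U (@measure_bigcup _ R _ lam2 setT (region P s) (fun i _ => measurable_region P s i) (tR _ hs)).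
  rewrite (@measure_bigcup _ R _ lam2 setT (region P 0) (fun i _ => measurable_region P 0 i) (tR _ hs0)).
  by apply: eq_eseriesr => i _; exact: lam2_region.
exact (@measure_diff_null _ _ R lam2 (inside P) U (\bigcup_i region P 0 i) mI mU m0 UI U0I
  lam2_inside_fin e lam2_region0_cover).
Qed.

Section nonnegative.
Variables (M C : R) (wa wb : R * R -> R).
Hypothesis M0 : 0 <= M.
Hypothesis mwa : measurable_fun (setT : set RR) wa.
Hypothesis mwb : measurable_fun (setT : set RR) wb.
Hypothesis wa0 : forall x, 0 <= wa x.
Hypothesis wb0 : forall x, 0 <= wb x.
Hypothesis waC : forall x, wa x <= C.
Hypothesis wbC : forall x, wb x <= C.
Hypothesis ev : weak_evolution v a b M wa wb.

Lemma pull_transfer_nneg N : measurable (N : set RR) -> N `<=` inside P ->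
  (\int[lam2]_(x in N) (wb x)%:E = \int[lam2]_(x in pull P s N) (wa x)%:E)%E.
Proof.
move=> mN NP.
have mQ := @measurable_unit_square R.
have mid : measurable_fun (setT : set RR) (id : RR -> RR) by exact: measurable_id.
pose mb : {measure set RR -> \bar R} := image_mass mwb wb0 mid.
pose ma : {measure set RR -> \bar R} := image_mass mwa wa0 mid.
have pullP : pull P s N `<=` inside P by move=> x [i _ [+ _]]; exact: (region_inside' wx0 wy0 hs0).
have E1 : (\int[lam2]_(x in N) (wb x)%:E = mb N)%E.
  by rewrite /mb /= /image_mass preimage_id (setIidl (subset_trans NP PQ)).
have E2 : (\int[lam2]_(x in pull P s N) (wa x)%:E = ma (pull P s N))%E.
  by rewrite /ma /= /image_mass preimage_id (setIidl (subset_trans pullP PQ)).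
rewrite E1 E2 (measureDI mb mN mU).
rewrite [X in (X + _)%E](_ : _ = 0%E); last first.
  rewrite /mb /= /image_mass preimage_id; apply: integral_null => //.
    by apply: measurableI => //; exact: measurableD.
  apply/eqP; rewrite -measure_le0 -lam2_region_cover; apply: le_measure; rewrite ?inE.
  - by apply: measurableI => //; exact: measurableD.
  - by apply: measurableD => //; exact: measurable_inside.
  - by move=> x [[Nx Ux] _]; split => //; exact: NP.
have tR s' : 0 <= s' <= 2 -> trivIset setT (region P s') by move=> h; apply: trivIset_region.
pose A i := N `&` region P s i.
pose B i := region P 0 i `&` (fun x => chart_inv P i s (chart_pi P i 0 x)) @^-1` N.
have mA i : measurable (A i : set RR) by apply: measurableI => //; exact: measurable_region.
have mB i : measurable (B i : set RR).
  apply: measurableI; first exact: measurable_region.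
  apply: (@measurable_preim _ (fun x => chart_inv P i s (chart_pi P i 0 x))) => //.
  by apply: (measurableT_comp (measurable_chart_inv _ i s)); exact: measurable_chart_pi.
have tA : trivIset setT A.
  apply/trivIsetP => i j _ _ ij; have /trivIsetP/(_ i j I I ij) e := tR _ hs.
  apply/seteqP; split => // x [[_ xi] [_ xj]].
  by have : (region P s i `&` region P s j) x by []; rewrite e.
have tB : trivIset setT B.
  apply/trivIsetP => i j _ _ ij; have /trivIsetP/(_ i j I I ij) e := tR _ hs0.
  apply/seteqP; split => // x [[xi _] [xj _]].
  by have : (region P 0 i `&` region P 0 j) x by []; rewrite e.
rewrite add0e; transitivity (mb (\bigcup_n A n)); first by rewrite /A -setI_bigcupr.
transitivity (ma (\bigcup_n B n)); last by [].
rewrite (@measure_bigcup _ R _ mb setT A (fun i _ => mA i) tA).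
rewrite (@measure_bigcup _ R _ ma setT B (fun i _ => mB i) tB).
apply: eq_eseriesr => i _; rewrite /mb /ma /= /image_mass !preimage_id.
exact: (region_transfer wx0 wy0 om0 ab abom PQ vP M0 mwa mwb wa0 wb0 waC wbC ev).
Qed.

End nonnegative.

Lemma lam2_pull N : measurable (N : set RR) -> N `<=` inside P -> lam2 (pull P s N) = lam2 N.
Proof.
move=> mN NP.
have := pull_transfer_nneg ler01 (measurable_cst (1 : R)) (measurable_cst (1 : R))
  (fun=> ler01) (fun=> ler01) (fun=> lexx _) (fun=> lexx _) ev1 mN NP.
rewrite !integral_cst_fin ?mul1e //.
exact: measurable_pull.
Qed.

Lemma pull_inside N : pull P s N `<=` inside P.
Proof. by move=> x [i _ [+ _]]; exact: (region_inside' wx0 wy0 hs0). Qed.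

Lemma pull_transfer M C (wa wb : R * R -> R) N : 0 <= M -> 0 <= a -> b <= 1 ->
  measurable_fun (setT : set RR) wa -> measurable_fun (setT : set RR) wb ->
  (forall x, `|wa x| <= C /\ `|wb x| <= C) -> weak_evolution v a b M wa wb ->
  measurable (N : set RR) -> N `<=` inside P ->
  (\int[lam2]_(x in N) (wb x)%:E = \int[lam2]_(x in pull P s N) (wa x)%:E)%E.
Proof.
move=> M0 a0 b1 mwa mwb wC ev mN NP.
have C0 : 0 <= C by apply: le_trans (wC 0).1; exact: normr_ge0.
have mp := @measurable_pull _ P s _ mN.
(* A signed density becomes nonnegative by adding the constant [C], which evolves into itself. At
   the end its contribution [C * lam2 N] is subtracted from both sides, [pull] being area
   preserving. *)
have cC : weak_evolution v a b C (cst C) (cst C).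
  move=> F K S B sF cK KQ FK mS B0 FB.
  have h := ev1 sF cK KQ FK mS B0 FB.
  have e t : a <= t <= b -> \int[lam2]_(x in unit_square) (cst C x * F (x, t)) =
      C * \int[lam2]_(x in unit_square) (cst 1 x * F (x, t)).
    move=> /andP[t1 t2]; rewrite -RintegralZl; last 2 first.
    - exact: measurable_unit_square.
    - apply: (@integrable_slice _ _ 1) => //; last exact: smooth_continuous.
        by rewrite (le_trans a0 t1) (le_trans t2 b1).
      by move=> x; rewrite /= normr1.
    by apply: eq_Rintegral => x _; rewrite /= mul1r.
  rewrite !e ?lexx ?ab //= -mulrBr normrM ger0_norm //.
  by rewrite mul1r in h; rewrite -!mulrA ler_wpM2l // mulrA.
have ev' := @weak_evolutionD _ v a b M C wa wb (cst C) (cst C) C a0 b1 ab mwa mwb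
  (measurable_cst _) (measurable_cst _) _ ev cC.
have bC x : [/\ `|wa x| <= C, `|wb x| <= C, `|cst C x| <= C & `|cst C x| <= C].
  by have [h1 h2] := wC x; split => //=; rewrite ger0_norm.
have nn w x : (`|w x| <= C) -> 0 <= w x + C <= C + C.
  by rewrite ler_norml => /andP[h1 h2]; apply/andP; split; lra.
have mD (w : R * R -> R) : measurable_fun (setT : set RR) w -> measurable_fun (setT : set RR) (fun x => w x + C).
  by move=> mw; apply: measurable_funD.
have := @pull_transfer_nneg (M + C) (C + C) (fun x => wa x + C) (fun x => wb x + C) (addr_ge0 M0 C0)
  (mD _ mwa) (mD _ mwb) (fun x => proj1 (andP (nn _ _ _ (wC x).1))) (fun x => proj1 (andP (nn _ _ _ (wC x).2)))
  (fun x => proj2 (andP (nn _ _ _ (wC x).1))) (fun x => proj2 (andP (nn _ _ _ (wC x).2))) (ev' bC) N mN NP.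
have fN A : measurable (A : set RR) -> A `<=` inside P -> (lam2 A < +oo)%E.
  move=> mA AP; apply: le_lt_trans lam2_inside_fin.
  by apply: le_measure; rewrite ?inE //; exact: measurable_inside.
have iN (w : R * R -> R) A : measurable_fun (setT : set RR) w -> (forall x, `|w x| <= C) ->
    measurable (A : set RR) -> A `<=` inside P -> lam2.-integrable A (EFin \o w).
  move=> mw wC' mA AP; apply: (@bounded_integrable _ _ _ _ _ _ C) => //; first exact: fN.
  exact: measurable_funS mw.
have E (w : R * R -> R) A : measurable_fun (setT : set RR) w -> (forall x, `|w x| <= C) ->
    measurable (A : set RR) -> A `<=` inside P ->
    (\int[lam2]_(x in A) (w x + C)%:E = \int[lam2]_(x in A) (w x)%:E + C%:E * lam2 A)%E.
  move=> mw wC' mA AP; under eq_integral do rewrite EFinD.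
  rewrite integralD //; last 2 first.
  - exact: iN.
  - by apply: (iN (cst C)) => // x; rewrite /= ger0_norm.
  by congr (_ + _)%E; exact: integral_cst_fin.
rewrite !E //; try exact: pull_inside; try by move=> x; have [] := wC x.
rewrite lam2_pull // => h.
have f : (C%:E * lam2 N)%E \is a fin_num by rewrite fin_numM // ge0_fin_numE // fN.
by have := congr1 (fun z => z - C%:E * lam2 N)%E h; rewrite !addeK.
Qed.

End turn.

Section quarter.
Context {R : realType}.
Local Notation RR := (measurableTypeR R * measurableTypeR R)%type.
Variable P : @rect R.
Hypothesis wx0 : 0 < rwx P.
Hypothesis wy0 : 0 < rwy P.

(** The quarter turn in normalized coordinates: [uncart P 1] reads the old coordinates 0 and 1 as
    the new coordinates 1 and 2. *)
Definition rot (x : R * R) : R * R := uncart P 1 (co P 0 x, co P 1 x).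

Lemma uncart_rot i x : uncart P i.+1 (co P i x, co P i.+1 x) = rot x.
Proof.
elim: i => // i IH.
rewrite -IH -[LHS]/(uncart P i.+1 (- co P i.+2 x, co P i.+1 x)).
by rewrite -[co P i.+2 x]/(- co P i x) opprK.
Qed.

Lemma co_rot i x : co P i.+1 (rot x) = co P i x.
Proof. by rewrite -(uncart_rot i); exact: (co_uncart wx0 wy0 i.+1 _).1. Qed.

Lemma measurable_rot : measurable_fun (setT : set RR) (rot : RR -> RR).
Proof.
apply: (measurableT_comp (measurable_uncart P 1)).
by apply: measurable_fun_pair; exact: measurable_co.
Qed.

Lemma rot_inside x : inside P (rot x) <-> inside P x.
Proof.
by rewrite (co_inside 1 (rot x) wx0 wy0) (co_inside 0 x wx0 wy0) !co_rot.
Qed.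

Lemma region0_lt i x : region P 0 i x -> co P i.+1 x < co P i x /\ rmax P i x = co P i x.
Proof.
rewrite /region; case: ifP => // _ [/= _ []]; rewrite mulr0 subr0 /rdif subr_lt0 => h _.
by split => //; apply/max_idPl; exact: ltW.
Qed.

(** At the angle 2 the difference q + 2 m equals [co P i + co P i.+1], which is positive on the
    sector, so the maximum has passed to the next coordinate: a sector moves onto the next one. *)
Lemma chart_inv_quarter i x : region P 0 i x -> chart_inv P i 2 (chart_pi P i 0 x) = rot x.
Proof.
move=> rx; have [c1 c2] := region0_lt rx; move: rx.
rewrite /region; case: ifP => // _ [/= _ [_]]; rewrite -(uncart_rot i) /chart_inv /= c2 /rdif !mulr0 !subr0 => h.
have e : co P i.+1 x - co P i x + co P i x * 2 = co P i x + co P i.+1 x by ring.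
rewrite e; have h' : 0 <= co P i x + co P i.+1 x by lra.
by rewrite (max_idPl h') (min_idPr h') addr0 opprD addrA subrr add0r.
Qed.

Lemma pull_quarter N : pull P 2 N = rot @^-1` N `&` \bigcup_i region P 0 i.
Proof.
apply/seteqP; split => x.
  move=> [i _ [ri]]; rewrite /= chart_inv_quarter // => h; split => //; by exists i.
by move=> [Nx [i _ ri]]; exists i => //; split => //=; rewrite chart_inv_quarter.
Qed.

Lemma pull0 N : pull P 0 N = N `&` \bigcup_i region P 0 i.
Proof.
apply/seteqP; split => x.
  by move=> [i _ [ri]]; rewrite /= chart_piK // => h; split => //; exists i.
by move=> [Nx [i _ ri]]; exists i => //; split => //=; rewrite chart_piK.
Qed.

Hypothesis PQ : inside P `<=` unit_square.

Lemma integral_region0 (w : R * R -> R) C A : measurable_fun (setT : set RR) w ->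
  (forall x, `|w x| <= C) -> measurable (A : set RR) -> A `<=` inside P ->
  (\int[lam2]_(x in A `&` \bigcup_i region P 0%R i) (w x)%:E = \int[lam2]_(x in A) (w x)%:E)%E.
Proof.
move=> mw wC mA AP.
have mU : measurable (\bigcup_i region P 0 i : set RR).
  by apply: bigcupT_measurable => i; exact: measurable_region.
have mAU : measurable (A `\` \bigcup_i region P 0 i : set RR) by exact: measurableD.
have lA : (lam2 A < +oo)%E.
  apply: le_lt_trans (lam2_inside_fin PQ).
  by apply: le_measure; rewrite ?inE //; exact: measurable_inside.
rewrite [RHS](@negligible_integral _ _ R lam2 A (A `\` \bigcup_i region P 0 i)) //.
- by rewrite setDD.
- apply: (@bounded_integrable _ _ _ _ _ _ C) => //; exact: measurable_funS mw.
- apply/eqP; rewrite -measure_le0 -(lam2_region0_cover wx0 wy0 PQ).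
  apply: le_measure; rewrite ?inE //.
    by apply: measurableD => //; exact: measurable_inside.
  by move=> x [Ax nx]; split => //; exact: AP.
Qed.

Variables (om a b M C : R) (v : R * R -> R * R) (w : R -> R * R -> R).
Hypothesis om0 : 0 <= om.
Hypothesis a0 : 0 <= a.
Hypothesis b1 : b <= 1.
Hypothesis vP : forall x, inside P x -> v x = box_field P om x.
Hypothesis M0 : 0 <= M.
Hypothesis hw : forall t, a <= t <= b ->
  measurable_fun (setT : set RR) (w t) /\ forall x, `|w t x| <= C.
Hypothesis ev1 : forall t t', a <= t -> t <= t' -> t' <= b ->
  weak_evolution v t t' 1 (cst 1) (cst 1).
Hypothesis ev : forall t t', a <= t -> t <= t' -> t' <= b ->
  weak_evolution v t t' M (w t) (w t').

(** A chart lasts for one quarter turn, so the time interval is cut into pieces of angle at most 2,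
    going backwards from [t]. At a general angle only the area and the mass of the pulled back set
    are recorded. *)
Lemma turn_exists t N : a <= t <= b -> measurable (N : set RR) -> N `<=` inside P ->
  exists N0 : set RR, [/\ measurable N0, N0 `<=` inside P, lam2 N0 = lam2 N &
  (\int[lam2]_(x in N) (w t x)%:E = \int[lam2]_(x in N0) (w a x)%:E)%E].
Proof.
move=> /andP[at_ tb]; have aab : a <= a <= b by rewrite lexx (le_trans at_ tb).
have step t0 t' A : a <= t0 -> t0 <= t' -> t' <= b -> (t' - t0) * om <= 2 ->
    measurable (A : set RR) -> A `<=` inside P ->
    [/\ measurable (pull P ((t' - t0) * om) A : set RR),
        pull P ((t' - t0) * om) A `<=` inside P,
        lam2 (pull P ((t' - t0) * om) A) = lam2 A &
        (\int[lam2]_(x in A) (w t' x)%:E =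
         \int[lam2]_(x in pull P ((t' - t0) * om) A) (w t0 x)%:E)%E].
  move=> h1 h2 h3 h4 mA AP; have h5 : a <= t0 <= b by rewrite h1 (le_trans h2 h3).
  have h6 : a <= t' <= b by rewrite h3 (le_trans h1 h2).
  have [m1 c1] := hw h5; have [m2 c2] := hw h6.
  split; [exact: measurable_pull|exact: pull_inside| |].
    by apply: (lam2_pull wx0 wy0 om0 h2 h4 PQ vP) => //; exact: ev1.
  exact: (@pull_transfer R P om t0 t' v wx0 wy0 om0 h2 h4 PQ vP (ev1 h1 h2 h3) M C (w t0) (w t') A
    M0 (le_trans a0 h1) (le_trans h3 b1) m1 m2 (fun x => conj (c1 x) (c2 x)) (ev h1 h2 h3) mA AP).
have [n] : exists n : nat, (t - a) * om <= n%:R * 2.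
  have [n _ Hn] : \forall n \near \oo, (t - a) * om <= n%:R.
    by near=> n; near: n; exact: nbhs_infty_ger.
  exists n; apply: le_trans (Hn n (leqnn n)) _.
  by rewrite ler_peMr ?ler0n // ler1n.
elim: n t N at_ tb => [|n IH] t N at_ tb hn mN NP.
  have h2 : (t - a) * om <= 2 by apply: (le_trans hn); rewrite mul0r.
  by have [h3 h4 h5 h6] := step a t N (lexx a) at_ tb h2 mN NP; exists (pull P ((t - a) * om) N).
have [h2|h2] := leP ((t - a) * om) 2.
  by have [h3 h4 h5 h6] := step a t N (lexx a) at_ tb h2 mN NP; exists (pull P ((t - a) * om) N).
have omp : 0 < om.
  by rewrite lt_neqAle om0 andbT; apply/eqP => e; move: h2; rewrite -e mulr0; lra.
pose t0 := t - 2 / om.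
have e0 : (t - t0) * om = 2 by rewrite /t0; field; rewrite gt_eqF.
have e1 : (t0 - a) * om = (t - a) * om - 2 by rewrite /t0; field; rewrite gt_eqF.
have t0t : t0 <= t by rewrite /t0 gerBl divr_ge0.
have at0 : a <= t0 by rewrite -subr_ge0 -(pmulr_lge0 _ omp) e1; lra.
have [m1 p1 l1 i1] := step t0 t N at0 t0t tb (eq_ind_r (fun z => z <= 2) (lexx 2) e0) mN NP.
have hn' : (t0 - a) * om <= n%:R * 2 by rewrite e1; move: hn; rewrite -natr1; lra.
have [N0 [n1 n2 n3 n4]] := IH t0 _ at0 (le_trans t0t tb) hn' m1 p1.
by exists N0; split; [exact: n1|exact: n2|rewrite n3|rewrite i1].
Unshelve. all: by end_near. Qed.

(** For whole numbers of quarter turns the pulled back set is explicit: a preimage under [rot], up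
    to the null set of the diagonals. *)
Lemma turns n t N : a <= t <= b -> (t - a) * om = n%:R * 2 ->
  measurable (N : set RR) -> N `<=` inside P ->
  (\int[lam2]_(x in N) (w t x)%:E = \int[lam2]_(x in iter n rot @^-1` N) (w a x)%:E)%E.
Proof.
elim: n t N => [|n IH] t N /andP[at_ tb] e mN NP.
  have aab : a <= a <= b by rewrite lexx (le_trans at_ tb).
  have tab : a <= t <= b by rewrite at_ tb.
  have [m1 c1] := hw aab; have [m2 c2] := hw tab.
  have h4 : (t - a) * om <= 2 by rewrite e mul0r.
  have h := @pull_transfer R P om a t v wx0 wy0 om0 at_ h4 PQ vP (ev1 (lexx a) at_ tb)
    M C (w a) (w t) N M0 a0 (le_trans tb b1) m1 m2 (fun x => conj (c1 x) (c2 x))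
    (ev (lexx a) at_ tb) mN NP.
  by rewrite h e mul0r pull0 (integral_region0 m1 c1).
have omp : 0 < om.
  by rewrite lt_neqAle om0 andbT; apply/eqP => e'; move: e; rewrite -e' mulr0 -natr1 => e2;
     have := ler0n R n; lra.
pose t0 := t - 2 / om.
have e0 : (t - t0) * om = 2 by rewrite /t0; field; rewrite gt_eqF.
have e1' : (t0 - a) * om = (t - a) * om - 2 by rewrite /t0; field; rewrite gt_eqF.
have e1 : (t0 - a) * om = n%:R * 2 by rewrite e1' e -natr1; ring.
have t0t : t0 <= t by rewrite /t0 gerBl divr_ge0.
have at0 : a <= t0 by rewrite -subr_ge0 -(pmulr_lge0 _ omp) e1 mulr_ge0.
have t0ab : a <= t0 <= b by rewrite at0 (le_trans t0t tb).
have tab : a <= t <= b by rewrite at_ tb.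
have [m1 c1] := hw t0ab; have [m2 c2] := hw tab.
have h4 : (t - t0) * om <= 2 by rewrite e0.
have h := @pull_transfer R P om t0 t v wx0 wy0 om0 t0t h4 PQ vP (ev1 at0 t0t tb)
    M C (w t0) (w t) N M0 (le_trans a0 at0) (le_trans tb b1) m1 m2 (fun x => conj (c1 x) (c2 x))
    (ev at0 t0t tb) mN NP.
have mrN : measurable (rot @^-1` N : set RR) by apply: measurable_preim => //; exact: measurable_rot.
have rNP : rot @^-1` N `<=` inside P by move=> x /NP /rot_inside.
rewrite h e0 pull_quarter (integral_region0 m1 c1) //.
by rewrite IH.
Qed.

End quarter.

(** * Flux and variation of the rectangle field *)

Section rectangles.
Context {R : realType}.
Variables (I J : set R) (g : R * R -> R) (C : R).
Hypothesis mI : measurable I.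
Hypothesis mJ : measurable J.
Hypothesis Ifin : (lam I < +oo)%E.
Hypothesis Jfin : (lam J < +oo)%E.
Hypothesis mg : measurable_fun setT g.
Hypothesis gC : forall x, (I `*` J) x -> `|g x| <= C.

Let f := (EFin \o g) \_ (I `*` J).

Let mIJ : measurable (I `*` J : set (measurableTypeR R * measurableTypeR R)).
Proof. exact: measurableX. Qed.

Let fin : (lam2 (I `*` J) < +oo)%E.
Proof.
rewrite /lam2 product_measure1E //.
have h1 : lam I \is a fin_num by rewrite ge0_fin_numE.
have h2 : lam J \is a fin_num by rewrite ge0_fin_numE.
have := fin_numM h1 h2; rewrite ge0_fin_numE //; exact: mule_ge0.
Qed.

Let iff : lam2.-integrable setT f.
Proof.
refine (proj1 (@integrable_mkcond _ _ R lam2 _ (EFin \o g) mIJ) _).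
apply: (@bounded_integrable _ _ _ _ _ _ C) => //; exact: measurable_funS mg.
Qed.

Let line1 x : I x -> lam.-integrable J (EFin \o (fun y => g (x, y))).
Proof.
move=> Ix; apply: (@bounded_integrable _ _ _ _ _ _ C) => //.
  by apply: (@measurable_funS _ _ _ _ setT) => //; exact: (@measurable_fun_pair2 _ _ _ _ _ _ _ x mg).
by move=> y Jy; apply: gC.
Qed.

Let line2 y : J y -> lam.-integrable I (EFin \o (fun x => g (x, y))).
Proof.
move=> Jy; apply: (@bounded_integrable _ _ _ _ _ _ C) => //.
  by apply: (@measurable_funS _ _ _ _ setT) => //; exact: (@measurable_fun_pair1 _ _ _ _ _ _ _ y mg).
by move=> x Ix; apply: gC.
Qed.

Let FE x : fubini_F lam f x = ((fun x => (\int[lam]_(y in J) g (x, y))%:E) \_ I) x.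
Proof.
rewrite /fubini_F patchE; case: ifPn => [/set_mem Ix|/negP nI].
  rewrite /Rintegral fineK; last exact: integrable_fin_num (line1 Ix).
  rewrite [RHS]integral_mkcond; apply: eq_integral => y _; rewrite /f !patchE.
  case: ifPn => [/set_mem[_ /= Jy]|]; first by rewrite mem_set.
  by case: ifPn => // /set_mem Jy /negP; rewrite inE => -[].
rewrite (eq_integral (cst 0%E)) ?integral0 // => y _; rewrite /f patchE.
by case: ifPn => // /set_mem[Ix]; exfalso; apply: nI; rewrite inE.
Qed.

Let GE y : fubini_G lam f y = ((fun y => (\int[lam]_(x in I) g (x, y))%:E) \_ J) y.
Proof.
rewrite /fubini_G patchE; case: ifPn => [/set_mem Jy|/negP nJ].
  rewrite /Rintegral fineK; last exact: integrable_fin_num (line2 Jy).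
  rewrite [RHS]integral_mkcond; apply: eq_integral => x _; rewrite /f !patchE.
  case: ifPn => [/set_mem[/= Ix _]|]; first by rewrite mem_set.
  by case: ifPn => // /set_mem Ix /negP; rewrite inE => -[].
rewrite (eq_integral (cst 0%E)) ?integral0 // => x _; rewrite /f patchE.
by case: ifPn => // /set_mem[_ Jy]; exfalso; apply: nJ; rewrite inE.
Qed.

Let E0 : (\int[lam2]_(x in I `*` J) (g x)%:E = \int[lam2]_x f x)%E.
Proof. by rewrite integral_mkcond. Qed.

Lemma Rintegral_rect12 : \int[lam2]_(x in I `*` J) g x =
  \int[lam]_(x in I) \int[lam]_(y in J) g (x, y).
Proof.
rewrite /Rintegral; congr fine; rewrite E0.
rewrite -(@integral12_prod_meas1 _ _ _ _ R lam lam _ iff).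
rewrite [RHS]integral_mkcond; apply: eq_integral => x _.
exact: FE.
Qed.

Lemma Rintegral_rect21 : \int[lam2]_(x in I `*` J) g x =
  \int[lam]_(y in J) \int[lam]_(x in I) g (x, y).
Proof.
rewrite /Rintegral; congr fine; rewrite E0.
rewrite -(@integral21_prod_meas1 _ _ _ _ R lam lam _ iff).
rewrite [RHS]integral_mkcond; apply: eq_integral => x _.
exact: GE.
Qed.

Lemma norm_Rintegral_rect12 K : 0 <= K ->
  (forall x, I x -> `|\int[lam]_(y in J) g (x, y)| <= K) ->
  `|\int[lam2]_(x in I `*` J) g x| <= K * fine (lam I).
Proof.
move=> K0 h; rewrite Rintegral_rect12.
rewrite -[in fine (lam I)](setIid I); apply: norm_Rintegral_le => //.
  have mF : measurable_fun setT ((fun x => (\int[lam]_(y in J) g (x, y))%:E) \_ I).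
    apply: (eq_measurable_fun (fubini_F lam f)); first by move=> x _; exact: FE.
    exact: (@measurable_fubini_F _ _ _ _ R lam lam _ iff).
  by have := (measurable_restrictT _ mI).2 mF; move/measurable_EFinP.
by move=> x Ix; rewrite indicE mem_set // mulr1 h.
Qed.

Lemma norm_Rintegral_rect21 K : 0 <= K ->
  (forall y, J y -> `|\int[lam]_(x in I) g (x, y)| <= K) ->
  `|\int[lam2]_(x in I `*` J) g x| <= K * fine (lam J).
Proof.
move=> K0 h; rewrite Rintegral_rect21.
rewrite -[in fine (lam J)](setIid J); apply: norm_Rintegral_le => //.
  have mG : measurable_fun setT ((fun y => (\int[lam]_(x in I) g (x, y))%:E) \_ J).
    apply: (eq_measurable_fun (fubini_G lam f)); first by move=> y _; exact: GE.
    exact: (@measurable_fubini_G _ _ _ _ R lam lam _ iff).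
  by have := (measurable_restrictT _ mJ).2 mG; move/measurable_EFinP.
by move=> y Jy; rewrite indicE mem_set // mulr1 h.
Qed.

End rectangles.

Section lines.
Context {R : realType}.
Implicit Types (psi : R -> R).

Let mitv (p q : R) : measurable (`]p, q[%classic : set R).
Proof. exact: measurable_itv. Qed.

Lemma lam_itv (p q : R) : p <= q -> lam (`]p, q[%classic : set R) = (q - p)%:E.
Proof.
move=> pq; rewrite lamE lebesgue_measure_itv /=; case: ifPn; first by rewrite EFinB.
by rewrite lte_fin -leNgt => qp; rewrite (le_anti (introT andP (conj pq qp))) subrr.
Qed.

Lemma lam_itv_fin (p q : R) : (lam (`]p, q[%classic : set R) < +oo)%E.
Proof. by rewrite lamE lebesgue_measure_itv /=; case: ifP => _; rewrite ?ltry // -EFinB ltry. Qed.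

Lemma smooth_integrable psi (p q : R) : continuous psi ->
  lam.-integrable `]p, q[ (EFin \o psi).
Proof.
move=> cp; have [C C0 HC] := compact_bounded (@segment_compact R p q) cp.
apply: (@bounded_integrable _ _ _ _ _ _ C) => //.
- exact: lam_itv_fin.
- by apply: (@measurable_funS _ _ _ _ setT) => //; exact: continuous_measurable_fun.
- by move=> t; rewrite /= in_itv /= => /andP[h1 h2]; apply: HC; rewrite /= in_itv /= !ltW.
Qed.

Lemma Rintegral_derive psi (p q : R) : p <= q -> smooth psi ->
  \int[lam]_(t in `]p, q[) 'D_1 psi t = psi q - psi p.
Proof.
move=> pq sp; have cd : continuous ('D_1 psi) by apply: smooth_continuous; exact: smooth_derive.
rewrite /Rintegral -[RHS]/(fine (psi q - psi p)%:E) -(FTC_smooth pq sp); congr fine.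
apply/esym; apply: (@integral_itv_bndoo R p q (fun t => ('D_1 psi t)%:E) true false).
apply/measurable_EFinP; apply: (@measurable_funS _ _ _ _ setT) => //.
exact: continuous_measurable_fun.
Qed.

Lemma Rintegral_subitv (k : R -> R) (p q l r : R) : p <= l -> r <= q ->
  \int[lam]_(t in `]p, q[) (\1_(`]l, r[%classic) t * k t) = \int[lam]_(t in `]l, r[) k t.
Proof.
move=> pl rq; rewrite /Rintegral; congr fine.
rewrite [LHS]integral_mkcond [RHS]integral_mkcond; apply: eq_integral => t _.
rewrite !patchE indicE; have [tlr|ntlr] := boolP (t \in `]l, r[%classic).
  rewrite mul1r mem_set //; move/set_mem: tlr; rewrite /= !in_itv /= => /andP[h1 h2].
  by rewrite (le_lt_trans pl h1) (lt_le_trans h2 rq).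
by rewrite mul0r; case: ifP.
Qed.

Lemma line_inner (c w kap : R) psi : 0 < w -> 0 <= kap <= 1 -> smooth psi ->
  \int[lam]_(t in `]c - w, c + w[) ((`|(t - c) / w| < kap)%R%:R * 'D_1 psi t) =
  psi (c + w * kap) - psi (c - w * kap).
Proof.
move=> w0 /andP[k0 k1] sp.
rewrite -Rintegral_derive //; last by rewrite lerD2l ge0_cp // mulr_ge0 // ltW.
rewrite -(@Rintegral_subitv _ (c - w) (c + w)) ?lerD2l ?lerN2 ?ler_piMr // ?ltW //.
apply: eq_Rintegral => t _; congr (_ * _); rewrite indicE; congr (_%:R); congr nat_of_bool.
rewrite normrM normfV (gtr0_norm w0) ltr_pdivrMr // mulrC ltr_distl.
by apply/idP/idP => [h|/set_mem]; [rewrite inE /= in_itv|rewrite /= in_itv].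
Qed.

(** Integration by parts: the boundary terms are at most 2 K, and the integral of [psi / w] over an
    interval of length at most 2 w is at most 2 K. *)
Lemma line_affine (c w l r K : R) psi : 0 < w -> l <= r -> c - w <= l -> r <= c + w ->
  smooth psi -> (forall t, `|psi t| <= K) ->
  `|\int[lam]_(t in `]l, r[) ((t - c) / w * 'D_1 psi t)| <= 4 * K.
Proof.
move=> w0 lr cl rc sp p1.
pose b t := (t - c) / w.
have sb : smooth b.
  apply: smoothM; last exact: smooth_cst.
  by apply: smoothB; [exact: smooth_id|exact: smooth_cst].
have db t : 'D_1 b t = w^-1.
  have := is_derive_mulr w^-1 (is_derive_sub (is_derive_id t (1 : R)) (is_derive_const c t (1 : R))).
  by rewrite subr0 mul1r => H; exact: (@derive_val _ _ _ _ _ _ _ H).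
have sbp : smooth (fun t => b t * psi t) by exact: smoothM.
have dbp t : 'D_1 (fun t => b t * psi t) t = b t * 'D_1 psi t + psi t * w^-1.
  have H := is_derive_mul (derivableP (smooth_derivable (x := t) (v := (1 : R)) sb))
    (derivableP (smooth_derivable (x := t) (v := (1 : R)) sp)).
  by rewrite (@derive_val _ _ _ _ _ _ _ H) db.
have -> : \int[lam]_(t in `]l, r[) ((t - c) / w * 'D_1 psi t) =
    \int[lam]_(t in `]l, r[) ('D_1 (fun t => b t * psi t) t - psi t * w^-1).
  by apply: eq_Rintegral => t _; rewrite dbp addrK.
have c1 : continuous ('D_1 (fun t => b t * psi t)) by apply: smooth_continuous; exact: smooth_derive.
have c2 : continuous (fun t => psi t * w^-1).
  by apply: smooth_continuous; apply: smoothM => //; exact: smooth_cst.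
rewrite RintegralB //; try exact: smooth_integrable.
rewrite Rintegral_derive //.
have bb t : l <= t <= r -> `|b t| <= 1.
  move=> /andP[lt tr]; rewrite /b normrM normfV (gtr0_norm w0) ler_pdivrMr // mul1r ler_norml.
  by apply/andP; split; lra.
have K0 : 0 <= K by apply: le_trans (p1 0); exact: normr_ge0.
have bl1 s' : l <= s' <= r -> `|b s' * psi s'| <= K.
  by move=> /bb h; rewrite normrM -[leRHS]mul1r; apply: ler_pM.
have b1 : `|b r * psi r| <= K by apply: bl1; rewrite lr lexx.
have b2 : `|b l * psi l| <= K by apply: bl1; rewrite lr lexx.
have : `|\int[lam]_(t in `]l, r[) (psi t * w^-1)| <= (K * w^-1) * fine (lam (setT `&` (`]l, r[%classic : set R))).
  apply: norm_Rintegral_le => //.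
  - exact: lam_itv_fin.
  - by apply: (@measurable_funS _ _ _ _ setT) => //; exact: continuous_measurable_fun.
  - by rewrite mulr_ge0 // invr_ge0 ltW.
  - by move=> t _; rewrite indicT mulr1 normrM normfV (gtr0_norm w0) ler_wpM2r // invr_ge0 ltW.
rewrite setTI lam_itv //= => h3.
have h4 : K * w^-1 * (r - l) <= K * 2.
  by rewrite -mulrA ler_wpM2l // mulrC ler_pdivrMr //; lra.
apply: (le_trans (ler_normB _ _)).
have := ler_normB (b r * psi r) (b l * psi l); lra.
Qed.

(** The indicator selects two intervals at the ends, each of which contributes [4 * K]. *)
Lemma line_outer (c w kap K : R) psi : 0 < w -> 0 <= kap <= 1 -> smooth psi ->
  (forall t, `|psi t| <= K) ->
  `|\int[lam]_(t in `]c - w, c + w[) ((t - c) / w * (kap < `|(t - c) / w|)%R%:R * 'D_1 psi t)| <= 8 * K.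
Proof.
move=> w0 /andP[k0 k1] sp p1.
have wk0 : 0 <= w * kap by rewrite mulr_ge0 // ltW.
have wk1 : w * kap <= w by rewrite ler_piMr // ltW.
pose k t := (t - c) / w * 'D_1 psi t.
have ck : continuous k.
  apply: smooth_continuous; apply: smoothM; last exact: smooth_derive.
  apply: smoothM; last exact: smooth_cst.
  by apply: smoothB; [exact: smooth_id|exact: smooth_cst].
have mk : measurable_fun setT k by exact: continuous_measurable_fun.
have [Ck Ck0 HC] := compact_bounded (@segment_compact R (c - w) (c + w)) ck.
have ik l r : lam.-integrable `]c - w, c + w[ (EFin \o (fun t => \1_(`]l, r[%classic) t * k t)).
  apply: (@bounded_integrable _ _ _ _ _ _ Ck) => //.
  - exact: lam_itv_fin.
  - apply: (@measurable_funS _ _ _ _ setT) => //; apply: measurable_funM => //.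
  - move=> t; rewrite /= in_itv /= => /andP[h1 h2]; rewrite normrM -[leRHS]mul1r.
    apply: ler_pM => //; first by rewrite indicE; case: (_ \in _); rewrite ?normr1 ?normr0.
    by apply: HC; rewrite /= in_itv /= !ltW.
have -> : \int[lam]_(t in `]c - w, c + w[) ((t - c) / w * (kap < `|(t - c) / w|)%R%:R * 'D_1 psi t) =
    \int[lam]_(t in `]c - w, c + w[) (\1_(`]c - w, c - w * kap[%classic) t * k t +
      \1_(`]c + w * kap, c + w[%classic) t * k t).
  apply: eq_Rintegral => t; rewrite inE /= in_itv /= => /andP[h1 h2].
  rewrite -mulrDl.
  suff -> : \1_(`]c - w, c - w * kap[%classic) t + \1_(`]c + w * kap, c + w[%classic) t =
      (kap < `|(t - c) / w|)%R%:R :> R by rewrite /k; set q := 'D_1 psi t; ring.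
  rewrite normrM normfV (gtr0_norm w0) ltr_pdivlMr // (mulrC kap) !indicE.
  have m p q : (t \in `]p, q[%classic) = (p < t < q).
    by apply/idP/idP => [/set_mem|h]; rewrite ?inE /= in_itv.
  rewrite !m h1 h2 andbT /=; have [tc|tc] := leP c t.
    rewrite ger0_norm ?subr_ge0 //.
    have -> : (t < c - w * kap) = false by apply/negbTE; rewrite -leNgt; lra.
    have -> : (w * kap < t - c) = (c + w * kap < t) by apply/idP/idP; lra.
    by rewrite add0r.
  rewrite ltr0_norm ?subr_lt0 //.
  have -> : (c + w * kap < t) = false by apply/negbTE; rewrite -leNgt; lra.
  have -> : (w * kap < - (t - c)) = (t < c - w * kap) by apply/idP/idP; lra.
  by rewrite addr0.
rewrite RintegralD //.
rewrite !Rintegral_subitv //; try by lra.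
apply: (le_trans (ler_normD _ _)).
have -> : 8 * K = 4 * K + 4 * K by ring.
by apply: lerD; apply: line_affine => //; lra.
Qed.

Lemma affine_subst (K : R -> R) c w : 0 < w -> continuous K ->
  \int[lam]_(t in `]c - w, c + w[) K t = w * \int[lam]_(t in `]-1, 1[) K (c + w * t).
Proof.
move=> w0 cK; pose F t := c + w * t.
have dF (t : R) : is_derive t (1 : R) F w.
  have := is_derive_add (is_derive_const c t (1 : R)) (is_derive_mul (is_derive_const w t (1 : R)) (is_derive_id t (1 : R))).
  by rewrite add0r mulr1 mulr0 addr0.
have F' : derive1 F = cst w by apply/funext => t; rewrite derive1E (@derive_val _ _ _ _ _ _ _ (dF t)).
have cF : continuous F.
  by move=> t; apply: differentiable_continuous; apply/derivable1_diffP; exact: (@ex_derive _ _ _ _ _ _ _ (dF t)).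
have cKF : continuous (fun t => K (F t)) by move=> t; apply: continuous_comp; [exact: cF|exact: cK].
have := @integration_by_substitution_increasing R F K (-1) 1.
rewrite F' => /(_ _ _ _ (is_cvg_cst _) (is_cvg_cst _)) H.
have {}H : (\int[lam]_(x in `[F (-1)%R, F 1%R]) (K x)%:E = \int[lam]_(x in `[(-1)%R, 1%R]) (((K \o F) * cst w) x)%:E)%E.
  apply: H.
  - lra.
  - by move=> x y _ _ xy; rewrite /F ltrD2l ltr_pM2l.
  - by move=> x _; exact: cvg_cst.
  - split; [by move=> x _; exact: (@ex_derive _ _ _ _ _ _ _ (dF x))| |].
      by apply: cvg_at_right_filter; exact: cF.
    by apply: cvg_at_left_filter; exact: cF.
  - exact: continuous_subspaceT.
have e1 : F (-1) = c - w by rewrite /F mulrN1.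
have e2 : F 1 = c + w by rewrite /F mulr1.
have m1 p q (f : R -> R) : continuous f ->
    (\int[lam]_(x in `[p, q]) (f x)%:E = \int[lam]_(x in `]p, q[) (f x)%:E)%E.
  move=> cf; apply: (@integral_itv_bndoo R p q (fun t => (f t)%:E) true false).
  apply/measurable_EFinP; apply: (@measurable_funS _ _ _ _ setT) => //.
  exact: continuous_measurable_fun.
rewrite e1 e2 m1 // (m1 _ _ (fun x => K (F x) * w)) in H; last first.
  by move=> x; apply: cvgM; [exact: cKF|exact: cvg_cst].
rewrite -RintegralZl //; last exact: smooth_integrable.
by rewrite /Rintegral H; congr fine; apply: eq_integral => x _; rewrite mulrC.
Qed.

Lemma Rintegral_odd (h : R -> R) : continuous h -> (forall t, h (- t) = - h t) ->
  \int[lam]_(t in `]-1, 1[) h t = 0.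
Proof.
move=> ch oh.
have m1 (f : R -> R) : continuous f ->
    (\int[lam]_(x in `[(-1)%R, 1%R]) (f x)%:E = \int[lam]_(x in `](-1)%R, 1%R[) (f x)%:E)%E.
  move=> cf; apply: (@integral_itv_bndoo R (-1) 1 (fun t => (f t)%:E) true false).
  apply/measurable_EFinP; apply: (@measurable_funS _ _ _ _ setT) => //.
  exact: continuous_measurable_fun.
have := @integration_by_substitution_oppr R h (-1) 1.
rewrite opprK => H.
have {}H : (\int[lam]_(x in `[(-1)%R, 1%R]) (h x)%:E = \int[lam]_(x in `[(-1)%R, 1%R]) (h (- x))%:E)%E.
  by apply: H; [lra|exact: continuous_subspaceT].
have e : \int[lam]_(t in `]-1, 1[) h t = - \int[lam]_(t in `]-1, 1[) h t.
  rewrite -[RHS]mulN1r -RintegralZl //; last exact: smooth_integrable.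
  rewrite {1}/Rintegral -m1 // H; congr fine.
  rewrite (m1 (fun x => h (- x))).
    by apply: eq_integral => x _; rewrite oh mulN1r.
  move=> x; apply: (cvg_comp (fun x => - x) h (G := nbhs (- x))); last exact: ch.
  by apply: cvgN; exact: cvg_id.
by lra.
Qed.

End lines.

Lemma continuous_comp2 (R : realType) (phi : R * R -> R) (f g : R -> R) : continuous phi ->
  continuous f -> continuous g -> continuous (fun t => phi (f t, g t)).
Proof.
move=> cphi cf cg t A /(cphi (f t, g t))[[U W] /= [nU nW] sub].
have h1 : \forall r \near t, U (f r) by exact: cf t _ nU.
have h2 : \forall r \near t, W (g r) by exact: cg t _ nW.
have : \forall r \near t, A (phi (f r, g r)); last by [].
near=> r; apply: (sub (f r, g r)); split => /=; near: r; [exact: h1|exact: h2].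
Unshelve. all: by end_near. Qed.

Section box_field.
Context {R : realType}.
Local Notation RR := (measurableTypeR R * measurableTypeR R)%type.
Variables (P : @rect R) (om : R).
Hypothesis wx0 : 0 < rwx P.
Hypothesis wy0 : 0 < rwy P.
Hypothesis om0 : 0 <= om.

Let a t := (t - rcx P) / rwx P.
Let b t := (t - rcy P) / rwy P.

Let I : set R := `](rcx P - rwx P), (rcx P + rwx P)[%classic.
Let J : set R := `](rcy P - rwy P), (rcy P + rwy P)[%classic.

Lemma inside_itv : inside P = I `*` J.
Proof.
by apply/seteqP; split => -[x y]; rewrite /inside /I /J /= !in_itv /= !ltr_distl => -[].
Qed.

Lemma norm_a t : I t -> `|a t| < 1.
Proof.
rewrite /I /= in_itv /= -ltr_distl => h.
by rewrite /a normrM normfV (gtr0_norm wx0) ltr_pdivrMr // mul1r.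
Qed.

Lemma norm_b t : J t -> `|b t| < 1.
Proof.
rewrite /J /= in_itv /= -ltr_distl => h.
by rewrite /b normrM normfV (gtr0_norm wy0) ltr_pdivrMr // mul1r.
Qed.

Lemma box_field_in x : inside P x -> box_field P om x =
  (om * rwx P * (- b x.2 * (`|a x.1| < `|b x.2|)%R%:R),
   om * rwy P * (a x.1 * (`|b x.2| < `|a x.1|)%R%:R)).
Proof. by move=> Px; rewrite /box_field asboolT. Qed.

Lemma box_field_out x : ~ inside P x -> box_field P om x = (0, 0).
Proof. by move=> Px; rewrite /box_field asboolF. Qed.

Lemma measurable_norm_lt (f g : R * R -> R) : measurable_fun (setT : set RR) f ->
  measurable_fun (setT : set RR) g ->
  measurable_fun (setT : set RR) (fun x => (`|f x| < `|g x|)%R%:R : R).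
Proof.
move=> mf mg.
have mh : measurable_fun (setT : set RR) (fun x => `|g x| - `|f x|).
  by apply: measurable_funB; apply: measurableT_comp.
have mS : measurable ([set x | `|f x| < `|g x|] : set RR).
  rewrite (_ : [set x | _] = setT `&` (fun x => `|g x| - `|f x|) @^-1` `]0, +oo[%classic).
    by apply: mh => //; exact: measurable_itv.
  by apply/seteqP; split => x; rewrite /= in_itv /= andbT subr_gt0; [|case].
rewrite (_ : (fun x => _) = \1_[set x | `|f x| < `|g x|]); first exact: measurable_indic.
apply/funext => x; rewrite indicE; congr (_%:R); congr nat_of_bool.
by apply/idP/idP => [h|/set_mem //]; rewrite inE.
Qed.

Lemma measurable_box_field : measurable_fun (setT : set RR) (fun x => (box_field P om x).1) /\
  measurable_fun (setT : set RR) (fun x => (box_field P om x).2).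
Proof.
have mi : measurable_fun (setT : set RR) (\1_(inside P) : RR -> R).
  by apply: measurable_indic; exact: measurable_inside.
have E x : box_field P om x = (\1_(inside P) x * (om * rwx P * (- co P 1 x * (`|co P 0 x| < `|co P 1 x|)%R%:R)),
   \1_(inside P) x * (om * rwy P * (co P 0 x * (`|co P 1 x| < `|co P 0 x|)%R%:R))).
  rewrite indicE; have [Px|nPx] := pselect (inside P x).
    by rewrite mem_set // !mul1r /box_field asboolT.
  by rewrite memNset // !mul0r box_field_out.
have m0 := @measurable_co _ P 0; have m1 := @measurable_co _ P 1.
under eq_fun do rewrite E.
under [X in _ /\ measurable_fun _ X]eq_fun do rewrite E.
split => /=; apply: measurable_funM => //; apply: measurable_funM => //; apply: measurable_funM => //.
- by apply: measurableT_comp.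
- exact: measurable_norm_lt.
- exact: measurable_norm_lt.
Qed.

Lemma box_field_bound x : `|(box_field P om x).1| <= om * rwx P /\ `|(box_field P om x).2| <= om * rwy P.
Proof.
have h1 : 0 <= om * rwx P by rewrite mulr_ge0 // ltW.
have h2 : 0 <= om * rwy P by rewrite mulr_ge0 // ltW.
have [Px|nPx] := pselect (inside P x); last by rewrite box_field_out // !normr0.
have [c0 c1] := (co_inside 0 x wx0 wy0).1 Px.
rewrite /box_field asboolT //=; move: (co P 0 x) (co P 1 x) c0 c1 => A B c0 c1.
have W (c d : R) (e : bool) : 0 <= c -> `|d| < 1 -> `|c * (d * e%:R)| <= c.
  move=> hc hd; rewrite normrM (ger0_norm hc) ler_piMr // normrM -[leRHS]mulr1.
  by apply: ler_pM => //; [exact: ltW|case: e; rewrite ?normr1 ?normr0].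
by split; apply: W => //; rewrite normrN.
Qed.

Section test.
Variable phi : R * R -> R.
Hypothesis sphi : smooth phi.

Let sx y : smooth (fun x => phi (x, y)). Proof. exact: smooth_slice. Qed.
Let sy x : smooth (fun y => phi (x, y)). Proof. exact: smooth_slice_snd. Qed.

Let smoothZ (k : R) (psi : R -> R) : smooth psi -> smooth (fun t => k * psi t).
Proof. by move=> sp; apply: smoothM => //; exact: smooth_cst. Qed.

Let deriveZ (k : R) (psi : R -> R) t : smooth psi -> 'D_1 (fun t => k * psi t) t = k * 'D_1 psi t.
Proof.
move=> sp; have H := is_derive_mul (is_derive_const k t (1 : R))
  (derivableP (smooth_derivable (x := t) (v := (1 : R)) sp)).
by rewrite (@derive_val _ _ _ _ _ _ _ H) mulr0 addr0.
Qed.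

Let ID x y : I x -> J y -> inside P (x, y).
Proof. by move=> Ix Jy; rewrite inside_itv. Qed.

(** On a horizontal line the first component is a constant on the interval between the diagonals and
    0 beyond it, so only values of [phi] on the diagonals remain and the sides contribute
    nothing. *)
Lemma line11 y : J y ->
  \int[lam]_(x in I) ((box_field P om (x, y)).1 * 'D_(1, 0) phi (x, y)) =
  - (om * rwx P * b y) * (phi (rcx P + rwx P * `|b y|, y) - phi (rcx P - rwx P * `|b y|, y)).
Proof.
move=> Jy; have b01 : 0 <= `|b y| <= 1 by rewrite normr_ge0 (ltW (norm_b Jy)).
pose k := - (om * rwx P * b y).
have := @line_inner _ (rcx P) (rwx P) `|b y| (fun x => k * phi (x, y)) wx0 b01 (smoothZ k (sx y)).
rewrite mulrBr => <-.
apply: eq_Rintegral => x; rewrite inE => Ix; rewrite (box_field_in (ID Ix Jy)) /=.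
rewrite (deriveZ _ _ (sx y)) (slice_fst phi 1 x y).2 /k; set D := 'D_(1, 0) phi _.
by rewrite -/(a x); ring.
Qed.

Lemma line22 x : I x ->
  \int[lam]_(y in J) ((box_field P om (x, y)).2 * 'D_(0, 1) phi (x, y)) =
  (om * rwy P * a x) * (phi (x, rcy P + rwy P * `|a x|) - phi (x, rcy P - rwy P * `|a x|)).
Proof.
move=> Ix; have a01 : 0 <= `|a x| <= 1 by rewrite normr_ge0 (ltW (norm_a Ix)).
pose k := om * rwy P * a x.
have := @line_inner _ (rcy P) (rwy P) `|a x| (fun y => k * phi (x, y)) wy0 a01 (smoothZ k (sy x)).
rewrite mulrBr => <-.
apply: eq_Rintegral => y; rewrite inE => Jy; rewrite (box_field_in (ID Ix Jy)) /=.
rewrite (deriveZ _ _ (sy x)) (slice_snd phi x y 1).2 /k; set D := 'D_(0, 1) phi _.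
by rewrite -/(b y); ring.
Qed.

Lemma line12 x : I x -> (forall z, `|phi z| <= 1) ->
  `|\int[lam]_(y in J) ((box_field P om (x, y)).1 * 'D_(0, 1) phi (x, y))| <= 8 * (om * rwx P).
Proof.
move=> Ix p1; have a01 : 0 <= `|a x| <= 1 by rewrite normr_ge0 (ltW (norm_a Ix)).
pose k := - (om * rwx P).
have kN : `|k| = om * rwx P by rewrite normrN ger0_norm // mulr_ge0 // ltW.
have k1 y : `|k * phi (x, y)| <= om * rwx P.
  by rewrite normrM kN ler_piMr // mulr_ge0 // ltW.
have h := @line_outer _ (rcy P) (rwy P) `|a x| _ (fun y => k * phi (x, y)) wy0 a01 (smoothZ k (sy x)) k1.
rewrite (_ : \int[lam]_(y in J) _ = \int[lam]_(y in J)
  (b y * (`|a x| < `|b y|)%R%:R * 'D_1 (fun y => k * phi (x, y)) y)); first exact: h.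
apply: eq_Rintegral => y; rewrite inE => Jy; rewrite (box_field_in (ID Ix Jy)) /=.
rewrite (deriveZ _ _ (sy x)) (slice_snd phi x y 1).2 /k; set D := 'D_(0, 1) phi _.
by rewrite -/(b y); ring.
Qed.

Lemma line21 y : J y -> (forall z, `|phi z| <= 1) ->
  `|\int[lam]_(x in I) ((box_field P om (x, y)).2 * 'D_(1, 0) phi (x, y))| <= 8 * (om * rwy P).
Proof.
move=> Jy p1; have b01 : 0 <= `|b y| <= 1 by rewrite normr_ge0 (ltW (norm_b Jy)).
pose k := om * rwy P.
have kN : `|k| = om * rwy P by rewrite ger0_norm // mulr_ge0 // ltW.
have k1 x : `|k * phi (x, y)| <= om * rwy P.
  by rewrite normrM kN ler_piMr // mulr_ge0 // ltW.
have h := @line_outer _ (rcx P) (rwx P) `|b y| _ (fun x => k * phi (x, y)) wx0 b01 (smoothZ k (sx y)) k1.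
rewrite (_ : \int[lam]_(x in I) _ = \int[lam]_(x in I)
  (a x * (`|b y| < `|a x|)%R%:R * 'D_1 (fun x => k * phi (x, y)) x)); first exact: h.
apply: eq_Rintegral => x; rewrite inE => Ix; rewrite (box_field_in (ID Ix Jy)) /=.
rewrite (deriveZ _ _ (sx y)) (slice_fst phi 1 x y).2 /k; set D := 'D_(1, 0) phi _.
by rewrite -/(a x); ring.
Qed.

Lemma derive_bounded (w : R * R) : exists2 C, 0 <= C & forall x, inside P x -> `|'D_w phi x| <= C.
Proof.
pose K : set (R * R) := `[rcx P - rwx P, rcx P + rwx P] `*` `[rcy P - rwy P, rcy P + rwy P].
have cK : compact K by apply: compact_setX; exact: segment_compact.
have [C C0 HC] := compact_bounded cK (smooth_continuous (smooth_derive w sphi)).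
exists C => // x; rewrite inside_itv => -[]; rewrite /I /J /= !in_itv /= => /andP[h1 h2] /andP[h3 h4].
by apply: HC; rewrite /K /= !in_itv /= !(ltW h1) !(ltW h2) !(ltW h3) !(ltW h4).
Qed.

Lemma measurable_derive (w : R * R) : measurable_fun (setT : set RR) ('D_w phi).
Proof. by apply: continuous_measurable2; apply: smooth_continuous; exact: smooth_derive. Qed.

Let mI : measurable I. Proof. exact: measurable_itv. Qed.
Let mJ : measurable J. Proof. exact: measurable_itv. Qed.
Let Ifin : (lam I < +oo)%E. Proof. exact: lam_itv_fin. Qed.
Let Jfin : (lam J < +oo)%E. Proof. exact: lam_itv_fin. Qed.

Let mf1 w : measurable_fun (setT : set RR) (fun x => (box_field P om x).1 * 'D_w phi x).
Proof. by apply: measurable_funM; [exact: measurable_box_field.1|exact: measurable_derive]. Qed.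

Let mf2 w : measurable_fun (setT : set RR) (fun x => (box_field P om x).2 * 'D_w phi x).
Proof. by apply: measurable_funM; [exact: measurable_box_field.2|exact: measurable_derive]. Qed.

Let bf w : exists C, forall x, (I `*` J) x ->
  `|(box_field P om x).1 * 'D_w phi x| <= C /\ `|(box_field P om x).2 * 'D_w phi x| <= C.
Proof.
have [C C0 HC] := derive_bounded w.
exists (om * (rwx P + rwy P) * C) => x; rewrite -inside_itv => Px.
have [h1 h2] := box_field_bound x.
have h3 : om * rwx P <= om * (rwx P + rwy P) by rewrite ler_wpM2l // lerDl ltW.
have h4 : om * rwy P <= om * (rwx P + rwy P) by rewrite ler_wpM2l // lerDr ltW.
by split; rewrite normrM; apply: ler_pM => //; [exact: le_trans h3|exact: HC|exact: le_trans h4|exact: HC].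
Qed.

Lemma box_field_integrable : lam2.-integrable (inside P)
    (EFin \o (fun x => (box_field P om x).1 * 'D_(1, 0) phi x)) /\
  lam2.-integrable (inside P) (EFin \o (fun x => (box_field P om x).2 * 'D_(0, 1) phi x)).
Proof.
have fin : (lam2 (inside P) < +oo)%E.
  rewrite inside_itv /lam2 product_measure1E //.
  have h1 : lam I \is a fin_num by rewrite ge0_fin_numE.
  have h2 : lam J \is a fin_num by rewrite ge0_fin_numE.
  have := fin_numM h1 h2; rewrite ge0_fin_numE //; exact: mule_ge0.
have mP := @measurable_inside _ P.
have [C1 H1] := bf (1, 0); have [C2 H2] := bf (0, 1).
split.
  apply: (@bounded_integrable _ _ _ _ _ _ C1) => //; first exact: measurable_funS (mf1 _).
  by move=> x; rewrite inside_itv => /H1[].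
apply: (@bounded_integrable _ _ _ _ _ _ C2) => //; first exact: measurable_funS (mf2 _).
by move=> x; rewrite inside_itv => /H2[].
Qed.

(** Both components leave integrals of [phi] along the diagonals. Scaled to a parameter t in ]-1,
    1[, the terms on one diagonal cancel pointwise and those on the other form an odd function of
    t. *)
Lemma box_field_flux : \int[lam2]_(x in inside P)
  ((box_field P om x).1 * 'D_(1, 0) phi x + (box_field P om x).2 * 'D_(0, 1) phi x) = 0.
Proof.
have [i1 i2] := box_field_integrable.
have mP := @measurable_inside _ P.
rewrite (@RintegralD _ _ _ lam2 _ _ _ mP i1 i2).
have [C1 H1] := bf (1, 0); have [C2 H2] := bf (0, 1).
rewrite inside_itv (Rintegral_rect21 mI mJ Ifin Jfin (mf1 _) (fun x h => (H1 x h).1)).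
rewrite (Rintegral_rect12 mI mJ Ifin Jfin (mf2 _) (fun x h => (H2 x h).2)).
pose K1 y := - (om * rwx P * b y) * (phi (rcx P + rwx P * `|b y|, y) - phi (rcx P - rwx P * `|b y|, y)).
pose K2 x := (om * rwy P * a x) * (phi (x, rcy P + rwy P * `|a x|) - phi (x, rcy P - rwy P * `|a x|)).
have -> : \int[lam]_(y in J) \int[lam]_(x in I) ((box_field P om (x, y)).1 * 'D_(1, 0) phi (x, y)) =
   \int[lam]_(y in J) K1 y.
  by apply: eq_Rintegral => y; rewrite inE => Jy; rewrite line11.
have -> : \int[lam]_(x in I) \int[lam]_(y in J) ((box_field P om (x, y)).2 * 'D_(0, 1) phi (x, y)) =
   \int[lam]_(x in I) K2 x.
  by apply: eq_Rintegral => x; rewrite inE => Ix; rewrite line22.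
have cphi := smooth_continuous sphi.
have c2 (f g : R -> R) : continuous f -> continuous g -> continuous (fun t => phi (f t, g t)).
  by move=> cf cg; exact: continuous_comp2.
have cid : continuous (fun t : R => t) by move=> t; exact: cvg_id.
have ca : continuous a by move=> t; apply: cvgM; [apply: cvgB; [exact: cvg_id|exact: cvg_cst]|exact: cvg_cst].
have cb : continuous b by move=> t; apply: cvgM; [apply: cvgB; [exact: cvg_id|exact: cvg_cst]|exact: cvg_cst].
have cN (f : R -> R) (c w : R) : continuous f -> continuous (fun t => c + w * `|f t|).
  move=> cf t; apply: cvgD; first exact: cvg_cst.
  by apply: cvgM; [exact: cvg_cst|apply: cvg_norm; exact: cf].
have cNB (f : R -> R) (c w : R) : continuous f -> continuous (fun t => c - w * `|f t|).
  move=> cf t; apply: cvgB; first exact: cvg_cst.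
  by apply: cvgM; [exact: cvg_cst|apply: cvg_norm; exact: cf].
have cK1 : continuous K1.
  move=> t; apply: cvgM; first by apply: cvgN; apply: cvgM; [exact: cvg_cst|exact: cb].
  by apply: cvgB; [exact: (c2 _ _ (cN _ _ _ cb) cid)|exact: (c2 _ _ (cNB _ _ _ cb) cid)].
have cK2 : continuous K2.
  move=> t; apply: cvgM; first by apply: cvgM; [exact: cvg_cst|exact: ca].
  by apply: cvgB; [exact: (c2 _ _ cid (cN _ _ _ ca))|exact: (c2 _ _ cid (cNB _ _ _ ca))].
rewrite /J /I (affine_subst _ wy0 cK1) (affine_subst _ wx0 cK2).
have caff (c w : R) (f : R -> R) : continuous f -> continuous (fun t => f (c + w * t)).
  move=> cf t; apply: (cvg_comp (fun t => c + w * t) f (G := nbhs (c + w * t))); last exact: cf.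
  apply: cvgD; first exact: cvg_cst.
  by apply: cvgM; [exact: cvg_cst|exact: cvg_id].
rewrite -!RintegralZl //; try by apply: smooth_integrable; exact: caff.
rewrite -RintegralD //; last 2 first.
- by apply: smooth_integrable => t; apply: cvgM; [exact: cvg_cst|exact: caff].
- by apply: smooth_integrable => t; apply: cvgM; [exact: cvg_cst|exact: caff].
apply: Rintegral_odd.
  by move=> t; apply: cvgD; apply: cvgM; try exact: cvg_cst; exact: caff.
move=> t; rewrite /K1 /K2.
have bE s : b (rcy P + rwy P * s) = s by rewrite /b; field; rewrite gt_eqF.
have aE s : a (rcx P + rwx P * s) = s by rewrite /a; field; rewrite gt_eqF.
rewrite !bE !aE normrN.
pose G s r := phi (rcx P + rwx P * s, rcy P + rwy P * r).
have E1 s r : phi (rcx P - rwx P * s, rcy P + rwy P * r) = G (- s) r by rewrite /G mulrN.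
have E2 s r : phi (rcx P + rwx P * s, rcy P - rwy P * r) = G s (- r) by rewrite /G mulrN.
have E3 s r : phi (rcx P + rwx P * s, rcy P + rwy P * r) = G s r by [].
rewrite !E1 !E2 !E3.
by have [t0|t0] := leP 0 t; [rewrite ger0_norm // | rewrite ltr0_norm // opprK]; ring.
Qed.

(** The entries of the distributional gradient. Each integral is taken first along the axis of the
    derivative, where the one-dimensional estimates bound it, and then over the length of the other
    side. *)
Lemma box_field_variation : (forall z, `|phi z| <= 1) ->
  [/\ `|\int[lam2]_(x in inside P) ((box_field P om x).1 * 'D_(1, 0) phi x)| <= 8 * (om * rwx P) * (2 * rwy P),
      `|\int[lam2]_(x in inside P) ((box_field P om x).1 * 'D_(0, 1) phi x)| <= 8 * (om * rwx P) * (2 * rwx P),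
      `|\int[lam2]_(x in inside P) ((box_field P om x).2 * 'D_(1, 0) phi x)| <= 8 * (om * rwy P) * (2 * rwy P) &
      `|\int[lam2]_(x in inside P) ((box_field P om x).2 * 'D_(0, 1) phi x)| <= 8 * (om * rwy P) * (2 * rwx P)].
Proof.
move=> p1; rewrite inside_itv.
have [C1 H1] := bf (1, 0); have [C2 H2] := bf (0, 1).
have lI : fine (lam I) = 2 * rwx P.
  by rewrite /I lam_itv /=; [ring|move: wx0; lra].
have lJ : fine (lam J) = 2 * rwy P.
  by rewrite /J lam_itv /=; [ring|move: wy0; lra].
have ox : 0 <= om * rwx P by rewrite mulr_ge0 // ltW.
have oy : 0 <= om * rwy P by rewrite mulr_ge0 // ltW.
have d1 z z' : `|phi z - phi z'| <= 8.
  by apply: (le_trans (ler_normB _ _)); have := p1 z; have := p1 z'; lra.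
rewrite -lI -lJ; split.
- apply: (norm_Rintegral_rect21 mI mJ Ifin Jfin (mf1 _) (fun x h => (H1 x h).1)).
    by rewrite mulr_ge0.
  move=> y Jy; rewrite line11 // normrM normrN mulrC; apply: ler_pM => //.
  rewrite normrM ger0_norm // ler_piMr //; exact: ltW (norm_b Jy).
- apply: (norm_Rintegral_rect12 mI mJ Ifin Jfin (mf1 _) (fun x h => (H2 x h).1)).
    by rewrite mulr_ge0.
  by move=> x Ix; exact: line12.
- apply: (norm_Rintegral_rect21 mI mJ Ifin Jfin (mf2 _) (fun x h => (H1 x h).2)).
    by rewrite mulr_ge0.
  by move=> y Jy; exact: line21.
- apply: (norm_Rintegral_rect12 mI mJ Ifin Jfin (mf2 _) (fun x h => (H2 x h).2)).
    by rewrite mulr_ge0.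
  move=> x Ix; rewrite line22 // normrM mulrC; apply: ler_pM => //.
  rewrite normrM ger0_norm // ler_piMr //; exact: ltW (norm_a Ix).
Qed.

End test.
End box_field.

(** * The Gagliardo seminorm of the rectangle field *)

Section exhaust.
Context d (T : measurableType d) (R : realType) (mu : {measure set T -> \bar R}).
Local Open Scope ereal_scope.

(** Monotone convergence along the increasing sets [F n]; this is how integrals of singular powers
    are obtained from the fundamental theorem away from the singularity. *)
Lemma integral_exhaust (F : nat -> set T) (S : set T) (f : T -> \bar R) (K : \bar R) :
  (forall n, measurable (F n)) -> {homo F : n m / (n <= m)%N >-> n `<=` m} ->
  measurable S -> S `<=` \bigcup_n F n ->
  (forall n, measurable_fun (F n) f) -> (forall x, 0 <= f x) ->
  (forall n, \int[mu]_(x in F n) f x <= K) -> \int[mu]_(x in S) f x <= K.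
Proof.
move=> mF hF mS SF mf f0 fK.
have mU : measurable (\bigcup_n F n) by exact: bigcupT_measurable.
have mfU : measurable_fun (\bigcup_n F n) f by apply/measurable_fun_bigcup.
apply: (@le_trans _ _ (\int[mu]_(x in \bigcup_n F n) f x)).
  by apply: ge0_subset_integral.
have ndF : {homo F : n m / (n <= m)%N >-> (n <= m)%O} by move=> n m nm; apply/subsetPset/hF.
have cv := @ge0_nondecreasing_set_cvg_integral _ _ _ F f mu ndF mF mf (fun n x _ => f0 x).
rewrite -(cvg_lim _ cv) //; apply: lime_le.
  by apply/cvg_ex; eexists; exact: cv.
by apply: nearW => n; exact: fK.
Qed.

Lemma integral_cover (A B S : set T) (f : T -> \bar R) :
  measurable A -> measurable B -> measurable S -> S `<=` A `|` B ->
  measurable_fun setT f -> (forall x, 0 <= f x) ->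
  \int[mu]_(x in S) f x <= \int[mu]_(x in A) f x + \int[mu]_(x in B) f x.
Proof.
move=> mA mB mS SAB mf f0.
have mBA : measurable (B `\` A) by exact: measurableD.
have mU : measurable (A `|` B) by exact: measurableU.
apply: (@le_trans _ _ (\int[mu]_(x in A `|` B) f x)).
  by apply: ge0_subset_integral => //; exact: measurable_funS mf.
have -> : A `|` B = A `|` (B `\` A) by rewrite setUDr setDv setD0 // setUC.
rewrite ge0_integral_setU //; last 2 first.
- by apply: (@measurable_funS _ _ _ _ setT).
- by apply/disj_setPS => x [Ax []].
rewrite leeD2l //; apply: ge0_subset_integral => //.
by apply: (@measurable_funS _ _ _ _ setT).
Qed.

End exhaust.

Section power_integrals.
Context {R : realType}.

Let mitv (i : interval R) : measurable ([set` i] : set R).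
Proof. exact: measurable_itv. Qed.

(** The sign [s], with [s * s = 1], treats the two sides of the singularity [c] at once. *)
Lemma is_derive_powR (s c kap x : R) : s * s = 1 -> kap != 1 -> 0 < s * (x - c) ->
  is_derive x (1 : R) (fun t => s * (s * (t - c)) `^ (1 - kap) / (1 - kap)) ((s * (x - c)) `^ (- kap)).
Proof.
move=> ss k1 x0.
have H1 : is_derive x (1 : R) (fun t => s * (t - c)) s.
  have := is_derive_mul (is_derive_const s x (1 : R))
    (is_derive_sub (is_derive_id x (1 : R)) (is_derive_const c x (1 : R))).
  by rewrite subr0 mulr1 mulr0 addr0.
have H2 := is_derive_outer (f := fun t => s * (t - c)) (is_derive1_powR (1 - kap) x0) H1.
have H3 := is_derive_mulr (1 - kap)^-1 (is_derive_mul (is_derive_const s x (1 : R)) H2).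
rewrite (_ : (s * (x - c)) `^ (- kap) = (s * ((1 - kap) * (s * (x - c)) `^ (1 - kap - 1) * s) +
  (s * (x - c)) `^ (1 - kap) * 0) * (1 - kap)^-1) //.
have -> : 1 - kap - 1 = - kap by ring.
rewrite mulr0 addr0.
have -> : s * ((1 - kap) * (s * (x - c)) `^ (- kap) * s) = (s * s) * (1 - kap) * (s * (x - c)) `^ (- kap) by ring.
by rewrite ss mul1r mulrAC divff ?mul1r // subr_eq0 eq_sym.
Qed.

Lemma measurable_pow (c kap : R) : measurable_fun setT (fun t : R => `|t - c| `^ kap).
Proof.
apply: (measurableT_comp (measurable_powR kap)); apply: measurableT_comp => //.
exact: measurable_funB.
Qed.

Lemma pow_FTC (s c kap p q : R) : s * s = 1 -> kap != 1 -> p <= q ->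
  (forall t, p <= t <= q -> 0 < s * (t - c)) ->
  (\int[lam]_(t in `[p, q]) (`|t - c| `^ (- kap))%:E =
   (s * (s * (q - c)) `^ (1 - kap) / (1 - kap) - s * (s * (p - c)) `^ (1 - kap) / (1 - kap))%:E)%E.
Proof.
move=> ss k1 pq pos.
have [->|pq'] := eqVneq p q; first by rewrite set_itv1 integral_set1 subrr.
have {pq'}pq' : p < q by rewrite lt_neqAle pq'.
have absE t : p <= t <= q -> `|t - c| = s * (t - c).
  move=> /pos h; have s1 : `|s| = 1.
    by apply/eqP; rewrite -sqrp_eq1 // -normrX expr2 ss normr1.
  by rewrite -[LHS]mul1r -s1 -normrM gtr0_norm.
pose F t := s * (s * (t - c)) `^ (1 - kap) / (1 - kap).
have dF t : p <= t <= q -> is_derive t (1 : R) F ((s * (t - c)) `^ (- kap)).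
  by move=> /pos h; exact: is_derive_powR.
have cF t : p <= t <= q -> {for t, continuous F}.
  move=> h; apply: differentiable_continuous; apply/derivable1_diffP.
  exact: (@ex_derive _ _ _ _ _ _ _ (dF t h)).
transitivity (\int[lam]_(t in `[p, q]) ((s * (t - c)) `^ (- kap))%:E)%E.
  by apply: eq_integral => t; rewrite inE /= in_itv /= => h; rewrite absE.
rewrite (@continuous_FTC2 _ (fun t => (s * (t - c)) `^ (- kap)) F p q pq') ?EFinB //.
- have cg t : p <= t <= q -> {for t, continuous (fun t => (s * (t - c)) `^ (- kap))}.
    move=> h; apply: differentiable_continuous; apply/derivable1_diffP.
    have H1 : is_derive t (1 : R) (fun t => s * (t - c)) s.
      have := is_derive_mul (is_derive_const s t (1 : R))
        (is_derive_sub (is_derive_id t (1 : R)) (is_derive_const c t (1 : R))).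
      by rewrite subr0 mulr1 mulr0 addr0.
    have H2 := is_derive_outer (f := fun t => s * (t - c)) (is_derive1_powR (- kap) (pos _ h)) H1.
    exact: (@ex_derive _ _ _ _ _ _ _ H2).
  apply: continuous_in_subspaceT => t; rewrite inE /= in_itv /= => h; exact: cg.
- split.
  + move=> t; rewrite in_itv /= => /andP[h1 h2].
    have h : p <= t <= q by rewrite !ltW.
    exact: (@ex_derive _ _ _ _ _ _ _ (dF t h)).
  + by apply: cvg_at_right_filter; apply: cF; rewrite lexx.
  + by apply: cvg_at_left_filter; apply: cF; rewrite lexx andbT.
- move=> t; rewrite in_itv /= => /andP[h1 h2].
  have h : p <= t <= q by rewrite !ltW.
  by rewrite derive1E (@derive_val _ _ _ _ _ _ _ (dF t h)).
Qed.

Lemma measurable_pow_EFin (c kap : R) (D : set R) :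
  measurable_fun D (fun t : R => (`|t - c| `^ kap)%:E).
Proof.
by apply/measurable_EFinP; apply: (@measurable_funS _ _ _ _ setT) => //; exact: measurable_pow.
Qed.

Lemma pow_integral_right (c r kap : R) : 0 < r -> kap < 1 ->
  (\int[lam]_(t in `]c, (c + r)%R[) (`|t - c|%R `^ (- kap))%:E <=
   (r `^ (1 - kap) / (1 - kap))%:E)%E.
Proof.
move=> r0 k1.
have k0 : 0 < 1 - kap by rewrite subr_gt0.
pose F n : set R := `[c + r / n.+1%:R, c + r]%classic.
have rn n : 0 < r / n.+1%:R <= r.
  by rewrite divr_gt0 ?ltr0n //= ler_pdivrMr ?ltr0n // ler_peMr ?(ltW r0) // ler1n.
apply: (@integral_exhaust _ _ _ lam F) => //.
- by move=> n; exact: mitv.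
- move=> n m nm t; rewrite /F /= !in_itv /= => /andP[h1 ->]; rewrite andbT (le_trans _ h1) //.
  by rewrite lerD2l ler_wpM2l ?(ltW r0) // lef_pV2 ?posrE ?ltr0n // ler_nat.
- move=> t; rewrite /= in_itv /= => /andP[h1 h2].
  have tc : 0 < t - c by rewrite subr_gt0.
  have [n _ Hn] : \forall n \near \oo, r / (t - c) <= n%:R.
    by near=> n; near: n; exact: nbhs_infty_ger.
  exists n => //; rewrite /F /= in_itv /= (ltW h2) andbT -lerBrDl ler_pdivrMr ?ltr0n //.
  rewrite mulrC -ler_pdivrMr //; apply: (le_trans (Hn n (leqnn n))).
  by rewrite ler_nat.
- by move=> n; exact: measurable_pow_EFin.
- move=> n; have /andP[n0 n1] := rn n.
  rewrite (@pow_FTC 1) ?mulr1 ?lt_eqF ?lerD2l //; last first.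
    by move=> t /andP[h1 h2]; rewrite mul1r; move: (r / n.+1%:R) n0 h1 => z; lra.
  rewrite lee_fin !mul1r !(addrC c) !addrK gerBl divr_ge0 ?powR_ge0 // ltW.
Unshelve. all: by end_near. Qed.

Lemma pow_integral_left (c r kap : R) : 0 < r -> kap < 1 ->
  (\int[lam]_(t in `](c - r)%R, c[) (`|t - c|%R `^ (- kap))%:E <=
   (r `^ (1 - kap) / (1 - kap))%:E)%E.
Proof.
move=> r0 k1.
have k0 : 0 < 1 - kap by rewrite subr_gt0.
pose F n : set R := `[c - r, c - r / n.+1%:R]%classic.
have rn n : 0 < r / n.+1%:R <= r.
  by rewrite divr_gt0 ?ltr0n //= ler_pdivrMr ?ltr0n // ler_peMr ?(ltW r0) // ler1n.
apply: (@integral_exhaust _ _ _ lam F) => //.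
- by move=> n; exact: mitv.
- move=> n m nm t; rewrite /F /= !in_itv /= => /andP[-> h1]; rewrite (le_trans h1) //.
  by rewrite lerD2l lerN2 ler_wpM2l ?(ltW r0) // lef_pV2 ?posrE ?ltr0n // ler_nat.
- move=> t; rewrite /= in_itv /= => /andP[h1 h2].
  have tc : 0 < c - t by rewrite subr_gt0.
  have [n _ Hn] : \forall n \near \oo, r / (c - t) <= n%:R.
    by near=> n; near: n; exact: nbhs_infty_ger.
  exists n => //; rewrite /F /= in_itv /= (ltW h1) /= lerBrDr -lerBrDl ler_pdivrMr ?ltr0n //.
  rewrite mulrC -ler_pdivrMr //; apply: (le_trans (Hn n (leqnn n))).
  by rewrite ler_nat.
- by move=> n; exact: measurable_pow_EFin.
- move=> n; have /andP[n0 n1] := rn n.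
  rewrite (@pow_FTC (-1)) ?mulrNN ?mulr1 ?lt_eqF ?lerD2l ?lerN2 //; last first.
    by move=> t /andP[h1 h2]; rewrite mulN1r; move: (r / n.+1%:R) n0 h2 => z; lra.
  rewrite lee_fin !mulN1r.
  have -> : - (c - r / n.+1%:R - c) = r / n.+1%:R by ring.
  have -> : - (c - r - c) = r by ring.
  by rewrite !mulNr opprK addrC gerBl divr_ge0 ?powR_ge0 // ltW.
Unshelve. all: by end_near. Qed.

Lemma pow_integral_near (c r kap : R) : 0 < r -> kap < 1 ->
  (\int[lam]_(t in `](c - r)%R, (c + r)%R[) (`|t - c|%R `^ (- kap))%:E <=
   (2 * (r `^ (1 - kap) / (1 - kap)))%:E)%E.
Proof.
move=> r0 k1; set f := fun t : R => (`|t - c|%R `^ (- kap))%:E.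
have mf : measurable_fun setT f by exact: measurable_pow_EFin.
have f0 t : (0 <= f t)%E by rewrite lee_fin powR_ge0.
apply: (@le_trans _ _ (\int[lam]_(t in `](c - r)%R, c[) f t +
   \int[lam]_(t in [set c] `|` `]c, (c + r)%R[%classic) f t)%E).
  apply: integral_cover => //; first exact: measurableU.
  move=> t; rewrite /= !in_itv /= => /andP[h1 h2].
  by have [h|h|h] := ltgtP t c; [left; rewrite h1|right; right; rewrite h2|right; left].
rewrite mulr_natl mulr2n EFinD; apply: leeD; first exact: pow_integral_left.
apply: (@le_trans _ _ (\int[lam]_(t in [set c]) f t + \int[lam]_(t in `]c, (c + r)%R[) f t)%E).
  by apply: integral_cover => //; exact: measurableU.
by rewrite integral_set1 add0e; exact: pow_integral_right.
Qed.

Lemma pow_integral_far (c d g : R) : 0 < d -> 0 < g ->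
  (\int[lam]_(t in `[(c + d)%R, (c + d + 1)%R]) (`|t - c|%R `^ (- (1 + g)))%:E <= (d `^ (- g) / g)%:E)%E /\
  (\int[lam]_(t in `[(c - d - 1)%R, (c - d)%R]) (`|t - c|%R `^ (- (1 + g)))%:E <= (d `^ (- g) / g)%:E)%E.
Proof.
move=> d0 g0.
have k1 : 1 + g != 1 by rewrite -subr_eq0 addrAC subrr add0r gt_eqF.
have e : 1 - (1 + g) = - g by ring.
split.
  rewrite (@pow_FTC 1) ?mulr1 // ?lerDl //; last by move=> t /andP[h1 h2]; rewrite mul1r; lra.
  rewrite lee_fin !mul1r e; have -> : c + d - c = d by ring.
  by rewrite !invrN !mulrN opprK addrC gerBl divr_ge0 ?powR_ge0 // ltW.
rewrite (@pow_FTC (-1)) ?mulrNN ?mulr1 //; last 2 first.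
- by rewrite gerBl.
- by move=> t /andP[h1 h2]; rewrite mulN1r; lra.
rewrite lee_fin !mulN1r e; have -> : - (c - d - c) = d by ring.
by rewrite !invrN !mulrNN gerBl divr_ge0 ?powR_ge0 // ltW.
Qed.

(** Within distance [d] the integrand is constant on a length 2 d. Beyond it, one interval of length
    1 on either side suffices to cover ]0, 1[ because [c] lies in it. *)
Lemma kernel_far (c d g : R) : 0 < d -> 0 < g -> 0 < c < 1 ->
  (\int[lam]_(t in `]0%R, 1%R[) ((Num.max `|t - c| d) `^ (- (1 + g)))%:E <=
   ((2 + 2 / g) * d `^ (- g))%:E)%E.
Proof.
move=> d0 g0 /andP[c0 c1].
set f := fun t : R => ((Num.max `|t - c| d) `^ (- (1 + g)))%:E.
have mf : measurable_fun setT f.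
  apply/measurable_EFinP; apply: (measurableT_comp (measurable_powR _)).
  apply: measurable_maxr => //; apply: measurableT_comp => //; exact: measurable_funB.
have f0 t : (0 <= f t)%E by rewrite lee_fin powR_ge0.
have [h1 h2] := pow_integral_far c d0 g0.
have {}h1 : (\int[lam]_(t in `[(c + d)%R, (c + d + 1)%R]) f t <= (d `^ (- g) / g)%:E)%E.
  rewrite (_ : (\int[lam]_(t in `[(c + d)%R, (c + d + 1)%R]) f t =
    \int[lam]_(t in `[(c + d)%R, (c + d + 1)%R]) (`|t - c|%R `^ (- (1 + g)))%:E)%E); first exact: h1.
  apply: eq_integral => t; rewrite inE /= in_itv /= => /andP[t1 t2].
  by rewrite /f (max_idPl _) // ger0_norm; lra.
have {}h2 : (\int[lam]_(t in `[(c - d - 1)%R, (c - d)%R]) f t <= (d `^ (- g) / g)%:E)%E.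
  rewrite (_ : (\int[lam]_(t in `[(c - d - 1)%R, (c - d)%R]) f t =
    \int[lam]_(t in `[(c - d - 1)%R, (c - d)%R]) (`|t - c|%R `^ (- (1 + g)))%:E)%E); first exact: h2.
  apply: eq_integral => t; rewrite inE /= in_itv /= => /andP[t1 t2].
  by rewrite /f (max_idPl _) // ler0_norm; lra.
have h3 : (\int[lam]_(t in `](c - d)%R, (c + d)%R[) f t <= (2 * d `^ (- g))%:E)%E.
  rewrite (_ : (\int[lam]_(t in `](c - d)%R, (c + d)%R[) f t =
    \int[lam]_(t in `](c - d)%R, (c + d)%R[) (d `^ (- (1 + g)))%:E)%E); last first.
    apply: eq_integral => t; rewrite inE /= in_itv /= => /andP[t1 t2]; rewrite /f (max_idPr _) //.
    by rewrite ler_norml; apply/andP; split; lra.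
  have lI : lam (`](c - d)%R, (c + d)%R[%classic : set R) = (2 * d)%:E.
    by rewrite lam_itv; [congr EFin; ring|lra].
  apply: (@le_trans _ _ ((d `^ (- (1 + g)))%:E * lam (`](c - d)%R, (c + d)%R[%classic : set R))%E).
    by rewrite le_eqVlt; apply/orP; left; apply/eqP; exact: (@integral_cst _ _ R lam _ (mitv _)).
  rewrite lI -EFinM lee_fin (_ : - g = - (1 + g) + 1); last by ring.
  rewrite powRD ?(gt_eqF d0) ?implybT // powRr1 ?(ltW d0) //.
  by rewrite le_eqVlt; apply/orP; left; apply/eqP; ring.
apply: (@le_trans _ _ (\int[lam]_(t in `[(c - d - 1)%R, (c - d)%R]) f t +
   \int[lam]_(t in `](c - d)%R, (c + d)%R[ `|` `[(c + d)%R, (c + d + 1)%R]%classic) f t)%E).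
  apply: integral_cover => //; first exact: measurableU.
  move=> t; rewrite /= !in_itv /= => /andP[t1 t2].
  have [h|h] := leP t (c - d); first by left; apply/andP; split; lra.
  have [h'|h'] := leP (c + d) t; first by right; right; apply/andP; split; lra.
  by right; left; apply/andP.
have -> : (2 + 2 / g) * d `^ (- g) = d `^ (- g) / g + (2 * d `^ (- g) + d `^ (- g) / g) by ring.
rewrite EFinD; apply: leeD => //.
apply: (@le_trans _ _ (\int[lam]_(t in `](c - d)%R, (c + d)%R[) f t +
   \int[lam]_(t in `[(c + d)%R, (c + d + 1)%R]) f t)%E).
  by apply: integral_cover => //; exact: measurableU.
by rewrite EFinD; apply: leeD.
Qed.

End power_integrals.

Section tonelli.
Context {R : realType}.
Local Notation RR := (measurableTypeR R * measurableTypeR R)%type.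
Variables (I J : set R) (f : R * R -> \bar R) (k : R -> \bar R).
Hypothesis mI : measurable I.
Hypothesis mJ : measurable J.
Hypothesis mf : measurable_fun (setT : set RR) f.
Hypothesis f0 : forall x, (0 <= f x)%E.
Hypothesis mk : measurable_fun setT k.
Local Open Scope ereal_scope.

Let g := f \_ (I `*` J).

Let mg : measurable_fun (setT : set RR) g.
Proof.
refine ((measurable_restrictT _ _).1 _); first exact: measurableX.
exact: measurable_funS mf.
Qed.

Let g0 x : 0 <= g x.
Proof. by rewrite /g patchE; case: ifPn. Qed.

Lemma tonelli_rect12 : (forall x, I x -> \int[lam]_(y in J) f (x, y) <= k x) ->
  \int[lam2]_(x in I `*` J) f x <= \int[lam]_(x in I) k x.
Proof.
move=> h; rewrite integral_mkcond (_ : \int[lam2]_x g x = \int[lam]_x fubini_F lam g x); last first.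
  exact: (@fubini_tonelli1 _ _ _ _ R lam lam g mg g0).
rewrite [leRHS]integral_mkcond; apply: ge0_le_integral => //.
- by move=> x _; apply: integral_ge0.
- exact: (@measurable_fun_fubini_tonelli_F _ _ _ _ R lam g mg g0).
- refine ((measurable_restrictT _ _).1 _) => //; exact: measurable_funS mk.
- move=> x _; rewrite /fubini_F patchE; case: ifPn => [/set_mem Ix|/negP nI].
    apply: le_trans (h x Ix); rewrite [leRHS]integral_mkcond le_eqVlt; apply/orP; left; apply/eqP.
    apply: eq_integral => y _; rewrite /g !patchE.
    case: ifPn => [/set_mem[_ /= Jy]|]; first by rewrite mem_set.
    by case: ifPn => // /set_mem Jy /negP; rewrite inE => -[].
  rewrite (eq_integral (cst 0)) ?integral0 // => y _; rewrite /g patchE.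
  by case: ifPn => // /set_mem[Ix]; exfalso; apply: nI; rewrite inE.
Qed.

Lemma tonelli_rect21 : (forall y, J y -> \int[lam]_(x in I) f (x, y) <= k y) ->
  \int[lam2]_(x in I `*` J) f x <= \int[lam]_(y in J) k y.
Proof.
move=> h; rewrite integral_mkcond (_ : \int[lam2]_x g x = \int[lam]_x fubini_G lam g x); last first.
  exact: (@fubini_tonelli2 _ _ _ _ R lam lam g mg g0).
rewrite [leRHS]integral_mkcond; apply: ge0_le_integral => //.
- by move=> x _; apply: integral_ge0.
- exact: (@measurable_fun_fubini_tonelli_G _ _ _ _ R lam g mg g0).
- refine ((measurable_restrictT _ _).1 _) => //; exact: measurable_funS mk.
- move=> x _; rewrite /fubini_G patchE; case: ifPn => [/set_mem Ix|/negP nI].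
    apply: le_trans (h x Ix); rewrite [leRHS]integral_mkcond le_eqVlt; apply/orP; left; apply/eqP.
    apply: eq_integral => y _; rewrite /g !patchE.
    case: ifPn => [/set_mem[/= Jy _]|]; first by rewrite mem_set.
    by case: ifPn => // /set_mem Jy /negP; rewrite inE => -[].
  rewrite (eq_integral (cst 0)) ?integral0 // => y _; rewrite /g patchE.
  by case: ifPn => // /set_mem[_ Ix]; exfalso; apply: nI; rewrite inE.
Qed.

End tonelli.

Section kernels.
Context {R : realType}.
Local Notation RR := (measurableTypeR R * measurableTypeR R)%type.

Lemma product_integral_le (I J : set R) (f g : R -> R) (a b : R) :
  measurable I -> measurable J ->
  measurable_fun setT f -> measurable_fun setT g ->
  (forall t, 0 <= f t) -> (forall t, 0 <= g t) -> 0 <= a ->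
  (\int[lam]_(t in I) (f t)%:E <= a%:E)%E -> (\int[lam]_(t in J) (g t)%:E <= b%:E)%E ->
  (\int[lam2]_(x in I `*` J) (f x.1 * g x.2)%:E <= (a * b)%:E)%E.
Proof.
move=> mI mJ mf mg f0 g0 a0 fa gb.
have mEg : measurable_fun J (fun t => (g t)%:E).
  by apply/measurable_EFinP; exact: measurable_funS mg.
have mEf : measurable_fun I (fun t => (f t)%:E).
  by apply/measurable_EFinP; exact: measurable_funS mf.
have b0 : 0 <= b by rewrite -lee_fin; apply: le_trans gb; apply: integral_ge0 => t _; rewrite lee_fin.
pose k t : \bar R := ((f t)%:E * b%:E)%E.
apply: (@le_trans _ _ (\int[lam]_(t in I) k t)%E).
  apply: tonelli_rect12 => //.
  - apply/measurable_EFinP; apply: measurable_funM.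
      exact: (measurableT_comp mf measurable_fst).
    exact: (measurableT_comp mg measurable_snd).
  - by move=> x; rewrite lee_fin mulr_ge0.
  - apply: emeasurable_funM => //; exact/measurable_EFinP.
  - move=> t It /=; rewrite /k.
    apply: (@le_trans _ _ ((f t)%:E * \int[lam]_(y in J) (g y)%:E)%E); last first.
      by apply: lee_wpmul2l => //; rewrite lee_fin.
    rewrite le_eqVlt; apply/orP; left; apply/eqP.
    by apply: (@ge0_integralZl_EFin _ _ R lam _ mJ (fun y => (g y)%:E)) => // y _; rewrite lee_fin.
have -> : (\int[lam]_(t in I) k t = b%:E * \int[lam]_(t in I) (f t)%:E)%E.
  rewrite -ge0_integralZl_EFin //; last by move=> y _; rewrite lee_fin.
  by apply: eq_integral => y _; rewrite /k muleC.
by rewrite mulrC EFinM; apply: lee_wpmul2l => //; rewrite lee_fin.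
Qed.

Lemma vline_null (c : R) : lam2 ([set x | x.1 = c] : set RR) = 0%E.
Proof.
have -> : [set x : R * R | x.1 = c] = [set c] `*` setT by apply/seteqP; split => x //= [].
have H := @product_measure1E _ _ _ _ R lam lam _ _ (measurable_set1 c) (@measurableT _ (measurableTypeR R)).
have l0 : lam ([set c] : set (measurableTypeR R)) = 0%E by exact: lebesgue_measure_set1.
by apply: (eq_trans H); apply/eqP; rewrite mule_eq0; apply/orP; left; apply/eqP; exact: l0.
Qed.

Lemma hline_null (c : R) : lam2 ([set x | x.2 = c] : set RR) = 0%E.
Proof.
have -> : [set x : R * R | x.2 = c] = setT `*` [set c] by apply/seteqP; split => x //= [].
have H := @product_measure1E _ _ _ _ R lam lam _ _ (@measurableT _ (measurableTypeR R)) (measurable_set1 c).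
have l0 : lam ([set c] : set (measurableTypeR R)) = 0%E by exact: lebesgue_measure_set1.
by apply: (eq_trans H); apply/eqP; rewrite mule_eq0; apply/orP; right; apply/eqP; exact: l0.
Qed.

Lemma measurable_line (c : R) : measurable ([set x | x.1 = c] : set RR) /\
  measurable ([set x | x.2 = c] : set RR).
Proof.
have m1 : measurable ([set c] : set (measurableTypeR R)) by exact: measurable_set1.
have := @measurable_snd _ _ (measurableTypeR R) (measurableTypeR R) measurableT _ m1.
have := @measurable_fst _ _ (measurableTypeR R) (measurableTypeR R) measurableT _ m1.
by rewrite !setTI; split.
Qed.

Lemma powR_add (a e1 e2 : R) : 0 < a -> a `^ (e1 + e2) = a `^ e1 * a `^ e2.
Proof. by move=> a0; rewrite powRD // (gt_eqF a0) implybT. Qed.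

(** The squares of the one-dimensional constants of [kernel_far], with [g = sg / 2], and of
    [kernel_near]. *)
Definition kernel_constant (sg : R) : R := (2 + 4 / sg) ^+ 2 + (4 / (1 - sg)) ^+ 2.

(** The planar kernel is dominated by products of functions of one coordinate, to be integrated
    separately. For r >= d the exponent 2 + sg is shared equally. For r < d the factor r / d lowers
    it to 1 + sg, and each half is an integrable power because sg < 1. *)
Lemma kernel_split (z1 z2 d sg : R) : 0 < d -> 0 < sg < 1 -> z1 != 0 -> z2 != 0 ->
  let r := Num.max `|z1| `|z2| in
  Num.min 1 (r / d) / r `^ (2 + sg) <=
  Num.max `|z1| d `^ (- (1 + sg / 2)) * Num.max `|z2| d `^ (- (1 + sg / 2)) +
  (d `^ (- 2^-1) * (`|z1| `^ (- ((1 + sg) / 2)) * (`|z1| < d)%R%:R)) *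
  (d `^ (- 2^-1) * (`|z2| `^ (- ((1 + sg) / 2)) * (`|z2| < d)%R%:R)).
Proof.
move=> d0 /andP[s0 s1] n1 n2 /=; set r := Num.max `|z1| `|z2|.
have r1 : `|z1| <= r by rewrite le_max lexx.
have r2 : `|z2| <= r by rewrite le_max lexx orbT.
have p1 : 0 < `|z1| by rewrite normr_gt0.
have p2 : 0 < `|z2| by rewrite normr_gt0.
have r0 : 0 < r by rewrite (lt_le_trans p1).
have low (a b e : R) : 0 < a -> a <= b -> 0 <= e -> b `^ (- e) <= a `^ (- e).
  move=> a0 ab e0; rewrite !powRN lef_pV2 ?posrE ?powR_gt0 // ?(lt_le_trans a0) //.
  by rewrite ge0_ler_powR ?nnegrE // ltW // (lt_le_trans a0).
have [dr|rd] := leP d r.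
  rewrite -[leLHS]addr0; apply: lerD; last by rewrite !mulr_ge0 ?powR_ge0.
  rewrite (min_idPl _); last by rewrite ler_pdivlMr // mul1r.
  rewrite mul1r -powRN (_ : - (2 + sg) = - (1 + sg / 2) + - (1 + sg / 2)); last by field.
  rewrite (powR_add _ _ r0).
  by apply: ler_pM; rewrite ?powR_ge0 //; apply: low; rewrite ?ge_max ?lt_max ?d0 ?orbT ?r1 ?r2 ?dr //; lra.
rewrite -[leLHS]add0r; apply: lerD; first by rewrite mulr_ge0 ?powR_ge0.
rewrite (le_lt_trans r1 rd) (le_lt_trans r2 rd) !mulr1.
rewrite (min_idPr _); last by rewrite ler_pdivrMr // mul1r ltW.
rewrite mulrACA -(powR_add _ _ d0).
rewrite (_ : - 2^-1 - 2^-1 = - 1 :> R); last by field.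
rewrite powR_inv1 ?(ltW d0) // mulrAC mulrC ler_wpM2l ?invr_ge0 ?(ltW d0) //.
rewrite -powRN -[X in X * _]powRr1 ?(ltW r0) // -(powR_add _ _ r0).
rewrite (_ : 1 + - (2 + sg) = - ((1 + sg) / 2) + - ((1 + sg) / 2)); last by field.
rewrite (powR_add _ _ r0).
by apply: ler_pM; rewrite ?powR_ge0 //; apply: low => //; lra.
Qed.

Lemma kernel_near (c d sg : R) : 0 < d -> 0 < sg < 1 ->
  (\int[lam]_(t in `]0%R, 1%R[)
    (d `^ (- 2^-1) * (`|t - c| `^ (- ((1 + sg) / 2)) * (`|t - c| < d)%R%:R))%:E <=
   (4 / (1 - sg) * d `^ (- (sg / 2)))%:E)%E.
Proof.
move=> d0 /andP[s0 s1].
pose f t : R := `|t - c| `^ (- ((1 + sg) / 2)).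
have mI : measurable (`](c - d), (c + d)[%classic : set R) by exact: measurable_itv.
have m01 : measurable (`]0, 1[%classic : set R) by exact: measurable_itv.
have E t : f t * (`|t - c| < d)%R%:R = f t * \1_(`](c - d), (c + d)[%classic : set R) t.
  congr (_ * _); rewrite indicE; congr (_%:R); congr nat_of_bool; apply/idP/idP.
    by rewrite ltr_norml => h; rewrite mem_set // /= in_itv /=; lra.
  by move=> /set_mem; rewrite /= in_itv /= => h; rewrite ltr_norml; lra.
have mh : measurable_fun setT (fun t => f t * (`|t - c| < d)%R%:R).
  apply: (eq_measurable_fun (fun t => f t * \1_(`](c - d), (c + d)[%classic : set R) t)).
    by move=> t _; rewrite E.
  by apply: measurable_funM; [exact: measurable_pow|exact: measurable_indic].
have h0 t : 0 <= f t * (`|t - c| < d)%R%:R by rewrite mulr_ge0 ?powR_ge0.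
apply: (@le_trans _ _ ((d `^ (- 2^-1))%:E * \int[lam]_(t in `]0%R, 1%R[) (f t * (`|t - c| < d)%R%:R)%:E)%E).
  rewrite le_eqVlt; apply/orP; left; apply/eqP.
  apply: (@ge0_integralZl_EFin _ _ R lam _ m01 (fun t => (f t * (`|t - c| < d)%R%:R)%:E)).
  - by move=> t _; rewrite lee_fin.
  - by apply/measurable_EFinP; exact: measurable_funS mh.
  - by rewrite powR_ge0.
have H := @pow_integral_near R c d ((1 + sg) / 2) d0 ltac:(lra).
have H2 : (\int[lam]_(t in `]0%R, 1%R[) (f t * (`|t - c| < d)%R%:R)%:E <=
   (2 * (d `^ (1 - (1 + sg) / 2) / (1 - (1 + sg) / 2)))%:E)%E.
  apply: le_trans H; rewrite [leRHS]integral_mkcond.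
  apply: (@le_trans _ _ (\int[lam]_t (f t * (`|t - c| < d)%R%:R)%:E)%E).
    by apply: ge0_subset_integral => //; [exact/measurable_EFinP|move=> t _; rewrite lee_fin].
  rewrite le_eqVlt; apply/orP; left; apply/eqP; apply: eq_integral => t _.
  by rewrite E patchE indicE; case: ifP; rewrite ?mulr1 ?mulr0.
apply: (@le_trans _ _ ((d `^ (- 2^-1))%:E * (2 * (d `^ (1 - (1 + sg) / 2) / (1 - (1 + sg) / 2)))%:E)%E).
  by apply: lee_wpmul2l => //; rewrite lee_fin powR_ge0.
rewrite -EFinM lee_fin (_ : - (sg / 2) = - 2^-1 + (1 - (1 + sg) / 2)); last by field.
rewrite (powR_add (- 2^-1) _ d0); move: (d `^ (- 2^-1)) (d `^ (1 - _)) => u v.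
rewrite le_eqVlt; apply/orP; left; apply/eqP.
have s1' : 1 - sg != 0 by rewrite subr_eq0 gt_eqF.
have -> : 1 - (1 + sg) / 2 = (1 - sg) / 2 by field.
by field.
Qed.

Lemma kernel_bound (x : R * R) (d sg : R) : 0 < d -> 0 < sg < 1 -> unit_square x ->
  (\int[lam2]_(y in unit_square)
     (Num.min 1 (Num.max `|y.1 - x.1| `|y.2 - x.2| / d) /
       Num.max `|y.1 - x.1| `|y.2 - x.2| `^ (2 + sg))%:E <=
   (kernel_constant sg * d `^ (- sg))%:E)%E.
Proof.
move=> d0 hs [x1 x2].
have {}x1 : 0 < x.1 < 1 by move: x1; rewrite /= in_itv.
have {}x2 : 0 < x.2 < 1 by move: x2; rewrite /= in_itv.
have /andP[s0 s1] := hs.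
pose g1 (c t : R) : R := Num.max `|t - c| d `^ (- (1 + sg / 2)).
pose g2 (c t : R) : R := d `^ (- 2^-1) * (`|t - c| `^ (- ((1 + sg) / 2)) * (`|t - c| < d)%R%:R).
have mdist c : measurable_fun setT (fun t : R => `|t - c|).
  by apply: measurableT_comp => //; exact: measurable_funB.
have mg1 c : measurable_fun setT (g1 c).
  by apply: (measurableT_comp (measurable_powR _)); apply: measurable_maxr.
have mg2 c : measurable_fun setT (g2 c).
  apply: measurable_funM => //; apply: measurable_funM; first exact: measurable_pow.
  have mI : measurable (`](c - d), (c + d)[%classic : set R) by exact: measurable_itv.
  apply: (eq_measurable_fun (fun t : measurableTypeR R => \1_(`](c - d), (c + d)[%classic : set R) t : R)); last exact: measurable_indic.
  move=> t _; rewrite indicE; congr (_%:R); congr nat_of_bool; apply/idP/idP.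
    by move=> /set_mem; rewrite /= in_itv /= => h; rewrite ltr_norml; lra.
  by rewrite ltr_norml => h; rewrite mem_set // /= in_itv /=; lra.
have g10 c t : 0 <= g1 c t by rewrite powR_ge0.
have g20 c t : 0 <= g2 c t by rewrite !mulr_ge0 ?powR_ge0.
have G1 c : 0 < c < 1 -> (\int[lam]_(t in `]0%R, 1%R[) (g1 c t)%:E <= ((2 + 4 / sg) * d `^ (- (sg / 2)))%:E)%E.
  move=> hc; rewrite (_ : 4 / sg = 2 / (sg / 2)); last by field; rewrite gt_eqF.
  by apply: kernel_far => //; lra.
have G2 c : (\int[lam]_(t in `]0%R, 1%R[) (g2 c t)%:E <= (4 / (1 - sg) * d `^ (- (sg / 2)))%:E)%E.
  exact: kernel_near.
have k10 : 0 <= (2 + 4 / sg) * d `^ (- (sg / 2)).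
  by rewrite mulr_ge0 ?powR_ge0 // addr_ge0 // divr_ge0 // ltW.
have k20 : 0 <= 4 / (1 - sg) * d `^ (- (sg / 2)).
  by rewrite mulr_ge0 ?powR_ge0 // divr_ge0 // subr_ge0 ltW.
have m01 : measurable (`]0, 1[%classic : set R) by exact: measurable_itv.
pose P1 (y : R * R) := g1 x.1 y.1 * g1 x.2 y.2.
pose P2 (y : R * R) := g2 x.1 y.1 * g2 x.2 y.2.
have mP1 : measurable_fun (setT : set RR) P1.
  by apply: measurable_funM; [exact: (measurableT_comp (mg1 _) measurable_fst)|exact: (measurableT_comp (mg1 _) measurable_snd)].
have mP2 : measurable_fun (setT : set RR) P2.
  by apply: measurable_funM; [exact: (measurableT_comp (mg2 _) measurable_fst)|exact: (measurableT_comp (mg2 _) measurable_snd)].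
have I1 := product_integral_le m01 m01 (mg1 x.1) (mg1 x.2) (g10 _) (g10 _) k10 (G1 _ x1) (G1 _ x2).
have I2 := product_integral_le m01 m01 (mg2 x.1) (mg2 x.2) (g20 _) (g20 _) k20 (G2 x.1) (G2 x.2).
have mQ := @measurable_unit_square R.
have mr : measurable_fun (setT : set RR) (fun y : R * R => Num.max `|y.1 - x.1| `|y.2 - x.2|).
  by apply: measurable_maxr; [exact: (measurableT_comp (mdist _) measurable_fst)|exact: (measurableT_comp (mdist _) measurable_snd)].
apply: (@le_trans _ _ (\int[lam2]_(y in unit_square) ((P1 y)%:E + (P2 y)%:E))%E); last first.
  rewrite (_ : (\int[lam2]_(y in unit_square) ((P1 y)%:E + (P2 y)%:E) =
    \int[lam2]_(y in unit_square) (P1 y)%:E + \int[lam2]_(y in unit_square) (P2 y)%:E)%E); last first.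
    apply: (@ge0_integralD _ _ R lam2 _ mQ (fun y => (P1 y)%:E) (fun y => (P2 y)%:E)).
    - by move=> y _; rewrite lee_fin mulr_ge0.
    - by apply/measurable_EFinP; exact: measurable_funS mP1.
    - by move=> y _; rewrite lee_fin mulr_ge0.
    - by apply/measurable_EFinP; exact: measurable_funS mP2.
  apply: (le_trans (leeD I1 I2)); rewrite -EFinD lee_fin.
  rewrite [X in _ <= _ * d `^ X](_ : - sg = - (sg / 2) + - (sg / 2)); last by field.
  rewrite (powR_add _ _ d0) /kernel_constant; move: (d `^ _) => D.
  by rewrite le_eqVlt; apply/orP; left; apply/eqP; ring.
have mr' : measurable_fun (setT : set RR) (fun y : R * R => Num.min 1 (Num.max `|y.1 - x.1| `|y.2 - x.2| / d) /
       Num.max `|y.1 - x.1| `|y.2 - x.2| `^ (2 + sg)).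
  apply: measurable_funM.
    by apply: measurable_minr => //; apply: measurable_funM.
  rewrite (_ : (fun _ => _) = (fun y : RR => Num.max `|y.1 - x.1| `|y.2 - x.2| `^ (- (2 + sg)))).
    by apply: (measurableT_comp (measurable_powR _)).
  by apply/funext => y; rewrite powRN.
apply: (@ae_ge0_le_integral _ _ R lam2 _ mQ).
- move=> y _; rewrite lee_fin divr_ge0 ?powR_ge0 // le_min ler01 divr_ge0 ?(ltW d0) // le_max normr_ge0.
- by apply/measurable_EFinP; exact: measurable_funS mr'.
- by move=> y _; rewrite -EFinD lee_fin addr_ge0 // mulr_ge0.
- apply: emeasurable_funD; apply/measurable_EFinP; [exact: measurable_funS mP1|exact: measurable_funS mP2].
(* On these two lines a negative power of 0 has the value 0, so the pointwise bound may fail there;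
   they are null. *)
exists ([set y | y.1 = x.1] `|` [set y | y.2 = x.2]); split.
- exact: measurableU (measurable_line _).1 (measurable_line _).2.
- exact: null_set_setU (measurable_line _).1 (measurable_line _).2 (vline_null _) (hline_null _).
- move=> y /=; apply: contra_notP => /not_orP[n1 n2] _.
  rewrite -EFinD lee_fin; apply: kernel_split => //; rewrite subr_eq0; exact/eqP.
Qed.

End kernels.

Section norms.
Context {R : realType}.
Implicit Types z : R * R.

Lemma norm2_ge0 z : 0 <= norm2 z.
Proof. exact: sqrtr_ge0. Qed.

Lemma norm2_le z : norm2 z <= `|z.1| + `|z.2|.
Proof.
have h : 0 <= `|z.1| + `|z.2| by rewrite addr_ge0.
rewrite -(ger0_norm h) -sqrtr_sqr; apply: ler_wsqrtr; rewrite /dot2.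
rewrite -!expr2 -(real_normK (num_real z.1)) -(real_normK (num_real z.2)).
by rewrite sqrrD -addrA lerD2l lerDr mulrn_wge0 // mulr_ge0.
Qed.

Lemma norm2_max z : Num.max `|z.1| `|z.2| <= norm2 z.
Proof.
have h : 0 <= Num.max `|z.1| `|z.2| by rewrite le_max normr_ge0.
rewrite -(ger0_norm h) -sqrtr_sqr; apply: ler_wsqrtr; rewrite /dot2 -!expr2.
rewrite -(real_normK (num_real z.1)) -(real_normK (num_real z.2)).
by case: (leP `|z.1| `|z.2|) => _; rewrite ?lerDl ?lerDr sqr_ge0.
Qed.

Lemma norm2_eq0 : norm2 (0 : R * R) = 0.
Proof. by rewrite /norm2 /dot2 /= mulr0 addr0 sqrtr0. Qed.

Lemma measurable_norm2 d (T : measurableType d) (v : T -> R * R) :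
  measurable_fun setT (fun x => (v x).1) -> measurable_fun setT (fun x => (v x).2) ->
  measurable_fun setT (fun x => norm2 (v x)).
Proof.
move=> m1 m2; apply: (eq_measurable_fun (fun x => dot2 (v x) (v x) `^ 2^-1)).
  by move=> x _; rewrite powR12_sqrt // /dot2 -!expr2 addr_ge0 ?sqr_ge0.
apply: (measurableT_comp (measurable_powR _)).
by apply: measurable_funD; apply: measurable_funM.
Qed.

End norms.

(** The coordinates move too little to reach the sides, and the gap between their absolute values,
    which changes by at most 2 z, keeps its sign. *)
Lemma quarter_stable (R : realFieldType) (a b a' b' z : R) :
  `|a' - a| <= z -> `|b' - b| <= z ->
  z < Num.min (Num.min (1 - `|a|) (1 - `|b|)) `| `|a| - `|b| | / 2 ->
  [/\ `|a'| < 1, `|b'| < 1, (`|a'| < `|b'|) = (`|a| < `|b|) & (`|b'| < `|a'|) = (`|b| < `|a|)].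
Proof.
move=> ha hb; rewrite ltr_pdivlMr // !lt_min => /andP[/andP[h1 h2] h3].
have T (x y : R) : `|x| <= `|x - y| + `|y| by rewrite -{1}(subrK y x) ler_normD.
have a1 := T a' a; have a2 := T a a'; have b1 := T b' b; have b2 := T b b'.
rewrite (distrC a a') in a2; rewrite (distrC b b') in b2.
have z0 : 0 <= z by apply: le_trans ha.
move: (`|a' - a|) (`|b' - b|) (`|a|) (`|b|) (`|a'|) (`|b'|) ha hb h1 h2 h3 a1 a2 b1 b2.
move=> da db A B A' B' ha hb h1 h2 h3 a1 a2 b1 b2.
have [AB|AB] := leP 0 (A - B).
  rewrite ger0_norm // in h3.
  by split; [lra|lra|apply/idP/idP; lra|apply/idP/idP; lra].
rewrite ltr0_norm // in h3.
by split; [lra|lra|apply/idP/idP; lra|apply/idP/idP; lra].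
Qed.

Section box_kernel.
Context {R : realType}.
Local Notation RR := (measurableTypeR R * measurableTypeR R)%type.
Variables (P : @rect R) (om M sg l : R).
Hypothesis wx0 : 0 < rwx P.
Hypothesis wy0 : 0 < rwy P.
Hypothesis PQ : inside P `<=` unit_square.
Hypothesis om0 : 0 <= om.
Hypothesis hx : om * rwx P <= M.
Hypothesis hy : om * rwy P <= M.
Hypothesis hs : 0 < sg < 1.
Hypothesis lx : rwx P <= l.
Hypothesis ly : rwy P <= l.

Let w := Num.min (rwx P) (rwy P).

Let w0 : 0 < w. Proof. by rewrite lt_min wx0. Qed.

Let M0 : 0 <= M. Proof. by apply: le_trans hx; rewrite mulr_ge0 // ltW. Qed.

(* A lower bound for the distance to the sides and the diagonals. *)
Definition depth x : R := Num.min (rwx P) (rwy P) / 2 *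
  Num.min (Num.min (1 - `|co P 0 x|) (1 - `|co P 1 x|)) `| `|co P 0 x| - `|co P 1 x| |.

(** Within distance [depth x] the point [y] stays in the sector of [x], where the field is linear in
    the normalized coordinates; farther away the bound 4 M of the difference is trivial. The minimum
    combines both cases. *)
Lemma box_field_lipschitz (v : R * R -> R * R) x y :
  (forall x, inside P x -> v x = box_field P om x) ->
  (forall x, `|(v x).1| <= M /\ `|(v x).2| <= M) ->
  inside P x -> 0 < depth x ->
  norm2 (v x - v y) <= 4 * M * Num.min 1 (Num.max `|y.1 - x.1| `|y.2 - x.2| / depth x).
Proof.
move=> vP vM Px d0; set r : R := Num.max `|y.1 - x.1| _.
have r0 : 0 <= r by rewrite le_max normr_ge0.
have M40 : 0 <= 4 * M by rewrite mulr_ge0.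
have [dr|rd] := leP (depth x) r.
  rewrite (min_idPl _) ?mulr1; last by rewrite ler_pdivlMr // mul1r.
  apply: (le_trans (norm2_le _)) => /=.
  have [a1 a2] := vM x; have [b1 b2] := vM y.
  have := ler_normB (v x).1 (v y).1; have := ler_normB (v x).2 (v y).2; lra.
rewrite (min_idPr _); last by rewrite ler_pdivrMr // mul1r ltW.
have wa : `|co P 0 y - co P 0 x| <= r / w.
  rewrite /= -mulrBl opprB addrA subrK normrM normfV (gtr0_norm wx0).
  apply: ler_pM; rewrite ?invr_ge0 ?(ltW wx0) //; first by rewrite /r le_max lexx.
  by rewrite lef_pV2 ?posrE // ge_min lexx.
have wb : `|co P 1 y - co P 1 x| <= r / w.
  rewrite /= -mulrBl opprB addrA subrK normrM normfV (gtr0_norm wy0).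
  apply: ler_pM; rewrite ?invr_ge0 ?(ltW wy0) //; first by rewrite /r le_max lexx orbT.
  by rewrite lef_pV2 ?posrE // ge_min lexx orbT.
have [A1 B1] := (co_inside 0 x wx0 wy0).1 Px.
have rw : r / w < Num.min (Num.min (1 - `|co P 0 x|) (1 - `|co P 1 x|)) `| `|co P 0 x| - `|co P 1 x| | / 2.
  by rewrite ltr_pdivrMr // mulrC; apply: (lt_le_trans rd); rewrite /depth -/w; lra.
have dw : depth x <= w.
  have : Num.min (Num.min (1 - `|co P 0 x|) (1 - `|co P 1 x|)) `| `|co P 0 x| - `|co P 1 x| | <= 1.
    by rewrite !ge_min gerBl normr_ge0.
  rewrite /depth -/w -mulrA; move: (Num.min _ `| _ |) => m m1.
  by rewrite ler_piMr ?(ltW w0) //; lra.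
have h4 : M * (r / w) <= 4 * M * (r / depth x).
  have : r / w <= r / depth x by rewrite ler_wpM2l // lef_pV2 ?posrE.
  have q0 : 0 <= r / depth x by rewrite divr_ge0 // ltW.
  move=> h; apply: (@le_trans _ _ (M * (r / depth x))); first by rewrite ler_wpM2l.
  by move: (mulr_ge0 M0 q0) => h'; rewrite -(mulrA 4); move: (M * _) h' => z; lra.
apply: le_trans h4.
have [a1 b1 e1 e2] := quarter_stable wa wb rw.
have Py : inside P y by apply/(co_inside 0 y wx0 wy0).
rewrite (vP _ Px) (vP _ Py) /box_field !asboolT //.
have Z (b b' k : R) : 0 <= k <= M -> `|b' - b| <= r / w ->
    `|k * (- b) - k * (- b')| <= M * (r / w).
  move=> /andP[k0 kM] h; have -> : k * (- b) - k * (- b') = k * (b' - b) by ring.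
  by rewrite normrM (ger0_norm k0) ler_pM.
have Y (a a' k : R) : 0 <= k <= M -> `|a' - a| <= r / w -> `|k * a - k * a'| <= M * (r / w).
  move=> hk ha; have -> : k * a - k * a' = k * - (- a) - k * - (- a') by rewrite !opprK.
  by apply: Z; rewrite // opprK addrC distrC.
apply: (le_trans (norm2_le _)); rewrite /= e1 e2.
have k1 : 0 <= om * rwx P <= M by rewrite hx andbT mulr_ge0 // ltW.
have k2 : 0 <= om * rwy P <= M by rewrite hy andbT mulr_ge0 // ltW.
have r1 : 0 <= M * (r / w) by rewrite !mulr_ge0 // invr_ge0 ltW.
case: ltgtP => _ /=; rewrite ?mulr1 ?mulr0 ?subrr ?normr0 ?addr0 ?add0r //.
  exact: Z.
exact: Y.
Qed.

Definition gagliardo (p : R) (v : R * R -> R * R) (x : R * R) : \bar R :=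
  (\int[lam2]_(y in unit_square) (norm2 (v x - v y) `^ p / norm2 (x - y) `^ (2 + sg))%:E)%E.

(** Since p >= 1, the p-th power of a minimum with 1 is at most the minimum itself, so the integral
    over [y] is the one of [kernel_bound] with [d = depth x]. *)
Lemma gagliardo_inner (p : R) (v : R * R -> R * R) x : 1 <= p ->
  measurable_fun (setT : set RR) (fun x => (v x).1) ->
  measurable_fun (setT : set RR) (fun x => (v x).2) ->
  (forall x, inside P x -> v x = box_field P om x) ->
  (forall x, `|(v x).1| <= M /\ `|(v x).2| <= M) ->
  inside P x -> 0 < depth x ->
  (gagliardo p v x <= ((4 * M) `^ p * kernel_constant sg * depth x `^ (- sg))%:E)%E.
Proof.
move=> p1 m1 m2 vP vM Px d0.
have M40 : 0 <= 4 * M by rewrite mulr_ge0.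
pose r (y : R * R) : R := Num.max `|y.1 - x.1| `|y.2 - x.2|.
pose k (y : R * R) : R := Num.min 1 (r y / depth x) / r y `^ (2 + sg).
have r0 y : 0 <= r y by rewrite le_max normr_ge0.
have k0 y : 0 <= k y.
  by rewrite divr_ge0 ?powR_ge0 // le_min ler01 divr_ge0 // ltW.
have mdist c : measurable_fun (setT : set (measurableTypeR R)) (fun t : R => `|t - c|).
  by apply: measurableT_comp => //; exact: measurable_funB.
have mr : measurable_fun (setT : set RR) r.
  by apply: measurable_maxr; [exact: (measurableT_comp (mdist _) measurable_fst)|exact: (measurableT_comp (mdist _) measurable_snd)].
have mk : measurable_fun (setT : set RR) k.
  apply: measurable_funM.
    by apply: measurable_minr => //; apply: measurable_funM.
  rewrite (_ : (fun _ => _) = (fun y : RR => r y `^ (- (2 + sg)))).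
    by apply: (measurableT_comp (measurable_powR _)).
  by apply/funext => y; rewrite powRN.
have mQ := @measurable_unit_square R.
pose g (y : R * R) : R := norm2 (v x - v y) `^ p / norm2 (x - y) `^ (2 + sg).
have mg : measurable_fun (setT : set RR) g.
  apply: measurable_funM.
    apply: (measurableT_comp (measurable_powR _)).
    by apply: measurable_norm2; apply: measurable_funB.
  rewrite (_ : (fun _ => _) = (fun y : RR => norm2 (x - y) `^ (- (2 + sg)))).
    apply: (measurableT_comp (measurable_powR _)).
    by apply: measurable_norm2; apply: measurable_funB.
  by apply/funext => y; rewrite powRN.
have gk y : g y <= (4 * M) `^ p * k y.
  have h1 : norm2 (v x - v y) `^ p <= (4 * M) `^ p * Num.min 1 (r y / depth x).
    have m0 : 0 <= Num.min 1 (r y / depth x) by rewrite le_min ler01 divr_ge0 // ltW.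
    apply: (@le_trans _ _ ((4 * M * Num.min 1 (r y / depth x)) `^ p)).
      rewrite ge0_ler_powR ?nnegrE ?norm2_ge0 ?mulr_ge0 //; first exact: le_trans p1.
      exact: box_field_lipschitz.
    rewrite powRM // ler_wpM2l ?powR_ge0 //.
    have [->|n0] := eqVneq (Num.min 1 (r y / depth x)) 0.
      by rewrite powR0 // gt_eqF // (lt_le_trans ltr01).
    by apply: ge1r_powR => //; rewrite lt_neqAle eq_sym n0 m0 ge_min lexx.
  have [rz|rn] := eqVneq (r y) 0.
    have xy : x = y.
      have z1 : `|y.1 - x.1| <= 0 by rewrite -rz /r le_max lexx.
      have z2 : `|y.2 - x.2| <= 0 by rewrite -rz /r le_max lexx orbT.
      rewrite !normr_le0 !subr_eq0 in z1 z2.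
      by rewrite (surjective_pairing x) (surjective_pairing y) (eqP z1) (eqP z2).
    rewrite /g xy subrr norm2_eq0 powR0; last by rewrite gt_eqF // (lt_le_trans ltr01).
    by rewrite mul0r mulr_ge0 ?powR_ge0.
  have {rn}rp : 0 < r y by rewrite lt_neqAle eq_sym rn r0.
  have rn : r y <= norm2 (x - y).
    by apply: le_trans (norm2_max _); rewrite /r /= (distrC y.1) (distrC y.2).
  rewrite /g /k mulrA; apply: ler_pM; rewrite ?powR_ge0 ?invr_ge0 ?powR_ge0 //.
  rewrite lef_pV2 ?posrE ?powR_gt0 //; last exact: lt_le_trans rn.
  rewrite ge0_ler_powR ?nnegrE ?norm2_ge0 //.
  by rewrite addr_ge0 //; case/andP: hs => /ltW.
have Qx := PQ Px.
apply: (@le_trans _ _ (\int[lam2]_(y in unit_square) (((4 * M) `^ p)%:E * (k y)%:E))%E).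
  apply: (@ge0_le_integral _ _ R lam2 _ mQ).
  - by move=> y _; rewrite lee_fin mulr_ge0 ?invr_ge0 ?powR_ge0.
  - by apply/measurable_EFinP; exact: measurable_funS mg.
  - apply/measurable_EFinP; apply: measurable_funM => //; exact: measurable_funS mk.
  - by move=> y _; rewrite lee_fin; exact: gk.
have E : (\int[lam2]_(y in unit_square) (((4 * M) `^ p)%:E * (k y)%:E) =
    ((4 * M) `^ p)%:E * \int[lam2]_(y in unit_square) (k y)%:E)%E.
  apply: (@ge0_integralZl_EFin _ _ R lam2 _ mQ (fun y => (k y)%:E)).
  - by move=> y _; rewrite lee_fin.
  - by apply/measurable_EFinP; exact: measurable_funS mk.
  - by rewrite powR_ge0.
rewrite E -mulrA EFinM; apply: lee_wpmul2l; first by rewrite lee_fin powR_ge0.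
exact: (@kernel_bound R x (depth x) sg d0 hs Qx).
Qed.

(** After scaling, the singularity sits at cx + wx c, in the closed interval of integration, which
    therefore lies within distance 2 wx of it. *)
Lemma line_power (cx wx c : R) : 0 < wx -> `|c| <= 1 ->
  (\int[lam]_(t in `](cx - wx)%R, (cx + wx)%R[) (`|(t - cx) / wx - c|%R `^ (- sg))%:E <=
   (4 * wx / (1 - sg))%:E)%E.
Proof.
move=> w' c1; have /andP[s0 s1] := hs; rewrite ler_norml in c1.
have wn : wx != 0 by rewrite gt_eqF.
pose c' := cx + wx * c.
have E t : `|(t - cx) / wx - c| `^ (- sg) = wx `^ sg * `|t - c'| `^ (- sg).
  have -> : (t - cx) / wx - c = wx^-1 * (t - c') by rewrite /c'; field.
  rewrite normrM ger0_norm ?invr_ge0 ?(ltW w') // powRM ?invr_ge0 ?(ltW w') //.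
  by congr (_ * _); rewrite -powR_inv1 ?(ltW w') // -powRrM mulN1r opprK.
have mD : measurable (`](cx - wx), (cx + wx)[%classic : set (measurableTypeR R)) by exact: measurable_itv.
apply: (@le_trans _ _ ((wx `^ sg)%:E * \int[lam]_(t in `](cx - wx)%R, (cx + wx)%R[) (`|t - c'|%R `^ (- sg))%:E)%E).
  rewrite le_eqVlt; apply/orP; left; apply/eqP.
  transitivity (\int[lam]_(t in `](cx - wx)%R, (cx + wx)%R[) ((wx `^ sg)%:E * (`|t - c'|%R `^ (- sg))%:E))%E.
    by apply: eq_integral => t _; rewrite E EFinM.
  apply: (@ge0_integralZl_EFin _ _ R lam _ mD (fun t => (`|t - c'| `^ (- sg))%:E)).
  - by move=> t _; rewrite lee_fin powR_ge0.
  - exact: measurable_pow_EFin.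
  - by rewrite powR_ge0.
have H := @pow_integral_near R c' (2 * wx) sg ltac:(lra) s1.
have H2 : (\int[lam]_(t in `](cx - wx)%R, (cx + wx)%R[) (`|t - c'|%R `^ (- sg))%:E <=
    (2 * ((2 * wx) `^ (1 - sg) / (1 - sg)))%:E)%E.
  apply: le_trans H; apply: ge0_subset_integral => //.
  - exact: measurable_pow_EFin.
  - move=> t; rewrite /= !in_itv /= /c' => h; nra.
apply: (@le_trans _ _ ((wx `^ sg)%:E * (2 * ((2 * wx) `^ (1 - sg) / (1 - sg)))%:E)%E).
  by apply: lee_wpmul2l => //; rewrite lee_fin powR_ge0.
rewrite -EFinM lee_fin powRM ?(ltW w') //.
have h2 : 2 `^ (1 - sg) <= 2 :> R.
  by rewrite -[leRHS]powRr1 // ler_powR // ?ler1n //; lra.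
have hw : wx `^ sg * wx `^ (1 - sg) = wx.
  by rewrite -powR_add // addrC subrK powRr1 // ltW.
have -> : wx `^ sg * (2 * (2 `^ (1 - sg) * wx `^ (1 - sg) / (1 - sg))) =
  2 `^ (1 - sg) * (2 * (wx `^ sg * wx `^ (1 - sg)) / (1 - sg)) by ring.
rewrite hw; have -> : 4 * wx / (1 - sg) = 2 * (2 * wx / (1 - sg)) by ring.
by rewrite ler_wpM2r // divr_ge0 ?mulr_ge0 ?(ltW w') // subr_ge0 ltW.
Qed.

Let I : set R := `](rcx P - rwx P), (rcx P + rwx P)[%classic.
Let J : set R := `](rcy P - rwy P), (rcy P + rwy P)[%classic.

Let mI : measurable (I : set (measurableTypeR R)). Proof. exact: measurable_itv. Qed.
Let mJ : measurable (J : set (measurableTypeR R)). Proof. exact: measurable_itv. Qed.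

Let const_integral (c wx k : R) : 0 < wx ->
  (\int[lam]_(t in `](c - wx)%R, (c + wx)%R[) (k%:E) = (k * (2 * wx))%:E)%E.
Proof.
move=> w'; have mD : measurable (`](c - wx), (c + wx)[%classic : set (measurableTypeR R)) by exact: measurable_itv.
transitivity (k%:E * lam (`](c - wx)%R, (c + wx)%R[%classic : set R))%E.
  exact: (@integral_cst _ _ R lam _ mD).
have lI : lam (`](c - wx)%R, (c + wx)%R[%classic : set R) = (2 * wx)%:E.
  by rewrite lam_itv; [congr EFin; ring|lra].
by rewrite lI -EFinM.
Qed.

(** The centre may vary with the second coordinate, so that the same bound covers two sides of the
    box and both diagonals. *)
Lemma strip_power1 (c : R -> R) : measurable_fun setT c -> (forall t, J t -> `|c t| <= 1) ->
  (\int[lam2]_(x in inside P) (`|co P 0 x - c x.2| `^ (- sg))%:E <=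
   (8 * rwx P * rwy P / (1 - sg))%:E)%E.
Proof.
move=> mc c1; rewrite inside_itv -/I -/J.
have mf : measurable_fun (setT : set RR) (fun x : R * R => (`|co P 0 x - c x.2| `^ (- sg))%:E).
  apply/measurable_EFinP; apply: (measurableT_comp (measurable_powR _)).
  apply: measurableT_comp => //; apply: measurable_funB; first exact: measurable_co.
  exact: (measurableT_comp mc measurable_snd).
have f0 x : (0 <= (`|co P 0 x - c x.2| `^ (- sg))%:E)%E by rewrite lee_fin powR_ge0.
have H := @tonelli_rect21 R I J _ (cst (4 * rwx P / (1 - sg))%:E) mI mJ mf f0 (measurable_cst _).
apply: (le_trans (H _)); first by move=> y Jy; exact: line_power (c1 _ Jy).
rewrite const_integral // lee_fin le_eqVlt; apply/orP; left; apply/eqP; ring.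
Qed.

Lemma strip_power2 (c : R) : `|c| <= 1 ->
  (\int[lam2]_(x in inside P) (`|co P 1 x - c| `^ (- sg))%:E <=
   (8 * rwx P * rwy P / (1 - sg))%:E)%E.
Proof.
move=> c1; rewrite inside_itv -/I -/J.
have mf : measurable_fun (setT : set RR) (fun x : R * R => (`|co P 1 x - c| `^ (- sg))%:E).
  apply/measurable_EFinP; apply: (measurableT_comp (measurable_powR _)).
  by apply: measurableT_comp => //; apply: measurable_funB; first exact: measurable_co.
have f0 x : (0 <= (`|co P 1 x - c| `^ (- sg))%:E)%E by rewrite lee_fin powR_ge0.
have H := @tonelli_rect12 R I J _ (cst (4 * rwy P / (1 - sg))%:E) mI mJ mf f0 (measurable_cst _).
apply: (le_trans (H _)); first by move=> x Ix; exact: line_power.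
rewrite const_integral // lee_fin le_eqVlt; apply/orP; left; apply/eqP; ring.
Qed.

(** [depth] is a multiple of the smallest of six normalized distances, to the four sides and the two
    diagonals; its negative power is thus one of six terms, and at most their sum. *)
Lemma depth_pow x : inside P x -> depth x `^ (- sg) <= (w / 2) `^ (- sg) *
  (((`|co P 0 x - 1| `^ (- sg) + `|co P 0 x - (-1)| `^ (- sg)) +
    (`|co P 1 x - 1| `^ (- sg) + `|co P 1 x - (-1)| `^ (- sg))) +
   (`|co P 0 x - co P 1 x| `^ (- sg) + `|co P 0 x - (- co P 1 x)| `^ (- sg))).
Proof.
move=> Px; have [A1 B1] := (co_inside 0 x wx0 wy0).1 Px.
rewrite /depth -/w powRM; last 2 first.
- by rewrite divr_ge0 // ltW.
- by rewrite !le_min !subr_ge0 !(ltW A1, ltW B1) normr_ge0.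
rewrite ler_wpM2l ?powR_ge0 //.
move: (co P 0 x) (co P 1 x) A1 B1 => a b A1 B1.
pose f t : R := t `^ (- sg); rewrite -!/(f _).
have f0 t : 0 <= f t by rewrite powR_ge0.
rewrite -/(f (Num.min _ _)).
have H : [\/ Num.min (Num.min (1 - `|a|) (1 - `|b|)) `| `|a| - `|b| | \in [:: `|a - 1|; `|a - (-1)|],
  Num.min (Num.min (1 - `|a|) (1 - `|b|)) `| `|a| - `|b| | \in [:: `|b - 1|; `|b - (-1)|] |
  Num.min (Num.min (1 - `|a|) (1 - `|b|)) `| `|a| - `|b| | \in [:: `|a - b|; `|a - (- b)|]].
  have E (c : R) : `|c| < 1 -> 1 - `|c| \in [:: `|c - 1|; `|c - (-1)|].
    rewrite !inE => c1; move: (c1); rewrite ltr_norml => c1'.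
    have [c0|c0] := leP 0 c.
      by apply/orP; left; apply/eqP; rewrite (ger0_norm c0) ler0_norm; lra.
    by apply/orP; right; apply/eqP; rewrite (ltr0_norm c0) ger0_norm; lra.
  case: (leP _ `| `|a| - `|b| |) => _.
    by case: leP => _; [apply: Or31|apply: Or32]; exact: E.
  apply: Or33; rewrite !inE opprK; case: (lerP 0 a) => a0; case: (lerP 0 b) => b0.
  - by rewrite (ger0_norm a0) (ger0_norm b0) eqxx.
  - by rewrite (ger0_norm a0) (ltr0_norm b0) opprK eqxx orbT.
  - by rewrite (ltr0_norm a0) (ger0_norm b0) -opprD normrN eqxx orbT.
  - by rewrite (ltr0_norm a0) (ltr0_norm b0) -opprD normrN eqxx.
move: (Num.min _ _) H => m.
have := f0 `|a - 1|; have := f0 `|a - -1|; have := f0 `|b - 1|; have := f0 `|b - -1|.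
have := f0 `|a - b|; have := f0 `|a - - b|.
by move=> h1 h2 h3 h4 h5 h6 []; rewrite !inE => /orP[] /eqP ->; move: h1 h2 h3 h4 h5 h6; lra.
Qed.

Let small (f : R * R -> R) (a : R) := [/\ measurable_fun (setT : set RR) f, forall x, 0 <= f x &
  (\int[lam2]_(x in inside P) (f x)%:E <= a%:E)%E].

Let mP : measurable (inside P : set RR). Proof. exact: measurable_inside. Qed.

Let smallD f g a b : small f a -> small g b -> small (fun x => f x + g x) (a + b).
Proof.
move=> [mf f0 hf] [mg g0 hg]; split; [exact: measurable_funD|by move=> x; rewrite addr_ge0|].
apply: (@le_trans _ _ (\int[lam2]_(x in inside P) (f x)%:E + \int[lam2]_(x in inside P) (g x)%:E)%E).
  rewrite le_eqVlt; apply/orP; left; apply/eqP.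
  apply: (@ge0_integralD _ _ R lam2 _ mP (fun y => (f y)%:E) (fun y => (g y)%:E)).
  - by move=> y _; rewrite lee_fin.
  - by apply/measurable_EFinP; exact: measurable_funS mf.
  - by move=> y _; rewrite lee_fin.
  - by apply/measurable_EFinP; exact: measurable_funS mg.
by rewrite EFinD; apply: leeD.
Qed.

Let smallZ f k a : 0 <= k -> small f a -> small (fun x => k * f x) (k * a).
Proof.
move=> k0 [mf f0 hf]; split; [exact: measurable_funM|by move=> x; rewrite mulr_ge0|].
apply: (@le_trans _ _ (k%:E * \int[lam2]_(x in inside P) (f x)%:E)%E).
  rewrite le_eqVlt; apply/orP; left; apply/eqP.
  apply: (@ge0_integralZl_EFin _ _ R lam2 _ mP (fun y => (f y)%:E)) => //.
  - by move=> y _; rewrite lee_fin.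
  - by apply/measurable_EFinP; exact: measurable_funS mf.
by rewrite EFinM; apply: lee_wpmul2l.
Qed.

Let mpow (f g : R * R -> R) : measurable_fun (setT : set RR) f -> measurable_fun (setT : set RR) g ->
  measurable_fun (setT : set RR) (fun x => `|f x - g x| `^ (- sg)).
Proof.
move=> mf mg; apply: (measurableT_comp (measurable_powR _)).
by apply: measurableT_comp => //; exact: measurable_funB.
Qed.

(** Six terms of 8 wx wy / (1 - sg) and the factor 2 that bounds (1/2)^(-sg) give 96. A thin
    rectangle does no harm: wx wy is w times the longer half side, and this w absorbs w^(-sg)
    because sg < 1, which leaves only the upper bound [l] of the half sides. *)
Lemma box_integral (Phi : R * R -> \bar R) (K : R) : 0 <= K ->
  measurable_fun (setT : set RR) Phi -> (forall x, (0 <= Phi x)%E) ->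
  (forall x, inside P x -> 0 < depth x -> (Phi x <= (K * depth x `^ (- sg))%:E)%E) ->
  (\int[lam2]_(x in inside P) Phi x <= (K * (96 / (1 - sg)) * l `^ (2 - sg))%:E)%E.
Proof.
move=> K0 mPhi Phi0 hPhi; have /andP[s0 s1] := hs.
pose B := 8 * rwx P * rwy P / (1 - sg).
have mco i : measurable_fun (setT : set RR) (co P i : RR -> R) by exact: measurable_co.
have S1 c : `|c| <= 1 -> small (fun x => `|co P 0 x - c| `^ (- sg)) B.
  move=> c1; split; [exact: mpow|by move=> x; rewrite powR_ge0|].
  by apply: (@strip_power1 (cst c)) => //; exact: measurable_cst.
have S2 c : `|c| <= 1 -> small (fun x => `|co P 1 x - c| `^ (- sg)) B.
  by move=> c1; split; [exact: mpow|by move=> x; rewrite powR_ge0|exact: strip_power2].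
pose b t := (t - rcy P) / rwy P.
have mb : measurable_fun (setT : set (measurableTypeR R)) b by apply: measurable_funM => //; exact: measurable_funB.
have b1 t : J t -> `|b t| <= 1 by move=> Jt; apply/ltW; exact: norm_b.
have S3 : small (fun x => `|co P 0 x - co P 1 x| `^ (- sg)) B.
  split; [exact: mpow|by move=> x; rewrite powR_ge0|].
  exact: (@strip_power1 b).
have S4 : small (fun x => `|co P 0 x - (- co P 1 x)| `^ (- sg)) B.
  split; [apply: mpow => //; exact: measurableT_comp|by move=> x; rewrite powR_ge0|].
  apply: (@strip_power1 (fun t => - b t)); first exact: measurableT_comp.
  by move=> t Jt; rewrite normrN b1.
have n1 : `|1 : R| <= 1 by rewrite normr1.
have n2 : `|-1 : R| <= 1 by rewrite normrN1.
have Kw : 0 <= K * (w / 2) `^ (- sg) by rewrite mulr_ge0 ?powR_ge0.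
have [mT T0 hT] := smallZ Kw (smallD (smallD (smallD (S1 _ n1) (S1 _ n2)) (smallD (S2 _ n1) (S2 _ n2))) (smallD S3 S4)).
have hB : K * (w / 2) `^ (- sg) * (((B + B) + (B + B)) + (B + B)) <= K * (96 / (1 - sg)) * l `^ (2 - sg).
  have l0 : 0 < l by rewrite (lt_le_trans wx0).
  have wl : w `^ (- sg) * (rwx P * rwy P) <= l `^ (2 - sg).
    have -> : rwx P * rwy P = w * Num.max (rwx P) (rwy P) by rewrite /w; case: (leP (rwx P)) => _; rewrite // mulrC.
    rewrite mulrA -{2}(powRr1 (ltW w0)) -(powR_add _ _ w0).
    have -> : 2 - sg = (- sg + 1) + 1 by ring.
    rewrite (powR_add _ 1 l0) (powRr1 (ltW l0)); apply: ler_pM; rewrite ?powR_ge0 //.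
    - by rewrite le_max (ltW wx0).
    - rewrite ge0_ler_powR ?nnegrE ?(ltW w0) ?(ltW l0) //; first lra.
      by rewrite ge_min lx.
    - by rewrite ge_max lx.
  have w2 : (w / 2) `^ (- sg) <= 2 * w `^ (- sg).
    rewrite powRM ?(ltW w0) ?invr_ge0 // mulrC ler_wpM2r ?powR_ge0 //.
    rewrite -powR_inv1 // -powRrM mulN1r opprK -[leRHS]powRr1 // ler_powR ?ler1n //; exact: ltW.
  have -> : K * (w / 2) `^ (- sg) * (B + B + (B + B) + (B + B)) =
     K * (48 / (1 - sg)) * ((w / 2) `^ (- sg) * (rwx P * rwy P)) by rewrite /B; ring.
  have -> : K * (96 / (1 - sg)) * l `^ (2 - sg) = K * (48 / (1 - sg)) * (2 * l `^ (2 - sg)) by ring.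
  apply: ler_wpM2l; first by rewrite mulr_ge0 // divr_ge0 // subr_ge0 ltW.
  apply: (@le_trans _ _ (2 * (w `^ (- sg) * (rwx P * rwy P)))); last by rewrite ler_wpM2l.
  by rewrite [leRHS]mulrA ler_wpM2r // mulr_ge0 // ltW.
rewrite -lee_fin in hB; apply: le_trans hB; apply: le_trans hT.
apply: (@ae_ge0_le_integral _ _ R lam2 _ mP).
- by move=> x _.
- exact: measurable_funS mPhi.
- by move=> x _; rewrite lee_fin.
- by apply/measurable_EFinP; exact: measurable_funS mT.
(* On the diagonals the depth is 0 and the hypothesis on [Phi] says nothing. *)
exists ([set x | rdif P 0 x = 0] `&` unit_square `|` [set x | rdif P 1 x = 0] `&` unit_square).
have mr i : measurable ([set x | rdif P i x = 0] `&` unit_square : set RR).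
  apply: measurableI; last exact: measurable_unit_square.
  have := measurable_rdif P i measurableT (measurable_set1 0); rewrite setTI.
  by rewrite (_ : _ @^-1` [set 0] = [set x | rdif P i x = 0]).
split; first exact: measurableU.
  exact: null_set_setU (mr _) (mr _) (lam2_rdif0 wx0 wy0 _) (lam2_rdif0 wx0 wy0 _).
move=> x /=; apply: contra_notP => /not_orP[r0 r1] Px.
have dp : 0 < depth x.
  rewrite /depth mulr_gt0 ?divr_gt0 // !lt_min !subr_gt0.
  have [-> ->] := (co_inside 0 x wx0 wy0).1 Px.
  rewrite normr_gt0 subr_eq0 /= eqr_norm2; apply/norP; split; apply/eqP => e.
    by apply: r0; split; [rewrite /rdif e subrr|exact: PQ].
  have e2 : co P 2 x = - co P 0 x by [].
  by apply: r1; split; [rewrite /rdif e2 e opprK subrr|exact: PQ].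
apply: (le_trans (hPhi _ Px dp)); rewrite lee_fin -mulrA ler_wpM2l //.
exact: depth_pow.
Qed.

End box_kernel.

(** * Cells and stages *)

Section cuts.
Context {R : realType}.
Local Notation RR := (measurableTypeR R * measurableTypeR R)%type.

Implicit Types (P : @rect R) (i : nat) (d : bool) (kap w c : R).

Definition side (d : bool) : R := if d then 1 else -1.

(* The part of P where side d * (co P (odd i) x - kap) > 0. *)
Definition cut (P : @rect R) (i : nat) (d : bool) (kap : R) : rect :=
  if odd i then Rect (rcx P) (rcy P + rwy P * ((kap + side d) / 2))
                     (rwx P) (rwy P * ((1 - side d * kap) / 2))
  else Rect (rcx P + rwx P * ((kap + side d) / 2)) (rcy P)
            (rwx P * ((1 - side d * kap) / 2)) (rwy P).

Lemma co0E P x : co P 0 x = (x.1 - rcx P) / rwx P. Proof. by []. Qed.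

Lemma co1E P x : co P 1 x = (x.2 - rcy P) / rwy P. Proof. by []. Qed.

Lemma sideP d : side d = 1 \/ side d = -1.
Proof. by case: d; [left|right]. Qed.

Lemma inside_cut P i d kap x : 0 < rwx P -> 0 < rwy P -> -1 <= kap <= 1 ->
  inside (cut P i d kap) x <-> inside P x /\ 0 < side d * (co P (odd i) x - kap).
Proof.
move=> wx0 wy0 hk.
have H w c t : 0 < w -> `|t - (c + w * ((kap + side d) / 2))| < w * ((1 - side d * kap) / 2) <->
    `|t - c| < w /\ 0 < side d * ((t - c) / w - kap).
  move=> w0; have wa : t - c = w * ((t - c) / w) by rewrite mulrC divfK // gt_eqF.
  have -> : t - (c + w * ((kap + side d) / 2)) = w * ((t - c) / w - (kap + side d) / 2) by rewrite mulrBr -wa; ring.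
  rewrite {2}wa; move: ((t - c) / w) => a; rewrite !normrM (gtr0_norm w0) ltr_pM2l // gtr_pMr //.
  by rewrite !ltr_norml; case: (sideP d) => ->; split; lra.
rewrite /inside /cut; case: (odd i) => /=.
  by rewrite (H (rwy P)) //; tauto.
by rewrite (H (rwx P)) //; tauto.
Qed.

Lemma co_cut P i d kap x : 0 < rwx P -> 0 < rwy P -> side d * kap < 1 ->
  co P (odd i) x = (kap + side d) / 2 + (1 - side d * kap) / 2 * co (cut P i d kap) (odd i) x.
Proof.
move=> wx0 wy0 hk; have h : 1 - side d * kap != 0 by rewrite subr_eq0 gt_eqF.
have [hx hy] : rwx P != 0 /\ rwy P != 0 by rewrite !gt_eqF.
rewrite /cut; move: (side d) h => z h; case: (odd i); rewrite ?co0E ?co1E /=.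
  by field; rewrite h hy.
by field; rewrite h hx.
Qed.

(** A cut at an end of the rectangle leaves one part of width 0, which has no interior. Such parts
    stay in the families and are treated as a separate case. *)
Lemma cut_pos P i d kap : 0 < rwx P -> 0 < rwy P -> -1 <= kap <= 1 ->
  side d * kap < 1 \/ inside (cut P i d kap) = set0.
Proof.
move=> wx0 wy0 hk; have [h|h] := ltP (side d * kap) 1; [by left|right].
apply/seteqP; split => x // /(inside_cut i d x wx0 wy0 hk)[Px].
have [A B] : `|co P 0 x| < 1 /\ `|co P 1 x| < 1 by apply/(co_inside 0 x wx0 wy0).
have : `|co P (odd i) x| < 1 by case: (odd i).
by rewrite ltr_norml; case: (sideP d) => e; rewrite e in h *; lra.
Qed.

Lemma rw_cut P i d kap : 0 < rwx P -> 0 < rwy P -> -1 <= kap <= 1 ->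
  [/\ 0 <= rwx (cut P i d kap) <= rwx P, 0 <= rwy (cut P i d kap) <= rwy P &
   side d * kap < 1 -> 0 < rwx (cut P i d kap) /\ 0 < rwy (cut P i d kap)].
Proof.
move=> wx0 wy0 hk.
have h : 0 <= (1 - side d * kap) / 2 <= 1 by case: (sideP d) => ->; lra.
have H w : 0 < w -> 0 <= w * ((1 - side d * kap) / 2) <= w.
  by move=> w0; case/andP: h => h1 h2; rewrite mulr_ge0 ?(ltW w0) //= ler_piMr // ltW.
rewrite /cut; case: (odd i) => /=; rewrite H // lexx ?(ltW wx0) ?(ltW wy0); split => // k1.
  by split => //; rewrite mulr_gt0 // divr_gt0 // subr_gt0.
by split => //; rewrite mulr_gt0 // divr_gt0 // subr_gt0.
Qed.

Lemma cut_line_null P i kap : 0 < rwx P -> 0 < rwy P ->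
  lam2.-negligible [set x | co P (odd i) x = kap].
Proof.
move=> wx0 wy0; case: (odd i) => /=.
  exists [set x | x.2 = rcy P + rwy P * kap]; split; [exact: (measurable_line _).2|exact: hline_null|].
  by move=> x /= <-; rewrite mulrC divfK ?gt_eqF // addrC subrK.
exists [set x | x.1 = rcx P + rwx P * kap]; split; [exact: (measurable_line _).1|exact: vline_null|].
by move=> x /= <-; rewrite mulrC divfK ?gt_eqF // addrC subrK.
Qed.

Lemma cut_cover P i kap x : 0 < rwx P -> 0 < rwy P -> -1 <= kap <= 1 ->
  inside P x -> co P (odd i) x <> kap -> exists d, inside (cut P i d kap) x.
Proof.
move=> wx0 wy0 hk Px ne; have [h|h|//] := ltgtP (co P (odd i) x) kap.
  by exists false; apply/inside_cut => //; split => //; rewrite /side; lra.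
by exists true; apply/inside_cut => //; split => //; rewrite /side; lra.
Qed.

Lemma cut_disjoint P i kap x : 0 < rwx P -> 0 < rwy P -> -1 <= kap <= 1 ->
  inside (cut P i false kap) x -> inside (cut P i true kap) x -> False.
Proof.
by move=> wx0 wy0 hk /inside_cut[] // _ h1 /inside_cut[] // _; move: h1; rewrite /side; lra.
Qed.

End cuts.

Section families.
Context {R : realType} {T : finType}.
Local Notation RR := (measurableTypeR R * measurableTypeR R)%type.
Variable D : T -> set (R * R).
Hypothesis mD : forall t, measurable (D t : set RR).

Definition covers := exists2 N : set (R * R), lam2.-negligible N &
  forall x, unit_square x -> ~ N x -> exists t, D t x.

Definition disjoint_family := forall t t' x, D t x -> D t' x -> t = t'.

Lemma integral_le_cover (Phi : R * R -> \bar R) : covers ->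
  measurable_fun (setT : set RR) Phi -> (forall x, (0 <= Phi x)%E) ->
  (\int[lam2]_(x in unit_square) Phi x <= \sum_t \int[lam2]_(x in D t) Phi x)%E.
Proof.
move=> [N0 [N [mN N0' NN]] cov] mf f0.
have H (r : seq T) (S : set (R * R)) : measurable (S : set RR) ->
    (forall x, S x -> exists2 t, t \in r & D t x) ->
    (\int[lam2]_(x in S) Phi x <= \sum_(t <- r) \int[lam2]_(x in D t) Phi x)%E.
  elim: r S => [|t r IH] S mS hS.
    have -> : S = set0 by apply/seteqP; split => x // /hS[].
    by rewrite integral_set0 big_nil.
  have mSt : measurable (S `\` D t : set RR) by exact: measurableD.
  rewrite big_cons; apply: (@le_trans _ _ (\int[lam2]_(x in D t) Phi x + \int[lam2]_(x in S `\` D t) Phi x)%E).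
    apply: (@integral_cover _ _ R lam2 _ _ _ _ (mD t) mSt mS) => // x Sx.
    by have [h|h] := pselect (D t x); [left|right].
  apply: leeD => //; apply: IH => // x [/hS[t']]; rewrite inE => /orP[/eqP -> //|h1 h2 _].
  by exists t'.
have mQ := @measurable_unit_square R.
have mQN : measurable (unit_square `\` N : set RR) by exact: measurableD.
apply: (@le_trans _ _ (\int[lam2]_(x in N) Phi x + \int[lam2]_(x in unit_square `\` N) Phi x)%E).
  apply: (@integral_cover _ _ R lam2 _ _ _ _ mN mQN mQ) => // x Qx.
  by have [h|h] := pselect (N x); [left|right].
have -> : (\int[lam2]_(x in N) Phi x = 0)%E.
  by apply: (@null_set_integral _ _ R lam2 _ _ mN) => //; exact: measurable_funS mf.
rewrite add0e; apply: H => // x [Qx nN]; have [t Dt] := cov x Qx (fun h => nN (NN _ h)).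
by exists t => //; rewrite mem_index_enum.
Qed.

Lemma sum_measure_le (S : set (R * R)) : disjoint_family -> measurable (S : set RR) ->
  (\sum_t lam2 (S `&` D t) <= lam2 S)%E.
Proof.
move=> dis mS.
have H (r : seq T) : uniq r -> forall S : set (R * R), measurable (S : set RR) ->
    (\sum_(t <- r) lam2 (S `&` D t) <= lam2 S)%E.
  elim: r => [|t r IH] /=; first by move=> _ S0 _; rewrite big_nil.
  move=> /andP[tr ur] S0 mS0; rewrite big_cons.
  have m1 : measurable (S0 `&` D t : set RR) by exact: measurableI.
  have m2 : measurable (S0 `\` D t : set RR) by exact: measurableD.
  have -> : lam2 S0 = (lam2 (S0 `&` D t) + lam2 (S0 `\` D t))%E.
    rewrite addeC; exact: (@measureDI _ _ R lam2 _ _ mS0 (mD t)).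
  rewrite leeD2l //; apply: le_trans (IH ur _ m2).
  rewrite big_seq [leRHS]big_seq; apply: lee_sum => t' t'r.
  rewrite (_ : S0 `&` D t' = (S0 `\` D t) `&` D t') //.
  apply/seteqP; split => x [a b]; last by split => //; case: a.
  split => //; split => // Dt; have e := dis _ _ _ Dt b.
  by rewrite e t'r in tr.
by apply: H => //; exact: index_enum_uniq.
Qed.

End families.

Section cells.
Context {R : realType}.
Local Notation RR := (measurableTypeR R * measurableTypeR R)%type.

Definition root : @rect R := Rect 2^-1 2^-1 2^-1 2^-1.

Lemma inside_root : inside root = unit_square.
Proof.
rewrite inside_itv /unit_square /=.
by have -> : 2^-1 - 2^-1 = 0 :> R; [ring|have -> : 2^-1 + 2^-1 = 1 :> R by field].
Qed.

(** The head of the list is the most recent halving; its direction is the parity of the number of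
    earlier ones. *)
Fixpoint cell (s : seq bool) : @rect R :=
  if s is d :: s' then cut (cell s') (size s') d 0 else root.

(** 2^(-n/2), the square root of the area of a cell of size [n]. *)
Definition side_bound (n : nat) : R := (2^-1 `^ (2^-1)) ^+ n.

Lemma side_bound_sqr (n : nat) : side_bound n ^+ 2 = 2^-1 ^+ n.
Proof. by rewrite /side_bound -!exprM mulnC exprM powR12_sqrt ?invr_ge0 // sqr_sqrtr ?invr_ge0. Qed.

Lemma side_bound_gt0 n : 0 < side_bound n.
Proof. by rewrite exprn_gt0 // powR_gt0. Qed.

Lemma side_boundSS n : side_bound n.+2 = side_bound n / 2.
Proof.
rewrite /side_bound !exprS mulrA mulrC; congr (_ * _).
by rewrite powR12_sqrt ?invr_ge0 // -expr2 sqr_sqrtr ?invr_ge0.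
Qed.

Lemma side_boundS_le n : side_bound n.+1 <= side_bound n.
Proof.
rewrite /side_bound exprS ler_piMl ?exprn_ge0 ?powR_ge0 //.
have h : 2^-1 `^ 2^-1 * 2^-1 `^ 2^-1 = 2^-1 :> R.
  by rewrite powR12_sqrt ?invr_ge0 // -expr2 sqr_sqrtr ?invr_ge0.
move: h; set b := 2^-1 `^ 2^-1; have b0 : 0 <= b by exact: powR_ge0.
nra.
Qed.

Let z11 : -1 <= (0 : R) <= 1. Proof. by rewrite oppr_le0 ler01. Qed.

(** Halving one side shifts its bound by two indices, while the change of parity exchanges the roles
    of the sides; so the pair of bounds with indices n + 1 and n + 2 is invariant. *)
Lemma cell_widths s :
  [/\ 0 < rwx (cell s), 0 < rwy (cell s),
      2 * rwx (cell s) * (2 * rwy (cell s)) = 2^-1 ^+ size s,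
      (if odd (size s) then rwy (cell s) else rwx (cell s)) <= side_bound (size s).+1 &
      (if odd (size s) then rwx (cell s) else rwy (cell s)) <= side_bound (size s).+2].
Proof.
elim: s => [|d s [x0 y0 area h1 h2]].
  have b2 : side_bound 2 = 2^-1 by rewrite side_boundSS /side_bound expr0 mul1r.
  rewrite b2 /= expr0 mulfV ?mul1r //; split => //; rewrite ?invr_gt0 //.
  by rewrite -b2 side_boundS_le.
have [/andP[wx _] /andP[wy _] pos] := rw_cut (size s) d x0 y0 z11.
have [wx0 wy0] := pos ltac:(by rewrite mulr0).
have e : 2 * rwx (cut (cell s) (size s) d 0) * (2 * rwy (cut (cell s) (size s) d 0)) =
  2 * rwx (cell s) * (2 * rwy (cell s)) / 2.
  by rewrite /cut mulr0 subr0; case: (odd _) => /=; field.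
split => //=.
- by rewrite e area exprS mulrC.
- move: h2; rewrite /cut mulr0 subr0; case: (odd _) => /=; exact.
- move: h1; rewrite side_boundSS /cut mulr0 subr0; case: (odd _) => /= h; lra.
Qed.

Lemma cell_le s : rwx (cell s) <= side_bound (size s) /\ rwy (cell s) <= side_bound (size s).
Proof.
have [_ _ _ h1 h2] := cell_widths s.
have l1 := side_boundS_le (size s); have l2 := side_boundS_le (size s).+1.
by move: h1 h2; case: (odd _) => h1 h2; split; lra.
Qed.

Lemma cell_sub d s : inside (cell (d :: s)) `<=` inside (cell s).
Proof.
have [x0 y0 _ _ _] := cell_widths s.
by move=> x /(inside_cut _ _ _ x0 y0 z11)[].
Qed.

Lemma cell_unit s : inside (cell s) `<=` unit_square.
Proof.
elim: s => [|d s IH]; first by rewrite inside_root.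
by apply: subset_trans IH; exact: cell_sub.
Qed.

Lemma cell_disjoint s s' x : size s = size s' -> inside (cell s) x -> inside (cell s') x -> s = s'.
Proof.
elim: s s' => [|d s IH] [|d' s'] //= [e] h1 h2.
have es : s = s' by exact: IH e (cell_sub h1) (cell_sub h2).
rewrite -es in h2 *; congr (_ :: _).
have [x0 y0 _ _ _] := cell_widths s.
by case: d d' h1 h2 => -[] // h1 h2; exfalso; [apply: (cut_disjoint x0 y0 z11 h2 h1)|apply: (cut_disjoint x0 y0 z11 h1 h2)].
Qed.

(** Countably many lines, off which every point of the square lies in a cell of each size. *)
Definition cell_lines : set (R * R) :=
  \bigcup_s [set x | co (cell s) (odd (size s)) x = 0].

Lemma cell_lines_null : lam2.-negligible cell_lines.
Proof.
pose F (n : nat) : set (R * R) := if (unpickle n : option (seq bool)) is Some s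
  then [set x | co (cell s) (odd (size s)) x = 0] else set0.
have FN n : lam2.-negligible (F n).
  rewrite /F; case: (unpickle n) => [s|]; last exact: negligible_set0.
  by have [x0 y0 _ _ _] := cell_widths s; exact: cut_line_null.
apply: negligibleS (@negligible_bigcup _ _ R lam2 F FN) => x [s _ h].
by exists (pickle s) => //; rewrite /F pickleK.
Qed.

Lemma cell_cover n x : unit_square x -> ~ cell_lines x -> exists s : n.-tuple bool, inside (cell s) x.
Proof.
move=> Qx nl; elim: n => [|n [s sx]]; first by exists [tuple]; rewrite /= inside_root.
have [x0 y0 _ _ _] := cell_widths s.
have ne : co (cell s) (odd (size s)) x <> 0 by move=> e; apply: nl; exists (s : seq bool).
by have [d dx] := cut_cover x0 y0 z11 sx ne; exists [tuple of d :: s].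
Qed.

Definition stage_box n (kap : seq bool -> R) (t : n.-tuple bool * bool) : rect :=
  cut (cell t.1) n t.2 (kap t.1).

Section stage.
Variables (n : nat) (kap : seq bool -> R).
Implicit Type t : n.-tuple bool * bool.
Hypothesis hk : forall s, -1 <= kap s <= 1.

Lemma stage_cell t : inside (stage_box kap t) `<=` inside (cell t.1).
Proof.
have [x0 y0 _ _ _] := cell_widths t.1.
by move=> x /(inside_cut _ _ _ x0 y0 (hk _))[].
Qed.

Lemma stage_unit t : inside (stage_box kap t) `<=` unit_square.
Proof. by apply: subset_trans (@cell_unit t.1); exact: stage_cell. Qed.

Lemma stage_disjoint : disjoint_family (fun t : n.-tuple bool * bool => inside (stage_box kap t)).
Proof.
move=> [s d] [s' d'] x h1 h2.
have e : s = s'.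
  by apply/val_inj/(cell_disjoint (x := x)); [rewrite !size_tuple|exact: stage_cell h1|exact: stage_cell h2].
rewrite -e in h2 *; congr (_, _).
have [x0 y0 _ _ _] := cell_widths s.
by case: d d' h1 h2 => -[] // h1 h2; exfalso; [apply: (cut_disjoint x0 y0 (hk _) h2 h1)|apply: (cut_disjoint x0 y0 (hk _) h1 h2)].
Qed.

Lemma stage_covers : covers (fun t : n.-tuple bool * bool => inside (stage_box kap t)).
Proof.
exists (cell_lines `|` \big[setU/set0]_(s : n.-tuple bool) [set x | co (cell s) (odd n) x = kap s]).
  apply: negligibleU; first exact: cell_lines_null.
  apply: (big_ind (fun A => lam2.-negligible A)); first exact: negligible_set0.
    by move=> A B; exact: negligibleU.
  by move=> s _; have [x0 y0 _ _ _] := cell_widths s; exact: cut_line_null.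
move=> x Qx /not_orP[n1 n2]; have [s sx] := cell_cover n Qx n1.
have [x0 y0 _ _ _] := cell_widths s.
have ne : co (cell s) (odd n) x <> kap s.
  move=> e; apply: n2; rewrite -bigcup_seq; exists s => //=; exact: mem_index_enum.
by have [d dx] := cut_cover x0 y0 (hk _) sx ne; exists (s, d).
Qed.

Lemma stage_pos t : (0 < rwx (stage_box kap t) /\ 0 < rwy (stage_box kap t)) \/
  inside (stage_box kap t) = set0.
Proof.
have [x0 y0 _ _ _] := cell_widths t.1.
have [h|h] := cut_pos n t.2 x0 y0 (hk t.1); [left|by right].
by have [_ _ /(_ h)] := rw_cut n t.2 x0 y0 (hk t.1).
Qed.

Lemma stage_le t : rwx (stage_box kap t) <= side_bound n /\ rwy (stage_box kap t) <= side_bound n.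
Proof.
have [x0 y0 _ _ _] := cell_widths t.1; have [l1 l2] := cell_le t.1.
rewrite size_tuple in l1 l2.
have [/andP[_ h1] /andP[_ h2] _] := rw_cut n t.2 x0 y0 (hk t.1).
by split; [exact: le_trans l1|exact: le_trans l2].
Qed.

End stage.
End cells.

(** * Norms of a field assembled from disjoint rectangles *)

Section field.
Context {R : realType} {T : finType}.
Local Notation RR := (measurableTypeR R * measurableTypeR R)%type.
Variables (P : T -> @rect R) (om : T -> R) (l W : R).
Hypothesis pos : forall t, (0 < rwx (P t) /\ 0 < rwy (P t)) \/ inside (P t) = set0.
Hypothesis unit : forall t, inside (P t) `<=` unit_square.
Hypothesis lP : forall t, rwx (P t) <= l /\ rwy (P t) <= l.
Hypothesis omW : forall t, 0 <= om t <= W.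
Hypothesis dis : disjoint_family (fun t => inside (P t)).
Hypothesis l0 : 0 <= l.
Hypothesis W0 : 0 <= W.

(** A sum instead of a choice of the rectangle that contains [x]: measurability and integrals are
    then taken term by term, and disjointness leaves at most one nonzero term at each point. *)
Definition field (x : R * R) : R * R :=
  (\sum_t (box_field (P t) (om t) x).1, \sum_t (box_field (P t) (om t) x).2).

Lemma field_in t x : inside (P t) x -> field x = box_field (P t) (om t) x.
Proof.
move=> Ptx; rewrite /field (bigD1 t) //= [X in _ + X]big1 ?addr0; last first.
  move=> t' ne; rewrite box_field_out // => Pt'x.
  by rewrite (dis Ptx Pt'x) eqxx in ne.
rewrite (bigD1 t) //= [X in _ + X]big1 ?addr0 -?surjective_pairing //.
move=> t' ne; rewrite box_field_out // => Pt'x.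
by rewrite (dis Ptx Pt'x) eqxx in ne.
Qed.

Lemma field_out x : (forall t, ~ inside (P t) x) -> field x = (0, 0).
Proof. by move=> h; rewrite /field !big1 // => t _; rewrite box_field_out. Qed.

Let M0 : 0 <= W * l. Proof. exact: mulr_ge0. Qed.

Lemma field_bound x : `|(field x).1| <= W * l /\ `|(field x).2| <= W * l.
Proof.
have [[t Pt]|h] := pselect (exists t, inside (P t) x); last first.
  by rewrite field_out ?normr0 // => t Pt; apply: h; exists t.
rewrite (field_in Pt); have [[x0 y0]|e] := pos t; last by rewrite e in Pt.
have /andP[p0 pW] := omW t; have [l1 l2] := lP t.
have [h1 h2] := box_field_bound x0 y0 p0 x.
by split; [apply: le_trans h1 _|apply: le_trans h2 _]; apply: ler_pM => //; exact: ltW.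
Qed.

Lemma measurable_field : measurable_fun (setT : set RR) (fun x => (field x).1) /\
  measurable_fun (setT : set RR) (fun x => (field x).2).
Proof.
split.
  rewrite (_ : (fun _ => _) = (fun x : RR => \sum_t (box_field (P t) (om t) x).1)) //.
  by apply: measurable_sum => t; exact: (measurable_box_field _ _).1.
rewrite (_ : (fun _ => _) = (fun x : RR => \sum_t (box_field (P t) (om t) x).2)) //.
by apply: measurable_sum => t; exact: (measurable_box_field _ _).2.
Qed.

Let mQ := @measurable_unit_square R.
Let Qfin : (lam2 (@unit_square R) < +oo)%E.
Proof. by rewrite lam2_unit_square ltry. Qed.

Let Qroot : inside (@root R) = unit_square. Proof. exact: inside_root. Qed.

Lemma box_on_unit (phi : R * R -> R) (w : R * R) t (c : R * R -> R) :
  smooth phi -> (forall x, `|c (box_field (P t) (om t) x)| <= W * l) -> c (0, 0) = 0 ->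
  measurable_fun (setT : set RR) (fun x => c (box_field (P t) (om t) x)) ->
  lam2.-integrable unit_square (EFin \o (fun x => c (box_field (P t) (om t) x) * 'D_w phi x)) /\
  \int[lam2]_(x in unit_square) (c (box_field (P t) (om t) x) * 'D_w phi x) =
  \int[lam2]_(x in inside (P t)) (c (box_field (P t) (om t) x) * 'D_w phi x).
Proof.
move=> sphi cb c0 mc; have [C C0 hC] := derive_bounded (@root R) sphi w; split.
  apply: (@bounded_integrable _ _ _ lam2 _ _ (W * l * C)) => //.
    apply: measurable_funM; first exact: measurable_funS mc.
    by apply: (@measurable_funS _ _ _ _ setT) => //; exact: measurable_derive.
  move=> x Qx; rewrite normrM; apply: ler_pM => //; apply: hC; by rewrite Qroot.
rewrite [LHS]Rintegral_mkcond [RHS]Rintegral_mkcond; apply: eq_Rintegral => x _.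
rewrite !patchE; case: ifPn => h1; case: ifPn => h2 //.
  by rewrite box_field_out ?c0 ?mul0r // => Px; rewrite mem_set in h2.
by rewrite mem_set // in h1; apply: (unit (t := t)); exact: set_mem h2.
Qed.

Let comp_ok t : [/\ (forall x, `|(box_field (P t) (om t) x).1| <= W * l),
  (forall x, `|(box_field (P t) (om t) x).2| <= W * l),
  measurable_fun (setT : set RR) (fun x => (box_field (P t) (om t) x).1) &
  measurable_fun (setT : set RR) (fun x => (box_field (P t) (om t) x).2)].
Proof.
have [m1 m2] := measurable_box_field (P t) (om t).
have H x : `|(box_field (P t) (om t) x).1| <= W * l /\ `|(box_field (P t) (om t) x).2| <= W * l.
  have [Pt|nP] := pselect (inside (P t) x); last by rewrite box_field_out // normr0.
  by rewrite -(field_in Pt); exact: field_bound.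
by split => // x; case: (H x).
Qed.

Lemma Rintegral_big_sum (S : set (R * R)) (f : T -> R * R -> R) : measurable (S : set RR) ->
  (forall t, lam2.-integrable S (EFin \o f t)) ->
  lam2.-integrable S (EFin \o (fun x => \sum_t f t x)) /\
  \int[lam2]_(x in S) (\sum_t f t x) = \sum_t \int[lam2]_(x in S) f t x.
Proof.
move=> mS fi.
elim: (index_enum T) => [|t r [IH1 IH2]].
  rewrite big_nil; split.
    by under eq_fun do rewrite big_nil; exact: integrable0.
  under eq_Rintegral do rewrite big_nil.
  by rewrite /Rintegral integral0.
have E : (EFin \o (fun x => \sum_(u <- t :: r) f u x)) = (EFin \o f t) \+ (EFin \o (fun x => \sum_(u <- r) f u x)).
  by apply/funext => x /=; rewrite big_cons EFinD.
split; first by rewrite E; exact: integrableD.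
under eq_Rintegral do rewrite big_cons.
by rewrite RintegralD // IH2 big_cons.
Qed.

Lemma field_integral (phi : R * R -> R) (w : R * R) : smooth phi ->
  [/\ lam2.-integrable unit_square (EFin \o (fun x => (field x).1 * 'D_w phi x)),
      lam2.-integrable unit_square (EFin \o (fun x => (field x).2 * 'D_w phi x)),
      \int[lam2]_(x in unit_square) ((field x).1 * 'D_w phi x) =
        \sum_t \int[lam2]_(x in inside (P t)) ((box_field (P t) (om t) x).1 * 'D_w phi x) &
      \int[lam2]_(x in unit_square) ((field x).2 * 'D_w phi x) =
        \sum_t \int[lam2]_(x in inside (P t)) ((box_field (P t) (om t) x).2 * 'D_w phi x)].
Proof.
move=> sphi.
have B1 t := let: And4 b1 _ m1 _ := comp_ok t in box_on_unit (c := fst) w sphi b1 erefl m1.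
have B2 t := let: And4 _ b2 _ m2 := comp_ok t in box_on_unit (c := snd) w sphi b2 erefl m2.
have [i1 e1] := Rintegral_big_sum mQ (fun t => (B1 t).1).
have [i2 e2] := Rintegral_big_sum mQ (fun t => (B2 t).1).
have F1 : (fun x => (field x).1 * 'D_w phi x) = (fun x => \sum_t ((box_field (P t) (om t) x).1 * 'D_w phi x)).
  by apply/funext => x; rewrite /field /= mulr_suml.
have F2 : (fun x => (field x).2 * 'D_w phi x) = (fun x => \sum_t ((box_field (P t) (om t) x).2 * 'D_w phi x)).
  by apply/funext => x; rewrite /field /= mulr_suml.
rewrite F1 F2; split => //.
  by rewrite e1; apply: eq_bigr => t _; exact: (B1 t).2.
by rewrite e2; apply: eq_bigr => t _; exact: (B2 t).2.
Qed.

Lemma field_flux : no_normal_flux field.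
Proof.
move=> phi sphi.
have [i1 _ e1 _] := field_integral (1, 0) sphi.
have [_ i2 _ e2] := field_integral (0, 1) sphi.
have [m1 m2] := measurable_field.
rewrite integral_leb2 //; last first.
  apply/measurable_EFinP; apply: (@measurable_funS _ _ _ _ setT) => //.
  by apply: measurable_funD; apply: measurable_funM => //; exact: measurable_derive.
have E : (\int[lam2]_(x in unit_square) ((field x).1 * 'D_(1%R, 0%R) phi x + (field x).2 * 'D_(0%R, 1%R) phi x))%R = 0%R.
  rewrite (@RintegralD _ _ _ lam2 _ _ _ mQ i1 i2) e1 e2 -big_split /= big1 // => t _.
  have [[x0 y0]|e] := pos t; last by rewrite e !Rintegral_set0 addr0.
  have /andP[p0 _] := omW t.
  have [j1 j2] := box_field_integrable x0 y0 p0 sphi.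
  rewrite -(@RintegralD _ _ _ lam2 _ _ _ (@measurable_inside _ (P t)) j1 j2).
  exact: box_field_flux.
have I := @integrableD _ _ R lam2 _ mQ _ _ i1 i2.
transitivity (0%R%:E : \bar R); last by [].
rewrite -E /Rintegral fineK; last exact: integrable_fin_num I.
by [].
Qed.

Lemma field_L1 : (L1_norm field <= (2 * (W * l))%:E)%E.
Proof.
have [m1 m2] := measurable_field.
have mn : measurable_fun (setT : set RR) (fun x => norm2 (field x)) by exact: measurable_norm2.
rewrite /L1_norm integral_leb2 //; last by apply/measurable_EFinP; exact: measurable_funS mn.
apply: (@le_trans _ _ (\int[lam2]_(x in unit_square) (2 * (W * l))%:E)%E).
  apply: (@ge0_le_integral _ _ R lam2 _ mQ).
  - by move=> x _; rewrite lee_fin norm2_ge0.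
  - by apply/measurable_EFinP; exact: measurable_funS mn.
  - exact: measurable_cst.
  - move=> x _; rewrite lee_fin; apply: (le_trans (norm2_le _)).
    by have [h1 h2] := field_bound x; rewrite mulr_natl mulr2n lerD.
apply: (@le_trans _ _ ((2 * (W * l))%:E * lam2 (@unit_square R))%E).
  by rewrite le_eqVlt; apply/orP; left; apply/eqP; exact: (@integral_cst _ _ R lam2 _ mQ).
by rewrite lam2_unit_square mule1.
Qed.

Lemma field_variation (phi : R * R -> R) : smooth phi -> (forall z, `|phi z| <= 1) ->
  [/\ `|\int[lam2]_(x in unit_square) ((field x).1 * 'D_(1, 0) phi x)| <= #|T|%:R * (16 * W * l ^+ 2),
      `|\int[lam2]_(x in unit_square) ((field x).1 * 'D_(0, 1) phi x)| <= #|T|%:R * (16 * W * l ^+ 2),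
      `|\int[lam2]_(x in unit_square) ((field x).2 * 'D_(1, 0) phi x)| <= #|T|%:R * (16 * W * l ^+ 2) &
      `|\int[lam2]_(x in unit_square) ((field x).2 * 'D_(0, 1) phi x)| <= #|T|%:R * (16 * W * l ^+ 2)].
Proof.
move=> sphi p1.
have [_ _ e1 e2] := field_integral (1, 0) sphi.
have [_ _ e3 e4] := field_integral (0, 1) sphi.
have C0 : 0 <= 16 * W * l ^+ 2 by rewrite !mulr_ge0 ?exprn_ge0.
have S (f : T -> R) : (forall t, `|f t| <= 16 * W * l ^+ 2) -> `|\sum_t f t| <= #|T|%:R * (16 * W * l ^+ 2).
  move=> h; apply: (le_trans (ler_norm_sum _ _ _)).
  apply: (@le_trans _ _ (\sum_(t : T) (16 * W * l ^+ 2))); first by apply: ler_sum => t _.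
  by move: (16 * W * l ^+ 2) => C; rewrite sumr_const mulr_natl.
have K t a b : 0 <= a <= l -> 0 <= b <= l -> 8 * (om t * a) * (2 * b) <= 16 * W * l ^+ 2.
  move=> /andP[a0 al] /andP[b0 bl]; have /andP[p0 pW] := omW t.
  have -> : 8 * (om t * a) * (2 * b) = 16 * (om t * (a * b)) by ring.
  rewrite -mulrA ler_wpM2l // expr2; apply: ler_pM => //; first exact: mulr_ge0.
  exact: ler_pM.
have Bt t : [/\ `|\int[lam2]_(x in inside (P t)) ((box_field (P t) (om t) x).1 * 'D_(1, 0) phi x)| <= 16 * W * l ^+ 2,
      `|\int[lam2]_(x in inside (P t)) ((box_field (P t) (om t) x).1 * 'D_(0, 1) phi x)| <= 16 * W * l ^+ 2,
      `|\int[lam2]_(x in inside (P t)) ((box_field (P t) (om t) x).2 * 'D_(1, 0) phi x)| <= 16 * W * l ^+ 2 &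
      `|\int[lam2]_(x in inside (P t)) ((box_field (P t) (om t) x).2 * 'D_(0, 1) phi x)| <= 16 * W * l ^+ 2].
  have [[x0 y0]|e] := pos t; last first.
    have Z (f : R * R -> R) : `|\int[lam2]_(x in inside (P t)) f x| <= 16 * W * l ^+ 2.
      by rewrite e /Rintegral integral_set0 normr0.
    by split; exact: Z.
  have /andP[p0 _] := omW t; have [lx ly] := lP t.
  have hx : 0 <= rwx (P t) <= l by rewrite ltW.
  have hy : 0 <= rwy (P t) <= l by rewrite ltW.
  have [v1 v2 v3 v4] := box_field_variation x0 y0 p0 sphi p1.
  split; [apply: le_trans v1 _|apply: le_trans v2 _|apply: le_trans v3 _|apply: le_trans v4 _]; exact: K.
split.
- by rewrite e1; apply: S => t; case: (Bt t) => h _ _ _; exact: h.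
- by rewrite e3; apply: S => t; case: (Bt t) => _ h _ _; exact: h.
- by rewrite e2; apply: S => t; case: (Bt t) => _ _ h _; exact: h.
- by rewrite e4; apply: S => t; case: (Bt t) => _ _ _ h; exact: h.
Qed.

(** Each rectangle contributes at most 8 W l times 2 l to each of the four entries of the gradient;
    the bound on the Frobenius norm of the test field bounds its entries by 1. *)
Lemma field_BV : (BV_norm field <= (2 * (W * l) + 4 * (#|T|%:R * (16 * W * l ^+ 2)))%:E)%E.
Proof.
rewrite /BV_norm EFinD; apply: leeD; first exact: field_L1.
apply: ub_ereal_sup => _ [Phi1 [Phi2 [[t1 t2 t3 t4] [hle ->]]]].
have [m1 m2] := measurable_field.
pose a x := (Phi1 x).1; pose b x := (Phi1 x).2; pose c x := (Phi2 x).1; pose d x := (Phi2 x).2.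
have [sa _ _] := t1; have [sb _ _] := t2; have [sc _ _] := t3; have [sd _ _] := t4.
have sq (x y : R) : x ^+ 2 + y <= 1 -> 0 <= y -> `|x| <= 1.
  by move=> h y0; rewrite -ler_sqr ?nnegrE // expr1n real_normK ?num_real //; lra.
have h1 z : `|a z| <= 1.
  have := hle z; rewrite /dot2 -!expr2 -/(a z) -/(b z) -/(c z) -/(d z) => h.
  have := sqr_ge0 (a z); have := sqr_ge0 (b z); have := sqr_ge0 (c z); have := sqr_ge0 (d z) => q1 q2 q3 q4.
  by apply: (sq _ (1 - a z ^+ 2)); lra.
have h2 z : `|b z| <= 1.
  have := hle z; rewrite /dot2 -!expr2 -/(a z) -/(b z) -/(c z) -/(d z) => h.
  have := sqr_ge0 (a z); have := sqr_ge0 (b z); have := sqr_ge0 (c z); have := sqr_ge0 (d z) => q1 q2 q3 q4.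
  by apply: (sq _ (1 - b z ^+ 2)); lra.
have h3 z : `|c z| <= 1.
  have := hle z; rewrite /dot2 -!expr2 -/(a z) -/(b z) -/(c z) -/(d z) => h.
  have := sqr_ge0 (a z); have := sqr_ge0 (b z); have := sqr_ge0 (c z); have := sqr_ge0 (d z) => q1 q2 q3 q4.
  by apply: (sq _ (1 - c z ^+ 2)); lra.
have h4 z : `|d z| <= 1.
  have := hle z; rewrite /dot2 -!expr2 -/(a z) -/(b z) -/(c z) -/(d z) => h.
  have := sqr_ge0 (a z); have := sqr_ge0 (b z); have := sqr_ge0 (c z); have := sqr_ge0 (d z) => q1 q2 q3 q4.
  by apply: (sq _ (1 - d z ^+ 2)); lra.
have [ia _ _ _] := field_integral (1, 0) sa; have [ib _ _ _] := field_integral (0, 1) sb.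
have [_ ic _ _] := field_integral (1, 0) sc; have [_ id' _ _] := field_integral (0, 1) sd.
have [va _ _ _] := field_variation sa h1; have [_ vb _ _] := field_variation sb h2.
have [_ _ vc _] := field_variation sc h3; have [_ _ _ vd] := field_variation sd h4.
have E x : (field x).1 * divergence Phi1 x + (field x).2 * divergence Phi2 x =
  ((field x).1 * 'D_(1, 0) a x + (field x).1 * 'D_(0, 1) b x) +
  ((field x).2 * 'D_(1, 0) c x + (field x).2 * 'D_(0, 1) d x) by rewrite /divergence !mulrDr.
have mD (g : R * R -> R) w : smooth g -> measurable_fun (setT : set RR) ('D_w g) by move=> sg; exact: measurable_derive.
rewrite integral_leb2 //; last first.
  apply/measurable_EFinP; apply: (@measurable_funS _ _ _ _ setT) => //.
  by apply: measurable_funD; apply: measurable_funM => //; apply: measurable_funD; exact: mD.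
have I1 := @integrableD _ _ R lam2 _ mQ _ _ ia ib.
have I2 := @integrableD _ _ R lam2 _ mQ _ _ ic id'.
have I := @integrableD _ _ R lam2 _ mQ _ _ I1 I2.
pose g x := ((field x).1 * 'D_(1, 0) a x + (field x).1 * 'D_(0, 1) b x) +
  ((field x).2 * 'D_(1, 0) c x + (field x).2 * 'D_(0, 1) d x).
have Ig : lam2.-integrable unit_square (EFin \o g) by exact: I.
rewrite (_ : (\int[lam2]_(x in unit_square) _ = (\int[lam2]_(x in unit_square) g x)%:E)%E); last first.
  rewrite /Rintegral fineK; last exact: integrable_fin_num Ig.
  by apply: eq_integral => x _; rewrite E.
rewrite lee_fin /g (@RintegralD _ _ _ lam2 _ _ _ mQ I1 I2) (@RintegralD _ _ _ lam2 _ _ _ mQ ia ib) (@RintegralD _ _ _ lam2 _ _ _ mQ ic id').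
rewrite (_ : 4 * _ = (#|T|%:R * (16 * W * l ^+ 2) + #|T|%:R * (16 * W * l ^+ 2)) +
  (#|T|%:R * (16 * W * l ^+ 2) + #|T|%:R * (16 * W * l ^+ 2))); last by ring.
by apply: lerD; apply: lerD; [exact: le_trans (ler_norm _) va|exact: le_trans (ler_norm _) vb|
  exact: le_trans (ler_norm _) vc|exact: le_trans (ler_norm _) vd].
Qed.

Lemma measurable_gagliardo sg p : measurable_fun (setT : set RR) (gagliardo sg p field).
Proof.
have [m1 m2] := measurable_field.
pose g (z : (R * R) * (R * R)) : R := norm2 (field z.1 - field z.2) `^ p / norm2 (z.1 - z.2) `^ (2 + sg).
pose f (z : (R * R) * (R * R)) : \bar R := (g z * \1_(@unit_square R) z.2)%:E.
have mg : measurable_fun (setT : set (RR * RR)) g.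
  have mfst (h : R * R -> R) : measurable_fun (setT : set RR) h -> measurable_fun (setT : set (RR * RR)) (fun z => h z.1).
    by move=> mh; exact: (measurableT_comp mh measurable_fst).
  have msnd (h : R * R -> R) : measurable_fun (setT : set RR) h -> measurable_fun (setT : set (RR * RR)) (fun z => h z.2).
    by move=> mh; exact: (measurableT_comp mh measurable_snd).
  apply: measurable_funM.
    apply: (measurableT_comp (measurable_powR _)); apply: measurable_norm2.
      by apply: measurable_funB; [exact: mfst m1|exact: msnd m1].
    by apply: measurable_funB; [exact: mfst m2|exact: msnd m2].
  rewrite (_ : (fun _ => _) = (fun z : RR * RR => norm2 (z.1 - z.2) `^ (- (2 + sg)))).
    apply: (measurableT_comp (measurable_powR _)); apply: measurable_norm2.
      by apply: measurable_funB; [exact: mfst measurable_fst|exact: msnd measurable_fst].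
    by apply: measurable_funB; [exact: mfst measurable_snd|exact: msnd measurable_snd].
  by apply/funext => y; rewrite powRN.
have mf : measurable_fun (setT : set (RR * RR)) f.
  apply/measurable_EFinP; apply: measurable_funM => //.
  have mi : measurable_fun (setT : set RR) (\1_(@unit_square R) : RR -> R) by exact: measurable_indic.
  exact: (measurableT_comp mi measurable_snd).
have f0 z : (0 <= f z)%E.
  by rewrite lee_fin mulr_ge0 // divr_ge0 // powR_ge0.
have := @measurable_fun_fubini_tonelli_F _ _ _ _ R lam2 f mf f0.
apply: eq_measurable_fun => x _; rewrite /fubini_F /gagliardo [RHS]integral_mkcond.
apply: eq_integral => y _; rewrite /f indicE patchE /g /=.
by case: ifP => _; rewrite ?mulr1 ?mulr0.
Qed.

Lemma gagliardo_ge0 sg p x : (0 <= gagliardo sg p field x)%E.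
Proof. by apply: integral_ge0 => y _; rewrite lee_fin divr_ge0 // powR_ge0. Qed.

(** Only the outer integral is split over the rectangles. The inner one runs over the whole square,
    and [box_field_lipschitz] covers the pairs of points in different rectangles as well. *)
Lemma field_gagliardo sg p : covers (fun t => inside (P t)) -> 1 <= p -> 0 < sg < 1 ->
  (\int[lam2]_(x in unit_square) gagliardo sg p field x <=
   (#|T|%:R * ((4 * (W * l)) `^ p * kernel_constant sg * (96 / (1 - sg)) * l `^ (2 - sg)))%:E)%E.
Proof.
move=> cov p1 hs; have [m1 m2] := measurable_field; have /andP[s0 s1] := hs.
have mP t : measurable (inside (P t) : set RR) by exact: measurable_inside.
apply: (le_trans (integral_le_cover mP cov (measurable_gagliardo sg p) (gagliardo_ge0 sg p))).
have kc0 : 0 <= kernel_constant sg by rewrite addr_ge0 ?sqr_ge0.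
have K0 : 0 <= (4 * (W * l)) `^ p * kernel_constant sg by rewrite mulr_ge0 ?powR_ge0.
set B := _ * _ * _ * _.
have B0 : 0 <= B.
  have c0 : 0 <= 96 / (1 - sg) by rewrite divr_ge0 // subr_ge0 ltW.
  by apply: mulr_ge0; [exact: mulr_ge0|exact: powR_ge0].
apply: (@le_trans _ _ (\sum_(t : T) B%:E)%E); last first.
  by rewrite sumEFin lee_fin; move: (B) => b; rewrite sumr_const mulr_natl.
apply: lee_sum => t _.
have [[x0 y0]|e] := pos t; last by rewrite e integral_set0 lee_fin.
have /andP[p0 pW] := omW t; have [lx ly] := lP t.
have hx : om t * rwx (P t) <= W * l by rewrite ler_pM // ltW.
have hy : om t * rwy (P t) <= W * l by rewrite ler_pM // ltW.
apply: (@box_integral _ (P t) sg l x0 y0 (unit (t := t)) hs lx ly _ _ K0 (measurable_gagliardo sg p) (gagliardo_ge0 sg p)).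
move=> x Px dx; apply: (@gagliardo_inner _ (P t) (om t) (W * l) sg) => //.
- by move=> y Py; exact: field_in.
- exact: field_bound.
Qed.

Lemma field_sobolev s p : covers (fun t => inside (P t)) -> 1 <= p -> 0 < s -> s * p < 1 ->
  (sobolev_seminorm s p field <=
   ((#|T|%:R * ((4 * (W * l)) `^ p * kernel_constant (s * p) * (96 / (1 - s * p)) * l `^ (2 - s * p))) `^ p^-1)%:E)%E.
Proof.
move=> cov p1 s0 sp; have p0 : 0 < p by rewrite (lt_le_trans ltr01).
have hs : 0 < s * p < 1 by rewrite mulr_gt0.
rewrite /sobolev_seminorm (gt_eqF s0) -poweR_EFin.
have [m1 m2] := measurable_field.
have mg x : measurable_fun (setT : set RR) (fun y => norm2 (field x - field y) `^ p / norm2 (x - y) `^ (2 + s * p)).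
  apply: measurable_funM.
    by apply: (measurableT_comp (measurable_powR _)); apply: measurable_norm2; exact: measurable_funB.
  rewrite (_ : (fun _ => _) = (fun y : RR => norm2 (x - y) `^ (- (2 + s * p)))).
    by apply: (measurableT_comp (measurable_powR _)); apply: measurable_norm2; exact: measurable_funB.
  by apply/funext => y; rewrite powRN.
have E x : (\int[leb2]_(y in unit_square) (norm2 (field x - field y) `^ p / norm2 (x - y) `^ (2 + s * p))%:E =
   gagliardo (s * p) p field x)%E.
  by rewrite integral_leb2 //; apply/measurable_EFinP; exact: measurable_funS (mg x).
have -> : (\int[leb2]_(x in unit_square) \int[leb2]_(y in unit_square)
    (norm2 (field x - field y) `^ p / norm2 (x - y) `^ (2 + s * p))%:E =
   \int[lam2]_(x in unit_square) gagliardo (s * p) p field x)%E.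
  rewrite -integral_leb2 //; last exact: measurable_funS (measurable_gagliardo _ _).
  by apply: eq_integral => x _; exact: E.
have I0 : (0 <= \int[lam2]_(x in unit_square) gagliardo (s * p) p field x)%E.
  by apply: integral_ge0 => x _; exact: gagliardo_ge0.
have G := field_gagliardo cov p1 hs.
apply: gt0_ler_poweR => //; rewrite ?invr_ge0 ?(ltW p0) //.
  by rewrite in_itv /= I0 leey.
by rewrite in_itv /= leey andbT; exact: le_trans G.
Qed.

Lemma field_sobolev0 p : 1 <= p -> (sobolev_seminorm 0 p field <= (2 * (W * l))%:E)%E.
Proof.
move=> p1; have p0 : 0 < p by rewrite (lt_le_trans ltr01).
rewrite /sobolev_seminorm eqxx; have [m1 m2] := measurable_field.
have M20 : 0 <= 2 * (W * l) by rewrite mulr_ge0.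
have mn : measurable_fun (setT : set RR) (fun x => norm2 (field x) `^ p).
  by apply: (measurableT_comp (measurable_powR _)); exact: measurable_norm2.
rewrite integral_leb2 //; last by apply/measurable_EFinP; exact: measurable_funS mn.
have H : (\int[lam2]_(x in unit_square) (norm2 (field x) `^ p)%:E <= ((2 * (W * l)) `^ p)%:E)%E.
  apply: (@le_trans _ _ (\int[lam2]_(x in unit_square) ((2 * (W * l)) `^ p)%:E)%E).
    apply: (@ge0_le_integral _ _ R lam2 _ mQ).
    - by move=> x _; rewrite lee_fin powR_ge0.
    - by apply/measurable_EFinP; exact: measurable_funS mn.
    - exact: measurable_cst.
    - move=> x _; rewrite lee_fin ge0_ler_powR ?nnegrE ?norm2_ge0 ?(ltW p0) //.
      apply: (le_trans (norm2_le _)).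
      by have [h1 h2] := field_bound x; rewrite mulr_natl mulr2n lerD.
  apply: (@le_trans _ _ (((2 * (W * l)) `^ p)%:E * lam2 (@unit_square R))%E).
    by rewrite le_eqVlt; apply/orP; left; apply/eqP; exact: (@integral_cst _ _ R lam2 _ mQ).
  by rewrite lam2_unit_square mule1.
have -> : ((2 * (W * l))%:E = ((2 * (W * l)) `^ p)%:E `^ p^-1)%E.
  by rewrite poweR_EFin -powRrM mulfV ?gt_eqF // powRr1.
have I0 : (0 <= \int[lam2]_(x in unit_square) (norm2 (field x) `^ p)%:E)%E.
  by apply: integral_ge0 => x _; rewrite lee_fin powR_ge0.
apply: gt0_ler_poweR => //; rewrite ?invr_ge0 ?(ltW p0) //.
  by rewrite in_itv /= I0 leey.
by rewrite in_itv /= leey andbT lee_fin powR_ge0.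
Qed.

End field.

(** * Redistribution of mass *)

Section mass.
Context {R : realType}.
Local Notation RR := (measurableTypeR R * measurableTypeR R)%type.
Implicit Types (w : R * R -> R) (N B S : set (R * R)) (P : @rect R).

Definition mass w N : R := \int[lam2]_(x in N) w x.
Definition vol N : R := fine (lam2 (N : set RR)).

Lemma sub_unit_fin N : measurable (N : set RR) -> N `<=` unit_square -> (lam2 N < +oo)%E.
Proof.
move=> mN NQ; apply: (@le_lt_trans _ _ (lam2 (@unit_square R))); last by rewrite lam2_unit_square ltry.
by apply: le_measure; rewrite ?inE //; exact: measurable_unit_square.
Qed.

Lemma volE N : measurable (N : set RR) -> N `<=` unit_square -> lam2 N = (vol N)%:E.
Proof. by move=> mN NQ; rewrite /vol fineK // ge0_fin_numE //; exact: sub_unit_fin. Qed.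

Lemma vol_ge0 N : 0 <= vol N.
Proof. exact: fine_ge0. Qed.

Lemma vol_mass N : measurable (N : set RR) -> vol N = mass (cst 1) N.
Proof. by move=> mN; rewrite /mass Rintegral_cst // mul1r. Qed.

Section additivity.
Variables (w : R * R -> R) (C : R).
Hypothesis mw : measurable_fun (setT : set RR) w.
Hypothesis wC : forall x, `|w x| <= C.

Lemma mass_integrable N : measurable (N : set RR) -> N `<=` unit_square -> lam2.-integrable N (EFin \o w).
Proof.
move=> mN NQ; apply: (@bounded_integrable _ _ _ lam2 _ _ C) => //; first exact: sub_unit_fin.
exact: measurable_funS mw.
Qed.

Lemma massE N : measurable (N : set RR) -> N `<=` unit_square ->
  (\int[lam2]_(x in N) (w x)%:E = (mass w N)%:E)%E.
Proof.
by move=> mN NQ; rewrite /mass /Rintegral fineK //; exact: integrable_fin_num (mass_integrable mN NQ).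
Qed.

Lemma mass_split N B : measurable (N : set RR) -> measurable (B : set RR) -> N `<=` unit_square ->
  mass w N = mass w (N `&` B) + mass w (N `\` B).
Proof.
move=> mN mB NQ; rewrite /mass -Rintegral_setU.
- by rewrite setUIDK.
- exact: measurableI.
- exact: measurableD.
- by rewrite setUIDK; exact: mass_integrable.
- by apply/disj_setPS => x [[_ h] [_]].
Qed.

Lemma mass_null N : measurable (N : set RR) -> lam2 N = 0%E -> mass w N = 0.
Proof. by move=> mN N0; rewrite /mass /Rintegral (@integral_null _ _ R lam2) //; exact: mN. Qed.

Lemma mass_cut P i kap N : 0 < rwx P -> 0 < rwy P -> -1 <= kap <= 1 -> inside P `<=` unit_square ->
  measurable (N : set RR) -> N `<=` inside P ->
  mass w N = mass w (N `&` inside (cut P i false kap)) + mass w (N `&` inside (cut P i true kap)).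
Proof.
move=> x0 y0 hk PQ mN NP.
have mi d : measurable (inside (cut P i d kap) : set RR) by exact: measurable_inside.
have NQ : N `<=` unit_square by exact: subset_trans PQ.
rewrite (mass_split mN (mi false) NQ); congr (_ + _).
have mD : measurable (N `\` inside (cut P i false kap) : set RR) by exact: measurableD.
have DQ : N `\` inside (cut P i false kap) `<=` unit_square by move=> x [/NQ].
rewrite (mass_split mD (mi true) DQ) [X in _ + X]mass_null ?addr0.
- congr (mass _ _); apply/seteqP; split => x [h1 h2]; split => //; first by case: h1.
  by split => // h3; exact: (cut_disjoint x0 y0 hk h3 h2).
- exact: measurableD.
- have [Z [mZ Z0 ZN]] := cut_line_null i kap x0 y0.
  apply/eqP; rewrite -measure_le0 -Z0; apply: le_measure; rewrite ?inE //; first exact: measurableD.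
  move=> x [[Nx n1] n2]; apply: ZN => /=; apply: contrapT => ne.
  by have [[] ] := cut_cover x0 y0 hk (NP _ Nx) ne.
Qed.

(** The hypothesis for the subset where [w] is negative bounds its mass below by 0, so changing the
    sign there cannot increase the total. *)
Lemma abs_mass N : measurable (N : set RR) -> N `<=` unit_square ->
  (forall N', measurable (N' : set RR) -> N' `<=` N -> 0 <= mass w N') ->
  mass (fun x => `|w x|) N <= mass w N.
Proof.
move=> mN NQ h.
pose B : set (R * R) := [set x | 0 <= w x].
have mB : measurable (B : set RR).
  have := mw measurableT (measurable_itv `[0, +oo[); rewrite setTI.
  by rewrite (_ : _ @^-1` _ = B) //; apply/seteqP; split => x; rewrite /B /= in_itv /= andbT.
have mI : measurable (N `&` B : set RR) by exact: measurableI.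
have mD : measurable (N `\` B : set RR) by exact: measurableD.
have ma : measurable_fun (setT : set RR) (fun x => `|w x|) by exact: measurableT_comp.
have ia : lam2.-integrable N (EFin \o (fun x => `|w x|)).
  apply: (@bounded_integrable _ _ _ lam2 _ _ C) => //; first exact: sub_unit_fin.
    exact: measurable_funS ma.
  by move=> x _; rewrite normr_id.
have e : mass (fun x => `|w x|) N = mass (fun x => `|w x|) (N `&` B) + mass (fun x => `|w x|) (N `\` B).
  rewrite /mass -Rintegral_setU ?setUIDK //.
  by apply/disj_setPS => x [[_ h1] [_]].
rewrite e (mass_split mN mB NQ).
have e1 : mass (fun x => `|w x|) (N `&` B) = mass w (N `&` B).
  by apply: eq_Rintegral => x; rewrite inE => -[_ h1]; rewrite ger0_norm.
have e2 : mass (fun x => `|w x|) (N `\` B) = - mass w (N `\` B).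
  rewrite /mass -mulN1r -RintegralZl //; last by apply: mass_integrable => // x [/NQ].
  by apply: eq_Rintegral => x; rewrite inE => -[_ h1]; rewrite mulN1r ltr0_norm // ltNge; apply/negP.
have := h _ mD (@subDsetl _ _ _); rewrite e1 e2; lra.
Qed.

End additivity.

Lemma vol_split N B : measurable (N : set RR) -> measurable (B : set RR) -> N `<=` unit_square ->
  vol N = vol (N `&` B) + vol (N `\` B).
Proof.
move=> mN mB NQ; rewrite !vol_mass //; [|exact: measurableD|exact: measurableI].
by apply: (@mass_split _ 1) => // x; rewrite normr1.
Qed.

Lemma vol_cut P i kap N : 0 < rwx P -> 0 < rwy P -> -1 <= kap <= 1 -> inside P `<=` unit_square ->
  measurable (N : set RR) -> N `<=` inside P ->
  vol N = vol (N `&` inside (cut P i false kap)) + vol (N `&` inside (cut P i true kap)).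
Proof.
move=> x0 y0 hk PQ mN NP; have mi d : measurable (inside (cut P i d kap) : set RR) by exact: measurable_inside.
rewrite !vol_mass //; [|exact: measurableI|exact: measurableI].
by apply: (@mass_cut _ 1) => // x; rewrite normr1.
Qed.

Lemma vol_sub N B : measurable (N : set RR) -> measurable (B : set RR) -> B `<=` unit_square ->
  N `<=` B -> vol N <= vol B.
Proof.
move=> mN mB BQ NB; rewrite (vol_split mB mN BQ) (_ : B `&` N = N) ?lerDl ?vol_ge0 //.
by apply/setIidPr.
Qed.

(* On P, the density w is the indicator of S, up to a null set. *)
Definition holds w P S := forall N, measurable (N : set RR) -> N `<=` inside P ->
  mass w N = vol (N `&` S).

Lemma holds_sub w P P' S S' : inside P' `<=` inside P ->
  (forall x, inside P' x -> S x <-> S' x) -> holds w P S -> holds w P' S'.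
Proof.
move=> PP e h N mN NP; rewrite (h _ mN (subset_trans NP PP)).
congr vol; apply/seteqP; split => x [Nx Sx]; split => //; exact/(e _ (NP _ Nx)).
Qed.

(** The integrated form of 0 <= w <= 1 almost everywhere on [P], with total mass [a]. In the middle
    of a stage this is all that is kept of the density. *)
Definition filled w P (a : R) :=
  (forall N, measurable (N : set RR) -> N `<=` inside P -> 0 <= mass w N <= vol N) /\
  mass w (inside P) = a.

Lemma filled_cut w C P i kap a b : measurable_fun (setT : set RR) w -> (forall x, `|w x| <= C) ->
  0 < rwx P -> 0 < rwy P -> -1 <= kap <= 1 -> inside P `<=` unit_square ->
  filled w (cut P i false kap) a -> filled w (cut P i true kap) b -> filled w P (a + b).
Proof.
move=> mw wC x0 y0 hk PQ [h1 e1] [h2 e2].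
have mi d : measurable (inside (cut P i d kap) : set RR) by exact: measurable_inside.
have sub d : inside (cut P i d kap) `<=` inside P by move=> x /(inside_cut _ _ _ x0 y0 hk)[].
split.
  move=> N mN NP; rewrite (mass_cut mw wC i x0 y0 hk PQ mN NP) (vol_cut i x0 y0 hk PQ mN NP).
  have /andP[a1 b1] := h1 (N `&` inside (cut P i false kap)) (measurableI _ _ mN (mi _)) (@subIsetr _ _ _).
  have /andP[a2 b2] := h2 (N `&` inside (cut P i true kap)) (measurableI _ _ mN (mi _)) (@subIsetr _ _ _).
  move: a1 b1 a2 b2; move: (mass _ _) (mass _ _) (vol _) (vol _) => x1 x2 x3 x4 a1 b1 a2 b2.
  by apply/andP; split; [exact: addr_ge0|exact: lerD].
rewrite (mass_cut mw wC i x0 y0 hk PQ (measurable_inside P) (@subset_refl _ _)) -e1 -e2.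
by congr (mass _ _ + mass _ _); apply/setIidPr; exact: sub.
Qed.

(** By equality of the total masses, the integral of 1 - w over the part in [S] equals that of w
    over the part outside. Their sum is the distance, and the common value is at most the area of
    either part. *)
Lemma filled_L1 w C P S : measurable_fun (setT : set RR) w -> (forall x, `|w x| <= C) ->
  inside P `<=` unit_square -> measurable (S : set RR) -> filled w P (vol (inside P `&` S)) ->
  mass (fun x => `|w x - \1_S x|) (inside P) <=
    2 * Num.min (vol (inside P `&` S)) (vol (inside P `\` S)).
Proof.
move=> mw wC PQ mS [hf e].
have mP : measurable (inside P : set RR) by exact: measurable_inside.
have mI : measurable (inside P `&` S : set RR) by exact: measurableI.
have mD : measurable (inside P `\` S : set RR) by exact: measurableD.
have IQ : inside P `&` S `<=` unit_square by move=> x [/PQ].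
have DQ : inside P `\` S `<=` unit_square by move=> x [/PQ].
have m1S : measurable_fun (setT : set RR) (\1_S : RR -> R) by exact: measurable_indic.
pose g x : R := `|w x - \1_S x|.
have mg : measurable_fun (setT : set RR) g.
  by apply: measurableT_comp => //; exact: measurable_funB.
have i1 x : `|\1_S x : R| <= 1 by rewrite indicE; case: (_ \in _); rewrite ?normr1 ?normr0.
have gC x : `|g x| <= C + 1.
  by rewrite normr_id (le_trans (ler_normB _ _)) // lerD.
rewrite (mass_split mg gC mP mS PQ).
pose w' x : R := 1 - w x.
have mw' : measurable_fun (setT : set RR) w' by exact: measurable_funB.
have wC' x : `|w' x| <= 1 + C by rewrite (le_trans (ler_normB _ _)) // normr1 lerD.
have w'E N : measurable (N : set RR) -> N `<=` unit_square -> mass w' N = vol N - mass w N.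
  move=> mN NQ; rewrite vol_mass // /mass -RintegralB //.
    by apply: (@mass_integrable _ 1) => // x; rewrite normr1.
  exact: mass_integrable mw wC _ mN NQ.
have A1 : mass g (inside P `&` S) <= vol (inside P `&` S) - mass w (inside P `&` S).
  rewrite -w'E //; apply: le_trans (abs_mass mw' wC' mI IQ _).
    rewrite le_eqVlt; apply/orP; left; apply/eqP; apply: eq_Rintegral => x; rewrite inE => -[_ Sx].
    by rewrite /g /w' indicE mem_set // distrC.
  move=> N mN NP; have NQ := subset_trans NP IQ; rewrite w'E // subr_ge0.
  by have /andP[] := hf N mN (fun x h => (NP x h).1).
have A2 : mass g (inside P `\` S) <= mass w (inside P `\` S).
  apply: le_trans (abs_mass mw wC mD DQ _).
    rewrite le_eqVlt; apply/orP; left; apply/eqP; apply: eq_Rintegral => x; rewrite inE => -[_ Sx].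
    by rewrite /g indicE memNset // subr0.
  by move=> N mN NP; have /andP[] := hf N mN (fun x h => (NP x h).1).
have s := mass_split mw wC mP mS PQ; rewrite e in s.
have /andP[b1 b2] := hf _ mI (@subIsetl _ _ _).
have /andP[b3 b4] := hf _ mD (@subDsetl _ _ _).
have := vol_ge0 (inside P `&` S).
move: (vol (inside P `&` S)) (vol (inside P `\` S)) s b1 b2 b3 b4 A1 A2 => x y.
move: (mass w (inside P `&` S)) (mass w (inside P `\` S)) (mass g _) (mass g _) => *.
by case: (leP x y); lra.
Qed.

End mass.

Section stage_evolution.
Context {R : realType}.
Local Notation RR := (measurableTypeR R * measurableTypeR R)%type.
Variables (a b M C : R) (v : R * R -> R * R) (w : R -> R * R -> R).
Hypothesis a0 : 0 <= a.
Hypothesis b1 : b <= 1.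
Hypothesis M0 : 0 <= M.
Hypothesis hw : forall t, a <= t <= b ->
  measurable_fun (setT : set RR) (w t) /\ forall x, `|w t x| <= C.
Hypothesis ev1 : forall t t', a <= t -> t <= t' -> t' <= b ->
  weak_evolution v t t' 1 (cst 1) (cst 1).
Hypothesis ev : forall t t', a <= t -> t <= t' -> t' <= b ->
  weak_evolution v t t' M (w t) (w t').

Section box.
Variables (P : @rect R) (om : R).
Hypothesis wx0 : 0 < rwx P.
Hypothesis wy0 : 0 < rwy P.
Hypothesis PQ : inside P `<=` unit_square.
Hypothesis om0 : 0 <= om.
Hypothesis vP : forall x, inside P x -> v x = box_field P om x.

Lemma measurable_co_lt i kap : measurable ([set x | co P i x < kap] : set RR).
Proof.
have := measurable_co P i measurableT (measurable_itv `]-oo, kap[); rewrite setTI.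
by rewrite (_ : _ @^-1` _ = [set x | co P i x < kap]) //; apply/seteqP; split => x; rewrite /= in_itv.
Qed.

Lemma co_iter_rot n i x : co P (i + n) (iter n (rot P) x) = co P i x.
Proof.
by elim: n => [|n IH]; [rewrite addn0|rewrite addnS iterS co_rot].
Qed.

Lemma iter_rot_inside n x : inside P (iter n (rot P) x) <-> inside P x.
Proof. by elim: n => // n IH; rewrite iterS rot_inside. Qed.

Lemma measurable_iter_rot n N : measurable (N : set RR) -> measurable (iter n (rot P) @^-1` N : set RR).
Proof.
move=> mN; have mr : measurable_fun (setT : set RR) (iter n (rot P) : RR -> RR).
  elim: n => [|n IH]; first exact: measurable_id.
  rewrite (_ : iter n.+1 (rot P) = rot P \o iter n (rot P)) //.
  exact: measurableT_comp (measurable_rot P) IH.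
by have := mr measurableT _ mN; rewrite setTI.
Qed.

(** A quarter turn shifts the index: [co P i.+1] after [rot] is [co P i] before it. The constant
    density takes the same turns, which converts the mass statement into one about areas. *)
Lemma turned n t i kap : a <= t <= b -> (t - a) * om = n%:R * 2 ->
  holds (w a) P [set x | co P i x < kap] -> holds (w t) P [set x | co P (i + n) x < kap].
Proof.
move=> tab e h N mN NP.
have aab : a <= a <= b by case/andP: tab => h1 h2; rewrite lexx (le_trans h1).
have T := turns wx0 wy0 PQ om0 a0 b1 vP M0 hw ev1 ev tab e mN NP.
have mN' := measurable_iter_rot n mN.
have N'P : iter n (rot P) @^-1` N `<=` inside P by move=> x /= /NP /iter_rot_inside.
have -> : mass (w t) N = mass (w a) (iter n (rot P) @^-1` N) by rewrite /mass /Rintegral T.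
rewrite (h _ mN' N'P).
have mS := measurable_co_lt (i + n) kap.
have mNS : measurable (N `&` [set x | co P (i + n) x < kap] : set RR) by exact: measurableI.
have hw1 t' : a <= t' <= b -> measurable_fun (setT : set RR) (cst 1 : R * R -> R) /\ forall x : R * R, `|cst 1 x : R| <= 1.
  by move=> _; split => // x; rewrite normr1.
have T1 := turns (w := fun _ => cst 1) wx0 wy0 PQ om0 a0 b1 vP ler01 hw1 ev1 ev1 tab e mNS (fun x h => NP x h.1).
rewrite [RHS]vol_mass // /mass /Rintegral T1 -/(Rintegral _ _ _) -/(mass _ _) -vol_mass; last exact: measurable_iter_rot.
congr vol; apply/seteqP; split => x /= [h1 h2]; split => //.
  by rewrite co_iter_rot.
by rewrite co_iter_rot in h2.
Qed.

(** At a general angle the set that carries the density is not explicit, but each [N] comes from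
    some [N0] of the same area, and the mass of [N] is the area of the part of [N0] in [S]. *)
Lemma box_filled t S : a <= t <= b -> measurable (S : set RR) -> holds (w a) P S ->
  filled (w t) P (vol (inside P `&` S)).
Proof.
move=> tab mS h.
have mP : measurable (inside P : set RR) by exact: measurable_inside.
have K N : measurable (N : set RR) -> N `<=` inside P ->
    exists N0 : set RR, [/\ measurable N0, N0 `<=` inside P, vol N0 = vol N & mass (w t) N = vol (N0 `&` S)].
  move=> mN NP; have [N0 [mN0 N0P e1 e2]] := turn_exists wx0 wy0 PQ om0 a0 b1 vP M0 hw ev1 ev tab mN NP.
  by exists N0; split; [exact: mN0|exact: N0P|rewrite /vol e1|rewrite /mass /Rintegral e2 -/(Rintegral _ _ _) -/(mass _ _) h].
split.
  move=> N mN NP; have [N0 [mN0 N0P <- ->]] := K N mN NP.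
  rewrite vol_ge0 /=; apply: vol_sub => //; first exact: measurableI.
  exact: subset_trans PQ.
have [N0 [mN0 N0P e1 ->]] := K _ mP (@subset_refl _ _).
have mI : measurable (inside P `&` S : set RR) by exact: measurableI.
have IQ : inside P `&` S `<=` unit_square by move=> x [/PQ].
have mD : measurable (inside P `\` N0 : set RR) by exact: measurableD.
(* The set from which the whole box comes has the area of the box, so it fills the box up to a null
   set. *)
have z : vol (inside P `\` N0) = 0.
  have := vol_split mP mN0 PQ; rewrite (_ : inside P `&` N0 = N0); last exact/setIidPr.
  by rewrite e1 -[LHS]addr0 => /addrI.
have := vol_split mI mN0 IQ; rewrite (_ : _ `&` N0 = N0 `&` S); last first.
  apply/seteqP; split => x; first by move=> [[_ Sx] Nx]; split.
  by move=> [Nx Sx]; split; [split; [exact: N0P|]|].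
have -> : vol ((inside P `&` S) `\` N0) = 0.
  apply: le_anti; apply/andP; split; last exact: vol_ge0.
  apply: (@le_trans _ _ (vol (inside P `\` N0))); last by rewrite z.
  apply: (vol_sub (measurableD mI mN0) mD) => x; first by move=> [/PQ].
  by move=> [[h1 _] h2].
by move=> ->; exact/esym/addr0.
Qed.

End box.

Lemma empty_filled t (P : @rect R) S : inside P = set0 -> filled (w t) P (vol (inside P `&` S)).
Proof.
move=> e; have z (N : set (R * R)) : N `<=` inside P -> N = set0.
  by rewrite e => h; apply/seteqP; split.
have v0 : vol (set0 : set (R * R)) = 0 by rewrite /vol measure0.
have m0 : mass (w t) (set0 : set (R * R)) = 0 by rewrite /mass Rintegral_set0.
split; last by rewrite e set0I v0 m0.
by move=> N _ /z ->; rewrite v0 m0 lexx.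
Qed.

Section first_half.
Variables (P : @rect R) (j : bool) (mL mR : R).
Hypothesis wx0 : 0 < rwx P.
Hypothesis wy0 : 0 < rwy P.
Hypothesis PQ : inside P `<=` unit_square.
Hypothesis hL : 0 <= 2 * mL <= 1.
Hypothesis hR : 0 <= 2 * mR <= 1.
(** [mL] and [mR] are the masses of the two children relative to the area of [P], each at most 1/2.
    The cut at [kap] separates the piece of the strip that stays, [L], from the part [U] that makes
    a half turn. *)
Let kap := 2 * mL - 1.
Let L := cut P j false kap.
Let U := cut P j true kap.
Hypothesis ab : a < b.
Hypothesis vL : forall x, inside L x -> v x = box_field L 0 x.
Hypothesis vU : forall x, inside U x -> v x = box_field U (4 / (b - a)) x.
Hypothesis start : holds (w a) P [set x | co P j x < 2 * (mL + mR) - 1].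

Let hk : -1 <= kap <= 1. Proof. by move: hL; rewrite /kap; lra. Qed.

Let k0 : kap <= 0. Proof. by move: hL; rewrite /kap; lra. Qed.

Let z11 : -1 <= (0 : R) <= 1. Proof. by rewrite oppr_le0 ler01. Qed.

Let oddj : odd j = j. Proof. by case: j. Qed.

Let mem d (c : R) x : -1 <= c <= 1 -> inside (cut P j d c) x <-> inside P x /\ 0 < side d * (co P j x - c).
Proof. by move=> hc; have := inside_cut j d x wx0 wy0 hc; rewrite oddj. Qed.

Let coE d c x : side d * c < 1 ->
  co P j x = (c + side d) / 2 + (1 - side d * c) / 2 * co (cut P j d c) j x.
Proof. by move=> h; have := co_cut j x wx0 wy0 h; rewrite oddj. Qed.

Let UP : inside U `<=` inside P. Proof. by move=> x /(mem _ _ hk)[]. Qed.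
Let LP : inside L `<=` inside P. Proof. by move=> x /(mem _ _ hk)[]. Qed.

Let om0 : 0 <= 4 / (b - a). Proof. by rewrite divr_ge0 // subr_ge0 ltW. Qed.

Let bab : a <= b <= b. Proof. by rewrite lexx ltW. Qed.

(** In the coordinates of [U] the remaining strip ends at [mu]. A half turn is two quarter turns: it
    shifts the index by 2 and reflects the strip to the other end of [U], which is also an end of
    [P]. *)
Let upper N : measurable (N : set RR) -> N `<=` inside U ->
  mass (w b) N = vol (N `&` [set x | 1 - 2 * mR < co P j x]).
Proof.
have kU : side true * kap < 1 by move: k0; rewrite /side mul1r; lra.
have [_ _ pos] := rw_cut j true wx0 wy0 hk; have [ux uy] := pos kU.
pose mu := (2 * (2 * (mL + mR) - 1) - (kap + 1)) / (1 - kap).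
have kn : 0 < 1 - kap by move: k0; lra.
have EU x : co P j x = (kap + 1) / 2 + (1 - kap) / 2 * co U j x.
  by have := coE x kU; rewrite /side !mul1r.
have hmu : (kap + 1) / 2 + (1 - kap) / 2 * mu = 2 * (mL + mR) - 1.
  by rewrite /mu; field; rewrite gt_eqF.
have H0 : holds (w a) U [set x | co U j x < mu].
  apply: holds_sub UP _ start => x _ /=; rewrite EU -hmu ltrD2l ltr_pM2l //.
  by rewrite divr_gt0.
have e : (b - a) * (4 / (b - a)) = 2%:R * 2 by rewrite mulrC divfK ?subr_eq0 ?gt_eqF //; ring.
have H := turned ux uy (subset_trans UP PQ) om0 vU bab e H0.
move=> mN NU; rewrite (H _ mN NU); congr vol.
have E x : (co U j.+2 x < mu) = (1 - 2 * mR < co P j x).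
  rewrite EU -[co U j.+2 x]/(- co U j x).
  have hm : 1 - 2 * mR = (kap + 1) / 2 + (1 - kap) / 2 * (- mu).
    by rewrite mulrN; move: hmu; rewrite /kap; lra.
  by rewrite hm ltrD2l ltr_pM2l ?divr_gt0 // ltrNl.
by apply/seteqP; split => x [Nx /= q]; split => //; move: q; rewrite addn2 E.
Qed.

(** The initial strip contains all of [L], which does not move, and the reflected part lies in the
    second child because [mR] is at most 1/2; what remains in the first child is exactly [L]. *)
Lemma first_half_left : holds (w b) (cut P j false 0) [set x | co (cut P j false 0) j x < 4 * mL - 1].
Proof.
have c1 : side false * 0 < 1 :> R by rewrite mulr0.
have C0 x := coE x c1; rewrite /side mulr0 subr0 add0r in C0.
move=> N mN NC.
have NP : N `<=` inside P by move=> x /NC /(mem _ _ z11)[].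
have neg x : N x -> co P j x < 0.
  by move=> /NC /(mem _ _ z11)[_]; rewrite /side subr0 mulN1r oppr_gt0.
have mL' : measurable (inside L : set RR) by exact: measurable_inside.
have mU' : measurable (inside U : set RR) by exact: measurable_inside.
have mNL : measurable (N `&` inside L : set RR) by exact: measurableI.
have mNU : measurable (N `&` inside U : set RR) by exact: measurableI.
have [mwb wbC] := hw bab.
have hj := mass_cut mwb wbC j wx0 wy0 hk PQ mN NP.
rewrite -/L -/U in hj; rewrite hj.
have -> : mass (w b) (N `&` inside U) = 0.
  rewrite (upper mNU (@subIsetr _ _ _)) (_ : _ `&` _ = set0) ?/vol ?measure0 //.
  apply/seteqP; split => // x [[Nx _] /= h]; have := neg _ Nx; move: hR; lra.
have -> : mass (w b) (N `&` inside L) = vol (N `&` inside L).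
  have [lx|e] := cut_pos j false wx0 wy0 hk; last first.
    rewrite /L e setI0; rewrite /mass Rintegral_set0 /vol measure0 //.
  have [_ _ pos] := rw_cut j false wx0 wy0 hk; have [ux uy] := pos lx.
  have e0 : (b - a) * 0 = 0%:R * 2 :> R by rewrite mulr0 mul0r.
  have T := turns ux uy (subset_trans LP PQ) (lexx 0) a0 b1 vL M0 hw ev1 ev bab e0 mNL (@subIsetr _ _ _).
  rewrite [in LHS]/mass /Rintegral T -/(Rintegral _ _ _) -/(mass _ _) /= start //; last by move=> x [/NP].
  congr vol; apply/seteqP; split => x; first by case.
  move=> [Nx Lx]; split => //=; have [_] := (mem _ _ hk).1 Lx.
  rewrite /side /kap => h; move: hL hR (neg _ Nx) h; lra.
rewrite addr0; congr vol; apply/seteqP; split => x /= [Nx h]; split => //.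
  have [_] := (mem _ _ hk).1 h; rewrite /side /kap C0; lra.
apply/(mem _ _ hk); split; first exact: NP.
by rewrite /side /kap C0; lra.
Qed.

Lemma first_half_right : holds (w b) (cut P j true 0) [set x | co (cut P j true 0) j.+2 x < 4 * mR - 1].
Proof.
have c1 : side true * 0 < 1 :> R by rewrite mulr0.
have C0 x := coE x c1; rewrite /side mulr0 subr0 add0r in C0.
move=> N mN NC.
have NU : N `<=` inside U.
  move=> x /NC /(mem _ _ z11)[Px]; rewrite /side subr0 mul1r => h.
  by apply/(mem _ _ hk); split => //; move: k0; rewrite /side; lra.
rewrite (upper mN NU); congr vol; apply/seteqP; split => x [Nx] /=; rewrite C0 => h; split => //=.
  by rewrite -[co _ j.+2 x]/(- co _ j x); lra.
by move: h; rewrite -[co _ j.+2 x]/(- co _ j x); lra.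
Qed.

Lemma first_half_filled t : a <= t <= b ->
  filled (w t) P (vol (inside P `&` [set x | co P j x < 2 * (mL + mR) - 1])).
Proof.
move=> tab; set S := [set x | _].
have mS : measurable (S : set RR) by exact: measurable_co_lt.
have mP : measurable (inside P : set RR) by exact: measurable_inside.
have mI : measurable (inside P `&` S : set RR) by exact: measurableI.
have IP : inside P `&` S `<=` inside P by move=> x [].
rewrite (vol_cut j wx0 wy0 hk PQ mI IP).
have [mwt wtC] := hw tab.
have E d : inside P `&` S `&` inside (cut P j d kap) = inside (cut P j d kap) `&` S.
  apply/seteqP; split => x; first by move=> [[_ s] c].
  by move=> [c s]; split => //; split => //; have [] := (mem _ _ hk).1 c.
rewrite !E; apply: (@filled_cut _ (w t) C P j kap _ _ mwt wtC wx0 wy0 hk PQ).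
  have [lx|e] := cut_pos j false wx0 wy0 hk; last exact: empty_filled.
  have [_ _ pos] := rw_cut j false wx0 wy0 hk; have [ux uy] := pos lx.
  apply: (@box_filled _ 0) => //; first exact: subset_trans LP PQ.
  by apply: holds_sub LP _ start.
have [lx|e] := cut_pos j true wx0 wy0 hk; last exact: empty_filled.
have [_ _ pos] := rw_cut j true wx0 wy0 hk; have [ux uy] := pos lx.
apply: (@box_filled _ (4 / (b - a))) => //; first exact: subset_trans UP PQ.
by apply: holds_sub UP _ start.
Qed.

End first_half.

(* A quarter turn is an exchange of axes; the other child cell needs three. *)
Lemma second_half (P : @rect R) (j d : bool) kap : 0 < rwx P -> 0 < rwy P -> inside P `<=` unit_square ->
  a < b -> let n := if d (+) j then 3%N else 1%N in
  (forall x, inside P x -> v x = box_field P (n%:R * 2 / (b - a)) x) ->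
  holds (w a) P [set x | co P (if d then j.+2 else j) x < kap] ->
  holds (w b) P [set x | co P (~~ j) x < kap].
Proof.
move=> x0 y0 PQ ab n vP h.
have om0 : 0 <= n%:R * 2 / (b - a) by rewrite divr_ge0 ?mulr_ge0 ?ler0n // subr_ge0 ltW.
have bab : a <= b <= b by rewrite lexx ltW.
have e : (b - a) * (n%:R * 2 / (b - a)) = n%:R * 2 by rewrite mulrC divfK // subr_eq0 gt_eqF.
have H := turned x0 y0 PQ om0 vP bab e h.
apply: holds_sub (@subset_refl _ _) _ H => x _ /=.
rewrite (_ : co P _ x = co P (~~ j) x) //.
(* Starting from [j], or from [j + 2] when [d] holds, [n] steps lead to [~~ j] modulo 4, and the
   coordinates have period 4 in the index. *)
have p4 i : co P i.+4 x = co P i x by rewrite -[LHS]/(- - co P i x) opprK.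
by rewrite /n; case: (d); case: (j) => /=; rewrite ?p4.
Qed.

Lemma second_half_filled (P : @rect R) (om : R) i kap t : 0 < rwx P -> 0 < rwy P -> inside P `<=` unit_square ->
  0 <= om -> (forall x, inside P x -> v x = box_field P om x) ->
  a <= t <= b -> holds (w a) P [set x | co P i x < kap] ->
  filled (w t) P (vol (inside P `&` [set x | co P i x < kap])).
Proof.
by move=> x0 y0 PQ om0 vP tab h; apply: (box_filled (om := om)) => //; exact: measurable_co_lt.
Qed.

End stage_evolution.

(** * Approximation of measurable sets by dyadic cells *)

Section dyadic_approximation.
Context {R : realType}.
Local Notation RR := (measurableTypeR R * measurableTypeR R)%type.
Implicit Types (A B S : set (R * R)).

Let mc (s : seq bool) : measurable (inside (@cell R s) : set RR).
Proof. exact: measurable_inside. Qed.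

Let mQ := @measurable_unit_square R.

(** The area of the difference between [A] and the best union of cells of size [n], in the square;
    the minimum decides for each cell whether to include it. *)
Definition err n A : R := \sum_(t : n.-tuple bool)
  Num.min (vol (inside (cell t) `&` A)) (vol (inside (cell t) `\` A)).

Lemma sum_vol_le n A : measurable (A : set RR) ->
  \sum_(t : n.-tuple bool) vol (inside (cell t) `&` A) <= vol (unit_square `&` A).
Proof.
move=> mA; have mQA : measurable (unit_square `&` A : set RR) by exact: measurableI.
rewrite -lee_fin -sumEFin -(volE mQA (@subIsetl _ _ _)).
have dis : disjoint_family (fun t : n.-tuple bool => inside (@cell R t)).
  by move=> t t' x h h'; apply/val_inj/(cell_disjoint _ h h'); rewrite !size_tuple.
apply: le_trans (@sum_measure_le R _ (fun t : n.-tuple bool => inside (@cell R t)) (fun t => mc t) _ dis mQA); apply: lee_sum => t _.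
have e : unit_square `&` A `&` inside (cell t) = inside (cell t) `&` A.
  apply/seteqP; split => x; first by move=> [[_ h1] h2].
  by move=> [h1 h2]; split => //; split => //; exact: cell_unit h1.
rewrite e -volE //; first exact: measurableI.
by move=> x [/cell_unit].
Qed.

(** These sets turn out to form a sigma-algebra that contains the half-planes, hence every Borel
    set. *)
Definition good A := measurable (A : set RR) /\
  forall e, 0 < e -> exists n0, forall n, (n0 <= n)%N -> err n A <= e.

Lemma goodC A : good A -> good (~` A).
Proof.
move=> [mA h]; split; first exact: measurableC.
move=> e /h[n0 H]; exists n0 => n /H; apply: le_trans; rewrite le_eqVlt; apply/orP; left; apply/eqP.
by apply: eq_bigr => t _; rewrite minC [_ `\` ~` A]setDE setCK [_ `\` A]setDE.
Qed.

Lemma vol_setU N B : measurable (N : set RR) -> measurable (B : set RR) ->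
  N `<=` unit_square -> B `<=` unit_square -> vol (N `|` B) <= vol N + vol B.
Proof.
move=> mN mB NQ BQ.
have mU : measurable (N `|` B : set RR) by exact: measurableU.
have UQ : N `|` B `<=` unit_square by move=> x [/NQ|/BQ].
rewrite (vol_split mU mN UQ); apply: lerD; apply: vol_sub => //.
- exact: measurableI.
- exact: measurableD.
- by move=> x [[]].
Qed.

(** In each cell the minimum for the union is at most the sum of the minima for [A] and [B]: the
    area inside is subadditive and the area outside only shrinks. *)
Lemma goodU A B : good A -> good B -> good (A `|` B).
Proof.
move=> [mA hA] [mB hB]; have mU : measurable (A `|` B : set RR) by exact: measurableU.
split; first exact: mU.
move=> e e0; have e2 : 0 < e / 2 by rewrite divr_gt0.
have [n1 H1] := hA _ e2; have [n2 H2] := hB _ e2.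
exists (maxn n1 n2) => n; rewrite geq_max => /andP[/H1 h1 /H2 h2].
have -> : e = e / 2 + e / 2 by field.
apply: le_trans (lerD h1 h2); rewrite -big_split; apply: ler_sum => t _ /=.
have mcA X : measurable (X : set RR) -> measurable (inside (cell t) `&` X : set RR) by move=> mX; exact: measurableI.
have mcD X : measurable (X : set RR) -> measurable (inside (cell t) `\` X : set RR) by move=> mX; exact: measurableD.
have cA X : inside (cell t) `&` X `<=` unit_square by move=> x [/cell_unit].
have cD X : inside (cell t) `\` X `<=` unit_square by move=> x [/cell_unit].
have u : vol (inside (cell t) `&` (A `|` B)) <= vol (inside (cell t) `&` A) + vol (inside (cell t) `&` B).
  by rewrite setIUr; apply: vol_setU => //; exact: mcA.
have d1 : vol (inside (cell t) `\` (A `|` B)) <= vol (inside (cell t) `\` A).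
  by apply: vol_sub => //; [exact: mcD|exact: mcD|move=> x [h1' h2']; split => // h; apply: h2'; left].
have d2 : vol (inside (cell t) `\` (A `|` B)) <= vol (inside (cell t) `\` B).
  by apply: vol_sub => //; [exact: mcD|exact: mcD|move=> x [h1' h2']; split => // h; apply: h2'; right].
have v1 := vol_ge0 (inside (cell t) `&` A); have v2 := vol_ge0 (inside (cell t) `&` B).
have v3 := vol_ge0 (inside (cell t) `\` A); have v4 := vol_ge0 (inside (cell t) `\` B).
move: u d1 d2 v1 v2 v3 v4.
move: (vol (inside (cell t) `&` (A `|` B))) (vol (inside (cell t) `\` (A `|` B))).
move: (vol _) (vol _) (vol _) (vol _) => x1 x2 x3 x4 y1 y2 u d1 d2 v1 v2 v3 v4.
case: (leP x4 x2) => _; case: (leP x3 x1) => _; rewrite ge_min.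
- by rewrite u.
- by rewrite (le_trans d2) ?orbT // lerDr.
- by rewrite (le_trans d1) ?orbT // lerDl.
- by rewrite (le_trans d1) ?orbT // lerDl.
Qed.

(** Passing from [B] to the larger [A] raises the minimum in a cell by at most the area of [A] minus
    [B] there, and these areas add up over the disjoint cells. *)
Lemma good_approx A : measurable (A : set RR) ->
  (forall e, 0 < e -> exists B, [/\ good B, B `<=` A & vol (unit_square `&` (A `\` B)) <= e]) -> good A.
Proof.
move=> mA h; split; first exact: mA.
move=> e e0; have e2 : 0 < e / 2 by rewrite divr_gt0.
have [B [[mB hB] BA le2]] := h _ e2; have [n0 H] := hB _ e2.
exists n0 => n /H h1; have -> : e = e / 2 + e / 2 by field.
have mAB : measurable (A `\` B : set RR) by exact: measurableD.
apply: le_trans (lerD h1 (le_trans (sum_vol_le n mAB) le2)).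
rewrite -big_split; apply: ler_sum => t _ /=.
have mI X : measurable (X : set RR) -> measurable (inside (cell t) `&` X : set RR) by move=> mX; exact: measurableI.
have cQ X : inside (cell t) `&` X `<=` unit_square by move=> x [/cell_unit].
have u : vol (inside (cell t) `&` A) <= vol (inside (cell t) `&` B) + vol (inside (cell t) `&` (A `\` B)).
  have -> : inside (cell t) `&` A = (inside (cell t) `&` B) `|` (inside (cell t) `&` (A `\` B)).
    by rewrite -setIUr setDUK.
  by apply: vol_setU => //; exact: mI.
have d : vol (inside (cell t) `\` A) <= vol (inside (cell t) `\` B).
  apply: vol_sub => //; [exact: measurableD|exact: measurableD|by move=> x [/cell_unit]|].
  by move=> x [h1' h2']; split => // /BA.
have v := vol_ge0 (inside (cell t) `&` (A `\` B)).
move: u d v; move: (vol _) (vol _) (vol _) (vol _) (vol _) => x1 x2 x3 x4 x5 u d v.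
by case: (leP x5 x2); case: (leP x4 x1); lra.
Qed.

Lemma good0 : good set0.
Proof.
split => // e e0; exists 0%N => n _; rewrite /err big1 ?ltW // => t _.
by rewrite setI0 {1}/vol measure0 (min_idPl _) // vol_ge0.
Qed.

Lemma good_bigcup (F : nat -> set (R * R)) : (forall n, good (F n)) -> good (\bigcup_n F n).
Proof.
move=> gF; pose G n := \big[setU/set0]_(i < n) F i.
have gG n : good (G n).
  rewrite /G; elim: n => [|n IH]; first by rewrite big_ord0; exact: good0.
  by rewrite big_ord_recr; exact: goodU IH (gF n).
have mF n : measurable (F n : set RR) by case: (gF n).
have mU : measurable (\bigcup_n F n : set RR) by exact: bigcupT_measurable.
apply: good_approx => // e e0.
pose D n := unit_square `&` (\bigcup_n F n `\` G n).
have mG n : measurable (G n : set RR) by case: (gG n).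
have mD n : measurable (D n : set RR) by apply: measurableI => //; exact: measurableD.
have nD : nonincreasing_seq D.
  move=> n m nm; apply/subsetPset => x [Qx [Ux nG]]; split => //; split => // Gx; apply: nG.
  by move: Gx; rewrite /G -!bigcup_mkord => -[i /= im Fi]; exists i => //=; exact: leq_trans nm.
have D0 : \bigcap_n D n = set0.
  apply/seteqP; split => // x h; have [_ [[i _ Fi] _]] := h 0%N I.
  have [_ [_ []]] := h i.+1 I; rewrite /G -bigcup_mkord; by exists i => /=.
have DQ n : D n `<=` unit_square by move=> x [].
have cv := @nonincreasing_cvg_mu _ RR R lam2 D (sub_unit_fin (mD 0%N) (DQ 0%N)) mD (bigcapT_measurable mD) nD.
rewrite D0 measure0 in cv.
have /fine_cvgP[_ cv'] : lam2 \o D @ \oo --> (0 : R)%:E by exact: cv.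
have [n _ Hn] : \forall n \near \oo, vol (D n) < e.
  exact: (cvgr_lt _ cv' e e0).
exists (G n); split => //; last by apply: ltW; exact: (Hn n (leqnn n)).
by rewrite /G -bigcup_mkord => x [i _ Fi]; exists i.
Qed.

Lemma side_bound_small e : 0 < e -> exists n0, forall n, (n0 <= n)%N -> side_bound n <= e :> R.
Proof.
move=> e0; have b1 : `|2^-1 `^ 2^-1 : R| < 1.
  rewrite ger0_norm ?powR_ge0 // powR12_sqrt ?invr_ge0 //.
  by rewrite -[ltRHS]sqrtr1 ltr_sqrt // invf_lt1 // ltr1n.
have [n _ Hn] := cvgr_lt _ (cvg_expr b1) e e0.
by exists n => m nm; apply: ltW; exact: (Hn m nm).
Qed.

(** A cell that leaves the strip of half width [h] around the line pr = r lies on one side of the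
    line, because its extent is less than [h], and contributes 0. The other cells contribute
    together at most the area [2 * h] of the strip, which is four times [side_bound n]. *)
Lemma good_half (pr : R * R -> R) r S : measurable (S : set RR) ->
  (forall h, 0 <= h -> measurable ([set x | `|pr x - r| <= h] : set RR) /\
     vol (unit_square `&` [set x | `|pr x - r| <= h]) <= 2 * h) ->
  (forall s x y, inside (@cell R s) x -> inside (cell s) y -> `|pr x - pr y| < 2 * side_bound (size s)) ->
  (forall x y, 0 < (pr x - r) * (pr y - r) -> S x -> S y) -> good S.
Proof.
move=> mS hstrip hwid hS; split => // e e0.
have e4 : 0 < e / 4 by rewrite divr_gt0.
have [n0 H] := side_bound_small e4; exists n0 => n /H hn.
pose h : R := 2 * side_bound n.
have h0 : 0 <= h by rewrite mulr_ge0 // ltW // side_bound_gt0.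
have [mT vT] := hstrip h h0.
apply: (@le_trans _ _ (2 * h)); last by rewrite /h; lra.
apply: le_trans vT; apply: le_trans (sum_vol_le n mT); apply: ler_sum => t _.
have mI X : measurable (X : set RR) -> measurable (inside (cell t) `&` X : set RR) by move=> mX; exact: measurableI.
have [inT|] := pselect (inside (cell t) `<=` [set x | `|pr x - r| <= h]).
  rewrite ge_min; apply/orP; left; apply: vol_sub; [exact: mI|exact: mI|by move=> x [/cell_unit]|].
  by move=> x [cx _]; split => //; exact: inT.
move=> /existsNP[z /not_implyP[cz /negP]]; rewrite -ltNge => hz.
have sgn x : inside (cell t) x -> 0 < (pr x - r) * (pr z - r).
  move=> cx; have := hwid t _ _ cx cz; rewrite size_tuple -/h ltr_norml => /andP[l1 l2].
  move: hz; case: (lerP 0 (pr z - r)) => s.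
    by rewrite ger0_norm // => s'; rewrite mulr_gt0 //; lra.
  by rewrite ltr0_norm // => s'; rewrite nmulr_rgt0 //; lra.
have v0 : vol (set0 : set (R * R)) = 0 by rewrite /vol measure0.
have [Sz|nSz] := pselect (S z).
  rewrite ge_min; apply/orP; right; rewrite (_ : _ `\` S = set0) ?v0 ?vol_ge0 //.
  apply/seteqP; split => // x [cx nSx]; apply: nSx; apply: (hS z) => //.
  by rewrite mulrC; exact: sgn.
rewrite ge_min; apply/orP; left; rewrite (_ : _ `&` S = set0) ?v0 ?vol_ge0 //.
by apply/seteqP; split => // x [cx Sx]; apply: nSz; apply: (hS x) => //; exact: sgn.
Qed.

Lemma strip1 r h : 0 <= h -> measurable ([set x | `|x.1 - r| <= h] : set RR) /\
  vol (unit_square `&` [set x : R * R | `|x.1 - r| <= h]) <= 2 * h.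
Proof.
move=> h0; have e : [set x : R * R | `|x.1 - r| <= h] = `[r - h, r + h] `*` setT.
  by apply/seteqP; split => x; rewrite /= in_itv /= ler_distl; [move=> ->|case].
have mJ : measurable (`[r - h, r + h]%classic : set (measurableTypeR R)) by exact: measurable_itv.
have mI : measurable (`]0, 1[%classic : set (measurableTypeR R)) by exact: measurable_itv.
have mS : measurable ([set x | `|x.1 - r| <= h] : set RR).
  by rewrite e; exact: measurableX mJ (@measurableT _ (measurableTypeR R)).
split => //.
have mP : measurable (`[r - h, r + h]%classic `*` `]0, 1[%classic : set RR) by exact: measurableX.
have l1 : lam (`[r - h, r + h]%classic : set R) = (2 * h)%:E.
  rewrite /lam /= lebesgue_measure_itv /= lte_fin; case: ltP => hh; first by congr EFin; ring.
  by congr EFin; lra.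
have P1 := @product_measure1E _ _ _ _ R lam lam _ _ mJ mI.
have vP : lam2 (`[r - h, r + h]%classic `*` `]0, 1[%classic) = (2 * h)%:E.
  apply: (eq_trans P1); transitivity ((2 * h)%:E * 1)%E; last by rewrite mule1.
  by congr (_ * _)%E; [exact: l1|exact: lam_unit_itv].
rewrite -lee_fin -vP -volE; [|exact: measurableI|by move=> x []].
apply: le_measure; rewrite ?inE //; first exact: measurableI.
by move=> x [[_ x2]]; rewrite e => -[x1 _].
Qed.

Lemma strip2 r h : 0 <= h -> measurable ([set x | `|x.2 - r| <= h] : set RR) /\
  vol (unit_square `&` [set x : R * R | `|x.2 - r| <= h]) <= 2 * h.
Proof.
move=> h0.
have mS : measurable ([set x | `|x.2 - r| <= h] : set RR).
  have e : [set x : R * R | `|x.2 - r| <= h] = setT `*` `[r - h, r + h].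
    by apply/seteqP; split => x; rewrite /= in_itv /= ler_distl; [move=> ->|case].
  have mJ : measurable (`[r - h, r + h]%classic : set (measurableTypeR R)) by exact: measurable_itv.
  by rewrite e; exact: measurableX (@measurableT _ (measurableTypeR R)) mJ.
split => //; rewrite -lee_fin -volE; [|exact: measurableI|by move=> x []].
by rewrite setIC; apply: (@lam2_strip R (cst r) h).
Qed.

Lemma cell_width1 s x y : inside (@cell R s) x -> inside (cell s) y -> `|x.1 - y.1| < 2 * side_bound (size s).
Proof.
move=> [x1 _] [y1 _]; have [l1 _] := cell_le (R := R) s.
by move: x1 y1; rewrite !ltr_norml; lra.
Qed.

Lemma cell_width2 s x y : inside (@cell R s) x -> inside (cell s) y -> `|x.2 - y.2| < 2 * side_bound (size s).
Proof.
move=> [_ x1] [_ y1]; have [_ l1] := cell_le (R := R) s.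
by move: x1 y1; rewrite !ltr_norml; lra.
Qed.

Lemma good_measurable A : measurable (A : set RR) -> good A.
Proof.
have lo (x y : R) : 0 < x * y -> x < 0 -> y < 0 by move=> h x0; rewrite -(nmulr_rgt0 _ x0).
have hi (x y : R) : 0 < x * y -> 0 < x -> 0 < y by move=> h x0; rewrite -(pmulr_rgt0 _ x0).
have mlt (pr : R * R -> R) r : measurable_fun (setT : set RR) pr ->
    measurable ([set x | pr x < r] : set RR) /\ measurable ([set x | r < pr x] : set RR).
  move=> mpr; split.
    have := mpr measurableT _ (measurable_itv `]-oo, r[); rewrite setTI.
    by rewrite (_ : _ @^-1` _ = [set x | pr x < r]) //; apply/seteqP; split => x; rewrite /= in_itv.
  have := mpr measurableT _ (measurable_itv `]r, +oo[); rewrite setTI.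
  by rewrite (_ : _ @^-1` _ = [set x | r < pr x]) //; apply/seteqP; split => x; rewrite /= in_itv /= andbT.
have g1 r : good [set x : R * R | x.1 < r].
  apply: (@good_half fst r); [exact: (mlt fst r measurable_fst).1|exact: strip1|exact: cell_width1|].
  by move=> x y h /=; rewrite -subr_lt0 -[y.1 < r]subr_lt0; exact: lo.
have g2 r : good [set x : R * R | r < x.1].
  apply: (@good_half fst r); [exact: (mlt fst r measurable_fst).2|exact: strip1|exact: cell_width1|].
  by move=> x y h /=; rewrite -subr_gt0 -[r < y.1]subr_gt0; exact: hi.
have g3 r : good [set x : R * R | x.2 < r].
  apply: (@good_half snd r); [exact: (mlt snd r measurable_snd).1|exact: strip2|exact: cell_width2|].
  by move=> x y h /=; rewrite -subr_lt0 -[y.2 < r]subr_lt0; exact: lo.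
have g4 r : good [set x : R * R | r < x.2].
  apply: (@good_half snd r); [exact: (mlt snd r measurable_snd).2|exact: strip2|exact: cell_width2|].
  by move=> x y h /=; rewrite -subr_gt0 -[r < y.2]subr_gt0; exact: hi.
have gI X Y : good X -> good Y -> good (X `&` Y).
  by move=> gX gY; rewrite -(setCK (X `&` Y)) setCI; apply: goodC; apply: goodU; exact: goodC.
have -> : measurable (A : set RR) = (<<s boxes >>) A by rewrite -measurable_boxes.
move: A; apply: smallest_sub.
  split; [exact: good0|by move=> X gX; rewrite setTD; exact: goodC|exact: good_bigcup].
move=> _ [q _ <-].
rewrite (_ : box q = ([set x | q.1.1 < x.1] `&` [set x | x.1 < q.1.2]) `&`
   ([set x | q.2.1 < x.2] `&` [set x | x.2 < q.2.2])).
  by apply: (gI _ _ (gI _ _ _ _) (gI _ _ _ _)).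
apply/seteqP; split => x; rewrite /box /= !in_itv /=.
  by move=> [/andP[-> ->] /andP[-> ->]].
by move=> [[-> ->] [-> ->]].
Qed.

End dyadic_approximation.

(** * The schedule *)

Section volumes.
Context {R : realType}.
Local Notation RR := (measurableTypeR R * measurableTypeR R)%type.
Implicit Types (P : @rect R).

Lemma vol_inside P : 0 <= rwx P -> 0 <= rwy P -> vol (inside P) = 2 * rwx P * (2 * rwy P).
Proof.
move=> x0 y0; rewrite inside_itv /vol.
have mI : measurable (`](rcx P - rwx P), (rcx P + rwx P)[%classic : set (measurableTypeR R)) by exact: measurable_itv.
have mJ : measurable (`](rcy P - rwy P), (rcy P + rwy P)[%classic : set (measurableTypeR R)) by exact: measurable_itv.
have lI (c w : R) : 0 <= w -> lam (`](c - w), (c + w)[%classic : set R) = (2 * w)%:E.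
  by move=> w0; rewrite lam_itv; [congr EFin; ring|lra].
have P1 := @product_measure1E _ _ _ _ R lam lam _ _ mI mJ.
have P2 : lam2 (`](rcx P - rwx P), (rcx P + rwx P)[%classic `*` `](rcy P - rwy P), (rcy P + rwy P)[%classic) =
    ((2 * rwx P)%:E * (2 * rwy P)%:E)%E.
  by apply: (eq_trans P1); congr (_ * _)%E; exact: lI.
by rewrite P2.
Qed.

Lemma vol_strip P (j d : bool) (kap : R) : 0 < rwx P -> 0 < rwy P -> -1 <= kap <= 1 ->
  vol (inside P `&` [set x | co P (if d then j.+2 else j) x < kap]) = (1 + kap) / 2 * (2 * rwx P * (2 * rwy P)).
Proof.
move=> x0 y0 hk; pose kap' := if d then - kap else kap.
have hk' : -1 <= kap' <= 1 by rewrite /kap'; case: (d); lra.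
have -> : inside P `&` [set x | co P (if d then j.+2 else j) x < kap] = inside (cut P j d kap').
  have oj : odd j = j by case: (j).
  apply/seteqP; split => x.
    move=> [Px h]; apply/inside_cut => //; split => //; rewrite oj; move: h; rewrite /kap' /side.
    by case: (d) => /=; [rewrite -[co P j.+2 x]/(- co P j x)|]; lra.
  move=> /(inside_cut _ _ _ x0 y0 hk')[Px]; rewrite oj => h; split => //; move: h; rewrite /kap' /side /=.
  by case: (d); [rewrite -[co P j.+2 x]/(- co P j x)|]; lra.
have [/andP[w1 _] /andP[w2 _] _] := rw_cut j d x0 y0 hk'.
rewrite vol_inside // /cut /kap' /side; case: (odd j) => /=; case: (d) => /=; field => //.
Qed.

Lemma vol_cell s : vol (inside (@cell R s)) = 2^-1 ^+ size s.
Proof. by have [x0 y0 <- _ _] := cell_widths (R := R) s; rewrite vol_inside ?ltW. Qed.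

Variable A : set (R * R).
Hypothesis mA : measurable (A : set RR).

(** The proportion of the cell that [A] fills, a cell of size n having area 2^(-n). *)
Definition frac (s : seq bool) : R := 2 ^+ size s * vol (inside (cell s) `&` A).

Lemma vol_frac s : vol (inside (cell s) `&` A) = 2^-1 ^+ size s * frac s.
Proof. by rewrite /frac mulrA -exprMn mulVf // expr1n mul1r. Qed.

Let mi s : measurable (inside (@cell R s) : set RR). Proof. exact: measurable_inside. Qed.

Lemma frac01 s : 0 <= frac s <= 1.
Proof.
rewrite /frac mulr_ge0 ?exprn_ge0 ?vol_ge0 //=.
have h : vol (inside (cell s) `&` A) <= 2^-1 ^+ size s.
  rewrite -vol_cell; apply: vol_sub => //; [exact: measurableI|exact: cell_unit].
rewrite (@le_trans _ _ (2 ^+ size s * 2^-1 ^+ size s)) //; first by rewrite ler_wpM2l ?exprn_ge0.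
by rewrite -exprMn mulfV // expr1n.
Qed.

Lemma frac_split s : frac s = (frac (false :: s) + frac (true :: s)) / 2.
Proof.
have z11 : -1 <= (0 : R) <= 1 by rewrite oppr_le0 ler01.
have [x0 y0 _ _ _] := cell_widths (R := R) s.
have h := vol_cut (size s) x0 y0 z11 (@cell_unit R s) (measurableI _ _ (mi s) mA) (@subIsetl _ _ _).
rewrite /frac h /= !exprS.
have e d : inside (cell s) `&` A `&` inside (cut (cell s) (size s) d 0) = inside (cut (cell s) (size s) d 0) `&` A.
  apply/seteqP; split => x; first by move=> [[_ h1] h2].
  by move=> [h1 h2]; split => //; split => //; exact: (@cell_sub R d s).
by rewrite !e; move: (vol _) (vol _) (2 ^+ size s) => x y z; field.
Qed.

End volumes.

Section schedule.
Context {R : realType}.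
Local Notation RR := (measurableTypeR R * measurableTypeR R)%type.
Variables (q : R) (A : set (R * R)).
Hypothesis q01 : 0 < q < 1.
Hypothesis mA : measurable (A : set RR).

Definition time (k : nat) : R := 1 - q ^+ k.
Definition duration (k : nat) : R := time k.+1 - time k.

Let q0 : 0 < q. Proof. by case/andP: q01. Qed.
Let q1 : q < 1. Proof. by case/andP: q01. Qed.

Lemma durationE k : duration k = q ^+ k * (1 - q).
Proof. by rewrite /duration /time exprS; ring. Qed.

Lemma duration_gt0 k : 0 < duration k.
Proof. by rewrite durationE mulr_gt0 ?exprn_gt0 // subr_gt0. Qed.

Lemma timeS k : time k < time k.+1.
Proof. by have := duration_gt0 k; rewrite /duration subr_gt0. Qed.

Lemma time_mono k m : (k <= m)%N -> time k <= time m.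
Proof.
move=> km; rewrite /time lerD2l lerN2; apply: ler_wiXn2l => //; exact: ltW.
Qed.

Lemma time0 : time 0 = 0. Proof. by rewrite /time expr0 subrr. Qed.

Lemma time_ge0 k : 0 <= time k.
Proof. by rewrite -time0 time_mono. Qed.

Lemma time_lt1 k : time k < 1.
Proof. by rewrite /time gtrBl exprn_gt0. Qed.

Lemma pow_small (e : R) : 0 < e -> exists k, q ^+ k < e.
Proof.
move=> e0; have nq : `|q| < 1 by rewrite gtr0_norm.
have [k _ Hk] := cvgr_lt _ (cvg_expr nq) e e0.
by exists k; exact: (Hk k (leqnn k)).
Qed.

Lemma stage_exists t : 0 <= t < 1 -> exists k, time k <= t < time k.+1.
Proof.
move=> /andP[t0 t1]; have ex : exists k, t < time k.
  have [k hk] := @pow_small (1 - t) ltac:(by rewrite subr_gt0).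
  by exists k; rewrite /time; lra.
case: (ex_minnP ex) => -[|k] tk mk; first by move: tk; rewrite time0 ltNge t0.
exists k; rewrite tk andbT leNgt; apply/negP => h.
by have := mk _ h; rewrite ltnn.
Qed.

(** The default 0 is taken only at times outside [0, 1), where no stage exists. *)
Definition stage (t : R) : nat := xget 0%N [set k | time k <= t < time k.+1].

Lemma stageE k t : time k <= t < time k.+1 -> stage t = k.
Proof.
move=> hk; rewrite /stage; case: xgetP => [m _ /= hm|]; last by move=> /(_ k).
have lt i j : time i <= t < time i.+1 -> time j <= t < time j.+1 -> ~ (i < j)%N.
  move=> /andP[_ h1] /andP[h2 _] ij; have := time_mono ij.
  by rewrite leNgt (le_lt_trans h2 h1).
by case: (ltngtP m k) => // h; [case: (lt _ _ hm hk h)|case: (lt _ _ hk hm h)].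
Qed.

(* An even stage 2n sweeps the mass of each cell of size n into its two halves;
   the following odd stage turns the halves back. *)
Definition stage_kap (k : nat) (s : seq bool) : R := if odd k then 0 else frac A (false :: s) - 1.

(** A quarter turn takes the time 2 / om, so m quarter turns in one stage need om = 2 m / duration:
    m is 1 or 3 in an odd stage, and 2 or 0 in an even one. *)
Definition stage_om (k : nat) (t : (k./2).-tuple bool * bool) : R :=
  if odd k then (if t.2 (+) odd k./2 then 3 else 1)%N%:R * 2 / duration k
  else if t.2 then 4 / duration k else 0.

Definition stage_field k : R * R -> R * R :=
  field (fun t : (k./2).-tuple bool * bool => stage_box (stage_kap k) t) (@stage_om k).

Lemma stage_kap_bound k s : -1 <= stage_kap k s <= 1.
Proof.
rewrite /stage_kap; case: (odd k); first by rewrite oppr_le0 ler01.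
by have := frac01 mA (false :: s); lra.
Qed.

Lemma stage_om_bound k t : 0 <= @stage_om k t <= 6 / duration k.
Proof.
have d0 := duration_gt0 k; have i0 : 0 < (duration k)^-1 by rewrite invr_gt0.
rewrite /stage_om; case: (odd k); case: (t.2); move: (duration k)^-1 i0 => z z0 /=.
- by case: (odd _) => /=; lra.
- by case: (odd _) => /=; lra.
- lra.
- lra.
Qed.

Let P k (t : (k./2).-tuple bool * bool) := stage_box (stage_kap k) t.
Let pos k := stage_pos (n := k./2) (stage_kap_bound k).
Let unit k := stage_unit (n := k./2) (stage_kap_bound k).
Let lP k := stage_le (n := k./2) (stage_kap_bound k).
Let dis k := stage_disjoint (n := k./2) (stage_kap_bound k).
Let cov k := @stage_covers R k./2 _ (stage_kap_bound k).
Let l0 k : 0 <= side_bound k./2 :> R. Proof. exact/ltW/side_bound_gt0. Qed.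
Let W0 k : 0 <= 6 / duration k. Proof. by rewrite divr_ge0 // ltW // duration_gt0. Qed.

Lemma measurable_stage k : measurable_fun (setT : set RR) (fun x => (stage_field k x).1) /\
  measurable_fun (setT : set RR) (fun x => (stage_field k x).2).
Proof. exact: measurable_field. Qed.

Lemma stage_bound k x : `|(stage_field k x).1| <= 6 / duration k * side_bound k./2 /\
  `|(stage_field k x).2| <= 6 / duration k * side_bound k./2.
Proof.
exact: (field_bound (@pos k) (@lP k) (@stage_om_bound k) (@dis k) (l0 k) (W0 k)).
Qed.

Lemma stage_flux k : no_normal_flux (stage_field k).
Proof.
exact: (field_flux (@pos k) (@unit k) (@lP k) (@stage_om_bound k) (@dis k) (l0 k) (W0 k)).
Qed.

Lemma stage_BV k : exists2 c, 0 <= c & (BV_norm (stage_field k) <= c%:E)%E.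
Proof.
eexists; last exact: (field_BV (@pos k) (@unit k) (@lP k) (@stage_om_bound k) (@dis k) (l0 k) (W0 k)).
move: (6 / duration k) (side_bound k./2) (W0 k) (l0 k) => x y x0 y0.
by rewrite addr_ge0 // !mulr_ge0 ?exprn_ge0.
Qed.

Lemma stage_in k t x : inside (@P k t) x -> stage_field k x = box_field (P t) (stage_om t) x.
Proof. by move=> h; exact: (field_in _ (@dis k) h). Qed.

Lemma stage_sobolev0 k p : 1 <= p ->
  (sobolev_seminorm 0 p (stage_field k) <= (2 * (6 / duration k * side_bound k./2))%:E)%E.
Proof.
exact: (field_sobolev0 (@pos k) (@lP k) (@stage_om_bound k) (@dis k) (l0 k) (W0 k)).
Qed.

Lemma stage_sobolev k s p : 1 <= p -> 0 < s -> s * p < 1 ->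
  (sobolev_seminorm s p (stage_field k) <=
   (((2 ^+ (k./2).+1) * ((4 * (6 / duration k * side_bound k./2)) `^ p * kernel_constant (s * p) *
     (96 / (1 - s * p)) * side_bound k./2 `^ (2 - s * p))) `^ p^-1)%:E)%E.
Proof.
move=> p1 s0 sp.
have := field_sobolev (@pos k) (@unit k) (@lP k) (@stage_om_bound k) (@dis k) (l0 k) (W0 k) (@cov k) p1 s0 sp.
by rewrite card_prod card_tuple !card_bool natrM natrX exprSr.
Qed.

End schedule.

(** * Evolution of an arbitrary solution along the schedule *)

Section evolution.
Context {R : realType}.
Local Notation RR := (measurableTypeR R * measurableTypeR R)%type.
Variables (q : R) (A : set (R * R)).
Hypothesis q01 : 0 < q < 1.
Hypothesis mA : measurable (A : set RR).
Hypothesis AQ : A `<=` unit_square.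
Variables (u : R * R * R -> R * R) (rho : R * R * R -> R) (M : R) (w : R -> R * R -> R).
Hypothesis uE : forall x t, 0 <= t < 1 -> u (x, t) = stage_field q A (stage q t) x.
Hypothesis sol : transport_solution u (\1_[set x : R * R | unit_square x /\ 0 < x.1 < vol A]) rho.
Hypothesis M0 : 0 <= M.
Hypothesis hw : forall t, 0 <= t < 1 ->
   [/\ measurable_fun setT (w t), (forall x, `|w t x| <= M),
      (forall x, ~ unit_square x -> w t x = 0) &
      {ae lam2, forall x, unit_square x -> rho (x, t) = w t x}].

Let T := time q.
Let mQ := @measurable_unit_square R.

Let in01 k t : T k <= t <= T k.+1 -> 0 <= t < 1.
Proof.
move=> /andP[h1 h2]; rewrite (le_trans (time_ge0 q01 k) h1) /=.
exact: le_lt_trans h2 (time_lt1 q01 k.+1).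
Qed.

Let refl_evolution v a K (w0 : R * R -> R) : weak_evolution v a a K w0 w0.
Proof. by move=> F K' S B _ _ _ _ _ _ _; rewrite !subrr normr0 mulr0. Qed.

Let ev1 k t t' : T k <= t -> t <= t' -> t' <= T k.+1 ->
  weak_evolution (stage_field q A k) t t' 1 (cst 1) (cst 1).
Proof.
move=> h1 h2 h3; have [->|ne] := eqVneq t t'; first exact: refl_evolution.
have [m1 m2] := measurable_stage q A k.
have /andP[t0 _] := in01 (k := k) (t := t) ltac:(by rewrite h1 (le_trans h2)).
have /andP[_ t1] := in01 (k := k) (t := t') ltac:(by rewrite h3 (le_trans h1)).
apply: (weak_evolution_cst t0 _ (ltW t1) m1 m2 (stage_bound q01 mA k) (stage_flux q01 mA k)).
by rewrite lt_neqAle ne.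
Qed.

(** [weak_inequality] asks for the velocity only strictly between the two times, so the final time
    of the stage, where the next field already acts, may be included. *)
Let ev k t t' : T k <= t -> t <= t' -> t' <= T k.+1 ->
  weak_evolution (stage_field q A k) t t' M (w t) (w t').
Proof.
move=> h1 h2 h3; have [->|ne] := eqVneq t t'; first exact: refl_evolution.
have [m1 m2] := measurable_stage q A k.
have /andP[t0 _] := in01 (k := k) (t := t) ltac:(by rewrite h1 (le_trans h2)).
have /andP[_ t1] := in01 (k := k) (t := t') ltac:(by rewrite h3 (le_trans h1)).
move=> F K S B sF cK KQ FK mS B0 FB.
have tt' : t < t' by rewrite lt_neqAle ne.
apply: (weak_inequality sol M0 hw sF cK KQ FK t0 tt' t1 _ m1 m2 (stage_bound q01 mA k) mS B0 FB).
move=> x r /andP[r1 r2]; rewrite uE.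
  rewrite (@stageE _ q q01 k) // (le_trans h1 (ltW r1)) /=; exact: lt_le_trans h3.
by rewrite (le_trans t0 (ltW r1)) (lt_trans r2).
Qed.

Let hwk k t : T k <= t <= T k.+1 ->
  measurable_fun (setT : set RR) (w t) /\ forall x, `|w t x| <= M.
Proof. by move=> /in01 /hw[]. Qed.

Let z11 : -1 <= (0 : R) <= 1. Proof. by rewrite oppr_le0 ler01. Qed.

Let cut_odd (P : @rect R) n d c : cut P (odd n) d c = cut P n d c.
Proof. by rewrite /cut oddb. Qed.

(** The shape of the density in the cell at the beginning of its even stage, across the direction in
    which the cell is halved next. *)
Definition strip s : set (R * R) := [set x | co (cell s) (odd (size s)) x < 2 * frac A s - 1].

Let a0 k : 0 <= T k. Proof. exact: time_ge0. Qed.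
Let b1 k : T k <= 1. Proof. exact/ltW/time_lt1. Qed.

Let inE k s d x : size s = k./2 -> inside (cut (cell s) k./2 d (stage_kap A k s)) x ->
  stage_field q A k x = box_field (cut (cell s) k./2 d (stage_kap A k s))
   (if odd k then (if d (+) odd k./2 then 3 else 1)%N%:R * 2 / duration q k
    else if d then 4 / duration q k else 0) x.
Proof.
move=> e h; pose t : k./2.-tuple bool := Tuple (introT eqP e).
exact: (@stage_in _ q A mA k (t, d) x h).
Qed.

Let vol_strip_cell s (d j : bool) :
  vol (inside (cell s) `&` [set x | co (cell s) (if d then j.+2 else j) x < 2 * frac A s - 1]) =
  vol (inside (cell s) `&` A).
Proof.
have [x0 y0 area _ _] := cell_widths (R := R) s.
have fs := frac01 mA s; rewrite (vol_strip j d x0 y0); last by lra.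
rewrite area (vol_frac A s); move: (frac A s) (2^-1 ^+ size s) => f z; field.
by [].
Qed.

Lemma even_stage k s : odd k = false -> size s = k./2 -> holds (w (T k)) (cell s) (strip s) ->
  [/\ holds (w (T k.+1)) (cell (false :: s)) [set x | co (cell (false :: s)) (odd (size s)) x < 2 * frac A (false :: s) - 1],
      holds (w (T k.+1)) (cell (true :: s)) [set x | co (cell (true :: s)) (odd (size s)).+2 x < 2 * frac A (true :: s) - 1] &
      forall t, T k <= t <= T k.+1 -> filled (w t) (cell s) (vol (inside (cell s) `&` A))].
Proof.
move=> ok es h; have [x0 y0 area _ _] := cell_widths (R := R) s.
have f0 := frac01 mA (false :: s); have f1 := frac01 mA (true :: s); have fs := frac01 mA s.
(* [frac] is relative to the child, whose area is half that of the cell. *)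
pose mL := frac A (false :: s) / 2; pose mR := frac A (true :: s) / 2.
have hL : 0 <= 2 * mL <= 1 by rewrite /mL mulrC divfK.
have hR : 0 <= 2 * mR <= 1 by rewrite /mR mulrC divfK.
have ek : stage_kap A k s = 2 * mL - 1 by rewrite /stage_kap ok /mL (mulrC 2) divfK.
have vL x : inside (cut (cell s) (odd (size s)) false (2 * mL - 1)) x ->
    stage_field q A k x = box_field (cut (cell s) (odd (size s)) false (2 * mL - 1)) 0 x.
  by rewrite cut_odd -ek es => hx; rewrite (inE es hx) ok.
have vU x : inside (cut (cell s) (odd (size s)) true (2 * mL - 1)) x ->
    stage_field q A k x = box_field (cut (cell s) (odd (size s)) true (2 * mL - 1)) (4 / (T k.+1 - T k)) x.
  by rewrite cut_odd -ek es => hx; rewrite (inE es hx) ok.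
have fe : 2 * (mL + mR) - 1 = 2 * frac A s - 1 by rewrite (frac_split mA s) /mL /mR; move: (frac _ _) (frac _ _) => x y; field.
have start : holds (w (T k)) (cell s) [set x | co (cell s) (odd (size s)) x < 2 * (mL + mR) - 1].
  by rewrite fe.
have e4 m : 4 * (m / 2) = 2 * m :> R by field.
split.
- have H := first_half_left (a0 k) (b1 k.+1) M0 (hwk (k := k)) (ev1 (k := k)) (ev (k := k)) x0 y0 (@cell_unit R s) hL hR (timeS q01 k) vL vU start.
  by move: H; rewrite cut_odd /mL e4.
- have H := first_half_right (a0 k) (b1 k.+1) M0 (hwk (k := k)) (ev1 (k := k)) (ev (k := k)) x0 y0 (@cell_unit R s) hL (timeS q01 k) vU start.
  by move: H; rewrite cut_odd /mR e4.
- move=> t tk.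
  have H := first_half_filled (a0 k) (b1 k.+1) M0 (hwk (k := k)) (ev1 (k := k)) (ev (k := k)) x0 y0 (@cell_unit R s) hL (timeS q01 k) vL vU start tk.
  by have /= e := vol_strip_cell s false (odd (size s)); move: H; rewrite fe e.
Qed.

Lemma odd_stage k s : odd k -> size s = k./2 ->
  holds (w (T k)) (cell (false :: s)) [set x | co (cell (false :: s)) (odd (size s)) x < 2 * frac A (false :: s) - 1] ->
  holds (w (T k)) (cell (true :: s)) [set x | co (cell (true :: s)) (odd (size s)).+2 x < 2 * frac A (true :: s) - 1] ->
  (forall d, holds (w (T k.+1)) (cell (d :: s)) (strip (d :: s))) /\
  forall t, T k <= t <= T k.+1 -> filled (w t) (cell s) (vol (inside (cell s) `&` A)).
Proof.
move=> ok es h0 h1; have [x0 y0 _ _ _] := cell_widths (R := R) s.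
have ek : stage_kap A k s = 0 by rewrite /stage_kap ok.
have h d : holds (w (T k)) (cell (d :: s)) [set x | co (cell (d :: s)) (if d then (odd (size s)).+2 else odd (size s)) x < 2 * frac A (d :: s) - 1].
  by case: d.
have vP d x : inside (cell (d :: s)) x -> stage_field q A k x =
    box_field (cell (d :: s)) ((if d (+) odd (size s) then 3 else 1)%N%:R * 2 / (T k.+1 - T k)) x.
  by rewrite /= -ek es => hx; rewrite (inE es hx) ok.
split.
  move=> d; have [cx cy _ _ _] := cell_widths (R := R) (d :: s).
  exact: (second_half (a0 k) (b1 k.+1) M0 (hwk (k := k)) (ev1 (k := k)) (ev (k := k)) cx cy (@cell_unit R (d :: s)) (timeS q01 k) (@vP d) (h d)).
move=> t tk; have [mw wC] := hwk tk.
have om0 d : 0 <= (if d (+) odd (size s) then 3 else 1)%N%:R * 2 / (T k.+1 - T k).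
  by rewrite divr_ge0 ?mulr_ge0 ?ler0n //; apply/ltW/duration_gt0.
have F d : filled (w t) (cell (d :: s)) (vol (inside (cell (d :: s)) `&` A)).
  have [cx cy area _ _] := cell_widths (R := R) (d :: s).
  have := second_half_filled (a0 k) (b1 k.+1) M0 (hwk (k := k)) (ev1 (k := k)) (ev (k := k)) cx cy (@cell_unit R (d :: s)) (om0 d) (@vP d) tk (h d).
  by rewrite vol_strip_cell.
have := filled_cut mw wC (i := size s) x0 y0 z11 (@cell_unit R s) (F false) (F true).
have mi : measurable (inside (cell s) `&` A : set RR) by apply: measurableI => //; exact: measurable_inside.
rewrite (vol_cut (size s) x0 y0 z11 (@cell_unit R s) mi (@subIsetl _ _ _)).
have e d : inside (cell s) `&` A `&` inside (cut (cell s) (size s) d 0) = inside (cell (d :: s)) `&` A.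
  apply/seteqP; split => x; first by move=> [[_ c1] c2].
  by move=> [c1 c2]; split => //; split => //; exact: (@cell_sub R d s).
by rewrite !e.
Qed.

(** In the root cell the normalized first coordinate is 2 x - 1, which turns the condition x < |A|
    into that of the strip. *)
Lemma start_holds : holds (w (T 0)) (cell [::]) (strip [::]).
Proof.
have T0 : T 0 = 0 by exact: time0.
have [mw wC w0 ae0] := hw (t := 0) ltac:(by rewrite lexx ltr01).
have [_ _ _ _ /ae_leb2 ini] := sol.
move=> N mN; rewrite /= inside_root => NQ; rewrite T0.
have fA : frac A [::] = vol A.
  by rewrite /frac /= expr0 mul1r inside_root (setIidr AQ).
have mS : measurable (strip [::] : set RR) by exact: measurable_co_lt.
have mI : measurable (N `&` strip [::] : set RR) by exact: measurableI.
have E : (\int[lam2]_(x in N) (w 0 x)%:E = \int[lam2]_(x in N) (\1_(strip [::]) x)%:E)%E.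
  apply: (@ae_eq_integral _ _ R lam2 N) => //.
  - by apply/measurable_EFinP; exact: measurable_funS mw.
  - by apply/measurable_EFinP; apply: (@measurable_funS _ _ _ _ setT) => //; exact: measurable_indic.
  - move: ae0 ini => [Z1 [mZ1 Z10 H1]] [Z2 [mZ2 Z20 H2]].
    exists (Z1 `|` Z2); split; [exact: measurableU|exact: null_set_setU|].
    move=> x /=; apply: contra_notP => /not_orP[n1 n2] Nx; congr EFin.
    have Qx := NQ _ Nx.
    have e1 : rho (x, 0) = w 0 x by apply: contrapT => ne; apply: n1; apply: H1 => /(_ Qx).
    have e2 : rho (x, 0) = \1_[set x0 : R * R | unit_square x0 /\ 0 < x0.1 < vol A] x.
      by apply: contrapT => ne; apply: n2; apply: H2 => /(_ Qx).
    have [x1 _] := Qx; move: x1; rewrite /= in_itv /= => /andP[x10 x11].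
    rewrite -e1 e2 !indicE; congr (_%:R); congr nat_of_bool; apply/idP/idP => /set_mem h; apply: mem_set.
      by case: h => _ /andP[_ h]; rewrite /strip /= fA co0E /=; lra.
    by split => //; move: h; rewrite /strip /= fA co0E /= x10; lra.
rewrite /mass /Rintegral E integral_indic // /vol setIC.
by [].
Qed.

Lemma even_holds n s : size s = n -> holds (w (T n.*2)) (cell s) (strip s).
Proof.
elim: n s => [|n IH] [|d s] // es; first exact: start_holds.
move: es => /= -[es].
have [h0 h1 _] := even_stage (k := n.*2) (odd_double n) (etrans es (esym (doubleK n))) (IH s es).
have [H _] := odd_stage (k := n.*2.+1) (s := s) ltac:(by rewrite /= odd_double) (etrans es (esym (half_bit_double n true))) h0 h1.
exact: H.
Qed.

Lemma cell_filled n s t : size s = n -> T n.*2 <= t <= T n.+1.*2 ->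
  filled (w t) (cell s) (vol (inside (cell s) `&` A)).
Proof.
move=> es /andP[t1 t2].
have [h0 h1 f0] := even_stage (k := n.*2) (odd_double n) (etrans es (esym (doubleK n))) (even_holds es).
have [_ f1] := odd_stage (k := n.*2.+1) (s := s) ltac:(by rewrite /= odd_double) (etrans es (esym (half_bit_double n true))) h0 h1.
have [h|h] := leP t (T n.*2.+1); first by apply: f0; rewrite t1.
by apply: f1; rewrite (ltW h).
Qed.

(** At every time of the two stages devoted to size [n], each cell of that size holds the mass of
    [A] and a density between 0 and 1, so [filled_L1] applies cell by cell. *)
Lemma L1_error n t : T n.*2 <= t <= T n.+1.*2 ->
  (\int[lam2]_(x in unit_square) (`|w t x - \1_A x|)%:E <= (2 * err n A)%:E)%E.
Proof.
move=> ht; have ht01 : 0 <= t < 1.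
  by case/andP: ht => h1 h2; rewrite (le_trans (a0 _) h1) (le_lt_trans h2) // time_lt1.
have [mw wC _ _] := hw ht01.
have m1 : measurable_fun (setT : set RR) (\1_A : RR -> R) by exact: measurable_indic.
have mg : measurable_fun (setT : set RR) (fun x => `|w t x - \1_A x|).
  by apply: measurableT_comp => //; exact: measurable_funB.
have gC x : `| `|w t x - \1_A x| | <= M + 1.
  rewrite normr_id (le_trans (ler_normB _ _)) // lerD // indicE.
  by case: (_ \in _); rewrite ?normr1 ?normr0.
have cv : covers (fun s : n.-tuple bool => inside (@cell R s)).
  by exists (@cell_lines R); [exact: cell_lines_null|move=> x; exact: cell_cover].
have mc (s : n.-tuple bool) : measurable (inside (@cell R s) : set RR) by exact: measurable_inside.
have g0 x : (0 <= (`|w t x - \1_A x|)%:E)%E by rewrite lee_fin.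
have mEg : measurable_fun (setT : set RR) (fun x => (`|w t x - \1_A x|)%:E) by exact/measurable_EFinP.
apply: (le_trans (integral_le_cover mc cv mEg g0)).
rewrite mulr_sumr -sumEFin; apply: lee_sum => s _.
have sQ := @cell_unit R s.
rewrite (massE mg gC (mc s) sQ) lee_fin.
have F := cell_filled (size_tuple s) ht.
exact: (filled_L1 mw wC sQ mA F).
Qed.

End evolution.

(** * The flow *)

Section uniform_bound.
Context {R : realType}.
Local Notation RR := (measurableTypeR R * measurableTypeR R)%type.
Variables (p s : R).
Hypothesis p1 : 1 <= p.
Hypothesis s0 : 0 <= s.
Hypothesis sp : s < p^-1.

Let p0 : 0 < p. Proof. exact: lt_le_trans p1. Qed.

Let s1 : s < 1.
Proof. by apply: lt_le_trans sp _; rewrite invf_le1. Qed.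

Definition rate : R := 2^-1 `^ ((1 - s) / 4).

Lemma rate01 : 0 < rate < 1.
Proof.
have e1 : (1 : R) = 1 `^ ((1 - s) / 4) by rewrite powR1.
rewrite powR_gt0 ?invr_gt0 //= [ltRHS]e1.
apply: gt0_ltr_powR; rewrite ?nnegrE ?invr_ge0 ?ler01 ?ltr0n //.
  by rewrite divr_gt0 // subr_gt0.
by rewrite invf_lt1 // ltr1n.
Qed.

(** The exponent (1 - s) / 4 is chosen for this: two stages per halving and cells of side 2^(-n/2)
    turn it into the power 1 - s of the side. *)
Lemma rate_side n : rate ^+ n.*2 = side_bound n `^ (1 - s).
Proof.
rewrite /rate /side_bound.
rewrite -(powR_mulrn n.*2 (powR_ge0 _ _)).
rewrite -(powR_mulrn n (powR_ge0 _ _)).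
rewrite -powRrM -powRrM -powRrM.
rewrite -muln2 natrM; move: (n%:R) => x.
by apply: (f_equal (powR 2^-1)); field.
Qed.

Definition speed_constant : R := 6 / (rate * (1 - rate)).

(** Write the side as its power 1 - s times its power s; [rate_side] cancels the first factor
    against the duration, up to [rate * (1 - rate)]. The extra factor [rate] accounts for odd
    [k]. *)
Lemma speed_bound k : 6 / duration rate k * side_bound k./2 <= speed_constant * side_bound k./2 `^ s.
Proof.
have /andP[q0 q1] := rate01; set n := k./2; have B0 := side_bound_gt0 (R := R) n.
have q1' : 0 < 1 - rate by rewrite subr_gt0.
have BE : side_bound n = rate ^+ n.*2 * side_bound n `^ s.
  by rewrite rate_side -(powR_add _ _ B0) subrK powRr1 // ltW.
have hd : rate ^+ n.*2 * (rate * (1 - rate)) <= duration rate k.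
  rewrite durationE mulrA ler_wpM2r ?(ltW q1') // -exprSr ler_wiXn2l ?(ltW q0) ?(ltW q1) //.
  by rewrite -[X in (X <= _)%N](odd_double_half k) -/n; case: (odd k).
have qn : 0 < rate ^+ n.*2 by rewrite exprn_gt0.
rewrite {1}BE mulrA ler_wpM2r ?powR_ge0 // /speed_constant -mulrA ler_wpM2l //.
rewrite mulrC ler_pdivrMr ?duration_gt0 ?rate01 // mulrC ler_pdivlMr ?mulr_gt0 //.
Qed.

(** For s > 0, with B = 2^(-n/2), each of the 2^(n+1) rectangles contributes a constant times B^(s
    p) B^(2 - s p) = 2^(-n), so the sum does not depend on the stage. For s = 0 the pointwise bound
    of the field is enough. *)
Lemma uniform_sobolev : exists C : R, forall (A : set (R * R)) k, measurable (A : set RR) ->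
  (sobolev_seminorm s p (stage_field rate A k) <= C%:E)%E.
Proof.
have [se|sn] := eqVneq s 0.
  exists (2 * speed_constant) => A k mA; have := stage_sobolev0 rate01 mA k p1.
  rewrite se => h; apply: (le_trans h); rewrite lee_fin ler_wpM2l //.
  by have := speed_bound k; rewrite se powRr0 mulr1.
have sp0 : 0 < s by rewrite lt_neqAle eq_sym sn.
have sp1 : s * p < 1 by rewrite -ltr_pdivlMr // div1r.
exists ((2 * ((4 * speed_constant) `^ p * kernel_constant (s * p) * (96 / (1 - s * p)))) `^ p^-1) => A k mA.
apply: (le_trans (stage_sobolev rate01 mA k p1 sp0 sp1)); rewrite lee_fin.
set B := side_bound k./2; have B0 : 0 < B by exact: side_bound_gt0.
have /andP[q0 q1] := rate01.
have D0 : 0 <= speed_constant by rewrite /speed_constant divr_ge0 // mulr_ge0 ?(ltW q0) // subr_ge0 ltW.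
have K0 : 0 <= kernel_constant (s * p) * (96 / (1 - s * p)).
  apply: mulr_ge0; first by rewrite addr_ge0 ?sqr_ge0.
  by rewrite divr_ge0 // subr_ge0 ltW.
have v0 : 0 <= 6 / duration rate k * B.
  rewrite mulr_ge0 ?(ltW B0) // divr_ge0 //; exact/ltW/duration_gt0/rate01.
have h : (4 * (6 / duration rate k * B)) `^ p <= (4 * speed_constant) `^ p * B `^ (s * p).
  have c1 : 0 <= 4 * (6 / duration rate k * B) by exact: mulr_ge0.
  have c2 : 0 <= 4 * speed_constant by exact: mulr_ge0.
  have c3 : 0 <= 4 * speed_constant * B `^ s by exact: mulr_ge0 c2 (powR_ge0 _ _).
  rewrite powRrM -powRM ?powR_ge0 // ge0_ler_powR ?nnegrE ?(ltW p0) //.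
  by rewrite -(mulrA 4) ler_wpM2l //; exact: speed_bound.
rewrite ge0_ler_powR ?nnegrE ?invr_ge0 ?(ltW p0) //.
- apply: mulr_ge0; rewrite ?exprn_ge0 //; apply: mulr_ge0; rewrite ?powR_ge0 // -mulrA.
  by apply: mulr_ge0; rewrite ?powR_ge0.
- by apply: mulr_ge0 => //; rewrite -mulrA; apply: mulr_ge0; rewrite ?powR_ge0.
have e2 : 2 ^+ (k./2).+1 * B ^+ 2 = 2.
  by rewrite /B side_bound_sqr exprSr mulrAC -exprMn mulfV // expr1n mul1r.
have eB : B `^ (2 - s * p) * B `^ (s * p) = B ^+ 2.
  by rewrite -(powR_add _ _ B0) subrK -powR_mulrn // ltW.
apply: (@le_trans _ _ (2 ^+ (k./2).+1 * ((4 * speed_constant) `^ p * B `^ (s * p) *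
   kernel_constant (s * p) * (96 / (1 - s * p)) * B `^ (2 - s * p)))).
  rewrite ler_wpM2l ?exprn_ge0 // ler_wpM2r ?powR_ge0 //.
  by rewrite -(mulrA _ (kernel_constant _)) -(mulrA _ (kernel_constant _)) ler_wpM2r.
rewrite -[X in _ <= X * _]e2 -eB le_eqVlt; apply/orP; left; apply/eqP.
by move: (2 ^+ _) (_ `^ p) (kernel_constant _) (96 / _) (B `^ (s * p)) (B `^ (2 - s * p)) => x1 x2 x3 x4 x5 x6; ring.
Qed.

End uniform_bound.

Section representative.
Context {R : realType}.
Local Notation RR := (measurableTypeR R * measurableTypeR R)%type.

(** The indicator of [A] is Borel off a null set [N]. The flow is built for [A] minus [N], which has
    the same measure and the same L^1 class. *)
Lemma borel_representative (A : set (lebesgue_plane R)) : measurable A -> A `<=` unit_square ->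
  exists N : set (R * R), [/\ measurable (N : set RR), lam2 N = 0%E, measurable (A `\` N : set RR) &
    fine (leb2 A) = vol (A `\` N)].
Proof.
move=> mA AQ; have mQ := @measurable_unit_square R.
have Qfin : (lam2 (@unit_square R) < +oo)%E by rewrite lam2_unit_square ltry.
have m1 : measurable_fun (unit_square : set (lebesgue_plane R)) (\1_A : R * R -> R).
  by apply: (@measurable_funS _ _ _ _ setT) => //; exact: measurable_indic.
have [N [mN N0 H]] := measurable_rep_leb2 mQ Qfin m1.
have mD : measurable (unit_square `\` N : set RR) by exact: measurableD.
have mAN : measurable (A `\` N : set RR).
  have := H _ mD (@subset_refl _ _) mD _ (measurable_set1 (1 : R)).
  rewrite (_ : _ `&` _ = A `\` N) //; apply/seteqP; split => x /=.
    move=> [[Qx nN]]; rewrite indicE; case: (boolP (x \in A)) => [/set_mem Ax _|_ /eqP]; first by split.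
    by rewrite eq_sym oner_eq0.
  by move=> [Ax nN]; rewrite indicE mem_set //; split => //; split => //; exact: AQ.
exists N; split => //; rewrite /vol -leb2E //; congr fine.
have mN' : measurable (N : set (lebesgue_plane R)).
  exact: (@completed_measurable _ _ R (@lebesgue_measure R \x @lebesgue_measure R)%E N mN).
have mI : measurable (A `&` N : set (lebesgue_plane R)) by exact: measurableI.
have -> : leb2 A = (leb2 (A `\` N) + leb2 (A `&` N))%E.
  exact: (@measureDI _ _ R leb2 A N mA mN').
rewrite (_ : leb2 (A `&` N) = 0%E) ?adde0 //.
apply/eqP; rewrite -measure_le0 -N0 -leb2E //.
by apply: le_measure; rewrite ?inE //; exact: subIsetr.
Qed.

End representative.

Section flow.
Context {R : realType}.
Local Notation RR := (measurableTypeR R * measurableTypeR R)%type.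
Variables (q : R) (A : set (R * R)).
Hypothesis q01 : 0 < q < 1.
Hypothesis mA : measurable (A : set RR).

Definition flow (z : (R * R) * R) : R * R := stage_field q A (stage q z.2) z.1.

(** Countably many time slabs cover the domain, and on each of them the function does not depend on
    time. *)
Lemma measurable_staged (f : nat -> R * R -> R) :
  (forall k, measurable_fun (setT : set RR) (f k)) ->
  measurable_evolution `]0, 1[ (fun z => f (stage q z.2) z.1).
Proof.
move=> mf; have mQ := @measurable_unit_square R.
have mJ : measurable (`]0, 1[%classic : set (measurableTypeR R)) by exact: measurable_itv.
split; last first.
  move=> t _; have mt : measurable_fun (unit_square : set RR) (f (stage q t)) by exact: measurable_funS (mf _).
  exact: (@completed_measurable_fun _ _ R (@lebesgue_measure R \x @lebesgue_measure R)%E _ _ unit_square _ mQ mt).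
pose D : set (R * R * R) := unit_square `*` `]0, 1[.
have mD : measurable (D : set (RR * measurableTypeR R)) by exact: measurableX.
suff mfD : measurable_fun (D : set (RR * measurableTypeR R)) (fun z : RR * measurableTypeR R => f (stage q z.2) z.1).
  exact: (@completed_measurable_fun _ _ R ((@lebesgue_measure R \x @lebesgue_measure R) \x @lebesgue_measure R)%E _ _ D _ mD mfD).
pose E k : set (RR * measurableTypeR R) := setT `*` `[time q k, time q k.+1[.
have mE k : measurable (E k).
  by apply: measurableX => //; exact: measurable_itv.
have mDE k : measurable (D `&` E k : set (RR * measurableTypeR R)) by exact: measurableI.
have -> : D = \bigcup_k (D `&` E k).
  apply/seteqP; split => z; last by move=> [k _ []].
  move=> Dz; have [_] := Dz; rewrite /= in_itv /= => /andP[z0 z1].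
  have [k hk] := @stage_exists _ q q01 z.2 ltac:(by rewrite ltW).
  by exists k => //; split => //; split => //=; rewrite in_itv.
apply/measurable_fun_bigcup => // k.
apply: (eq_measurable_fun (fun z : RR * measurableTypeR R => f k z.1)).
  move=> z /set_mem[_ [_ /=]]; rewrite in_itv /= => hk; congr (f _ _).
  exact/esym/stageE.
apply: (@measurable_funS _ _ _ _ setT) => //.
exact: (measurableT_comp (mf k) measurable_fst).
Qed.

Lemma flow_incompressible : incompressible_flow flow.
Proof.
split.
- by apply: (measurable_staged (f := fun k x => (stage_field q A k x).1)) => k; exact: (measurable_stage q A k).1.
- by apply: (measurable_staged (f := fun k x => (stage_field q A k x).2)) => k; exact: (measurable_stage q A k).2.
- move=> t _ phi [sphi _ _]; exact: (@stage_flux _ q A q01 mA (stage q t) phi sphi).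
Qed.

(** Only finitely many stages meet the times before 1 - delta; the sum of their bounds serves as a
    common bound. *)
Lemma flow_BV delta : 0 < delta ->
  (ereal_sup [set BV_norm (fun x => flow (x, t)) | t in `]0%R, (1 - delta)%R[] < +oo)%E.
Proof.
move=> d0; have [K hK] := pow_small q01 d0.
have cE k := cid2 (stage_BV q01 mA k).
pose c k : R := sval (cE k).
have c0 k : 0 <= c k by rewrite /c; case: (cE k).
have hc k : (BV_norm (stage_field q A k) <= (c k)%:E)%E by rewrite /c; case: (cE k).
apply: (@le_lt_trans _ _ (\sum_(k < K.+1) c k)%:E); last by rewrite ltry.
apply: ub_ereal_sup => _ [t + <-]; rewrite /= in_itv /= => /andP[t0 t1].
have t01 : 0 <= t < 1 by rewrite ltW //; lra.
have [k hk] := stage_exists q01 t01.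
have kK : (k < K.+1)%N.
  rewrite ltnNge; apply/negP => Kk; have := time_mono q01 (ltnW Kk).
  by case/andP: hk => h1 _; rewrite {1}/time; lra.
rewrite (_ : (fun x => flow (x, t)) = stage_field q A k); last first.
  by apply/funext => x; rewrite /flow (stageE q01 hk).
apply: le_trans (hc k) _; rewrite lee_fin (bigD1 (Ordinal kK)) //= lerDl.
by apply: sumr_ge0.
Qed.

Lemma flow_limit (A0 : set (lebesgue_plane R)) (N : set (R * R)) (rho : R * R * R -> R) :
  measurable A0 -> A0 `<=` unit_square -> measurable (N : set RR) -> lam2 N = 0%E -> A = A0 `\` N ->
  transport_solution flow (\1_[set x : R * R | unit_square x /\ 0 < x.1 < vol A]) rho ->
  (\int[leb2]_(x in unit_square) (`|rho (x, t) - \1_A0 x|%R)%:E)%E @[t --> 1^'-] --> 0%E.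
Proof.
move=> mA0 A0Q mN N0 AE sol; have mQ := @measurable_unit_square R.
have mQ' : measurable (unit_square : set (lebesgue_plane R)).
  exact: (@completed_measurable _ _ R (@lebesgue_measure R \x @lebesgue_measure R)%E _ mQ).
have AQ : A `<=` unit_square by rewrite AE => x [/A0Q].
have [M [w [M0 hw]]] := borel_solution sol.
have [[_ mrho] _ _ _ _] := sol.
have E t : 0 <= t < 1 -> (\int[leb2]_(x in unit_square) (`|rho (x, t) - \1_A0 x|%R)%:E =
    \int[lam2]_(x in unit_square) (`|w t x - \1_A x|%R)%:E)%E.
  move=> ht; have [mw wC _ aew] := hw t ht.
  have m1 : measurable_fun (setT : set RR) (\1_A : RR -> R) by exact: measurable_indic.
  have mg : measurable_fun (unit_square : set RR) (fun x => (`|w t x - \1_A x|)%:E).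
    apply/measurable_EFinP; apply: (@measurable_funS _ _ _ _ setT) => //.
    by apply: measurableT_comp => //; exact: measurable_funB.
  rewrite -(integral_leb2 mQ mg).
  have mg' : measurable_fun (unit_square : set (lebesgue_plane R)) (fun x => (`|w t x - \1_A x|)%:E).
    exact: (@completed_measurable_fun _ _ R (@lebesgue_measure R \x @lebesgue_measure R)%E _ _ unit_square _ mQ mg).
  have mr : measurable_fun (unit_square : set (lebesgue_plane R)) (fun x => rho (x, t)) by exact: mrho.
  have m10 : measurable_fun (unit_square : set (lebesgue_plane R)) (\1_A0 : lebesgue_plane R -> R).
    by apply: (@measurable_funS _ _ _ _ setT) => //; exact: measurable_indic.
  have mf : measurable_fun (unit_square : set (lebesgue_plane R)) (fun x => (`|rho (x, t) - \1_A0 x|)%:E).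
    have md := @measurable_funB _ (lebesgue_plane R) R _ _ _ mr m10.
    have mn := measurableT_comp (@normr_measurable R setT) md.
    by apply/measurable_EFinP; exact: mn.
  refine (@ae_eq_integral _ (lebesgue_plane R) R leb2 unit_square _ _ mQ' mf mg' _).
  have aeN : {ae lam2, forall x, ~ N x}.
    by exists N; split => // x /= /contrapT.
  have [Z [mZ Z0 HZ]] := ae_lam2 aew; have [Z' [mZ' Z0' HZ']] := ae_lam2 aeN.
  exists (Z `|` Z'); split; [exact: measurableU|exact: null_set_setU|].
  move=> x /=; apply: contra_notP => /not_orP[n1 n2] Qx; congr EFin.
  have -> : rho (x, t) = w t x by apply: contrapT => ne; apply: n1; apply: HZ => /(_ Qx).
  have nN : ~ N x by move=> Nx; apply: n2; apply: HZ' => /(_ Nx).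
  congr (`| _ - _ |); rewrite !indicE AE; congr (_%:R); congr nat_of_bool.
  by apply/idP/idP => /set_mem h; apply: mem_set; [|case: h].
have L n t : time q n.*2 <= t <= time q n.+1.*2 ->
    (\int[leb2]_(x in unit_square) (`|rho (x, t) - \1_A0 x|%R)%:E <= (2 * err n A)%:E)%E.
  move=> ht; rewrite E; last first.
    case/andP: ht => h1 h2; rewrite (le_trans (time_ge0 q01 n.*2) h1).
    exact: le_lt_trans h2 (time_lt1 q01 _).
  exact: (L1_error q01 mA AQ (fun x t _ => erefl) sol M0 hw ht).
have I0 t : (0 <= \int[leb2]_(x in unit_square) (`|rho (x, t) - \1_A0 x|%R)%:E)%E.
  by apply: integral_ge0 => x _; rewrite lee_fin.
have [_ small] := good_measurable mA.
have near_bound e : 0 < e -> \forall t \near 1^'-,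
    (\int[leb2]_(x in unit_square) (`|rho (x, t) - \1_A0 x|%R)%:E <= e%:E)%E.
  move=> e0; have [n0 Hn] := small (e / 2) ltac:(by rewrite divr_gt0).
  near=> t.
  have t1 : t < 1 by near: t; exact: nbhs_left_lt.
  have tn : time q n0.*2 <= t by near: t; apply: nbhs_left_ge; exact: time_lt1.
  have t01 : 0 <= t < 1 by rewrite t1 (le_trans (time_ge0 q01 _) tn).
  have [k /andP[k1 k2]] := stage_exists q01 t01.
  have nk : (n0 <= k./2)%N.
    rewrite leqNgt; apply/negP => h; have : (k.+1 <= n0.*2)%N by rewrite -ltn_half_double.
    by move=> /(time_mono q01) h'; move: (lt_le_trans k2 h'); rewrite ltNge tn.
  (* The stage [k] is one of the two that treat the cells of size [k./2], and together these span
     the interval of [L1_error]. *)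
  have htt : time q k./2.*2 <= t <= time q k./2.+1.*2.
    apply/andP; split.
      apply: le_trans k1; apply: time_mono => //; rewrite -[X in (_ <= X)%N](odd_double_half k); exact: leq_addl.
    apply: le_trans (ltW k2) _; apply: time_mono => //.
    by rewrite -[X in (X.+1 <= _)%N](odd_double_half k) doubleS; case: (odd k).
  by apply: (le_trans (L _ _ htt)); rewrite lee_fin; move: (Hn _ nk); move: (err _ _) => z; lra.
apply/fine_cvgP; split.
  near=> t; rewrite ge0_fin_numE //; apply: le_lt_trans (ltry 1); near: t; exact: near_bound.
apply/cvgrPdist_le => e e0; near=> t.
rewrite sub0r normrN ger0_norm ?fine_ge0 // -lee_fin fineK.
  by near: t; exact: near_bound.
rewrite ge0_fin_numE //; apply: le_lt_trans (ltry e); near: t; exact: near_bound.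
Unshelve. all: by end_near. Qed.

End flow.

Theorem corollary1p7 (R : realType) (p s : R)
    (hp : 1 <= p) (hs0 : 0 <= s) (hsp : s < p^-1) :
  exists C : R, forall A : set (lebesgue_plane R),
    measurable A -> A `<=` unit_square ->
    exists u : (R * R) * R -> R * R,
      [/\ incompressible_flow u,
          (forall t : R, 0 < t < 1 -> no_normal_flux (fun x => u (x, t))),
          (forall delta : R, 0 < delta ->
             (ereal_sup [set BV_norm (fun x => u (x, t))
                        | t in `]0%R, (1 - delta)%R[] < +oo)%E),
          (ereal_sup [set sobolev_seminorm s p (fun x => u (x, t))
                     | t in `]0%R, 1%R[] <= C%:E)%E &
          forall rho : (R * R) * R -> R,
            transport_solution u
              (\1_[set x : R * R | unit_square x /\ 0 < x.1 < fine (leb2 A)])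
              rho ->
            (\int[leb2]_(x in unit_square) (`|rho (x, t) - \1_A x|%R)%:E)%E
              @[t --> 1^'-] --> 0%E].
Proof.
have [C hC] := uniform_sobolev hp hs0 hsp.
have q01 := rate01 hp hsp.
(* The constant is independent of [A]. Since [A] is only Lebesgue measurable, a null set is removed
   first; by [e] the initial strip keeps its width. *)
exists C => A mA AQ; have [N [mN N0 mAN e]] := borel_representative mA AQ.
exists (flow (rate s) (A `\` N)); split.
- exact: flow_incompressible.
- by move=> t _ phi sphi; exact: (@stage_flux _ _ _ q01 mAN (stage (rate s) t) phi sphi).
- exact: flow_BV.
- by apply: ub_ereal_sup => _ [t _ <-]; exact: (hC (A `\` N) (stage (rate s) t) mAN).
- by rewrite e => rho sol; exact: (flow_limit q01 mAN mA AQ mN N0 erefl sol).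
Qed.
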